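(* Let $N\ge 2$ be an integer, $\alpha\in(0,\frac{\pi}{2}]$, $c_0>0$ and $c=c_0/\sin\alpha$. Let $\phi_\infty:\mathbb R^{N-1}\to\mathbb R$ be a $1$-homogeneous viscosity solution of the eikonal equation $$|D\phi_\infty(x)|=\cot\alpha,\qquad x\in\mathbb R^{N-1}.$$ Then there exists a smooth concave function $\phi\in C^\infty(\mathbb R^{N-1})$ solving $$-\operatorname{div}\left(\frac{D\phi}{\sqrt{1+|D\phi|^2}}\right)+c_0-\frac{c}{\sqrt{1+|D\phi|^2}}=0,\qquad x\in\mathbb R^{N-1},$$ and such that $\phi(x)=\phi_\infty(x)+o(|x|)$ as $|x|\to+\infty$.
   Context: A function $\psi:\mathbb R^{N-1}\to\mathbb R$ is $1$-homogeneous if $\psi(\lambda x)=\lambda\psi(x)$ for all $\lambda>0$ and $x\in\mathbb R^{N-1}$. Viscosity solutions of the eikonal equation are continuous viscosity solutions of $|D\phi_\infty|-\cot\alpha=0$ (with this sign convention: at a point where a $C^1$ test function touches $\phi_\infty$ from above its gradient has norm $\le\cot\alpha$; at a point where it touches from below its gradient has norm $\ge\cot\alpha$). *)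

(* Defs.v *)
From mathcomp Require Import all_boot all_order all_algebra.
From mathcomp Require Import all_classical all_reals all_analysis.

Set Implicit Arguments.
Unset Strict Implicit.
Unset Printing Implicit Defensive.

Import Order.TTheory GRing.Theory Num.Theory.
Import numFieldNormedType.Exports.

Local Open Scope classical_set_scope.
Local Open Scope ring_scope.

Definition cot (R : realType) (a : R) : R := cos a / sin a.

(* The library norm on row vectors is the sup norm, which induces the same
   topology but is not the norm of the equations below. *)
Definition enorm (R : realType) (n : nat) (x : 'rV[R]_n) : R :=
  Num.sqrt (\sum_(i < n) x ord0 i ^+ 2).

Definition partial (R : realType) (n : nat) (i : 'I_n) (f : 'rV[R]_n -> R) :
    'rV[R]_n -> R :=
  fun x => 'D_(delta_mx ord0 i) f x.

Definition grad (R : realType) (n : nat) (f : 'rV[R]_n -> R) (x : 'rV[R]_n) :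
    'rV[R]_n :=
  \row_(i < n) partial i f x.

Definition divergence (R : realType) (n : nat) (F : 'rV[R]_n -> 'rV[R]_n)
    (x : 'rV[R]_n) : R :=
  \sum_(i < n) partial i (fun y => F y ord0 i) x.

Fixpoint Ck (R : realType) (n : nat) (k : nat) (f : 'rV[R]_n -> R) : Prop :=
  match k with
  | 0%N => continuous f
  | k'.+1 => continuous f /\
      forall i : 'I_n, (forall x, derivable f x (delta_mx ord0 i)) /\
                       Ck k' (partial i f)
  end.

Definition Csmooth (R : realType) (n : nat) (f : 'rV[R]_n -> R) : Prop :=
  forall k : nat, Ck k f.

Definition concave (R : realType) (n : nat) (f : 'rV[R]_n -> R) : Prop :=
  convex_function (E := 'rV[R]_n) setT (fun x => - f x).

Definition homogeneous1 (R : realType) (n : nat) (f : 'rV[R]_n -> R) : Prop :=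
  forall (l : R) (x : 'rV[R]_n), 0 < l -> f (l *: x) = l * f x.

Definition touches_from_above (R : realType) (n : nat)
    (psi u : 'rV[R]_n -> R) (x : 'rV[R]_n) : Prop :=
  psi x = u x /\ \forall y \near x, u y <= psi y.

Definition touches_from_below (R : realType) (n : nat)
    (psi u : 'rV[R]_n -> R) (x : 'rV[R]_n) : Prop :=
  psi x = u x /\ \forall y \near x, psi y <= u y.

(* Viscosity solutions of |Du| - k = 0; the sign matters, since the solutions
   of k - |Du| = 0 are their opposites. *)
Definition eikonal_viscosity_solution (R : realType) (n : nat) (k : R)
    (u : 'rV[R]_n -> R) : Prop :=
  [/\ continuous u,
      forall (psi : 'rV[R]_n -> R) (x : 'rV[R]_n), Ck 1 psi ->
        touches_from_above psi u x -> enorm (grad psi x) <= k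
    & forall (psi : 'rV[R]_n -> R) (x : 'rV[R]_n), Ck 1 psi ->
        touches_from_below psi u x -> k <= enorm (grad psi x)].

Definition enorm_infty (R : realType) (n : nat) : set_system 'rV[R]_n :=
  filter_from setT (fun M : R => [set x | M < enorm x]).
Arguments enorm_infty : clear implicits.

Global Instance enorm_infty_filter (R : realType) (n : nat) :
  Filter (enorm_infty R n).
Proof.
apply: filter_from_filter; first by exists 0.
move=> M1 M2 _ _; exists (Num.max M1 M2) => // x /=.
by rewrite gt_max => /andP[].
Qed.

Canonical enorm_infty_filterType (R : realType) (n : nat) :=
  FilterType (enorm_infty R n) (enorm_infty_filter R n).

Definition forced_mean_curvature (R : realType) (n : nat) (c0 c : R)
    (phi : 'rV[R]_n -> R) (x : 'rV[R]_n) : R :=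
  - divergence
      (fun y => (Num.sqrt (1 + enorm (grad phi y) ^+ 2))^-1 *: grad phi y) x
  + c0 - c / Num.sqrt (1 + enorm (grad phi x) ^+ 2).

(* Main.v *)
Require Import Defs.
From mathcomp Require Import all_boot all_order all_algebra.
From mathcomp Require Import all_classical all_reals all_analysis.
From mathcomp Require Import ring lra.

Set Implicit Arguments.
Unset Strict Implicit.
Unset Printing Implicit Defensive.

Import Order.TTheory GRing.Theory Num.Theory.
Import numFieldNormedType.Exports.

Local Open Scope classical_set_scope.
Local Open Scope ring_scope.

(** Write [n = N - 1], [k = cot alpha] and [u = phi_infty]. Since [1 / sin alpha = sqrt (1 + k^2)],
    the equation in nondivergence form is [tr (A(Dphi) D^2 phi) = - 2 G(Dphi)], with
    [A(p) = 1 - p^T p / (1 + |p|^2)] and [G(p) = c0 / 2 (sqrt (1 + k^2) - sqrt (1 + |p|^2))] ([trA],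
    [half_speed]). In particular [G(p) >= 0] exactly when [|p| <= k], and planes of slope [k] are
    solutions.

    Data at infinity. The viscosity inequalities make [u] a [k]-Lipschitz function that descends
    from every point at rate [k] up to any distance ([eikonal_lipschitz], [eikonal_descent]).
    Following the descent to infinity gives a unit vector [nu] with [u <= k nu.y] everywhere, and
    homogeneity gives equality at the chosen point ([eikonal_support]). So [u] is the infimum of a
    sequence of linear functions [k nu_i.y], of which finitely many suffice up to an error [e |x|]
    ([dense_supports]).

    Existence. Perron's method is run between [u] and the planes [k nu_i.x + off_i], in the class of
    concave viscosity subsolutions that are semiconvex with a fixed constant. The class is not
    empty: a soft minimum of the planes has a lower paraboloid of trace [a (k^2 - |p|^2)], which is
    at most [G(p)] for a suitable smoothing parameter [a] ([softmin_touch], [half_speed_lower],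
    [barrier_class]). Zorn's lemma gives a maximal element. If it were not a supersolution at some
    point, the concave hull of it and of a small paraboloid bump would be a larger member of the
    class ([bump_class], [maximal_visc_sup]). A function squeezed between [u] and the planes is
    [u + o(|x|)] ([littleo_of_supports]).

    Regularity. The solution found is C^{1,1}. At each point a linear change of variables turns the
    operator with frozen coefficients into the Laplacian; comparison with harmonic functions on
    balls of radius [r = t^2] then gives harmonic approximants with error of order [t^5 = r^(5/2)]
    ([frozen_approx]). A Campanato iteration converts them into second order expansions with uniform
    constants ([jets_of_approx]), and a converse of Taylor's theorem yields C^{2,1/2} ([jets_Hol2]).
    The harmonic approximants come from Bernstein polynomials of a random walk, extended
    harmonically from a sphere ([harmonic_replacement]), and the derivative estimates from Brandt's
    barrier argument ([gradient_estimate]). The same scheme applied to a linear equation gains one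
    derivative ([schauder_step]); differentiating the equation and iterating gives smoothness
    ([schauder], [bootstrap_smooth]). *)

Section Vectors.
Variables (R : realType) (n : nat).
Implicit Types (x y z : 'rV[R]_n) (a b t : R) (M : 'M[R]_n).

(** * Euclidean norm and inner product on row vectors *)

Definition dot x y : R := \sum_(i < n) x ord0 i * y ord0 i.

Lemma dotC x y : dot x y = dot y x.
Proof. by apply: eq_bigr => i _; rewrite mulrC. Qed.

Lemma dotDl x y z : dot (x + y) z = dot x z + dot y z.
Proof. by rewrite -big_split; apply: eq_bigr => i _; rewrite mxE mulrDl. Qed.

Lemma dotDr x y z : dot z (x + y) = dot z x + dot z y.
Proof. by rewrite dotC dotDl !(dotC z). Qed.

Lemma dotZl a x y : dot (a *: x) y = a * dot x y.
Proof. by rewrite mulr_sumr; apply: eq_bigr => i _; rewrite mxE mulrA. Qed.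

Lemma dotZr a x y : dot x (a *: y) = a * dot x y.
Proof. by rewrite dotC dotZl dotC. Qed.

Lemma dotNl x y : dot (- x) y = - dot x y.
Proof. by rewrite -scaleN1r dotZl mulN1r. Qed.

Lemma dotNr x y : dot x (- y) = - dot x y.
Proof. by rewrite dotC dotNl dotC. Qed.

Lemma dotBl x y z : dot (x - y) z = dot x z - dot y z.
Proof. by rewrite dotDl dotNl. Qed.

Lemma dotBr x y z : dot z (x - y) = dot z x - dot z y.
Proof. by rewrite dotDr dotNr. Qed.

Lemma dot0l x : dot 0 x = 0.
Proof. by rewrite -(scale0r 0) dotZl mul0r. Qed.

Lemma dot0r x : dot x 0 = 0.
Proof. by rewrite dotC dot0l. Qed.

Definition dotE := (dotDl, dotDr, dotNl, dotNr, dotZl, dotZr, dot0l, dot0r).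

Lemma dot_delta x (i : 'I_n) : dot x (delta_mx ord0 i) = x ord0 i.
Proof.
rewrite /dot (bigD1 i) //= mxE !eqxx mulr1 big1 ?addr0// => j ji.
by rewrite mxE eqxx/= (negbTE ji) mulr0.
Qed.

Lemma dot_ge0 x : 0 <= dot x x.
Proof. by apply: sumr_ge0 => i _; rewrite -expr2 sqr_ge0. Qed.

Lemma enormE x : enorm x = Num.sqrt (dot x x).
Proof. by congr Num.sqrt; apply: eq_bigr => i _; rewrite expr2. Qed.

Lemma enorm_ge0 x : 0 <= enorm x.
Proof. by rewrite sqrtr_ge0. Qed.

Lemma enorm_sqr x : enorm x ^+ 2 = dot x x.
Proof. by rewrite enormE sqr_sqrtr // dot_ge0. Qed.

Lemma enormZ a x : enorm (a *: x) = `|a| * enorm x.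
Proof.
rewrite !enormE dotZl dotZr mulrA -expr2 sqrtrM ?sqr_ge0// sqrtr_sqr//.
Qed.

Lemma enormN x : enorm (- x) = enorm x.
Proof. by rewrite -scaleN1r enormZ normrN1 mul1r. Qed.

Lemma enorm0 : enorm (0 : 'rV[R]_n) = 0.
Proof. by rewrite enormE dot0l sqrtr0. Qed.

Lemma dot_eq0 x : dot x x = 0 -> x = 0.
Proof.
move=> /eqP; rewrite psumr_eq0 => [/allP h|i _]; last by rewrite -expr2 sqr_ge0.
apply/rowP => i; rewrite mxE; apply/eqP.
by have := h i; rewrite mem_index_enum -expr2 sqrf_eq0 => /(_ isT).
Qed.

Lemma enorm_eq0 x : enorm x = 0 -> x = 0.
Proof. by move=> h; apply: dot_eq0; rewrite -enorm_sqr h expr0n. Qed.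

Lemma enorm_gt0 x : x != 0 -> 0 < enorm x.
Proof.
move=> h; rewrite lt_neqAle enorm_ge0 andbT eq_sym.
by apply: contra h => /eqP/enorm_eq0 ->.
Qed.

Lemma dot_le x y : dot x y <= enorm x * enorm y.
Proof.
have [->|x0] := eqVneq x 0; first by rewrite dot0l enorm0 mul0r.
(* The squared length of this vector is [dot x x] times the Gram determinant of [x] and [y]. *)
have := dot_ge0 (dot x x *: y - dot x y *: x).
rewrite dotBl !dotBr !dotZl !dotZr (dotC y x) => h.
have p : 0 < dot x x by rewrite -enorm_sqr exprn_gt0// enorm_gt0.
have {}h : 0 <= dot x x * dot y y - dot x y ^+ 2.
  rewrite -(pmulr_rge0 _ p); apply: le_trans h _.
  rewrite le_eqVlt; apply/orP; left; apply/eqP; ring.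
have [d|d] := leP 0 (dot x y); last first.
  by apply: (le_trans (ltW d)); rewrite mulr_ge0 ?enorm_ge0.
rewrite -(ler_pXn2r (n := 2)) ?nnegrE ?mulr_ge0 ?enorm_ge0//.
rewrite exprMn !enorm_sqr; lra.
Qed.

Lemma ler_norm_dot x y : `|dot x y| <= enorm x * enorm y.
Proof. by rewrite ler_norml dot_le andbT lerNl -dotNl -(enormN x) dot_le. Qed.

Lemma enormD x y : enorm (x + y) <= enorm x + enorm y.
Proof.
rewrite -(ler_pXn2r (n := 2)) ?nnegrE ?addr_ge0 ?enorm_ge0//.
rewrite sqrrD !enorm_sqr dotDl !dotDr (dotC y x).
have := dot_le x y; lra.
Qed.

Lemma enormB x y : enorm (x - y) <= enorm x + enorm y.
Proof. by rewrite -(enormN y) enormD. Qed.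

Lemma enormBC x y : enorm (x - y) = enorm (y - x).
Proof. by rewrite -enormN opprB. Qed.

Lemma enorm_triangle z x y : enorm (x - y) <= enorm (x - z) + enorm (z - y).
Proof. by rewrite -(subrKA z) enormD. Qed.

Lemma coord_le x (i : 'I_n) : `|x ord0 i| <= enorm x.
Proof.
rewrite -(ler_pXn2r (n := 2)) ?nnegrE ?enorm_ge0// enorm_sqr.
rewrite /dot (bigD1 i) //= real_normK ?num_real// -expr2 lerDl.
by apply: sumr_ge0 => j _; rewrite -expr2 sqr_ge0.
Qed.

Lemma enorm_delta (i : 'I_n) : enorm (delta_mx ord0 i : 'rV[R]_n) = 1.
Proof. by rewrite enormE dot_delta mxE !eqxx sqrtr1. Qed.

Lemma rV_sum x : x = \sum_(i < n) x ord0 i *: delta_mx ord0 i.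
Proof. exact: row_sum_delta. Qed.

Lemma enorm_sum m (f : 'I_m -> 'rV[R]_n) :
  enorm (\sum_(i < m) f i) <= \sum_(i < m) enorm (f i).
Proof.
elim: m f => [|m IH] f; first by rewrite !big_ord0 enorm0.
by rewrite !big_ord_recr /= (le_trans (enormD _ _))// lerD2r.
Qed.

Lemma enorm_le_sum x : enorm x <= \sum_(i < n) `|x ord0 i|.
Proof.
rewrite [in leLHS](rV_sum x); apply: (le_trans (enorm_sum _)).
by apply: ler_sum => i _; rewrite enormZ enorm_delta mulr1.
Qed.

Lemma enorm_le_coord x a : (forall i, `|x ord0 i| <= a) -> enorm x <= n%:R * a.
Proof.
move=> h; apply: (le_trans (enorm_le_sum _)).
have -> : n%:R * a = \sum_(i < n) a by rewrite sumr_const card_ord mulr_natl.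
by apply: ler_sum => i _; exact: h.
Qed.

Lemma norm_le_enorm x : `|x| <= enorm x.
Proof.
rewrite [leLHS]/Num.Def.normr /= mx_normrE; apply/bigmax_leP; split=> [|i _].
  exact: enorm_ge0.
by rewrite (ord1 i.1) coord_le.
Qed.

Lemma coord_le_norm x (i : 'I_n) : `|x ord0 i| <= `|x|.
Proof.
rewrite [leRHS]/Num.Def.normr /= mx_normrE; apply/bigmax_geP; right => /=.
by exists (ord0, i).
Qed.

Lemma enorm_le_norm x : enorm x <= n%:R * `|x|.
Proof. by apply: enorm_le_coord => i; exact: coord_le_norm. Qed.

(** The ambient topology comes from the sup norm; the two norms bound each other up to the factor
    [n]. All later epsilon arguments in Euclidean balls pass through this bridge. *)
Lemma nbhs_enormP x (P : set 'rV[R]_n) :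
  nbhs x P <-> exists2 d, 0 < d & forall y, enorm (y - x) < d -> P y.
Proof.
split=> [/nbhs_ballP[d /= d0 h]|[d d0 h]].
  exists d => // y yd; apply: h; rewrite mx_norm_ball /ball_/= distrC.
  exact: le_lt_trans (norm_le_enorm _) yd.
(* [n.+1] instead of [n] keeps the radius positive when [n = 0]. *)
apply/nbhs_ballP; exists (d / n.+1%:R) => /= [|y]; first by rewrite divr_gt0.
rewrite mx_norm_ball /ball_/= distrC ltr_pdivlMr// => yd; apply: h.
apply: le_lt_trans (enorm_le_norm _) _; apply: le_lt_trans yd.
by rewrite mulrC ler_wpM2l// ler_nat.
Qed.

Lemma continuous_enormP (f : 'rV[R]_n -> R) x :
  {for x, continuous f} <-> forall e, 0 < e ->
    exists2 d, 0 < d & forall y, enorm (y - x) < d -> `|f y - f x| < e.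
Proof.
split=> [h e e0|h].
  have /nbhs_enormP[d d0 hd] : nbhs x [set y | `|f x - f y| < e].
    by move/cvgrPdist_lt : h; exact.
  by exists d => // y /hd /=; rewrite distrC.
apply/(@cvgrPdist_lt _ _ _ _ (nbhs_filter x)) => e e0.
have [d d0 hd] := h e e0.
suff : nbhs x [set y | `|f x - f y| < e] by [].
by apply/nbhs_enormP; exists d => // y /hd; rewrite distrC.
Qed.

Lemma enorm_dist x y : `|enorm x - enorm y| <= enorm (x - y).
Proof.
rewrite ler_norml lerNl opprB !lerBlDr enormBC -{1}(subrK x y) enormD/=.
by rewrite enormBC -{1}(subrK y x) enormD.
Qed.

Lemma lipschitz_continuous (f : 'rV[R]_n -> R) a :
  (forall x y, `|f x - f y| <= a * enorm (x - y)) -> continuous f.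
Proof.
move=> fa x; apply/continuous_enormP => e e0.
have a1 : 0 < `|a| + 1 by rewrite ltr_wpDl.
exists (e / (`|a| + 1)) => [|y ye]; first by rewrite divr_gt0.
rewrite ltr_pdivlMr// mulrC in ye; apply: le_lt_trans ye.
apply: (le_trans (fa _ _)); rewrite ler_wpM2r ?enorm_ge0//.
by rewrite (le_trans (ler_norm _))// lerDl.
Qed.

Lemma enorm_shift_continuous z : continuous (fun x => enorm (x - z)).
Proof.
apply: (@lipschitz_continuous _ 1) => x y; rewrite mul1r.
by apply: (le_trans (enorm_dist _ _)); rewrite opprB subrKA.
Qed.

Lemma ball_compact x r : compact [set y : 'rV[R]_n | enorm (y - x) <= r].
Proof.
apply: bounded_closed_compact.
  exists (r + enorm x); split; first by rewrite num_real.
  move=> M /= hM y /= yr; apply: ltW; apply: le_lt_trans hM.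
  apply: (le_trans (norm_le_enorm _)).
  by rewrite -{1}(subrK x y) (le_trans (enormD _ _))// lerD2r.
apply: (@closed_comp _ _ (fun y => enorm (y - x)) [set t | t <= r]).
  by move=> y _; exact: enorm_shift_continuous.
exact: closed_le.
Qed.

Lemma ball_max (f : 'rV[R]_n -> R) x r : 0 <= r -> continuous f ->
  exists2 y, enorm (y - x) <= r &
    forall z, enorm (z - x) <= r -> f z <= f y.
Proof.
move=> r0 cf.
have [||y] := @EVT_max_rV R n f _ _ (@ball_compact x r).
- by exists x; rewrite /= subrr enorm0.
- by apply: continuous_subspaceT.
by rewrite inE /= => yr h; exists y => // z zr; apply: h; rewrite inE.
Qed.

End Vectors.

(** * Quadratic forms and the coefficient matrix of the mean curvature operator *)

Section Quadratic.
Variables (R : realType) (n : nat).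
Implicit Types (x y z p q h : 'rV[R]_n) (a b t : R) (M N B : 'M[R]_n).

(** Matrices are not assumed symmetric and forms carry no factor 1/2: a paraboloid
    [dot p h + qf M h] has Hessian [M + M^T]. *)
Definition bf M x y : R := \sum_(i < n) \sum_(j < n) x ord0 i * M i j * y ord0 j.
Definition qf M x : R := bf M x x.
Definition psd M := forall x, 0 <= qf M x.

Lemma bfDl M x y z : bf M (x + y) z = bf M x z + bf M y z.
Proof.
rewrite -big_split; apply: eq_bigr => i _; rewrite -big_split.
by apply: eq_bigr => j _; rewrite mxE !mulrDl.
Qed.

Lemma bfDr M x y z : bf M z (x + y) = bf M z x + bf M z y.
Proof.
rewrite -big_split; apply: eq_bigr => i _; rewrite -big_split.
by apply: eq_bigr => j _; rewrite mxE !mulrDr.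
Qed.

Lemma bfZl M a x y : bf M (a *: x) y = a * bf M x y.
Proof.
rewrite mulr_sumr; apply: eq_bigr => i _; rewrite mulr_sumr.
by apply: eq_bigr => j _; rewrite mxE !mulrA.
Qed.

Lemma bfZr M a x y : bf M x (a *: y) = a * bf M x y.
Proof.
rewrite mulr_sumr; apply: eq_bigr => i _; rewrite mulr_sumr.
by apply: eq_bigr => j _; rewrite mxE mulrCA.
Qed.

Lemma qfZ M a x : qf M (a *: x) = a ^+ 2 * qf M x.
Proof. by rewrite /qf bfZl bfZr mulrA. Qed.

Lemma qfN M x : qf M (- x) = qf M x.
Proof. by rewrite -scaleN1r qfZ sqrrN expr1n mul1r. Qed.

Lemma qf0 M : qf M 0 = 0.
Proof. by rewrite -(scale0r 0) qfZ expr0n mul0r. Qed.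

Lemma qf_add M x y : qf M (x + y) = qf M x + (bf M x y + bf M y x) + qf M y.
Proof. by rewrite /qf bfDl !bfDr !addrA. Qed.

Lemma bf_mxD M N x y : bf (M + N) x y = bf M x y + bf N x y.
Proof.
rewrite -big_split; apply: eq_bigr => i _; rewrite -big_split.
by apply: eq_bigr => j _; rewrite mxE mulrDr mulrDl.
Qed.

Lemma bf_mxZ M a x y : bf (a *: M) x y = a * bf M x y.
Proof.
rewrite mulr_sumr; apply: eq_bigr => i _; rewrite mulr_sumr.
by apply: eq_bigr => j _; rewrite mxE; ring.
Qed.

Lemma qf_mxD M N x : qf (M + N) x = qf M x + qf N x.
Proof. exact: bf_mxD. Qed.

Lemma qf_mxZ M a x : qf (a *: M) x = a * qf M x.
Proof. exact: bf_mxZ. Qed.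

Lemma qf_mxN M x : qf (- M) x = - qf M x.
Proof. by rewrite -scaleN1r qf_mxZ mulN1r. Qed.

Lemma bf_scalar a x y : bf a%:M x y = a * dot x y.
Proof.
rewrite mulr_sumr; apply: eq_bigr => i _; rewrite (bigD1 i)//= big1 => [|j ji].
  by rewrite addr0 mxE eqxx mulr1n mulrCA mulrA.
by rewrite mxE eq_sym (negbTE ji) mulr0n mulr0 mul0r.
Qed.

Lemma qf_scalar a x : qf a%:M x = a * dot x x.
Proof. exact: bf_scalar. Qed.

Lemma qf_delta M (i : 'I_n) : qf M (delta_mx ord0 i) = M i i.
Proof.
rewrite /qf /bf (bigD1 i)//= (bigD1 i)//= !mxE !eqxx/= mul1r mulr1.
rewrite !big1 ?addr0// => j ji; last by rewrite mxE (negbTE ji) andbF mulr0.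
by rewrite big1// => k _; rewrite mxE (negbTE ji) andbF !mul0r.
Qed.

Lemma mxtrace_qf M : \tr M = \sum_(i < n) qf M (delta_mx ord0 i).
Proof. by apply: eq_bigr => i _; rewrite qf_delta. Qed.

Definition mxbound M := \sum_(i < n) \sum_(j < n) `|M i j|.

Lemma mxbound_ge0 M : 0 <= mxbound M.
Proof. by apply: sumr_ge0 => i _; apply: sumr_ge0 => j _. Qed.

Lemma bf_le M x y : `|bf M x y| <= mxbound M * (enorm x * enorm y).
Proof.
rewrite (le_trans (ler_norm_sum _ _ _))// mulr_suml ler_sum// => i _.
rewrite (le_trans (ler_norm_sum _ _ _))// mulr_suml ler_sum// => j _.
rewrite !normrM mulrAC mulrC ler_wpM2l//.
by rewrite ler_pM// coord_le.
Qed.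

Lemma qf_le M x : `|qf M x| <= mxbound M * dot x x.
Proof. by rewrite -enorm_sqr expr2 bf_le. Qed.

(* Summing the form over the vectors [x_j e_i - x_i e_j] gives twice
   [|x|^2 tr M - M(x, x)]. *)
Lemma psd_qf_le M x : psd M -> qf M x <= dot x x * \tr M.
Proof.
move=> psdM.
pose w (i j : 'I_n) : 'rV[R]_n :=
  x ord0 j *: delta_mx ord0 i - x ord0 i *: delta_mx ord0 j.
have : 0 <= \sum_(i < n) \sum_(j < n) qf M (w i j).
  by apply: sumr_ge0 => i _; apply: sumr_ge0 => j _; exact: psdM.
have dd (i j : 'I_n) :
    bf M (delta_mx ord0 i) (delta_mx ord0 j) = M i j.
  rewrite /bf (bigD1 i)//= (bigD1 j)//= !mxE !eqxx/= mul1r mulr1.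
  rewrite !big1 ?addr0// => l li; last by rewrite mxE (negbTE li) andbF mulr0.
  by rewrite big1// => k _; rewrite mxE (negbTE li) andbF !mul0r.
have wE i j : qf M (w i j) = x ord0 j ^+ 2 * M i i + x ord0 i ^+ 2 * M j j
    - (x ord0 i * M i j * x ord0 j + x ord0 j * M j i * x ord0 i).
  rewrite /w /qf -scaleNr !bfDl !bfDr !bfZl !bfZr !dd; ring.
under eq_bigr do under eq_bigr do rewrite wE.
have e1 : \sum_(i < n) \sum_(j < n) x ord0 j ^+ 2 * M i i = dot x x * \tr M.
  rewrite mulr_sumr; apply: eq_bigr => i _.
  by rewrite -mulr_suml; congr (_ * _); apply: eq_bigr => j _; rewrite expr2.
have e2 : \sum_(i < n) \sum_(j < n) x ord0 i ^+ 2 * M j j = dot x x * \tr M.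
  by rewrite exchange_big /= e1.
have e3 : \sum_(i < n) \sum_(j < n) x ord0 j * M j i * x ord0 i = qf M x.
  by rewrite exchange_big.
under eq_bigr do rewrite sumrB !big_split/=.
rewrite sumrB !big_split/= e1 e2 e3 -/(qf M x) /qf /bf; lra.
Qed.

Lemma psd_tr_ge0 M : psd M -> 0 <= \tr M.
Proof. by move=> h; rewrite mxtrace_qf sumr_ge0. Qed.

(** The trace of [A(p) M] with [A(p) = 1 - p^T p / (1 + |p|^2)], that is, the minimal surface
    operator in nondivergence form. *)
Definition trA p M : R := \tr M - qf M p / (1 + dot p p).

Lemma dot1_gt0 p : 0 < 1 + dot p p.
Proof. by rewrite ltr_pwDl// dot_ge0. Qed.

Lemma trAD p M N : trA p (M + N) = trA p M + trA p N.
Proof. by rewrite /trA mxtraceD qf_mxD mulrDl; ring. Qed.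

Lemma trAZ p a M : trA p (a *: M) = a * trA p M.
Proof. by rewrite /trA mxtraceZ qf_mxZ; ring. Qed.

Lemma trAN p M : trA p (- M) = - trA p M.
Proof. by rewrite -scaleN1r trAZ mulN1r. Qed.

(** Lower ellipticity bound: [A(p) >= (1 + |p|^2)^-1] as forms, read off from [psd_qf_le]. *)
Lemma psd_trA p M : psd M -> \tr M / (1 + dot p p) <= trA p M.
Proof.
move=> /(@psd_qf_le _ p) h; have p1 := dot1_gt0 p.
rewrite /trA lerBrDr -mulrDl ler_pdivrMr//; lra.
Qed.

Lemma psd_trA_ge0 p M : psd M -> 0 <= trA p M.
Proof.
move=> h; apply: le_trans (psd_trA p h).
by rewrite divr_ge0 ?psd_tr_ge0// ltW// dot1_gt0.
Qed.

Lemma trA_scalar_le p a : 0 <= a -> trA p a%:M <= n%:R * a.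
Proof.
move=> a0; rewrite /trA mxtrace_scalar qf_scalar mulr_natl gerBl.
by rewrite divr_ge0 ?mulr_ge0 ?dot_ge0// ltW// dot1_gt0.
Qed.

(** Ellipticity is uniform while [|p|] stays bounded, so a bound on [trA] together with positivity
    controls the whole matrix. The a priori opening of the Perron class comes from here. *)
Lemma psd_qf_le_trA k p M x : psd M -> dot p p <= k ->
  qf M x <= (1 + k) * trA p M * dot x x.
Proof.
move=> psdM pk; rewrite (le_trans (psd_qf_le x psdM))// mulrC.
rewrite ler_wpM2r ?dot_ge0//; have := psd_trA p psdM.
rewrite ler_pdivrMr ?dot1_gt0// => h; rewrite (le_trans h)// mulrC.
by rewrite ler_wpM2r ?psd_trA_ge0// lerD2l.
Qed.

End Quadratic.

(** * Convergent subsequences with an explicit rate *)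

Section Compactness.
Variables (R : realType).

(** Bolzano-Weierstrass in the form used below: [i <= s i] stands for extraction, and the rate
    [1 / (i + 1)] lets limits of inequalities be taken with [le_limit]. *)
Lemma subseq_rV m (u : nat -> 'rV[R]_m) b : (forall i, enorm (u i) <= b) ->
  exists l (s : nat -> nat), forall i, (i <= s i)%N /\ enorm (u (s i) - l) < i.+1%:R^-1.
Proof.
move=> ub.
have FP : ProperFilter (u @ \oo) by apply: fmap_proper_filter.
have [] := @ball_compact R m 0 b (u @ \oo) FP.
  by exists 0%N => // i _ /=; rewrite subr0.
move=> l [_ cl]; exists l.
have : forall i, exists j, (i <= j)%N /\ enorm (u j - l) < i.+1%:R^-1.
  move=> i.
  have [||y [[j ij <-] hj]] := cl [set y | exists2 j, (i <= j)%N & u j = y]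
     [set y | enorm (y - l) < i.+1%:R^-1].
  - by exists i => // j /= ij; exists j.
  - apply/nbhs_enormP; exists i.+1%:R^-1 => //; by rewrite invr_gt0.
  by exists j.
by move=> /choice[s hs]; exists s.
Qed.

Lemma subseq_real (u : nat -> R) b : (forall i, `|u i| <= b) ->
  exists l (s : nat -> nat), forall i, (i <= s i)%N /\ `|u (s i) - l| < i.+1%:R^-1.
Proof.
move=> ub.
have e1 (x : 'rV[R]_1) : enorm x = `|x ord0 ord0|.
  by rewrite /enorm big_ord1 sqrtr_sqr.
have [|l [s hs]] := @subseq_rV 1 (fun i => const_mx (u i)) b.
  by move=> i; rewrite e1 mxE.
exists (l ord0 ord0), s => i; have [? H] := hs i; split => //.
by move: H; rewrite e1 !mxE.
Qed.

Lemma subseq_mx m (u : nat -> 'M[R]_m) b : (forall i j k, `|u i j k| <= b) ->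
  exists (l : 'M[R]_m) (s : nat -> nat), forall i, (i <= s i)%N /\
    forall j k, `|u (s i) j k - l j k| < i.+1%:R^-1.
Proof.
move=> ub.
have [|l [s hs]] := @subseq_rV (m * m) (fun i => mxvec (u i)) ((m * m)%:R * b).
  move=> i; apply: enorm_le_coord => j; case/mxvec_indexP: j => j k.
  by rewrite mxvecE.
exists (vec_mx l), s => i; have [? h] := hs i; split => // j k.
apply: le_lt_trans h.
have := coord_le (mxvec (u (s i)) - l) (mxvec_index j k).
by rewrite !mxE mxvecE -{1}(vec_mxK l) mxvecE mxE.
Qed.

End Compactness.

(** * Derivatives along lines *)

Section Lines.
Variables (R : realType) (n : nat).
Implicit Types (x y v w : 'rV[R]_n) (f g : 'rV[R]_n -> R) (a b t d : R).

Lemma is_deriveP f x v d : is_derive x v f d <->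
  forall e, 0 < e -> exists2 r, 0 < r & forall t, `|t| < r ->
    `|f (x + t *: v) - f x - t * d| <= e * `|t|.
Proof.
have key : is_derive x v f d <->
    (fun t : R => t^-1 *: ((f \o shift x) (t *: v) - f x)) @ 0^' --> d.
  split=> [[h <-]//|h]; apply: DeriveDef; last exact: cvg_lim h.
  by apply/cvg_ex; exists d.
split=> [/key/cvgrPdist_lt h e e0|h].
  have /nbhs_ballP[r /= r0 hr] := h e e0; exists r => // t tr.
  have [->|t0] := eqVneq t 0.
    by rewrite scale0r addr0 subrr mul0r subr0 normr0 mulr0.
  have := hr t; rewrite /ball/= sub0r normrN => /(_ tr t0).
  rewrite /shift/= => {}h; rewrite addrC (addrC x).
  have -> : - (t * d) + (f (t *: v + x) - f x) =
      t * - (d - t^-1 *: (f (t *: v + x) - f x)).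
    by rewrite opprB mulrBr /GRing.scale/= mulVKf// addrC.
  by rewrite normrM normrN mulrC ler_wpM2r// ltW.
apply/key/cvgrPdist_le => e e0; have [r r0 hr] := h e e0.
apply/nbhs_ballP; exists r => // t; rewrite /ball/= sub0r normrN => tr t0.
have := hr t tr; rewrite (addrC x) /shift/=.
have -> : f (t *: v + x) - f x - t * d =
    t * - (d - t^-1 *: (f (t *: v + x) - f x)).
  by rewrite opprB mulrBr /GRing.scale/= mulVKf.
by rewrite normrM normrN mulrC ler_pM2r ?normr_gt0.
Qed.

Lemma is_derive_line f x v d t : is_derive (x + t *: v) v f d ->
  is_derive t 1 (fun s => f (x + s *: v)) d.
Proof.
move=> [h <-].
have E : (fun h : R => h^-1 *: (((fun s => f (x + s *: v)) \o shift t) (h *: 1)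
      - f (x + t *: v))) =
    (fun h => h^-1 *: ((f \o shift (x + t *: v)) (h *: v) - f (x + t *: v))).
  by apply/funext => s /=; rewrite /shift/= [_%:A]mulr1 scalerDl addrCA.
by apply: DeriveDef; rewrite /derivable /derive E.
Qed.

Lemma line_is_derive f x v d :
  is_derive (0 : R) 1 (fun s => f (x + s *: v)) d -> is_derive x v f d.
Proof.
have E : (fun h : R => h^-1 *: (((fun s => f (x + s *: v)) \o shift 0) (h *: 1)
      - f (x + 0 *: v))) =
    (fun h => h^-1 *: ((f \o shift x) (h *: v) - f x)).
  apply/funext => s /=.
  by rewrite /shift/= [_%:A]mulr1 addr0 scale0r addr0 (addrC x).
by move=> [h <-]; apply: DeriveDef; move: h; rewrite /derivable /derive E.
Qed.

Lemma is_deriveZv f x v d a : is_derive x v f d -> is_derive x (a *: v) f (a * d).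
Proof.
move=> /is_deriveP h; apply/is_deriveP => e e0.
have a1 : 0 < `|a| + 1 by rewrite ltr_wpDl.
have [r r0 hr] := h (e / (`|a| + 1)) (divr_gt0 e0 a1).
exists (r / (`|a| + 1)) => [|t tr]; first by rewrite divr_gt0.
have ta : `|t * a| < r.
  rewrite normrM; rewrite ltr_pdivlMr// in tr; apply: le_lt_trans tr.
  by rewrite ler_wpM2l// lerDl.
have := hr _ ta; rewrite scalerA mulrA => /le_trans; apply.
rewrite normrM mulrAC ler_pdivrMr// -mulrA ler_wpM2l ?(ltW e0)//.
by rewrite ler_wpM2l// lerDl.
Qed.

Lemma MVT_line f (df : 'rV[R]_n -> R) x v :
  (forall t, 0 <= t <= 1 -> is_derive (x + t *: v) v f (df (x + t *: v))) ->
  exists2 t, 0 <= t <= 1 & f (x + v) - f x = df (x + t *: v).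
Proof.
move=> h.
have hd t : 0 <= t <= 1 ->
    is_derive t 1 (fun s => f (x + s *: v)) (df (x + t *: v)).
  by move=> /h; exact: is_derive_line.
have [||c] := @MVT_segment R (fun s => f (x + s *: v))
   (fun t => df (x + t *: v)) 0 1 ler01.
- by move=> t; rewrite in_itv/= => /andP[t0 t1]; apply: hd; rewrite !ltW.
- apply: derivable_within_continuous => t; rewrite in_itv/= => /hd[//].
rewrite in_itv/= => c01; rewrite scale1r scale0r addr0 subr0 mulr1 => ->.
by exists c.
Qed.

Lemma incr_line f (df : 'rV[R]_n -> R) x v a :
  (forall y, is_derive y v f (df y)) ->
  (forall t, 0 <= t <= 1 -> `|df (x + t *: v)| <= a) ->
  `|f (x + v) - f x| <= a.
Proof. by move=> h ha; have [t t01 ->] := MVT_line (fun t _ => h (x + t *: v)); auto. Qed.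

(** The point [x + t (v + w)] is reached in two legs. The second leg starts at a moving point; the
    mean value theorem on it and the continuity of [dg] absorb the displacement. *)
Lemma is_deriveDv f (df dg : 'rV[R]_n -> R) v w :
  (forall x, is_derive x v f (df x)) -> (forall x, is_derive x w f (dg x)) ->
  continuous dg -> forall x, is_derive x (v + w) f (df x + dg x).
Proof.
move=> hv hw cg x; apply/is_deriveP => e e0.
have e2 : 0 < e / 2 by rewrite divr_gt0.
have /is_deriveP/(_ _ e2)[r1 r10 h1] := hv x.
have /continuous_enormP/(_ _ e2)[r2 r20 h2] := cg x.
pose b := enorm v + enorm w + 1.
have b0 : 0 < b by rewrite ltr_wpDl// addr_ge0// enorm_ge0.
exists (Num.min r1 (r2 / b)) => [|t]; first by rewrite lt_min r10 divr_gt0.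
rewrite lt_min ltr_pdivlMr// => /andP[t1 t2].
have [s _|s s01 es] := @MVT_line f (fun y => t * dg y) (x + t *: v) (t *: w).
  exact: is_deriveZv.
have -> : f (x + t *: (v + w)) - f x - t * (df x + dg x) =
    (f (x + t *: v) - f x - t * df x) +
    t * (dg (x + t *: v + s *: (t *: w)) - dg x).
  by rewrite mulrBr -es scalerDr addrA; ring.
rewrite (le_trans (ler_normD _ _))// (splitr e) mulrDl lerD ?h1//.
rewrite normrM mulrC ler_wpM2r// ltW// h2//.
rewrite addrAC (addrAC x) subrr add0r; apply: le_lt_trans t2.
rewrite (le_trans (enormD _ _))// !enormZ /b !mulrDr.
rewrite mulr1 -addrA lerD// ler_wpDr// ler_piMl ?mulr_ge0 ?enorm_ge0//.
by case/andP: s01 => s0 s1; rewrite ger0_norm.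
Qed.

Fact taylor2_deriv (z w t s d : R) : t * z + - (t * w) * 1 +
  - (t ^+ 2 / 2 * d) * (2 * s ^+ 2.-1 * 1) = t * (z - w - s * t * d).
Proof. rewrite /=; lra. Qed.

(** A second derivative is assumed at the single point [x]: the mean value theorem is applied to the
    whole remainder, as a function of the fraction [s] of the segment. *)
Lemma line_taylor2 f (df : 'rV[R]_n -> R) x v d :
  (forall y, is_derive y v f (df y)) -> is_derive x v df d ->
  forall e, 0 < e -> exists2 r, 0 < r & forall t, `|t| < r ->
    `|f (x + t *: v) - f x - t * df x - t ^+ 2 / 2 * d| <= e * t ^+ 2.
Proof.
move=> h /is_deriveP h2 e e0; have [r r0 hr] := h2 e e0; exists r => // t tr.
have [s s01 es] : exists2 s, 0 <= s <= 1 &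
  f (x + t *: v) - f x - t * df x - t ^+ 2 / 2 * d =
  t * (df (x + s *: (t *: v)) - df x - (s * t) * d).
  pose g s : R := f (x + s *: (t *: v)) - s * t * df x - s ^+ 2 * t ^+ 2 / 2 * d.
  have hg (s : R) : is_derive s 1 g (t * (df (x + s *: (t *: v)) - df x - (s * t) * d)).
    have h1 : is_derive s 1 (fun s => f (x + s *: (t *: v)))
        (t * df (x + s *: (t *: v))).
      by apply: is_derive_line => //; apply: is_deriveZv.
    have h3 : is_derive s 1 (fun s : R => s) 1 by exact: is_derive_id.
    have -> : g = (fun s => f (x + s *: (t *: v))) +
       ((- (t * df x)) *: (fun s : R => s)) + ((- (t ^+ 2 / 2 * d)) *: (fun s : R => s) ^+ 2).
      apply/funext => u; rewrite /g !fctE /GRing.scale/=; ring.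
    have h4 := is_deriveX 2 h3.
    have h5 := is_deriveD (is_deriveD h1 (is_deriveZ (- (t * df x)) h3))
      (is_deriveZ (- (t ^+ 2 / 2 * d)) h4).
    exact: (is_derive_eq h5 (taylor2_deriv _ _ _ _ _)).
  have [|c] := @MVT_segment R g _ 0 1 ler01 (fun s _ => hg s).
    apply: derivable_within_continuous => u _; by have [] := hg u.
  rewrite in_itv/= => c01; rewrite subr0 mulr1 => ec; exists c => //; rewrite -ec.
  by rewrite /g scale1r scale0r addr0; ring.
rewrite es normrM; have sr : `|s * t| < r.
  rewrite normrM; apply: le_lt_trans tr; rewrite ler_piMl//.
  by case/andP: s01 => s0 s1; rewrite ger0_norm.
rewrite scalerA; have := hr _ sr => /(ler_wpM2l (normr_ge0 t))/le_trans; apply.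
rewrite normrM -(real_normK (num_real t)) expr2 mulrCA ler_wpM2l ?(ltW e0)//.
rewrite mulrCA ler_piMl ?mulr_ge0//.
by case/andP: s01 => s0 s1; rewrite ger0_norm.
Qed.

(** Adding the inequalities at [t] and [- t] cancels the linear terms. *)
Lemma second_test f (df : 'rV[R]_n -> R) x v d a b r :
  (forall y, is_derive y v f (df y)) -> is_derive x v df d -> 0 < r ->
  (forall t, `|t| < r -> f (x + t *: v) <= f x + a * t + b * t ^+ 2) ->
  d <= 2 * b.
Proof.
move=> h1 h2 r0 h; rewrite leNgt; apply/negP => db.
have e0 : 0 < (d - 2 * b) / 4 by lra.
have [r1 r10 H] := line_taylor2 h1 h2 e0.
pose t := Num.min r r1 / 2.
have m0 : 0 < Num.min r r1 by rewrite lt_min r0.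
have t0 : 0 < t by rewrite divr_gt0.
have tm : `|t| < Num.min r r1 by rewrite gtr0_norm// /t; lra.
move: (tm); rewrite lt_min => /andP[tr tr1].
have := h t tr; have := H t tr1.
have := h (- t); have := H (- t); rewrite normrN sqrrN => /(_ tr1) H1 /(_ tr) H2.
move: H1; rewrite !ler_norml => /andP[H1 _] /andP[H3 _] H4.
have t2 : 0 < t ^+ 2 by rewrite exprn_gt0.
nra.
Qed.

End Lines.

(** * Calculus of C^k functions *)

Section Smooth.
Variables (R : realType) (n : nat).
Local Notation V := 'rV[R]_n.
Implicit Types (x y v w : V) (f g : V -> R) (a b t d : R) (k : nat) (i j : 'I_n).

Local Notation e_ i := (delta_mx ord0 i : V).

Lemma half_min (r1 r2 : R) : 0 < r1 -> 0 < r2 ->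
  exists2 t, 0 < t & 2 * t < r1 /\ 2 * t < r2.
Proof.
move=> r10 r20; exists (Num.min r1 r2 / 3); first by rewrite divr_gt0// lt_min r10.
have : Num.min r1 r2 <= r1 /\ Num.min r1 r2 <= r2 by rewrite !ge_min !lexx orbT.
by have [h|h] := leP r1 r2; lra.
Qed.

Lemma is_derive_ext f g x v d : f =1 g -> is_derive x v f d -> is_derive x v g d.
Proof. by move=> /funext ->. Qed.

Lemma is_deriveDf f g x v a b : is_derive x v f a -> is_derive x v g b ->
  is_derive x v (fun y => f y + g y) (a + b).
Proof. by move=> hf hg; exact: is_deriveD. Qed.

Lemma is_deriveBf f g x v a b : is_derive x v f a -> is_derive x v g b ->
  is_derive x v (fun y => f y - g y) (a - b).
Proof. by move=> hf hg; exact: is_deriveB. Qed.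

Lemma is_deriveMf f g x v a b : is_derive x v f a -> is_derive x v g b ->
  is_derive x v (fun y => f y * g y) (a * g x + f x * b).
Proof.
move=> hf hg; apply: is_derive_eq; rewrite /GRing.scale/=; ring.
Qed.

Lemma is_deriveZf f x v a (c : R) : is_derive x v f a ->
  is_derive x v (fun y => c * f y) (c * a).
Proof.
move=> hf; have h := is_deriveMf (is_derive_cst c x v) hf.
by apply: is_derive_eq h _; rewrite /cst mul0r add0r.
Qed.

Lemma is_derive_coord x v i : is_derive x v (fun y : V => y ord0 i) (v ord0 i).
Proof.
apply/is_deriveP => e e0; exists 1 => // t _.
rewrite !mxE (_ : _ - _ = 0) ?normr0 ?mulr_ge0 ?(ltW e0)//; ring.
Qed.

Lemma is_derive_sumf m (f : 'I_m -> V -> R) x v (d : 'I_m -> R) :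
  (forall l, is_derive x v (f l) (d l)) ->
  is_derive x v (fun y => \sum_(l < m) f l y) (\sum_(l < m) d l).
Proof.
elim: m f d => [|m IH] f d h.
  rewrite big_ord0; apply: (is_derive_ext (f := cst 0)).
  by move=> y; rewrite big_ord0.
rewrite big_ord_recr /=.
apply: (is_derive_ext (f := fun y =>
   \sum_(l < m) f (widen_ord (leqnSn m) l) y + f ord_max y)).
  by move=> y; rewrite big_ord_recr.
by apply: is_deriveDf; exact: IH.
Qed.

Lemma is_derive_sqrtf f x v d : 0 < f x -> is_derive x v f d ->
  is_derive x v (fun y => Num.sqrt (f y)) (d / (2 * Num.sqrt (f x))).
Proof.
move=> f0 h; apply: line_is_derive.
have h0 : is_derive (0 : R) 1 (fun s => f (x + s *: v)) d.
  by apply: is_derive_line; rewrite scale0r addr0.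
apply: is_derive_eq.
  apply: (@is_derive1_comp R Num.sqrt (fun s => f (x + s *: v)) 0
    (2 * Num.sqrt (f x))^-1 d).
  by rewrite scale0r addr0; exact: is_derive1_sqrt.
by rewrite mulrC.
Qed.

Lemma is_derive_invf f x v d : f x != 0 -> is_derive x v f d ->
  is_derive x v (fun y => (f y)^-1) (- (d * (f x)^-1 ^+ 2)).
Proof.
move=> f0 [h <-]; apply: DeriveDef; first exact: derivableV.
by rewrite deriveV// /GRing.scale/= mulNr exprVn mulrC.
Qed.

Lemma is_derive_shift x0 f x v d : is_derive (x0 + x) v f d ->
  is_derive x v (fun y => f (x0 + y)) d.
Proof.
move=> /is_deriveP h; apply/is_deriveP => e /h[r r0 hr]; exists r => // t /hr.
by rewrite addrA.
Qed.

Lemma derivable_partial f x i : derivable f x (e_ i) ->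
  is_derive x (e_ i) f (partial i f x).
Proof. by move=> h; exact: derivableP. Qed.

Lemma partial_eq f i (df : V -> R) :
  (forall x, is_derive x (e_ i) f (df x)) -> partial i f = df.
Proof. by move=> h; apply/funext => x; have [_] := h x. Qed.

Lemma Ck_cont k f : Ck k f -> continuous f.
Proof. by case: k => [//|k []]. Qed.

Lemma CkW k f : Ck k.+1 f -> Ck k f.
Proof.
elim: k f => [f []//|k IH f [cf h]]; split=> // i; have [d c] := h i.
by split => //; exact: IH.
Qed.

Lemma Ck_le k l f : (l <= k)%N -> Ck k f -> Ck l f.
Proof.
elim: k => [|k IH]; first by rewrite leqn0 => /eqP ->.
by rewrite leq_eqVlt => /predU1P[->//|/IH h /CkW/h].
Qed.

Lemma Ck_partial_is_derive k f x i : Ck k.+1 f ->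
  is_derive x (e_ i) f (partial i f x).
Proof. by case=> _ /(_ i)[h _]; exact: derivable_partial. Qed.

Lemma Ck_partial k f i : Ck k.+1 f -> Ck k (partial i f).
Proof. by case=> _ /(_ i)[]. Qed.

Lemma CkP k f (df : 'I_n -> V -> R) : continuous f ->
  (forall i x, is_derive x (e_ i) f (df i x)) -> (forall i, Ck k (df i)) ->
  Ck k.+1 f.
Proof.
move=> cf h hk; split => // i; split; first by move=> x; have [] := h i x.
by rewrite (partial_eq (h i)).
Qed.

Lemma Ck_cst k c : Ck k (fun _ : V => c).
Proof.
have cc (a : R) : continuous (fun _ : V => a) by exact: cst_continuous.
elim: k c => [|k IH] c; first exact: cc.
refine (CkP (df := fun _ _ => 0) _ _ _) => [|i]; [exact: cc|exact: IH].
Qed.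

Lemma coord_cont i : continuous (fun x : V => x ord0 i).
Proof. exact: coord_continuous. Qed.

Lemma Ck_coord k i : Ck k (fun x : V => x ord0 i).
Proof.
case: k => [|k]; first exact: coord_cont.
refine (CkP (df := fun j _ => e_ j ord0 i) _ _ _) => [|j x|j]; first exact: coord_cont.
  exact: is_derive_coord.
exact: Ck_cst.
Qed.

Lemma contD f g : continuous f -> continuous g -> continuous (fun x => f x + g x).
Proof. by move=> cf cg x; exact: (cvgD (cf x) (cg x)). Qed.

Lemma contM f g : continuous f -> continuous g -> continuous (fun x => f x * g x).
Proof. by move=> cf cg x; exact: (cvgM (cf x) (cg x)). Qed.

Lemma CkD k f g : Ck k f -> Ck k g -> Ck k (fun x => f x + g x).
Proof.
elim: k f g => [|k IH] f g hf hg.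
  exact: contD.
refine (CkP (df := fun i x => partial i f x + partial i g x) _ _ _).
- exact: contD (Ck_cont hf) (Ck_cont hg).
- by move=> i x; apply: is_deriveDf; apply: Ck_partial_is_derive; eassumption.
- by move=> i; apply: IH; apply: Ck_partial.
Qed.

Lemma CkM k f g : Ck k f -> Ck k g -> Ck k (fun x => f x * g x).
Proof.
elim: k f g => [|k IH] f g hf hg.
  exact: contM.
refine (CkP (df := fun i x => partial i f x * g x + f x * partial i g x) _ _ _).
- exact: contM (Ck_cont hf) (Ck_cont hg).
- by move=> i x; apply: is_deriveMf; apply: Ck_partial_is_derive; eassumption.
- by move=> i; apply: CkD; apply: IH; (apply: Ck_partial || apply: CkW).
Qed.

Lemma CkZ k a f : Ck k f -> Ck k (fun x => a * f x).
Proof. by move=> h; apply: CkM => //; exact: Ck_cst. Qed.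

Lemma CkN k f : Ck k f -> Ck k (fun x => - f x).
Proof.
move=> h; rewrite (_ : (fun x => - f x) = (fun x => -1 * f x)); first exact: CkZ.
by apply/funext => x; rewrite mulN1r.
Qed.

Lemma CkB k f g : Ck k f -> Ck k g -> Ck k (fun x => f x - g x).
Proof. by move=> hf hg; apply: CkD => //; exact: CkN. Qed.

Lemma Ck_sum k m (f : 'I_m -> V -> R) : (forall l, Ck k (f l)) ->
  Ck k (fun x => \sum_(l < m) f l x).
Proof.
elim: m f => [|m IH] f h.
  rewrite (_ : (fun x => _) = (fun=> 0)); first exact: Ck_cst.
  by apply/funext => x; rewrite big_ord0.
rewrite (_ : (fun x => _) = (fun x =>
   \sum_(l < m) f (widen_ord (leqnSn m) l) x + f ord_max x)).
  by apply: CkD => //; exact: IH.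
by apply/funext => x; rewrite big_ord_recr.
Qed.

(** The direction is built one coordinate at a time with [is_deriveDv]; the continuity of the
    partial sums has to be carried along in the induction. *)
Lemma C1_line f x v : Ck 1 f ->
  is_derive x v f (\sum_(i < n) v ord0 i * partial i f x).
Proof.
move=> hf.
have key (s : seq 'I_n) : (forall y, is_derive y (\sum_(i <- s) v ord0 i *: e_ i) f
    (\sum_(i <- s) v ord0 i * partial i f y)) /\
    continuous (fun y => \sum_(i <- s) v ord0 i * partial i f y).
  elim: s => [|i s [IH1 IH2]].
    split=> [y|]; first by rewrite !big_nil; exact: is_derive0.
    rewrite (_ : (fun y => _) = cst 0); first exact: cst_continuous.
    by apply/funext => y; rewrite big_nil.
  have c1 : continuous (fun y => v ord0 i * partial i f y).
    have := CkZ (v ord0 i) (Ck_partial i hf); exact.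
  split=> [y|].
    rewrite !big_cons.
    apply: (@is_deriveDv R n f (fun y => v ord0 i * partial i f y)
      (fun y => \sum_(i <- s) v ord0 i * partial i f y)) => // z.
    by apply: is_deriveZv; apply: Ck_partial_is_derive hf.
  rewrite (_ : (fun y => _) = (fun y => v ord0 i * partial i f y +
      \sum_(i <- s) v ord0 i * partial i f y)) => [y|].
    by apply: contD y; [exact: c1|exact: IH2].
  by apply/funext => y; rewrite big_cons.
by rewrite {1}(rV_sum v); have [] := key (index_enum 'I_n).
Qed.

Definition grad_dot f v x : R := \sum_(i < n) v ord0 i * partial i f x.

Lemma Ck_grad_dot k f v : Ck k.+1 f -> Ck k (grad_dot f v).
Proof. by move=> h; apply: Ck_sum => i; apply: CkZ; exact: Ck_partial. Qed.

Lemma grad_dotE f v x : grad_dot f v x = dot (grad f x) v.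
Proof. by apply: eq_bigr => i _; rewrite mxE mulrC. Qed.

Lemma grad_dot_delta f i x : grad_dot f (e_ i) x = partial i f x.
Proof. by rewrite grad_dotE dot_delta mxE. Qed.

Definition hess f x : 'M[R]_n := \matrix_(i, j) partial j (partial i f) x.

Lemma C2_line f x v : Ck 2 f -> is_derive x v (grad_dot f v) (qf (hess f x) v).
Proof.
move=> h; have -> : qf (hess f x) v =
    \sum_(i < n) v ord0 i * \sum_(j < n) v ord0 j * partial j (partial i f) x.
  apply: eq_bigr => i _; rewrite mulr_sumr; apply: eq_bigr => j _.
  by rewrite mxE; ring.
apply: is_derive_sumf => i; apply: is_deriveZf; apply: C1_line.
exact: Ck_partial.
Qed.

Lemma cont_partial2 f i j : Ck 2 f -> continuous (partial j (partial i f)).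
Proof. by move=> h; exact: (Ck_cont (Ck_partial j (Ck_partial i h))). Qed.

Lemma schwarz f i j : Ck 2 f -> partial j (partial i f) = partial i (partial j f).
Proof.
move=> hf; apply/funext => x.
(* The second difference over a parallelogram of side [t] is [t^2] times a mixed derivative at a
   point within [2 t]. It is symmetric in the two directions, so the two mixed derivatives share a
   value near [x]. *)
have mixed (i' j' : 'I_n) t : 0 <= t -> exists2 z, enorm (z - x) <= 2 * t &
    f (x + t *: e_ i' + t *: e_ j') - f (x + t *: e_ j') -
    (f (x + t *: e_ i') - f x) = t * (t * partial j' (partial i' f) z).
  move=> t0.
  pose g y := f (y + t *: e_ j') - f y.
  have [|s s01 es] := @MVT_line R n g (fun y =>
      t * (partial i' f (y + t *: e_ j') - partial i' f y)) x (t *: e_ i').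
    move=> s _; apply: is_deriveZv; apply: is_deriveBf.
      apply: (is_derive_ext (f := fun y => f (t *: e_ j' + y))) => [y|].
        by rewrite addrC.
      by apply: is_derive_shift; rewrite addrC; apply: Ck_partial_is_derive hf.
    exact: Ck_partial_is_derive hf.
  have [|s' s'01 es'] := @MVT_line R n (partial i' f) (fun y =>
      t * partial j' (partial i' f) y) (x + s *: (t *: e_ i')) (t *: e_ j').
    move=> u _; apply: is_deriveZv; apply: Ck_partial_is_derive.
    exact: Ck_partial hf.
  exists (x + s *: (t *: e_ i') + s' *: (t *: e_ j')).
    rewrite addrAC (addrAC x) subrr add0r (le_trans (enormD _ _))//.
    rewrite !enormZ !enorm_delta !mulr1 !(ger0_norm t0) mulr2n mulrDl mul1r.
    move: s01 s'01 => /andP[s0 s1] /andP[s'0 s'1].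
    by rewrite !ger0_norm// lerD// ler_piMl.
  rewrite -es' -es /g; ring.
have cij := @cont_partial2 f i j hf; have cji := @cont_partial2 f j i hf.
apply/eqP; rewrite -subr_eq0; apply/negPn/negP => ne.
have : 0 < `|partial j (partial i f) x - partial i (partial j f) x| / 2.
  by rewrite divr_gt0// normr_gt0.
have [e Ee] : exists e, e = `|partial j (partial i f) x - partial i (partial j f) x| / 2.
  by eexists.
rewrite -Ee => e0.
have /continuous_enormP/(_ _ e0)[r1 r10 h1] := cij x.
have /continuous_enormP/(_ _ e0)[r2 r20 h2] := cji x.
have [t t0 [tr1 tr2]] := half_min r10 r20.
have [z1 hz1 e1] := mixed i j t (ltW t0).
have [z2 hz2 e2] := mixed j i t (ltW t0).
have : t * (t * partial j (partial i f) z1) = t * (t * partial i (partial j f) z2).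
  apply: etrans (esym e1) (etrans _ e2); rewrite -[x + t *: e_ j + t *: e_ i]addrAC.
  move: (f _) (f _) (f _) (f _) => A B C D; ring.
move=> /(mulfI (lt0r_neq0 t0))/(mulfI (lt0r_neq0 t0)) E.
have := h1 _ (le_lt_trans hz1 tr1); have := h2 _ (le_lt_trans hz2 tr2).
rewrite E; move: Ee; clear.
move: (partial _ _ x) (partial _ _ x) (partial _ _ z2) => A B C ->.
rewrite !ltr_norml => /andP[a1 a2] /andP[b1 b2].
by case: (ler0P (B - A)) => h; rewrite ?(ler0_norm h) ?(gtr0_norm h) in a1 a2 b1 b2; lra.
Qed.

Section Affine.
Variables (x0 : V) (S : 'M[R]_n).
Local Notation aff := (fun y : V => x0 + y *m S).

Lemma is_derive_aff f x v d : is_derive (aff x) (v *m S) f d ->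
  is_derive x v (fun y => f (aff y)) d.
Proof.
move=> /is_deriveP h; apply/is_deriveP => e /h[r r0 hr]; exists r => // t /hr.
by rewrite mulmxDl -scalemxAl addrA.
Qed.

Lemma aff_lipschitz : exists2 a, 0 < a &
  forall y z, enorm (aff y - aff z) <= a * enorm (y - z).
Proof.
exists (n%:R * mxbound S + 1); first by rewrite ltr_wpDl// mulr_ge0// mxbound_ge0.
move=> y z; apply: (@le_trans _ _ (n%:R * mxbound S * enorm (y - z))); last first.
  by rewrite ler_wpM2r ?enorm_ge0// lerDl.
rewrite opprD addrACA subrr add0r -mulmxBl.
have -> : n%:R * mxbound S = \sum_(j < n) mxbound S.
  by rewrite sumr_const card_ord mulr_natl.
rewrite (le_trans (enorm_le_sum _))// mulr_suml; apply: ler_sum => i _; rewrite mxE.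
rewrite (le_trans (ler_norm_sum _ _ _))// mulr_suml.
rewrite [leRHS](_ : _ = \sum_(j < n) (\sum_(l < n) `|S j l|) * enorm (y - z))//.
apply: ler_sum => j _; rewrite normrM mulrC ler_pM ?coord_le//.
by rewrite (bigD1 i)//= lerDl; apply: sumr_ge0.
Qed.

Lemma cont_aff f : continuous f -> continuous (fun y => f (aff y)).
Proof.
move=> cf y; apply/continuous_enormP => e e0.
have /continuous_enormP/(_ _ e0)[r r0 hr] := cf (aff y).
have [a a0 ha] := aff_lipschitz; exists (r / a) => [|z]; first by rewrite divr_gt0.
rewrite ltr_pdivlMr// mulrC => h; apply: hr; exact: le_lt_trans (ha _ _) h.
Qed.

Lemma Ck_aff k f : Ck k f -> Ck k (fun y => f (aff y)).
Proof.
elim: k f => [|k IH] f hf; first exact: cont_aff.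
refine (CkP (df := fun i y => \sum_(j < n) S i j * partial j f (aff y)) _ _ _).
- exact/cont_aff/(Ck_cont hf).
- move=> i x; apply: is_derive_aff.
  have -> : (fun y => \sum_(j < n) S i j * partial j f (x0 + y *m S)) x =
     \sum_(j < n) (e_ i *m S) ord0 j * partial j f (aff x).
    by apply: eq_bigr => j _; rewrite -rowE mxE.
  exact/C1_line/(Ck_le _ hf).
- by move=> i; apply: Ck_sum => j; apply: CkZ; apply: IH; exact: Ck_partial.
Qed.

End Affine.

End Smooth.

(** * Inverses, square roots and squared distances *)

Section SmoothPositive.
Variables (R : realType) (n : nat).
Local Notation V := 'rV[R]_n.
Implicit Types (x y v w : V) (f g : V -> R) (k : nat).

Lemma Ck_inv k f : (forall x, 0 < f x) -> Ck k f -> Ck k (fun x => (f x)^-1).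
Proof.
move=> f0; have fn0 x : f x != 0 by rewrite gt_eqF.
have ci : continuous f -> continuous (fun x => (f x)^-1).
  by move=> cf x; exact: (cvgV (fn0 x) (cf x)).
elim: k f f0 fn0 ci => [|k IH] f f0 fn0 ci hf; first exact: ci.
apply: (CkP (df := fun i x => - (partial i f x * (f x)^-1 ^+ 2))).
- exact: ci (Ck_cont hf).
- by move=> i x; apply: is_derive_invf => //; exact: Ck_partial_is_derive hf.
- have hi : Ck k (fun x => (f x)^-1).
    by apply: IH => //; exact: CkW.
  move=> i; apply: CkN; apply: CkM; first exact: Ck_partial.
  by under eq_fun do rewrite expr2; exact: CkM.
Qed.

Lemma Ck_sqrt k f : (forall x, 0 < f x) -> Ck k f ->
  Ck k (fun x => Num.sqrt (f x)).
Proof.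
move=> f0; have s0 x : 0 < Num.sqrt (f x) by rewrite sqrtr_gt0.
have cs : continuous f -> continuous (fun x => Num.sqrt (f x)).
  move=> cf x; apply: (@continuous_comp _ _ _ f Num.sqrt x (cf x)).
  exact: sqrt_continuous.
elim: k f f0 s0 cs => [|k IH] f f0 s0 cs hf; first exact: cs.
apply: (CkP (df := fun i x => partial i f x / (2 * Num.sqrt (f x)))).
- exact: cs (Ck_cont hf).
- by move=> i x; apply: is_derive_sqrtf => //; exact: Ck_partial_is_derive hf.
- have hi : Ck k (fun x => Num.sqrt (f x)).
    by apply: IH => //; exact: CkW.
  move=> i; apply: CkM; first exact: Ck_partial.
  by apply: Ck_inv => [x|]; [rewrite mulr_gt0|exact: CkZ].
Qed.

Lemma Ck_sqdist k (z : V) : Ck k (fun x => dot (x - z) (x - z)).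
Proof.
apply: Ck_sum => i; have h : Ck k (fun x : V => (x - z) ord0 i).
  rewrite (_ : (fun x : V => _) = (fun x : V => x ord0 i + - z ord0 i)).
    by apply: CkD; [exact: Ck_coord|exact: Ck_cst].
  by apply/funext => x; rewrite !mxE.
exact: CkM.
Qed.

Lemma is_derive_sqdist (z x v : V) :
  is_derive x v (fun y => dot (y - z) (y - z)) (2 * dot (x - z) v).
Proof.
apply/is_deriveP => e e0; have v0 := dot_ge0 v.
exists (e / (dot v v + 1)) => [|t]; first by rewrite divr_gt0// ltr_wpDl.
rewrite ltr_pdivlMr ?ltr_wpDl// => te.
rewrite (_ : x + t *: v - z = (x - z) + t *: v); last by rewrite addrAC.
move: (x - z) => w; rewrite !(dotDl, dotDr, dotZl, dotZr) (dotC v w).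
rewrite [X in `|X|](_ : _ = t * (t * dot v v)); last by ring.
rewrite normrM mulrC ler_wpM2r// normrM (ger0_norm v0).
by apply: le_trans (ltW te); rewrite ler_wpM2l// lerDl.
Qed.

End SmoothPositive.

(** * Smoothed cones as test functions *)

Section SoftCone.
Variables (R : realType) (n : nat) (x0 : 'rV[R]_n) (e : R).
Hypothesis e0 : 0 < e.
Local Notation V := 'rV[R]_n.

(** A cone with vertex [x0] rounded at scale [e], hence an admissible C^1 test function at the
    vertex too. *)
Definition soft_cone (y : V) : R := Num.sqrt (e ^+ 2 + dot (y - x0) (y - x0)).

Lemma soft_cone_arg_gt0 y : 0 < e ^+ 2 + dot (y - x0) (y - x0).
Proof. by rewrite ltr_pwDl ?dot_ge0// exprn_gt0. Qed.

Lemma soft_cone_gt0 y : 0 < soft_cone y.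
Proof. by rewrite sqrtr_gt0 soft_cone_arg_gt0. Qed.

Lemma soft_cone_sqr y : soft_cone y ^+ 2 = e ^+ 2 + enorm (y - x0) ^+ 2.
Proof. by rewrite sqr_sqrtr ?enorm_sqr// ltW// soft_cone_arg_gt0. Qed.

Lemma soft_cone_ge y : enorm (y - x0) <= soft_cone y.
Proof.
rewrite -(ler_pXn2r (n := 2)) ?nnegrE ?enorm_ge0 ?(ltW (soft_cone_gt0 _))//.
by rewrite soft_cone_sqr lerDr sqr_ge0.
Qed.

Lemma soft_cone_le y : soft_cone y <= e + enorm (y - x0).
Proof.
rewrite -(ler_pXn2r (n := 2)) ?nnegrE ?addr_ge0 ?enorm_ge0 ?(ltW e0)//;
  last exact: ltW (soft_cone_gt0 _).
rewrite soft_cone_sqr sqrrD -addrA addrCA lerDr.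
by rewrite mulrn_wge0// mulr_ge0 ?enorm_ge0// ltW.
Qed.

Lemma soft_cone_center : soft_cone x0 = e.
Proof. by rewrite /soft_cone subrr dot0l addr0 sqrtr_sqr gtr0_norm. Qed.

Lemma Ck_soft_cone k : Ck k soft_cone.
Proof.
apply: Ck_sqrt => [y|]; first exact: soft_cone_arg_gt0.
by apply: CkD; [exact: Ck_cst|exact: Ck_sqdist].
Qed.

Lemma is_derive_soft_cone y v : is_derive y v soft_cone (dot (y - x0) v / soft_cone y).
Proof.
have h : is_derive y v (fun y => e ^+ 2 + dot (y - x0) (y - x0)) (0 + 2 * dot (y - x0) v).
  exact: is_deriveDf (is_derive_cst _ _ _) (is_derive_sqdist _ _ _).
have := is_derive_sqrtf (soft_cone_arg_gt0 y) h.
by rewrite add0r -mulf_div divff ?mul1r// gt_eqF.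
Qed.

Variables (a b c : R).
Definition barrier y := a * soft_cone y + b * dot (y - x0) (y - x0) + c.

Lemma Ck_barrier k : Ck k barrier.
Proof.
apply: CkD; last exact: Ck_cst.
by apply: CkD; apply: CkZ; [exact: Ck_soft_cone|exact: Ck_sqdist].
Qed.

Lemma grad_barrier y :
  grad barrier y = (a / soft_cone y + 2 * b) *: (y - x0).
Proof.
apply/rowP => i; rewrite !mxE.
set v : V := delta_mx ord0 i.
have h := is_deriveDf (is_deriveDf (is_deriveZf a (is_derive_soft_cone y v))
  (is_deriveZf b (is_derive_sqdist x0 y v))) (is_derive_cst c y v).
have [_] := h; rewrite /partial /barrier -/v => ->; rewrite dot_delta !mxE; ring.
Qed.

End SoftCone.

(** * One-homogeneous solutions of the eikonal equation *)

Section Eikonal.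
Variables (R : realType) (n : nat) (k : R) (u : 'rV[R]_n -> R).
Local Notation V := 'rV[R]_n.
Hypotheses (k0 : 0 <= k) (homu : homogeneous1 u).
Hypothesis solu : eikonal_viscosity_solution k u.

Let cu : continuous u. Proof. by case: solu. Qed.

Lemma hom1_0 : u 0 = 0.
Proof.
have := @homu 2 0 (ltr0n R 2); rewrite scaler0 => h; lra.
Qed.

Lemma hom1_bounded : exists2 M, 0 <= M & forall y, u y <= M * enorm y.
Proof.
have [z _ hz] := @ball_max R n u 0 1 ler01 cu.
have M0 : 0 <= u z by rewrite -hom1_0 hz// subrr enorm0 ler01.
exists (u z) => // y; have [->|y0] := eqVneq y 0.
  by rewrite hom1_0 enorm0 mulr0.
have e0 : 0 < enorm y by exact: enorm_gt0.
rewrite -{1}(scale1r y) -(mulfV (lt0r_neq0 e0)) -scalerA homu// mulrC.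
rewrite ler_wpM2r ?enorm_ge0// hz// subr0 enormZ gtr0_norm ?invr_gt0//.
by rewrite mulVf ?gt_eqF.
Qed.

(** Subtract from [u] a rounded cone of slope [k' > k] and a tiny quadratic that confines the
    maximum. The subsolution property forces the maximum point into a small neighbourhood of [x0];
    comparing its value with the one at [z] gives the bound. The four [eta] pay for the continuity
    of [u] at [x0], the rounding, the excess slope and the quadratic. *)
Lemma eikonal_lipschitz_approx x0 z eta : 0 < eta -> u z <= u x0 + k * enorm (z - x0) + 4 * eta.
Proof.
move=> eta0; have [M M0 hM] := hom1_bounded.
pose D := enorm (z - x0); have D0 : 0 <= D by exact: enorm_ge0.
pose k' := k + eta / (D + 1); have D1 : 0 < D + 1 by rewrite ltr_wpDl.
have kk' : k < k' by rewrite ltrDl divr_gt0.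
have k'0 : 0 < k' by exact: le_lt_trans kk'.
pose ka := eta / (D ^+ 2 + 1).
have D2 : 0 < D ^+ 2 + 1 by rewrite ltr_wpDl// sqr_ge0.
have ka0 : 0 < ka by rewrite divr_gt0.
have /continuous_enormP/(_ _ eta0)[r r0 hr] := @cu x0.
(* Solving [k' s <= k sqrt (e^2 + s^2)] for [s] gives [s <= C e], which locates the maximum
   point. *)
pose C := k / Num.sqrt (k' ^+ 2 - k ^+ 2).
have kk2 : 0 < k' ^+ 2 - k ^+ 2 by rewrite subr_sqr mulr_gt0 ?subr_gt0// ltr_wpDr.
have s0 : 0 < Num.sqrt (k' ^+ 2 - k ^+ 2) by rewrite sqrtr_gt0.
have C0 : 0 <= C by rewrite divr_ge0// ltW.
pose e := Num.min (eta / k') (r / (C + 1) / 2).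
have C1 : 0 < C + 1 by rewrite ltr_wpDl.
have e0 : 0 < e by rewrite lt_min !divr_gt0.
have ek : k' * e <= eta by rewrite mulrC -ler_pdivlMr// ge_min lexx.
have eC : C * e < r.
  apply: (@le_lt_trans _ _ ((C + 1) * e)).
    by rewrite ler_wpM2r ?lerDl// ltW.
  apply: (@le_lt_trans _ _ ((C + 1) * (r / (C + 1) / 2))).
    by rewrite ler_wpM2l ?(ltW C1)// ge_min lexx orbT.
  rewrite (_ : (C + 1) * _ = r / 2); first by rewrite ltr_pdivrMr// ltr_pMr// ltr1n.
  by field; rewrite gt_eqF.
pose f y := u y - k' * soft_cone x0 e y - ka * dot (y - x0) (y - x0).
have cf : continuous f.
  have : Ck 0 f; last exact.
  by apply: CkB; [apply: CkB|]; [exact: cu|apply: CkZ; exact: Ck_soft_cone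
     |apply: CkZ; exact: Ck_sqdist].
pose b := M + 1 + M * enorm x0 - u x0 + eta + enorm x0.
(* Beyond the radius [rho] the quadratic term dominates. *)
have [rho rho0 hrho] : exists2 rho, 0 < rho & D <= rho /\
    forall y, enorm (y - x0) = rho -> f y < f x0.
  pose A := M * enorm x0 + `|u x0| + eta + 1.
  have A0 : 0 < A.
    by rewrite ltr_wpDl// addr_ge0 ?(ltW eta0)// addr_ge0// mulr_ge0// enorm_ge0.
  have q0 : 0 <= (M + A) / ka by rewrite divr_ge0 ?(ltW ka0)// addr_ge0// ltW.
  exists (D + 1 + (M + A) / ka); first by rewrite ltr_wpDr.
  split; first by rewrite -addrA lerDl addr_ge0.
  move=> y; set rho := D + 1 + _ => hy.
  have r1 : 1 <= rho by rewrite /rho addrAC lerDr addr_ge0.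
  have rk : M + A <= ka * rho.
    by rewrite mulrC -ler_pdivrMr// /rho lerDr addr_ge0.
  have fx0 : f x0 = u x0 - k' * e.
    by rewrite /f soft_cone_center// subrr dot0l mulr0 subr0.
  rewrite fx0 /f -enorm_sqr hy.
  have h1 : u y <= M * (rho + enorm x0).
    apply: (le_trans (hM y)); rewrite ler_wpM2l// -hy.
    by rewrite -{1}(subrK x0 y) enormD.
  have h2 : 0 <= k' * soft_cone x0 e y by rewrite mulr_ge0 ?ltW// soft_cone_gt0.
  have h3 : M * rho + A <= ka * rho ^+ 2.
    apply: (@le_trans _ _ ((M + A) * rho)).
      by rewrite mulrDl lerD2l ler_peMr// ltW.
    by rewrite expr2 mulrA ler_wpM2r// (le_trans _ r1).
  have h4 := ler_norm (- u x0); rewrite normrN in h4.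
  move: h1 h2 h3 ek; rewrite /A mulrDr; lra.
case: hrho => Drho hrho.
have [y1 y1r y1max] := @ball_max R n f x0 rho (ltW rho0) cf.
have y1in : enorm (y1 - x0) < rho.
  rewrite lt_neqAle y1r andbT; apply/eqP => /hrho; rewrite ltNge.
  by rewrite y1max// subrr enorm0 ltW.
pose psi := barrier x0 e k' ka (f y1).
have [_ sub _] := solu.
have ta : touches_from_above psi u y1.
  split; first by rewrite /psi /barrier /f; ring.
  apply/nbhs_enormP; exists (rho - enorm (y1 - x0)); first by rewrite subr_gt0.
  move=> y hy; have : f y <= f y1.
    apply: y1max; rewrite (le_trans (enorm_triangle y1 _ _))//.
    by rewrite -lerBrDr ltW.
  by rewrite /psi /barrier {1}/f; lra.
have := sub psi y1 (Ck_barrier x0 e0 k' ka (f y1) 1) ta.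
rewrite grad_barrier// enormZ ger0_norm; last first.
  apply: addr_ge0; last by rewrite mulr_ge0// ltW.
  by rewrite divr_ge0 ?(ltW k'0)// ltW// soft_cone_gt0.
set s := enorm (y1 - x0) => hs; have sge0 : 0 <= s by exact: enorm_ge0.
pose N := soft_cone x0 e y1; have N0 : 0 < N by exact: soft_cone_gt0.
have hs' : k' * s <= k * N.
  rewrite -ler_pdivrMr//; apply: le_trans hs.
  rewrite [leLHS]mulrAC [leRHS]mulrDl -/N lerDl mulr_ge0//.
  by rewrite mulr_ge0// ltW.
have sC : s <= C * e.
  have : (k' * s) ^+ 2 <= (k * N) ^+ 2.
    by rewrite ler_pXn2r// nnegrE mulr_ge0// ltW.
  rewrite !exprMn soft_cone_sqr// -/s => h.
  rewrite /C mulrAC ler_pdivlMr//.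
  rewrite -(ler_pXn2r (n := 2)) ?nnegrE ?mulr_ge0// ?(ltW e0) ?(ltW s0)//.
  rewrite !exprMn (sqr_sqrtr (ltW kk2)).
  by rewrite mulrBr lerBlDr (mulrC _ (k ^+ 2)) -mulrDr mulrC.
have uy1 : u y1 < u x0 + eta.
  have := hr y1 (le_lt_trans sC eC); rewrite ltr_norml => /andP[_]; lra.
have := y1max z Drho.
have Nz := soft_cone_le x0 e0 z; rewrite -/D in Nz.
have Nz' : k' * soft_cone x0 e z <= k' * e + k * D + eta.
  apply: (le_trans (ler_wpM2l (ltW k'0) Nz)); rewrite mulrDr -addrA lerD2l.
  rewrite {1}/k' mulrDl lerD2l mulrAC ler_pdivrMr//.
  by rewrite ler_wpM2l ?(ltW eta0)// lerDl.
have kaD : ka * D ^+ 2 <= eta.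
  by rewrite /ka mulrAC ler_pdivrMr// ler_wpM2l ?(ltW eta0)// lerDl.
rewrite /f -enorm_sqr -/D -/N => h.
have h5 : 0 <= k' * N by rewrite mulr_ge0// ltW.
have h6 : 0 <= ka * dot (y1 - x0) (y1 - x0) by rewrite mulr_ge0 ?dot_ge0// ltW.
lra.
Qed.

Lemma eikonal_lipschitz x z : u z <= u x + k * enorm (z - x).
Proof.
apply/ler_addgt0Pr => e e0.
have e4 : 0 < e / 4 by rewrite divr_gt0.
by have := eikonal_lipschitz_approx x z e4; lra.
Qed.

(** Minimise [u] plus a rounded cone of slope [k' < k] over the closed ball: the minimum must lie on
    the sphere. *)
Lemma eikonal_descent x0 r d : (0 < n)%N -> 0 < r -> 0 < d ->
  exists2 y, enorm (y - x0) = r & u y <= u x0 - k * r + d.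
Proof.
move=> n0 r0 d0.
have [kE|kgt0] := eqVneq k 0.
  exists (x0 + r *: delta_mx ord0 (Ordinal n0)).
    by rewrite addrAC subrr add0r enormZ enorm_delta mulr1 gtr0_norm.
  rewrite kE mul0r subr0 (le_trans (eikonal_lipschitz x0 _))// kE mul0r addr0.
  by rewrite lerDl ltW.
have {}kgt0 : 0 < k by rewrite lt_neqAle eq_sym kgt0.
pose k' := Num.max 0 (k - d / r / 2).
have k'k : k' < k by rewrite gt_max kgt0/= gtrDl oppr_lt0 !divr_gt0.
have k'0 : 0 <= k' by rewrite le_max lexx.
have k'r : k * r <= k' * r + d / 2.
  apply: (@le_trans _ _ ((k - d / r / 2) * r + d / 2)).
    rewrite le_eqVlt; apply/orP; left; apply/eqP; field; rewrite gt_eqF//.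
  by rewrite lerD2r ler_wpM2r ?(ltW r0)// le_max lexx orbT.
pose e := d / (2 * (k' + 1)).
have k1 : 0 < k' + 1 by rewrite ltr_wpDl.
have e0 : 0 < e by rewrite divr_gt0// mulr_gt0.
have ke : k' * e <= d / 2.
  rewrite (_ : d / 2 = (k' + 1) * e); last by rewrite /e; field; rewrite gt_eqF.
  by rewrite ler_wpM2r ?lerDl// ltW.
pose f y := - (u y + k' * soft_cone x0 e y).
have cf : continuous f.
  have : Ck 0 f; last exact.
  by apply: CkN; apply: CkD; [exact: cu|apply: CkZ; exact: Ck_soft_cone].
have [y1 y1r y1max] := @ball_max R n f x0 r (ltW r0) cf.
(* At an interior minimum the test function would have slope at most [k' < k], against the
   supersolution property. *)
have y1e : enorm (y1 - x0) = r.
  apply/eqP; rewrite eq_le y1r leNgt; apply/negP => y1in.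
  pose psi := barrier x0 e (- k') 0 (- f y1).
  have [_ _ sup] := solu.
  have ta : touches_from_below psi u y1.
    split; first by rewrite /psi /barrier /f; ring.
    apply/nbhs_enormP; exists (r - enorm (y1 - x0)); first by rewrite subr_gt0.
    move=> y hy; have : f y <= f y1.
      apply: y1max; rewrite (le_trans (enorm_triangle y1 _ _))//.
      by rewrite -lerBrDr ltW.
    by rewrite /psi /barrier {1}/f mul0r; lra.
  have := sup psi y1 (Ck_barrier x0 e0 (- k') 0 (- f y1) 1) ta.
  rewrite grad_barrier// mulr0 addr0 enormZ mulNr normrN ger0_norm; last first.
    by rewrite divr_ge0// ltW// soft_cone_gt0.
  apply/negP; rewrite -ltNge; apply: le_lt_trans k'k.
  rewrite mulrAC ler_pdivrMr ?soft_cone_gt0// ler_wpM2l//.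
  exact: soft_cone_ge.
exists y1 => //.
have := y1max x0; rewrite subrr enorm0 (ltW r0) => /(_ isT).
rewrite /f soft_cone_center//.
have : k' * r <= k' * soft_cone x0 e y1 by rewrite -y1e ler_wpM2l// soft_cone_ge.
lra.
Qed.

(** Descend from [x0] to points [y i] at distance [i + 1]. The Lipschitz bound centred at [y i]
    reads [u z <= u (y i) + k |z - y i|], and far away the distance becomes affine in [z]. A limit
    [nu] of the directions gives a supporting affine function at [x0], with gradient of length
    [k]. *)
Lemma eikonal_support x0 : (0 < n)%N -> exists nu, enorm nu = 1 /\
  (forall y, u y <= k * dot nu y) /\ u x0 = k * dot nu x0.
Proof.
move=> n0.
have /choice[y hy] : forall i : nat, exists y,
    enorm (y - x0) = i.+1%:R /\ u y <= u x0 - k * i.+1%:R + i.+1%:R^-1.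
  move=> i; have [||y] := @eikonal_descent x0 i.+1%:R i.+1%:R^-1 n0.
  - by rewrite ltr0n.
  - by rewrite invr_gt0 ltr0n.
  by move=> h1 h2; exists y.
pose w i := i.+1%:R^-1 *: (x0 - y i).
have w1 i : enorm (w i) = 1.
  have [h _] := hy i.
  by rewrite enormZ enormBC h ger0_norm ?invr_ge0// mulVf// pnatr_eq0.
have [|nu [s hs]] := @subseq_rV R n w 1; first by move=> i; rewrite w1.
have nu1 : enorm nu = 1.
  apply/eqP; rewrite eq_le; apply/andP; split.
    apply/ler_addgt0Pr => e e0.
    have [i hi] : exists i : nat, i.+1%:R^-1 < e.
      exists (Num.trunc e^-1); rewrite invf_plt ?posrE//.
      by rewrite truncnS_gt// invr_ge0 ltW.
    have [_ h] := hs i.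
    rewrite -{1}(subrK (w (s i)) nu) (le_trans (enormD _ _))// w1 addrC lerD2l.
    by rewrite enormBC ltW// (lt_trans h).
  apply/ler_addgt0Pr => e e0.
  have [i hi] : exists i : nat, i.+1%:R^-1 < e.
    exists (Num.trunc e^-1); rewrite invf_plt ?posrE//.
    by rewrite truncnS_gt// invr_ge0 ltW.
  have [_ h] := hs i.
  rewrite -(w1 (s i)) -{1}(subrK nu (w (s i))) (le_trans (enormD _ _))// addrC lerD2l.
  by rewrite ltW// (lt_trans h).
have key z : u z <= u x0 + k * dot nu (z - x0).
  apply/ler_addgt0Pr => e e0.
  pose D := enorm (z - x0).
  pose B := 1 + k * D ^+ 2 + k * D.
  have D0 : 0 <= D by exact: enorm_ge0.
  have B0 : 0 < B by rewrite /B -addrA ltr_pwDl// addr_ge0// mulr_ge0// sqr_ge0.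
  have [i hi] : exists i : nat, i.+1%:R^-1 < e / B.
    exists (Num.trunc (e / B)^-1); rewrite invf_plt ?posrE ?divr_gt0//.
    by rewrite truncnS_gt// invr_ge0 divr_ge0// ltW.
  rewrite ltr_pdivlMr// in hi.
  have [isi h] := hs i; have [h1 h2] := hy (s i).
  have := eikonal_lipschitz (y (s i)) z.
  pose m : R := (s i).+1%:R; have m0 : 0 < m by rewrite ltr0n.
  have mi : m^-1 <= i.+1%:R^-1 by rewrite lef_pV2 ?posrE ?ltr0n// ler_nat ltnS.
  (* [|m w + v| <= m + w.v + |v|^2 / m] for a unit vector [w]. *)
  have E : z - y (s i) = m *: w (s i) + (z - x0).
    by rewrite /w scalerA mulfV ?gt_eqF// scale1r [RHS]addrC subrKA.
  have hn : enorm (z - y (s i)) <= m + dot (w (s i)) (z - x0) + D ^+ 2 / m.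
    have dw : - D <= dot (w (s i)) (z - x0).
      by have := ler_norm_dot (w (s i)) (z - x0); rewrite w1 mul1r ler_norml => /andP[].
    rewrite E -(ler_pXn2r (n := 2)) ?nnegrE ?enorm_ge0//; last first.
      have : 0 <= (m - D) ^+ 2 / m by rewrite divr_ge0 ?sqr_ge0// ltW.
      rewrite (_ : _ / m = m - 2 * D + D ^+ 2 / m); last by field; rewrite gt_eqF.
      by move: (D ^+ 2 / m) (dot _ _) dw D0 => q c; lra.
    rewrite enorm_sqr; have := enorm_sqr (z - x0); rewrite -/D.
    move: (z - x0) => v Dv.
    move: (w1 (s i)); move: (w (s i)) => a a1.
    rewrite !(dotDl, dotDr, dotZl, dotZr) (dotC v a) -(enorm_sqr a) a1 -Dv.
    move: (dot _ _) => c; rewrite -subr_ge0.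
    rewrite [leRHS](_ : _ = D ^+ 2 + (c + D ^+ 2 / m) ^+ 2); last first.
      by field; rewrite gt_eqF.
    by rewrite addr_ge0// sqr_ge0.
  have hd : dot (w (s i)) (z - x0) <= dot nu (z - x0) + i.+1%:R^-1 * D.
    rewrite -lerBlDl -dotBl (le_trans (dot_le _ _))// ler_wpM2r ?enorm_ge0//.
    exact: ltW.
  have kn := ler_wpM2l k0 hn; have kd := ler_wpM2l k0 hd.
  have D2m : k * (D ^+ 2 / m) <= k * D ^+ 2 * i.+1%:R^-1.
    by rewrite mulrA ler_wpM2l// mulr_ge0// sqr_ge0.
  move: h2 kn kd hi mi D2m; rewrite -/m /B.
  move: (enorm (z - y _)) (dot nu _) (dot (w _) _) i.+1%:R^-1 (D ^+ 2 / m) m^-1.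
  by move: (u (y _)) (u z) (u x0) => a b c d f g p q r; clear -k; lra.
(* On the ray of [x0] homogeneity makes the affine bound linear: the points [2 x0] and [x0 / 2] give
   the two inequalities between [u x0] and [k nu.x0]. *)
exists nu; split => //; move: (key (2 *: x0)) (key (2^-1 *: x0)).
rewrite !homu ?invr_gt0// !dotBr !dotZr => a1 a2.
have a3 : u x0 = k * dot nu x0 by lra.
by split => // t; have := key t; rewrite dotBr a3; lra.
Qed.

End Eikonal.

(** * Inequalities with a vanishing error *)

Section Limits.
Variables (R : realType).

Lemma inv_small (e : R) : 0 < e -> exists i : nat, i.+1%:R^-1 < e.
Proof.
move=> e0; exists (Num.trunc e^-1); rewrite invf_plt ?posrE//.
by rewrite truncnS_gt// invr_ge0 ltW.
Qed.

Lemma le_limit (a b K : R) : (forall i : nat, a <= b + K * i.+1%:R^-1) -> a <= b.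
Proof.
move=> h; apply/ler_addgt0Pr => e e0.
have K1 : 0 < `|K| + 1 by rewrite ltr_wpDl.
have [i hi] := inv_small (divr_gt0 e0 K1).
apply: (le_trans (h i)); rewrite lerD2l; rewrite ltr_pdivlMr// in hi.
apply: le_trans (ltW hi); rewrite mulrC ler_wpM2l ?invr_ge0//.
by rewrite (le_trans (ler_norm _))// lerDl.
Qed.

End Limits.

(** * Touching paraboloids, slopes and concavity *)

Section Touching.
Variables (R : realType) (n : nat).
Local Notation V := 'rV[R]_n.
Implicit Types (x y z p q h : V) (f : V -> R) (M B : 'M[R]_n) (r s t K : R).

Lemma bf_dotl M x y : bf M x y = dot (x *m M) y.
Proof.
rewrite /bf /dot exchange_big; apply: eq_bigr => j _.
by rewrite mxE mulr_suml.
Qed.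

Lemma bf_dotr M x y : bf M x y = dot (y *m M^T) x.
Proof.
rewrite -bf_dotl /bf exchange_big; apply: eq_bigr => j _.
by apply: eq_bigr => i _; rewrite mxE; ring.
Qed.

Lemma quad_shift M p h0 h : dot p (h0 + h) + qf M (h0 + h) =
  dot p h0 + qf M h0 + dot (p + h0 *m (M + M^T)) h + qf M h.
Proof.
rewrite qf_add (bf_dotl M h0) (bf_dotr M h) mulmxDr !dotDl !dotDr; ring.
Qed.

Lemma small_scale (w : V) r : 0 < r -> exists2 t, 0 < t &
  forall s, 0 < s -> s <= t -> enorm (s *: w) < r.
Proof.
move=> r0; have w1 : 0 < enorm w + 1 by rewrite ltr_wpDl ?enorm_ge0.
exists (r / (enorm w + 1)) => [|s s0 st]; first by rewrite divr_gt0.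
rewrite enormZ gtr0_norm//; apply: (@lt_le_trans _ _ (s * (enorm w + 1))).
  by rewrite ltr_pM2l// ltrDl.
by rewrite -ler_pdivlMr.
Qed.

(** Insert [h = s (p - q)] with [s] small: after division by [s] the quadratic error disappears. *)
Lemma slope_unique p q K r : 0 < r ->
  (forall h, enorm h < r -> dot p h <= dot q h + K * dot h h) -> p = q.
Proof.
move=> r0 hK; apply/eqP; rewrite -subr_eq0; apply/eqP/dot_eq0/le_anti.
rewrite dot_ge0 andbT; have [t t0 ht] := small_scale (p - q) r0.
have key s : 0 < s -> s <= t -> dot (p - q) (p - q) <= s * (K * dot (p - q) (p - q)).
  move=> s0 st; have := hK _ (ht s s0 st); rewrite !dotZr dotZl => hs; rewrite -(ler_pM2l s0).
  move: hs; rewrite {2}dotBl; move: (dot p _) (dot q _) (dot (p - q) _) => a b d; lra.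
apply: (@le_limit _ _ _ (t * (K * dot (p - q) (p - q)))) => i.
have := key (t * i.+1%:R^-1); rewrite add0r mulrAC; apply.
  by rewrite mulr_gt0// invr_gt0 ltr0n.
by rewrite ler_piMr ?(ltW t0)// invf_le1 ?ltr0n// ler1n.
Qed.

Lemma psd_local M r : 0 < r -> (forall h, enorm h < r -> 0 <= qf M h) -> psd M.
Proof.
move=> r0 h w; have [t t0 ht] := small_scale w r0.
by have := h _ (ht t t0 (lexx t)); rewrite qfZ pmulr_rge0// exprn_gt0.
Qed.

(** Concavity and convexity of [f + K |x|^2] in pointwise form. One slope serves for the plane above
    and the paraboloid below, so such an [f] is C^{1,1}. *)
Definition touch2 K f := forall x, exists p, forall h,
  f x + dot p h - K * dot h h <= f (x + h) /\ f (x + h) <= f x + dot p h.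

Definition cvx_comb f := forall a b x y, 0 <= a -> 0 <= b -> a + b = 1 ->
  a * f x + b * f y <= f (a *: x + b *: y).

Lemma supergrad_concave f :
  (forall x, exists p, forall h, f (x + h) <= f x + dot p h) -> cvx_comb f.
Proof.
move=> hf a b x y a0 b0 ab; set z := a *: x + b *: y.
have [p hp] := hf z.
have h1 := hp (x - z); have h2 := hp (y - z).
move: h1 h2; rewrite ![z + _]addrC !subrK => h1 h2.
apply: (le_trans (lerD (ler_wpM2l a0 h1) (ler_wpM2l b0 h2))).
rewrite !mulrDr addrACA -mulrDl ab mul1r -!dotZr -dotDr !scalerBr addrACA.
by rewrite -/z -opprD -scalerDl ab scale1r subrr dot0r addr0.
Qed.

Lemma touch2_concave K f : touch2 K f -> cvx_comb f.
Proof.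
by move=> hf; apply: supergrad_concave => x; have [p hp] := hf x; exists p => h;
  have [] := hp h.
Qed.

(* A concave function lies below the affine part of any paraboloid touching it
   from below. *)
Lemma concave_touch K f x p : cvx_comb f ->
  (forall h, f x + dot p h - K * dot h h <= f (x + h)) ->
  forall h, f (x + h) <= f x + dot p h.
Proof.
move=> cf hp h; apply: (@le_limit _ _ _ (K * dot h h)) => i.
pose t : R := i.+1%:R^-1; have t0 : 0 < t by rewrite invr_gt0 ltr0n.
have t1 : 0 < 1 + t by rewrite ltr_pwDl// ltW.
have := hp (- (t *: h)); rewrite !(dotNl, dotNr, dotZl, dotZr) => h1.
have := @cf (t / (1 + t)) (1 + t)^-1 (x + h) (x - t *: h).
rewrite divr_ge0 ?invr_ge0 ?(ltW t0) ?(ltW t1)// => /(_ isT isT).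
have -> : t / (1 + t) + (1 + t)^-1 = 1 by field; rewrite gt_eqF.
have -> : (t / (1 + t)) *: (x + h) + (1 + t)^-1 *: (x - t *: h) = x.
  rewrite scalerDr scalerBr scalerA (mulrC (1 + t)^-1) addrACA -scalerDl.
  rewrite subrr addr0 (_ : t / (1 + t) + _ = 1) ?scale1r//.
  by field; rewrite gt_eqF.
move=> /(_ erefl) h2.
have {}h2 : t * f (x + h) + f (x - t *: h) <= (1 + t) * f x.
  move: h2; rewrite -(ler_pM2l t1); congr (_ <= _).
  by field; rewrite gt_eqF.
rewrite -/t -(ler_pM2l t0); nra.
Qed.

(** A supergradient longer than [k] would make [f] fall along [- p] faster than the lower bound
    permits. *)
Lemma slope_le_bound f k b x p : 0 <= k ->
  (forall y, - (k * enorm y) - b <= f y) ->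
  (forall h, f (x + h) <= f x + dot p h) -> enorm p <= k.
Proof.
move=> k0 fb hp; rewrite leNgt; apply/negP => kp.
have p0 : 0 < enorm p by exact: le_lt_trans kp.
(* test the supergradient inequality along [- t p] *)
have key t : 0 < t -> t * (enorm p * (enorm p - k)) <= f x + b + k * enorm x.
  move=> t0; have := hp (- (t *: p)); rewrite dotNr dotZr -enorm_sqr.
  have := fb (x - t *: p).
  have : enorm (x - t *: p) <= enorm x + t * enorm p.
    by rewrite (le_trans (enormB _ _))// enormZ gtr0_norm.
  move=> /(ler_wpM2l k0); lra.
have a0 : 0 < enorm p * (enorm p - k) by rewrite mulr_gt0// subr_gt0.
have : `|f x + b + k * enorm x| + 1 <= f x + b + k * enorm x.
  have t0 : 0 < (`|f x + b + k * enorm x| + 1) / (enorm p * (enorm p - k)).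
    by rewrite divr_gt0// ltr_wpDl.
  by have := key _ t0; rewrite divfK// gt_eqF.
have := ler_norm (f x + b + k * enorm x); lra.
Qed.

Lemma supergrad_lipschitz f k :
  (forall x, exists2 p, enorm p <= k & forall h, f (x + h) <= f x + dot p h) ->
  forall x y, `|f x - f y| <= k * enorm (x - y).
Proof.
move=> hf.
have key x y : f x - f y <= k * enorm (x - y).
  have [p pk /(_ (x - y))] := hf y; rewrite addrC subrK -lerBlDl => /le_trans; apply.
  by rewrite (le_trans (dot_le _ _))// ler_wpM2r// enorm_ge0.
by move=> x y; rewrite ler_norml lerNl opprB key enormBC key.
Qed.

End Touching.

(** * Perron's method in a class of concave subsolutions *)

Section ViscosityClass.
Variables (R : realType) (n : nat) (k C : R) (G low : 'rV[R]_n -> R).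
Variables (slo : nat -> 'rV[R]_n) (off : nat -> R).
Local Notation V := 'rV[R]_n.
Implicit Types (x y z p q h : V) (f : V -> R) (M B : 'M[R]_n) (r s t : R).

(** The test paraboloid has Hessian [M + M^T], so this is the inequality [trA p (D^2 f) >= - 2 G p]
    divided by two. *)
Definition visc_sub f := forall x p M r, 0 < r ->
  (forall h, enorm h < r -> f (x + h) <= f x + dot p h + qf M h) ->
  - trA p M <= G p.

Definition visc_sup f := forall x p M r, 0 < r ->
  (forall h, enorm h < r -> f x + dot p h + qf M h <= f (x + h)) ->
  G p <= - trA p M.

Definition plane i x := dot (slo i) x + off i.

(** The lower bound keeps slopes at most [k], the planes bound the class from above, and the fixed
    opening [C] provides compactness of slopes. *)
Definition perron_class f := [/\ touch2 C f, visc_sub f,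
  forall x, low x <= f x & forall i x, f x <= plane i x].

Hypothesis k0 : 0 <= k.
Hypothesis C0 : 0 < C.
Hypothesis cG : continuous G.
Hypothesis low_ge : forall y, - (k * enorm y) <= low y.
Hypothesis slo_norm : forall i, enorm (slo i) = k.
Hypothesis G_ge0 : forall p, 0 <= G p -> enorm p <= k.
Hypothesis G_gt0 : forall p, 0 < G p -> enorm p < k.
(** What makes a fixed opening [C] consistent: a concave paraboloid satisfying the subsolution
    inequality cannot bend more than [C]. *)
Hypothesis C_bound : forall p B, psd B -> trA p B <= G p ->
  forall x, qf B x <= C * dot x x.

Lemma perron_slope f x p : perron_class f ->
  (forall h, f (x + h) <= f x + dot p h) -> enorm p <= k.
Proof.
move=> [_ _ lf _]; apply: slope_le_bound k0 _; last first.
(* The additive constant of [slope_le_bound] is [0], because [low] itself is at least [- k |y|]. *)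
Unshelve. 2: exact: 0.
by move=> y; rewrite subr0 (le_trans (low_ge _)).
Qed.

Lemma perron_touch f x : perron_class f -> exists2 p, enorm p <= k & forall h,
  f x + dot p h - C * dot h h <= f (x + h) /\ f (x + h) <= f x + dot p h.
Proof.
move=> Sf; have [tf _ _ _] := Sf; have [p hp] := tf x; exists p => //.
by apply: (perron_slope (x := x) Sf) => h; have [] := hp h.
Qed.

Lemma perron_lipschitz f x y : perron_class f -> `|f x - f y| <= k * enorm (x - y).
Proof.
move=> Sf; apply: supergrad_lipschitz => {}x.
have [p pk hp] := perron_touch x Sf; exists p => // h; by have [] := hp h.
Qed.

Lemma perron_cont f : perron_class f -> continuous f.
Proof. by move=> Sf; apply: lipschitz_continuous => x y; exact: perron_lipschitz. Qed.

Lemma trA_cont M : continuous (fun p => trA p M).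
Proof.
have c1 : Ck 0 (fun p : V => qf M p).
  apply: Ck_sum => i; apply: Ck_sum => j.
  by apply: CkM; [apply: CkM|]; [exact: Ck_coord|exact: Ck_cst|exact: Ck_coord].
have c2 : Ck 0 (fun p : V => 1 + dot p p).
  apply: CkD; first exact: Ck_cst.
  by apply: Ck_sum => i; apply: CkM; exact: Ck_coord.
have : Ck 0 (fun p : V => trA p M); last exact.
apply: CkB; first exact: Ck_cst.
by apply: CkM => //; apply: Ck_inv => // p; exact: dot1_gt0.
Qed.

Lemma slope_near p M : G p < - trA p M -> exists2 d, 0 < d & forall q,
  enorm (q - p) < d -> G q + trA q M + d < 0.
Proof.
move=> hp.
have : continuous (fun q => G q + trA q M) by apply: contD => //; exact: trA_cont.
pose g := - (G p + trA p M) / 2; have g0 : 0 < g by rewrite /g; lra.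
move=> /(_ p)/continuous_enormP/(_ g g0)[d d0 hd].
exists (Num.min d g) => [|q]; first by rewrite lt_min d0.
rewrite lt_min => /andP[/hd]; rewrite ltr_norml => /andP[_ h] _.
have : Num.min d g <= g by rewrite ge_min lexx orbT.
by move: h; rewrite /g; lra.
Qed.

(** A supremum of concave functions need not be concave, but in a chain two near-optimal members can
    be replaced by the larger one. Slopes converge along near-optimal members, and the subsolution
    inequality passes to the supremum by perturbing the test paraboloid. *)
Lemma chain_sup (A : set (V -> R)) : A !=set0 -> A `<=` perron_class ->
  (forall f g, A f -> A g -> (forall x, f x <= g x) \/ (forall x, g x <= f x)) ->
  exists2 phi, perron_class phi & forall f, A f -> forall x, f x <= phi x.
Proof.
move=> [f0 Af0] AS tot.
pose phi x := sup [set f x | f in A].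
have hs x : has_sup [set f x | f in A].
  split; first by exists (f0 x), f0.
  by exists (plane 0 x) => _ [f /AS[_ _ _ hf] <-]; exact: hf.
have ub f x : A f -> f x <= phi x.
  by move=> Af; apply: sup_upper_bound => //; exists f.
have adh x e : 0 < e -> exists2 f, A f & phi x - e < f x.
  by move=> e0; have [_ [f Af <-] h] := sup_adherent e0 (hs x); exists f.
exists phi; last by move=> f Af x; exact: ub.
have ccv : cvx_comb phi.
  move=> a b x y a0 b0 ab; apply/ler_addgt0Pr => e e0.
  have [f Af hf] := adh x e e0; have [g Ag hg] := adh y e e0.
  have [w [Aw wf wg]] : exists w, [/\ A w, f x <= w x & g y <= w y].
    by have [h|h] := tot f g Af Ag; [exists g|exists f].
  have [tw _ _ _] := AS w Aw; have := touch2_concave tw x y a0 b0 ab.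
  have := ub w (a *: x + b *: y) Aw.
  have h1 : phi x <= w x + e by lra.
  have h2 : phi y <= w y + e by lra.
  have := ler_wpM2l a0 h1; have := ler_wpM2l b0 h2; rewrite !mulrDr.
  have : a * e + b * e = e by rewrite -mulrDl ab mul1r.
  lra.
split => [x|x p M r r0 hM|x|i x].
- have /choice[u hu] : forall i : nat, exists u : (V -> R) * V,
      [/\ A u.1, phi x - i.+1%:R^-1 < u.1 x, enorm u.2 <= k & forall h,
       u.1 x + dot u.2 h - C * dot h h <= u.1 (x + h)].
    move=> i; have i0 : 0 < i.+1%:R^-1 :> R by rewrite invr_gt0 ltr0n.
    have [f Af hf] := adh x _ i0; have [p pk hp] := perron_touch x (AS f Af).
    by exists (f, p); split => // h; have [] := hp h.
  have [|p [s hsub]] := @subseq_rV R n (fun i => (u i).2) k.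
    by move=> i; have [] := hu i.
  have lo h : phi x + dot p h - C * dot h h <= phi (x + h).
    apply: (@le_limit _ _ _ (1 + enorm h)) => i.
    have [isi hi] := hsub i; have [Au hx _ /(_ h) hl] := hu (s i).
    have := ub _ (x + h) Au.
    have h1 : (s i).+1%:R^-1 <= i.+1%:R^-1 :> R.
      by rewrite lef_pV2 ?posrE ?ltr0n// ler_nat ltnS.
    have h2 : dot (p - (u (s i)).2) h <= i.+1%:R^-1 * enorm h.
      rewrite (le_trans (dot_le _ _))// ler_wpM2r ?enorm_ge0// enormBC.
      exact: ltW.
    move: h2 h1 hx; rewrite dotBl.
    by move: i.+1%:R^-1 (s i).+1%:R^-1 => a b; lra.
  exists p => h; split => //.
  exact: (concave_touch ccv lo).
- rewrite leNgt; apply/negP => gap.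
  (* Adding [e |h|^2] makes the contact strict. A chain member close to [phi] at [x] then has its
     maximum, relative to the new paraboloid, inside the small ball; re-expanding the paraboloid
     there gives a test with a slope close to [p]. *)
  have [d d0 hd] := slope_near gap.
  pose e := d / (n.+1)%:R.
  have e0 : 0 < e by rewrite divr_gt0// ltr0n.
  pose Me : 'M[R]_n := M + e%:M.
  have [a a0 ha] := @aff_lipschitz R n 0 (Me + Me^T).
  pose rho := Num.min (r / 2) (d / (2 * a)).
  have rho0 : 0 < rho by rewrite lt_min !divr_gt0// mulr_gt0.
  have rhor : rho < r.
    have : rho <= r / 2 by rewrite ge_min lexx.
    lra.
  have rhoa : a * rho < d.
    have : rho <= d / (2 * a) by rewrite ge_min lexx orbT.
    rewrite ler_pdivlMr ?mulr_gt0//; lra.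
  have er0 : 0 < e * rho ^+ 2 by rewrite mulr_gt0// exprn_gt0.
  have [f Af hf] := adh x _ er0.
  have Sf := AS f Af.
  pose g y := f y - (dot p (y - x) + qf Me (y - x)).
  have cg : continuous g.
    have : Ck 0 g; last exact.
    apply: CkB; first exact: perron_cont.
    have -> : (fun y => dot p (y - x) + qf Me (y - x)) =
       (fun y => (fun z => dot p z + qf Me z) (- x + y *m 1%:M)).
      by apply/funext => y; rewrite mulmx1 (addrC (- x)).
    apply: (@Ck_aff R n (- x) 1%:M 0 (fun z => dot p z + qf Me z)); apply: CkD.
      by apply: Ck_sum => i; apply: CkZ; exact: Ck_coord.
    apply: Ck_sum => i; apply: Ck_sum => j.
    by apply: CkM; [apply: CkM|]; [exact: Ck_coord|exact: Ck_cst|exact: Ck_coord].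
  have [y yr ymax] := @ball_max R n g x rho (ltW rho0) cg.
  have gx : phi x - e * rho ^+ 2 < g y.
    apply: (lt_le_trans hf); have := ymax x; rewrite subrr enorm0 (ltW rho0) => /(_ isT).
    by apply: le_trans; rewrite /g subrr dot0r qf0 addr0 subr0.
  have yin : enorm (y - x) < rho.
    rewrite lt_neqAle yr andbT; apply/eqP => ye.
    have := hM (y - x); rewrite ye => /(_ rhor); rewrite addrC subrK.
    have := ub f y Af; move: gx.
    by rewrite /g /Me qf_mxD qf_scalar -enorm_sqr ye; lra.
  pose q := p + (y - x) *m (Me + Me^T).
  have qp : enorm (q - p) < d.
    apply: le_lt_trans rhoa; rewrite /q addrAC subrr add0r.
    have := ha (y - x) 0; rewrite mul0mx !add0r subr0 => /le_trans; apply.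
    by rewrite subr0 ler_wpM2l ?(ltW a0).
  have [_ sf _ _] := Sf.
  have := sf y q Me (rho - enorm (y - x)); rewrite subr_gt0 yin => /(_ isT) {}sf.
  have {sf} : - trA q Me <= G q.
    apply: sf => h hh; have : g (y + h) <= g y.
      apply: ymax; rewrite addrAC (le_trans (enormD _ _))//.
      by rewrite -lerBrDl ltW.
    rewrite /g (_ : y + h - x = (y - x) + h); last by rewrite addrAC.
    by rewrite (quad_shift _ _ (y - x) h) -/q; move: (dot q h) (qf Me h) => a1 a2; lra.
  have := hd q qp.
  have : trA q (e%:M : 'M[R]_n) <= d.
    rewrite (le_trans (trA_scalar_le _ (ltW e0)))//.
    rewrite /e mulrCA ler_piMr ?(ltW d0)// ler_pdivrMr ?ltr0n// mul1r ler_nat.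
    exact: leqnSn.
  by rewrite /Me trAD; lra.
- have [_ _ lf _] := AS f0 Af0; exact: le_trans (lf x) (ub _ _ Af0).
- apply: ge_sup; first by have [] := hs x.
  by move=> _ [f /AS[_ _ _ hf] <-]; exact: hf.
Qed.

(* If [phi] violates the supersolution inequality at [x1], the concave hull [W]
   of [phi] and of a paraboloid [psi] slightly above [phi] near [x1] is a larger
   element of the class.  Points of [W] are convex combinations of one point of
   the graph of [phi] and one of the graph of [psi]; at such a point the second
   order condition is averaged because [psi] is smooth. *)
Section Bump.
Variables (phi : V -> R) (x1 p1 : V) (B : 'M[R]_n) (r eta del : R).
Hypothesis Sphi : perron_class phi.
Hypothesis psdB : psd B.
Hypothesis eta0 : 0 < eta.
Hypothesis del0 : 0 < del.

Let psi z := phi x1 + del + (dot p1 (z - x1) + qf (- B) (z - x1)).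
Let slope z := p1 + (z - x1) *m (- B + (- B)^T).

Hypothesis psi_sub : forall z, enorm (z - x1) <= eta -> trA (slope z) B <= G (slope z).
Hypothesis psi_phi : forall z, enorm (z - x1) <= eta -> psi z - del <= phi z.
Hypothesis psi_bd : forall z, enorm (z - x1) = eta -> psi z < phi z.
Hypothesis psi_plane : forall i z, enorm (z - x1) <= eta -> psi z <= plane i z.

Let psi_shift z h : psi (z + h) = psi z + dot (slope z) h - qf B h.
Proof.
rewrite /psi (_ : z + h - x1 = (z - x1) + h); last by rewrite addrAC.
by rewrite (quad_shift _ _ (z - x1) h) -/(slope z) !qf_mxN; ring.
Qed.

Let psi_cont : continuous psi.
Proof.
have : Ck 0 psi; last exact.
have -> : psi = (fun y => (fun z => phi x1 + del + (dot p1 z + qf (- B) z))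
    (- x1 + y *m 1%:M)).
  by apply/funext => y; rewrite mulmx1 (addrC (- x1)).
apply: (@Ck_aff R n (- x1) 1%:M 0 (fun z => phi x1 + del + (dot p1 z + qf (- B) z))).
apply: CkD; [exact: Ck_cst|apply: CkD].
  by apply: Ck_sum => i; apply: CkZ; exact: Ck_coord.
apply: Ck_sum => i; apply: Ck_sum => j.
by apply: CkM; [apply: CkM|]; [exact: Ck_coord|exact: Ck_cst|exact: Ck_coord].
Qed.

Let psi_touch z h : psi (z + h) <= psi z + dot (slope z) h.
Proof. by rewrite psi_shift gerBl psdB. Qed.

Let psi_ccv : cvx_comb psi.
Proof. by apply: supergrad_concave => z; exists (slope z). Qed.

Let psi_C z h : enorm (z - x1) <= eta -> psi z + dot (slope z) h - C * dot h h <= psi (z + h).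
Proof.
by move=> /psi_sub hz; rewrite psi_shift lerD2l lerN2 (C_bound psdB hz).
Qed.

Let phi_C x : exists2 p, enorm p <= k & forall h,
  phi x + dot p h - C * dot h h <= phi (x + h) /\ phi (x + h) <= phi x + dot p h.
Proof. exact: perron_touch. Qed.

Let phi_ccv : cvx_comb phi.
Proof. by have [tp _ _ _] := Sphi; exact: touch2_concave tp. Qed.

(* The lower paraboloid at an interior point of the ball also lies below [phi]
   outside the ball, because [phi + C |.|^2] is convex. *)
Let cross z h : enorm (z - x1) <= eta -> phi z <= psi z -> eta < enorm (z + h - x1) ->
  psi z + dot (slope z) h - C * dot h h <= phi (z + h).
Proof.
move=> zin pz out.
have [s s01 hs] : exists2 s, s \in `[0, 1] & enorm (z + s *: h - x1) = eta.
  apply: (@IVT R (fun s => enorm (z + s *: h - x1)) 0 1 eta ler01).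
    apply: continuous_subspaceT => s.
    apply/cvgrPdist_le => e e0.
    have h1 : 0 < enorm h + 1 by rewrite ltr_wpDl ?enorm_ge0.
    apply/nbhs_ballP; exists (e / (enorm h + 1)) => /=; first by rewrite divr_gt0.
    move=> t; rewrite /ball/= => st.
    rewrite (le_trans (enorm_dist _ _))//.
    rewrite (_ : _ - _ = (s - t) *: h); last by rewrite scalerBl opprB addrA subrK opprD addrACA subrr add0r.
    rewrite enormZ; apply: (@le_trans _ _ (`|s - t| * (enorm h + 1))).
      by rewrite ler_wpM2l// lerDl.
    by rewrite -ler_pdivlMr// ltW.
  by rewrite scale0r addr0 scale1r ge_min zin/= le_max (ltW out) orbT.
move: s01; rewrite in_itv/= => /andP[s0 s1].
have pzs := psi_bd hs.
have s0' : 0 < s.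
  rewrite lt_neqAle s0 andbT; apply/eqP => s00.
  by move: pzs; rewrite -s00 scale0r addr0 ltNge pz.
have [p _ hp] := phi_C (z + s *: h).
have [a1 _] := hp (- (s *: h)); have [a2 _] := hp ((1 - s) *: h).
move: a1 a2; rewrite addrK -(addrA z) -scalerDl (addrC s (1 - s)) subrK scale1r.
rewrite !(dotNr, dotNl, dotZr, dotZl) => a1 a2.
have a3 := @psi_C z (s *: h) zin; rewrite !(dotZr, dotZl) in a3.
have sm1 : 0 <= 1 - s by rewrite subr_ge0.
have b1 := ler_wpM2l sm1 a1; have b2 := ler_wpM2l s0 a2.
have b3 := ler_wpM2l sm1 pz; rewrite -(ler_pM2l s0').
move: pzs a3 b1 b2 b3.
move: (phi _) (phi _) (phi _) (psi _) (psi _) (dot _ _) (dot _ _) (dot _ _).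
by move=> A D E I J H K L; lra.
Qed.

Let Wset x : set R := [set v | exists m y z, [/\ 0 <= m <= 1,
  enorm (z - x1) <= eta, x = (1 - m) *: y + m *: z &
  v = (1 - m) * phi y + m * psi z]].
Let W x := sup (Wset x).

Let plane_comb i m y z :
  plane i ((1 - m) *: y + m *: z) = (1 - m) * plane i y + m * plane i z.
Proof. by rewrite /plane dotDr !dotZr; ring. Qed.

Let Wset_plane i x v : Wset x v -> v <= plane i x.
Proof.
move=> [m [y [z [/andP[m0 m1] zin -> ->]]]]; rewrite plane_comb.
have [_ _ _ pp] := Sphi.
by rewrite lerD// ler_wpM2l ?subr_ge0 ?pp ?psi_plane.
Qed.

Let center_in : enorm (x1 - x1) <= eta.
Proof. by rewrite subrr enorm0 ltW. Qed.

Let phi_Wset x : Wset x (phi x).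
Proof.
by exists 0, x, x1; split => //; rewrite ?lexx ?ler01 ?subr0 ?scale1r ?scale0r
  ?mul1r ?mul0r ?addr0.
Qed.

Let W_has_sup x : has_sup (Wset x).
Proof.
by split; [exists (phi x)|exists (plane 0 x) => v; exact: Wset_plane].
Qed.

Let W_ge m y z : 0 <= m <= 1 -> enorm (z - x1) <= eta ->
  (1 - m) * phi y + m * psi z <= W ((1 - m) *: y + m *: z).
Proof. by move=> m01 zin; apply: sup_upper_bound => //; exists m, y, z. Qed.

Let W_phi x : phi x <= W x.
Proof. exact: sup_upper_bound. Qed.

Let W_adh x e : 0 < e -> exists m y z, [/\ 0 <= m <= 1,
  enorm (z - x1) <= eta, x = (1 - m) *: y + m *: z &
  W x - e < (1 - m) * phi y + m * psi z].
Proof.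
move=> e0; have [v [m [y [z [m01 zin xE ->]]]] h] := sup_adherent e0 (W_has_sup x).
by exists m, y, z.
Qed.

Let W_plane i x : W x <= plane i x.
Proof.
by apply: ge_sup => [|v]; [have [] := W_has_sup x|exact: Wset_plane].
Qed.

(** Barycentre with unnormalised weights. Both weights may vanish, and then any point will do. *)
Let comb f a b x y : cvx_comb f -> 0 <= a -> 0 <= b -> exists w,
  [/\ (a + b) *: w = a *: x + b *: y, a * f x + b * f y <= (a + b) * f w &
   forall r, enorm (x - x1) <= r -> enorm (y - x1) <= r -> enorm (w - x1) <= r].
Proof.
move=> cf a0 b0; have [ab|ab] := eqVneq (a + b) 0.
  have aE : a = 0 by apply/eqP; rewrite eq_le a0 andbT -ab lerDl.
  have bE : b = 0 by rewrite aE add0r in ab.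
  by exists x; split => //; rewrite aE bE ?addr0 ?scale0r ?addr0// !mul0r addr0.
have ab0 : 0 < a + b by rewrite lt_neqAle eq_sym ab addr_ge0.
have E : a / (a + b) + b / (a + b) = 1 by rewrite -mulrDl mulfV.
have a1 : 0 <= a / (a + b) by rewrite divr_ge0// ltW.
have b1 : 0 <= b / (a + b) by rewrite divr_ge0// ltW.
exists ((a / (a + b)) *: x + (b / (a + b)) *: y); split.
- by rewrite scalerDr !scalerA ![(a + b) * _]mulrC !divfK.
- have := cf _ _ x y a1 b1 E; rewrite -(ler_pM2l ab0); apply: le_trans.
  by rewrite le_eqVlt; apply/orP; left; apply/eqP; field; rewrite gt_eqF.
- move=> t hx hy.
  have -> : (a / (a + b)) *: x + (b / (a + b)) *: y - x1 =
      (a / (a + b)) *: (x - x1) + (b / (a + b)) *: (y - x1).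
    by rewrite !scalerBr addrACA -opprD -scalerDl E scale1r.
  rewrite (le_trans (enormD _ _))// !enormZ !ger0_norm//.
  rewrite (le_trans (lerD (ler_wpM2l a1 hx) (ler_wpM2l b1 hy)))//.
  by rewrite -mulrDl E mul1r.
Qed.

(** Near-optimal decompositions of the two points are merged, points under [phi] among themselves
    and points under [psi] among themselves; both functions are concave. *)
Let W_ccv : cvx_comb W.
Proof.
move=> a b x y a0 b0 ab; apply/ler_addgt0Pr => e e0.
have [m [y1 [z1 [/andP[m0 m1] z1in xE hx]]]] := W_adh x e0.
have [l [y2 [z2 [/andP[l0 l1] z2in yE hy]]]] := W_adh y e0.
have sm : 0 <= 1 - m by rewrite subr_ge0.
have sl : 0 <= 1 - l by rewrite subr_ge0.
have [u [uE hu _]] := comb y1 y2 phi_ccv (mulr_ge0 a0 sm) (mulr_ge0 b0 sl).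
have [w [wE hw wr]] := comb z1 z2 psi_ccv (mulr_ge0 a0 m0) (mulr_ge0 b0 l0).
have mE : a * (1 - m) + b * (1 - l) = 1 - (a * m + b * l).
  by rewrite !mulrBr !mulr1 addrACA ab -opprD.
have := @W_ge (a * m + b * l) u w.
rewrite -mE uE wE; have -> : (a * (1 - m)) *: y1 + (b * (1 - l)) *: y2 +
    ((a * m) *: z1 + (b * l) *: z2) = a *: x + b *: y.
  by rewrite xE yE !scalerDr !scalerA addrACA.
have m01 : 0 <= a * m + b * l <= 1.
  rewrite addr_ge0 ?mulr_ge0//= -ab lerD//; first by rewrite ler_piMr.
  by rewrite ler_piMr.
move=> /(_ m01 (wr _ z1in z2in)) hW.
have := ler_wpM2l a0 (ltW hx); have := ler_wpM2l b0 (ltW hy).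
have : a * e + b * e = e by rewrite -mulrDl ab mul1r.
rewrite !mulrDr !mulrA in hu hw hW *; lra.
Qed.

Let le_limit_from N (a b K : R) :
  (forall i : nat, (N <= i)%N -> a <= b + K * i.+1%:R^-1) -> a <= b.
Proof.
move=> h; apply: (@le_limit _ _ _ `|K|) => i.
have := h (maxn N i) (leq_maxl _ _) => /le_trans; apply; rewrite lerD2l.
apply: (@le_trans _ _ (`|K| * (maxn N i).+1%:R^-1)).
  by rewrite ler_wpM2r ?ler_norm// invr_ge0.
by rewrite ler_wpM2l// lef_pV2 ?posrE ?ltr0n// ler_nat ltnS leq_maxr.
Qed.

Let slope_lip : exists2 a, 0 < a & forall y z,
  enorm (slope y - slope z) <= a * enorm (y - z).
Proof.
have [a a0 ha] := @aff_lipschitz R n p1 (- B + (- B)^T).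
exists a => // y z; rewrite (le_trans (ha (y - x1) (z - x1)))//.
by rewrite opprB addrA subrK.
Qed.

Section Gap.
Variable x : V.
Hypothesis gap : phi x < W x.

(* Almost optimal decompositions of [x], along which the weight, the point under
   the paraboloid and the slope of [phi] converge. *)
Let W_seq : exists m z p (mu : nat -> R) (y w q : nat -> V),
  [/\ 0 < m <= 1, enorm (z - x1) < eta & forall i,
  [/\ 0 <= mu i <= 1 /\ enorm (w i - x1) <= eta,
      x = (1 - mu i) *: y i + mu i *: w i,
      W x - i.+1%:R^-1 < (1 - mu i) * phi (y i) + mu i * psi (w i),
      phi (w i) <= psi (w i) /\
      (forall h, phi (y i) + dot (q i) h - C * dot h h <= phi (y i + h)) &
      [/\ `|mu i - m| < i.+1%:R^-1, enorm (w i - z) < i.+1%:R^-1 &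
          enorm (q i - p) < i.+1%:R^-1]]].
Proof.
(* A decomposition that beats [phi x] by [g] has weight at least [g / del], at a point where
   [psi - phi >= g]. So the limiting weight is positive and the limit point avoids the sphere, where
   [psi < phi]. *)
pose g := (W x - phi x) / 2; have g0 : 0 < g by rewrite divr_gt0// subr_gt0.
have /choice[u hu] : forall i : nat, exists u : R * V * V * V,
    [/\ 0 <= u.1.1.1 <= 1 /\ enorm (u.1.2 - x1) <= eta,
      x = (1 - u.1.1.1) *: u.1.1.2 + u.1.1.1 *: u.1.2,
      W x - i.+1%:R^-1 < (1 - u.1.1.1) * phi u.1.1.2 + u.1.1.1 * psi u.1.2,
      g <= u.1.1.1 * del /\ g <= psi u.1.2 - phi u.1.2 & enorm u.2 <= k /\
      (forall h, phi u.1.1.2 + dot u.2 h - C * dot h h <= phi (u.1.1.2 + h))].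
  move=> i; pose e := Num.min g i.+1%:R^-1.
  have e0 : 0 < e by rewrite lt_min g0 invr_gt0 ltr0n.
  have eg : e <= g by rewrite ge_min lexx.
  have ei : e <= i.+1%:R^-1 by rewrite ge_min lexx orbT.
  have [m [y [z [m01 zin xE hx]]]] := W_adh x e0.
  have [q qk hq] := phi_C y; exists (m, y, z, q) => /=.
  have sm : 0 <= 1 - m by rewrite subr_ge0; case/andP: m01.
  have m0 : 0 <= m by case/andP: m01.
  have h1 : (1 - m) * phi y + m * phi z <= phi x.
    by rewrite xE; apply: phi_ccv => //; rewrite subrK.
  have h2 : g <= m * (psi z - phi z).
    by move: h1 hx eg; rewrite /g; move: (phi _) (phi _) (psi _) => A D E; lra.
  have dpos : 0 <= psi z - phi z.
    rewrite leNgt; apply/negP => neg.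
    have : m * (psi z - phi z) <= 0 by rewrite mulr_ge0_le0// ltW.
    by move: (lt_le_trans g0 h2) => /lt_le_trans a /a; rewrite ltxx.
  split => //; last by split => // h; have [] := hq h.
    by apply: le_lt_trans hx; rewrite lerD2l lerN2.
  split; apply: (le_trans h2).
    by rewrite ler_wpM2l// lerBlDr -lerBlDl psi_phi.
  by rewrite ler_piMl//; case/andP: m01.
have [|m [s1 hs1]] := @subseq_real R (fun i => (u i).1.1.1) 1.
  by move=> i; have [[/andP[a b] _] _ _ _ _] := hu i; rewrite ger0_norm.
have [|z [s2 hs2]] := @subseq_rV R n (fun i => (u (s1 i)).1.2 - x1) eta.
  by move=> i; have [[]] := hu (s1 i).
have [|p [s3 hs3]] := @subseq_rV R n (fun i => (u (s1 (s2 i))).2) k.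
  by move=> i; have [_ _ _ _ []] := hu (s1 (s2 i)).
pose t i := s1 (s2 (s3 i)).
have ti i : (i <= t i)%N.
  by apply: leq_trans (hs1 _).1; apply: leq_trans (hs2 _).1; exact: (hs3 _).1.
have inv_le (i j : nat) : (i <= j)%N -> j.+1%:R^-1 <= i.+1%:R^-1 :> R.
  by move=> ij; rewrite lef_pV2 ?posrE ?ltr0n// ler_nat ltnS.
have c1 i : `|(u (t i)).1.1.1 - m| < i.+1%:R^-1.
  apply: lt_le_trans (hs1 _).2 (inv_le _ _ _).
  by apply: leq_trans (hs2 _).1; exact: (hs3 _).1.
have c2 i : enorm ((u (t i)).1.2 - (x1 + z)) < i.+1%:R^-1.
  rewrite opprD addrA; apply: lt_le_trans (hs2 _).2 (inv_le _ _ _).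
  exact: (hs3 _).1.
have c3 i : enorm ((u (t i)).2 - p) < i.+1%:R^-1 by exact: (hs3 i).2.
have m1 : m <= 1.
  apply: (@le_limit _ _ _ 1) => i; rewrite mul1r.
  have [[/andP[_ a] _] _ _ _ _] := hu (t i); have := c1 i.
  by rewrite ltr_norml => /andP[]; move: i.+1%:R^-1 => e b _; lra.
have m0 : 0 < m.
  apply: (@lt_le_trans _ _ (g / del)); first by rewrite divr_gt0.
  apply: (@le_limit _ _ _ 1) => i; rewrite mul1r.
  have [_ _ _ [a _] _] := hu (t i); have := c1 i; rewrite ltr_norml => /andP[_].
  by rewrite -ler_pdivrMr// in a; move: i.+1%:R^-1 => e b; lra.
have zin : enorm z <= eta.
  apply: (@le_limit _ _ _ 1) => i; rewrite mul1r.
  have [[_ a] _ _ _ _] := hu (t i).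
  have E : z = ((u (t i)).1.2 - x1) - ((u (t i)).1.2 - (x1 + z)).
    by rewrite opprD opprK addrACA subrr add0r addrA addNr add0r.
  by rewrite E (le_trans (enormB _ _))// lerD// ltW.
have zlt : enorm z < eta.
  rewrite lt_neqAle zin andbT; apply/eqP => ze.
  have := @psi_bd (x1 + z); rewrite addrAC subrr add0r => /(_ ze) h.
  have cd : continuous (fun v => psi v - phi v).
    have : Ck 0 (fun v => psi v - phi v); last exact.
    by apply: CkB; [exact: psi_cont|exact: perron_cont].
  have /continuous_enormP/(_ g g0)[d d0 hd] := cd (x1 + z).
  have [i hi] := inv_small d0.
  have := hd _ (lt_trans (c2 i) hi); rewrite ltr_norml => /andP[_].
  have [_ _ _ [_ a] _] := hu (t i).
  by move: h a; move: (phi _) (psi _) (phi _) (psi _) => A D E H; lra.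
exists m, (x1 + z), p, (fun i => (u (t i)).1.1.1), (fun i => (u (t i)).1.1.2),
  (fun i => (u (t i)).1.2), (fun i => (u (t i)).2).
split; [by rewrite m0|by rewrite addrAC subrr add0r|move=> i].
have [a1 a2 a3 [a4 a5] [a6 a7]] := hu (t i); split => //.
  apply: le_lt_trans a3; rewrite lerD2l lerN2; exact: inv_le.
split => //; rewrite -subr_ge0; apply: le_trans a5; exact: ltW.
Qed.

Let W_ge_phi m y w h : 0 <= m <= 1 -> x = (1 - m) *: y + m *: w ->
  (1 - m) * phi (y + h) + m * phi (w + h) <= W (x + h).
Proof.
move=> /andP[m0 m1] xE; rewrite -subr_ge0 in m1.
have E : x + h = (1 - m) *: (y + h) + m *: (w + h).
  by rewrite xE !scalerDr addrACA -[in RHS]scalerDl subrK scale1r.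
by rewrite E (le_trans _ (W_phi _))//; apply: phi_ccv => //; rewrite subrK.
Qed.

Let W_ge_psi m y w h : 0 <= m <= 1 -> x = (1 - m) *: y + m *: w ->
  enorm (w + h - x1) <= eta ->
  (1 - m) * phi (y + h) + m * psi (w + h) <= W (x + h).
Proof.
move=> m01 xE win.
have -> : x + h = (1 - m) *: (y + h) + m *: (w + h).
  by rewrite xE !scalerDr addrACA -[in RHS]scalerDl subrK scale1r.
exact: W_ge.
Qed.

Let comb_slope m mu (p q sz sw h : V) e a : 0 <= mu <= 1 -> 0 <= e -> 0 <= a ->
  `|mu - m| <= e -> enorm (q - p) <= e -> enorm (sw - sz) <= a * e ->
  dot ((1 - m) *: p + m *: sz) h <= (1 - mu) * dot q h + mu * dot sw h +
   (enorm h * (1 + enorm p + a + enorm sz)) * e.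
Proof.
move=> /andP[m0 m1] e0 a0 he hp hs; have h0 := enorm_ge0 h.
have m1' : 0 <= 1 - mu by rewrite subr_ge0.
have b1 : (1 - mu) * dot (p - q) h <= e * enorm h.
  apply: (@le_trans _ _ (1 * (e * enorm h))); last by rewrite mul1r.
  apply: (@le_trans _ _ ((1 - mu) * (e * enorm h))).
    rewrite ler_wpM2l// (le_trans (dot_le _ _))// ler_wpM2r//.
    by rewrite enormBC.
  by rewrite ler_wpM2r ?mulr_ge0// gerBl.
have b2 : mu * dot (sz - sw) h <= a * e * enorm h.
  apply: (@le_trans _ _ (1 * (a * e * enorm h))); last by rewrite mul1r.
  apply: (@le_trans _ _ (mu * (a * e * enorm h))).
    rewrite ler_wpM2l// (le_trans (dot_le _ _))// ler_wpM2r//.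
    by rewrite enormBC.
  by rewrite ler_wpM2r// !mulr_ge0.
have b3 (v : V) : (mu - m) * dot v h <= e * (enorm v * enorm h).
  rewrite (le_trans (ler_norm _))// normrM ler_pM// ler_norm_dot//.
have b4 (v : V) : (m - mu) * dot v h <= e * (enorm v * enorm h).
  by rewrite (le_trans (ler_norm _))// normrM distrC ler_pM// ler_norm_dot.
have := b3 p; have := b4 sz.
move: b1 b2; rewrite !dotBl dotDl !dotZl.
move: (dot p h) (dot q h) (dot sz h) (dot sw h) => A D E H; lra.
Qed.

(** Shift both points of an almost optimal decomposition by [h]; if the point under [psi] leaves the
    ball, [cross] lets [phi] take over. The limiting slope is the average of the two slopes. *)
Lemma W_lower : exists p, forall h, W x + dot p h - C * dot h h <= W (x + h).
Proof.
have [m [z [p [mu [y [w [q [_ _ hq]]]]]]]] := W_seq.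
have [a a0 ha] := slope_lip.
exists ((1 - m) *: p + m *: slope z) => h.
apply: (@le_limit _ _ _ (1 + enorm h * (1 + enorm p + a + enorm (slope z)))) => i.
have [[mu01 win] xE vx [pw qh] [c1 c2 c3]] := hq i.
have e0 : 0 <= i.+1%:R^-1 :> R by rewrite invr_ge0.
have hs : enorm (slope (w i) - slope z) <= a * i.+1%:R^-1.
  by rewrite (le_trans (ha _ _))// ler_wpM2l ?(ltW a0)// ltW.
have cs := comb_slope h mu01 e0 (ltW a0) (ltW c1) (ltW c3) hs.
have : (1 - mu i) * (phi (y i) + dot (q i) h - C * dot h h) +
    mu i * (psi (w i) + dot (slope (w i)) h - C * dot h h) <= W (x + h).
  have mu0 : 0 <= mu i by case/andP: mu01.
  have mu1 : 0 <= 1 - mu i by rewrite subr_ge0; case/andP: mu01.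
  have [inb|outb] := leP (enorm (w i + h - x1)) eta.
    apply: le_trans (W_ge_psi mu01 xE inb).
    by rewrite lerD// ler_wpM2l// psi_C.
  apply: le_trans (W_ge_phi h mu01 xE).
  by rewrite lerD// ler_wpM2l// cross.
move: cs vx e0.
move: (dot _ h) (dot (q i) h) (dot (slope _) h) (dot h h) (phi _) (psi _) i.+1%:R^-1.
by move=> A D E H I J L; lra.
Qed.

(** In the optimal decomposition [x = (1 - m) ys + m z] the slopes of [phi] at [ys] and of [psi] at
    [z] coincide. Translating both points, a paraboloid above [W] at [x] gives one above [phi] at
    [ys] with matrix [(M + m B) / (1 - m)]. The subsolution inequality of [phi] there, averaged with
    [psi_sub], is the desired one. The case [m = 1] is treated separately. *)
Lemma W_sub_gap p M t : 0 < t ->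
  (forall h, enorm h < t -> W (x + h) <= W x + dot p h + qf M h) -> - trA p M <= G p.
Proof.
move=> t0 hM.
have [m [z [p' [mu [y [w [q [/andP[m0 m1] zin hq]]]]]]]] := W_seq.
have zin' := ltW zin.
have psz := psi_sub zin'.
have [a a0 ha] := slope_lip.
have [mE|mlt] := eqVneq m 1.
  (* the mass sits at [z]: [psi] itself touches [W] from below, up to translation *)
  have lo h : enorm h < Num.min t ((eta - enorm (z - x1)) / 2) ->
      W x + dot (slope z) h - qf B h <= W (x + h).
    rewrite lt_min => /andP[ht hz].
    have gz : 0 < (eta - enorm (z - x1)) / 2 by rewrite divr_gt0// subr_gt0.
    have [N hN] := inv_small gz.
    apply: (@le_limit_from N _ _ (1 + enorm h * (1 + enorm p' + a + enorm (slope z))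
       + C * dot h h + `|qf B h|)) => i Ni.
    have [[mu01 win] xE vx [pw qh] [c1 c2 c3]] := hq i.
    have e0 : 0 <= i.+1%:R^-1 :> R by rewrite invr_ge0.
    have hs : enorm (slope (w i) - slope z) <= a * i.+1%:R^-1.
      by rewrite (le_trans (ha _ _))// ler_wpM2l ?(ltW a0)// ltW.
    have := comb_slope h mu01 e0 (ltW a0) (ltW c1) (ltW c3) hs.
    rewrite mE subrr scale0r add0r scale1r => cs.
    have iN : i.+1%:R^-1 <= N.+1%:R^-1 :> R.
      by rewrite lef_pV2 ?posrE ?ltr0n// ler_nat ltnS.
    have inb : enorm (w i + h - x1) <= eta.
      rewrite (_ : w i + h - x1 = (w i - z) + h + (z - x1)); last first.
        by apply/rowP => j; rewrite !mxE; ring.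
      rewrite (le_trans (enormD _ _))// (le_trans (lerD (enormD _ _) (lexx _)))//.
      move: c2 iN hN hz; move: i.+1%:R^-1 N.+1%:R^-1 => e1 e2.
      by move: (enorm (z - x1)) => c; lra.
    have mu0 : 0 <= mu i by case/andP: mu01.
    have mu1 : 0 <= 1 - mu i by rewrite subr_ge0; case/andP: mu01.
    have muE : 1 - mu i <= i.+1%:R^-1.
      by move: c1; rewrite mE ltr_norml => /andP[]; move: i.+1%:R^-1 => e1 e2 _; lra.
    have k1 := W_ge_psi mu01 xE inb.
    have k2 := ler_wpM2l mu1 (qh h).
    have k3 : (1 - mu i) * (C * dot h h) <= i.+1%:R^-1 * (C * dot h h).
      by rewrite ler_wpM2r// mulr_ge0 ?dot_ge0// ltW.
    have k4 : - ((1 - mu i) * qf B h) <= i.+1%:R^-1 * `|qf B h|.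
      rewrite -mulrN (le_trans (ler_norm _))// normrM normrN ger0_norm//.
      by rewrite ler_wpM2r.
    move: k1 k2 k3 k4 cs vx; rewrite psi_shift.
    move: (dot _ h) (dot (q i) h) (dot (slope _) h) (dot h h) (phi _) (phi _) (psi _) i.+1%:R^-1.
    by move=> A D E H I J L P; lra.
  set u := Num.min _ _ in lo.
  have u0 : 0 < u by rewrite lt_min t0 divr_gt0// subr_gt0.
  have ut : u <= t by rewrite ge_min lexx.
  have up h : enorm h < u -> dot (slope z) h <= dot p h + qf (M + B) h.
    move=> hu; have := lo h hu; have := hM h (lt_le_trans hu ut).
    by rewrite qf_mxD; lra.
  have sE : slope z = p.
    apply: (slope_unique (K := mxbound (M + B)) u0) => h /up /le_trans; apply.
    by rewrite lerD2l (le_trans (ler_norm _))// qf_le.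
  have : psd (M + B).
    by apply: (psd_local u0) => h /up; rewrite sE lerDl.
  move=> /(psd_trA_ge0 p); rewrite trAD; move: psz; rewrite sE; lra.
have {m1}mlt : 0 < 1 - m by rewrite subr_gt0 lt_neqAle mlt.
(* The point forced by the limits of the weights and of the [w i]; [att] shows that it realises
   [W x]. *)
pose ys := (1 - m)^-1 *: (x - m *: z).
have ysE : (1 - m) *: ys = x - m *: z by rewrite scalerA mulfV ?gt_eqF// scale1r.
have xE : x = (1 - m) *: ys + m *: z by rewrite ysE subrK.
have m01 : 0 <= m <= 1 by rewrite ltW//= -subr_ge0 ltW.
have [P Pk hP] := phi_C ys.
have att : W x <= (1 - m) * phi ys + m * psi z.
  apply: (@le_limit _ _ _ (1 + `|phi ys| + `|psi z| + enorm (slope z) +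
     enorm P * (1 + enorm z + enorm ys))) => i.
  have [[/andP[mu0 mu1] win] xEi vx _ [c1 c2 _]] := hq i.
  have e0 : 0 <= i.+1%:R^-1 :> R by rewrite invr_ge0.
  have mu1' : 0 <= 1 - mu i by rewrite subr_ge0.
  have [_ hp] := hP (y i - ys); rewrite addrC subrK in hp.
  have hs := psi_touch z (w i - z); rewrite addrC subrK in hs.
  have k1 := ler_wpM2l mu1' hp; have k2 := ler_wpM2l mu0 hs.
  have k3 : mu i * dot (slope z) (w i - z) <= enorm (slope z) * i.+1%:R^-1.
    apply: (@le_trans _ _ (1 * (enorm (slope z) * i.+1%:R^-1))); last by rewrite mul1r.
    apply: (@le_trans _ _ (mu i * (enorm (slope z) * i.+1%:R^-1))).
      rewrite ler_wpM2l// (le_trans (dot_le _ _))// ler_wpM2l ?enorm_ge0//.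
      exact: ltW.
    by rewrite ler_wpM2r// mulr_ge0 ?enorm_ge0.
  have k4 : (1 - mu i) * dot P (y i - ys) <=
      enorm P * ((1 + enorm z + enorm ys) * i.+1%:R^-1).
    rewrite -dotZr (le_trans (dot_le _ _))// ler_wpM2l ?enorm_ge0//.
    have -> : (1 - mu i) *: (y i - ys) =
        mu i *: (z - w i) + (m - mu i) *: (z - ys).
      rewrite scalerBr (_ : (1 - mu i) *: y i = x - mu i *: w i); last first.
        by rewrite [in RHS]xEi addrK.
      rewrite (_ : (1 - mu i) *: ys = x - m *: z + (m - mu i) *: ys); last first.
        by rewrite -ysE -scalerDl addrA subrK.
      by apply/rowP => j; rewrite !mxE; ring.
    rewrite (le_trans (enormD _ _))// (enormZ (mu i)) (enormZ (m - mu i)) (ger0_norm mu0).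
    have b1 : mu i * enorm (z - w i) <= i.+1%:R^-1.
      apply: (@le_trans _ _ (1 * enorm (z - w i))); last by rewrite mul1r enormBC ltW.
      by rewrite ler_wpM2r ?enorm_ge0.
    have b2 : `|m - mu i| * enorm (z - ys) <= i.+1%:R^-1 * (enorm z + enorm ys).
      by rewrite ler_pM ?enorm_ge0 ?enormB// distrC ltW.
    by move: b1 b2; move: i.+1%:R^-1 => e; lra.
  have k5 (A : R) : (m - mu i) * A <= i.+1%:R^-1 * `|A|.
    rewrite (le_trans (ler_norm _))// normrM distrC ler_pM//; exact: ltW.
  have k6 (A : R) : (mu i - m) * A <= i.+1%:R^-1 * `|A|.
    rewrite (le_trans (ler_norm _))// normrM ler_pM//; exact: ltW.
  have := k5 (phi ys); have := k6 (psi z).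
  move: k1 k2 k3 k4 vx e0; move: (phi (y i)) (psi (w i)) (phi ys) (psi z).
  move: (dot P _) (dot (slope z) _) i.+1%:R^-1 => D E e A H I J; lra.
(* Moving [ys] by [m d] and [z] by [- (1 - m) d] keeps [x] fixed, so the value cannot exceed [W x].
   To first order in [d] this equates the two slopes. *)
have PE : P = slope z.
  have gz : 0 < eta - enorm (z - x1) by rewrite subr_gt0.
  apply: (slope_unique (K := C * m + (1 - m) * mxbound B) gz) => d hd.
  have zd : enorm (z - (1 - m) *: d - x1) <= eta.
    rewrite addrAC (le_trans (enormB _ _))// enormZ gtr0_norm//.
    have : (1 - m) * enorm d <= enorm d by rewrite ler_piMl ?enorm_ge0// gerBl ltW.
    lra.
  have := @W_ge m (ys + m *: d) (z - (1 - m) *: d) m01 zd.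
  rewrite [X in W X](_ : _ = x); last first.
    rewrite [in RHS]xE; apply/rowP => j; rewrite !mxE; ring.
  have [lo _] := hP (m *: d); rewrite !(dotZr, dotZl) in lo.
  rewrite psi_shift dotNr dotZr qfN qfZ => hW.
  have lo' := ler_wpM2l (ltW mlt) lo.
  have qB : qf B d <= mxbound B * dot d d.
    by rewrite (le_trans (ler_norm _))// qf_le.
  have qB' : m * ((1 - m) * ((1 - m) * qf B d)) <=
      m * ((1 - m) * ((1 - m) * (mxbound B * dot d d))).
    by rewrite !(ler_pM2l m0, ler_pM2l mlt).
  rewrite -(ler_pM2l m0) -(ler_pM2l mlt).
  move: att hW lo' qB'; move: (W x) (phi _) (phi _) (psi z) (dot P d) (dot (slope z) d).
  by move=> A D E H I J; lra.
have touch h : enorm h < Num.min t (eta - enorm (z - x1)) ->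
    phi (ys + h) <= phi ys + dot ((1 - m)^-1 *: (p - m *: slope z)) h +
      qf ((1 - m)^-1 *: (M + m *: B)) h.
  rewrite lt_min => /andP[ht hz].
  have zh : enorm (z + h - x1) <= eta.
    by rewrite addrAC (le_trans (enormD _ _))// -lerBrDl ltW.
  have := W_ge_psi m01 xE zh; have := hM h ht.
  rewrite psi_shift dotZl dotBl dotZl qf_mxZ qf_mxD qf_mxZ => h1 h2.
  have : (1 - m) * phi (ys + h) <= (1 - m) * phi ys + (dot p h - m * dot (slope z) h) +
     (qf M h + m * qf B h) by lra.
  move=> h3; rewrite -(ler_pM2l mlt); apply: (le_trans h3).
  by rewrite le_eqVlt; apply/orP; left; apply/eqP; field; rewrite gt_eqF.
have u0 : 0 < Num.min t (eta - enorm (z - x1)) by rewrite lt_min t0 subr_gt0.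
have pE : P = (1 - m)^-1 *: (p - m *: slope z).
  apply: (slope_unique (K := C + mxbound ((1 - m)^-1 *: (M + m *: B))) u0) => h hh.
  have := touch h hh; have [lo _] := hP h.
  have := qf_le ((1 - m)^-1 *: (M + m *: B)) h; rewrite ler_norml => /andP[_].
  by move: lo; rewrite mulrDl; lra.
have [_ sphi _ _] := Sphi.
have := sphi _ _ _ _ u0 touch; rewrite -pE PE.
have -> : p = slope z.
  move: pE; rewrite PE => /(congr1 (fun v => (1 - m) *: v)).
  rewrite scalerA mulfV ?gt_eqF// scale1r scalerBl scale1r => /eqP.
  by rewrite subr_eq subrK => /eqP.
rewrite trAZ trAD trAZ => h1.
have : - (trA (slope z) M + m * trA (slope z) B) <= (1 - m) * G (slope z).
  move: h1; rewrite -(ler_pM2l mlt); apply: le_trans.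
  by rewrite mulrN mulVKf// gt_eqF.
by have := ler_wpM2l (ltW m0) psz; lra.
Qed.

End Gap.

Lemma bump_class : exists2 f, perron_class f &
  (forall x, phi x <= f x) /\ phi x1 < f x1.
Proof.
exists W; last first.
  split=> //; apply: (@lt_le_trans _ _ (psi x1)).
    by rewrite /psi subrr dot0r qf0 !addr0 ltrDl.
  have := @W_ge 1 x1 x1; rewrite ler01 lexx (subrr (1 : R)) scale0r scale1r add0r.
  by rewrite mul0r mul1r add0r; apply.
have low_touch x : exists p, forall h, W x + dot p h - C * dot h h <= W (x + h).
  have [g|ng] := ltP (phi x) (W x); first exact: W_lower.
  have WE : W x = phi x by apply/le_anti; rewrite ng W_phi.
  have [p _ hp] := phi_C x; exists p => h; rewrite WE.
  by apply: le_trans (W_phi _); have [] := hp h.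
split => [x|x p M t t0 hM|x|i x].
- have [p hp] := low_touch x; exists p => h; split=> //.
  exact: (concave_touch W_ccv hp).
- have [g|ng] := ltP (phi x) (W x); first exact: W_sub_gap t0 hM.
  have WE : W x = phi x by apply/le_anti; rewrite ng W_phi.
  have [_ sphi _ _] := Sphi; apply: (sphi x p M t t0) => h /hM.
  by rewrite WE; apply: le_trans (W_phi _).
- by have [_ _ lp _] := Sphi; exact: le_trans (lp x) (W_phi x).
- exact: W_plane.
Qed.

End Bump.

(** If the inequality fails at [x], then [G > 0] there and the slope is shorter than [k]. Hence
    [phi] keeps a positive distance from all planes at [x], and a bump fits below them. *)
Lemma maximal_visc_sup phi : perron_class phi ->
  (forall f, perron_class f -> (forall x, phi x <= f x) -> f = phi) ->
  visc_sup phi.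
Proof.
move=> Sphi maxphi x p M r r0 hM; rewrite leNgt; apply/negP => gap.
have [p' p'k hp'] := perron_touch x Sphi.
have up h : enorm h < r -> dot p h + qf M h <= dot p' h.
  by move=> /hM; have [_] := hp' h; lra.
have pE : p = p'.
  apply: (slope_unique (K := mxbound M) r0) => h /up.
  by have := qf_le M h; rewrite ler_norml => /andP[]; lra.
have psdM : psd (- M).
  by apply: (psd_local r0) => h /up; rewrite pE qf_mxN; lra.
have pk : enorm p < k.
  by apply: G_gt0; have := psd_trA_ge0 p psdM; rewrite trAN; lra.
have [d d0 hd] : exists2 d, 0 < d & forall q, enorm (q - p) < d -> trA q (- M) + d < G q.
  have : continuous (fun q => G q + - 1 * trA q (- M)).
    by apply: contD => //; apply: contM; [exact: cst_continuous|exact: trA_cont].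
  pose g := (G p - trA p (- M)) / 2.
  have g0 : 0 < g by rewrite /g trAN; lra.
  move=> /(_ p)/continuous_enormP/(_ g g0)[d d0 hd].
  exists (Num.min d g) => [|q]; first by rewrite lt_min d0.
  rewrite lt_min => /andP[/hd]; rewrite ltr_norml => /andP[h _] _.
  have : Num.min d g <= g by rewrite ge_min lexx orbT.
  by move: h; rewrite /g; lra.
pose e := d / n.+1%:R.
have e0 : 0 < e by rewrite divr_gt0// ltr0n.
pose B : 'M[R]_n := - M + e%:M.
have psdB : psd B.
  by move=> h; rewrite qf_mxD qf_scalar addr_ge0 ?psdM// mulr_ge0 ?dot_ge0// ltW.
have [a a0 ha] := @aff_lipschitz R n p (- B + (- B)^T).
pose gam := (k - enorm p) ^+ 2 / (4 * C).
have gam0 : 0 < gam by rewrite divr_gt0 ?exprn_gt0 ?subr_gt0// mulr_gt0.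
(* The paraboloid of opening [C] below [phi] at [x] stays under plane [i]. Optimising the
   displacement gives a gap [|p - slo i|^2 / (4 C)], and [|slo i| = k] makes it uniform in [i]. *)
have gapP i : phi x + gam <= plane i x.
  have ki : k - enorm p <= enorm (p - slo i).
    by rewrite lerBlDr -(slo_norm i) -{1}(subrK p (slo i)) enormBC enormD.
  have C4 : 0 < 4 * C by rewrite mulr_gt0.
  apply: (@le_trans _ _ (phi x + dot (p - slo i) (p - slo i) / (4 * C))).
    rewrite lerD2l ler_wpM2r ?invr_ge0 ?(ltW C4)// -enorm_sqr.
    by rewrite ler_pXn2r// nnegrE ?enorm_ge0// subr_ge0 ltW.
  have [lo _] := hp' ((2 * C)^-1 *: (p - slo i)).
  have [_ _ _ pp] := Sphi.
  have := pp i (x + (2 * C)^-1 *: (p - slo i)); move: lo.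
  rewrite -pE /plane dotDr !dotZr dotZl.
  have -> : dot p (p - slo i) = dot (p - slo i) (p - slo i) + dot (slo i) (p - slo i).
    by rewrite -dotDl subrK.
  move: (dot (p - slo i) _) (dot (slo i) (p - _)) => D E.
  have -> : C * ((2 * C)^-1 * ((2 * C)^-1 * D)) = D / (4 * C).
    by field; rewrite gt_eqF.
  have -> : (2 * C)^-1 * (D + E) = 2 * (D / (4 * C)) + (2 * C)^-1 * E.
    by field; rewrite gt_eqF.
  by move: ((2 * C)^-1 * E) (D / (4 * C)) => H I; lra.
(* The radius stays within the contact ball, keeps the slopes of the bump within [d] of [p], and
   makes the planes vary little compared with [gam]. The height [del] is small against [gam] and
   against [e eta^2], the drop of the bump on the sphere. *)
pose eta := Num.min (Num.min (r / 2) (d / (2 * a))) (gam / (4 * (k + 1))).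
have k1 : 0 < k + 1 by rewrite ltr_wpDl.
have a20 : 0 < 2 * a by rewrite mulr_gt0.
have k40 : 0 < 4 * (k + 1) by rewrite mulr_gt0.
have eta0 : 0 < eta.
  by rewrite !lt_min (divr_gt0 r0)// (divr_gt0 d0)// (divr_gt0 gam0).
have etar : eta < r.
  have : eta <= r / 2 by rewrite !ge_min lexx.
  lra.
have etaa : a * eta < d.
  have : eta <= d / (2 * a) by rewrite !ge_min lexx !orbT.
  rewrite ler_pdivlMr ?mulr_gt0//; lra.
have etag : 4 * (k * eta) <= gam.
  have : eta <= gam / (4 * (k + 1)) by rewrite !ge_min lexx orbT.
  rewrite ler_pdivlMr ?mulr_gt0//; lra.
pose del := Num.min (gam / 2) (e * eta ^+ 2 / 2).
have ee0 : 0 < e * eta ^+ 2 by rewrite mulr_gt0// exprn_gt0.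
have del0 : 0 < del by rewrite lt_min (divr_gt0 gam0)// (divr_gt0 ee0).
have delg : del <= gam / 2 by rewrite ge_min lexx.
have dele : del <= e * eta ^+ 2 / 2 by rewrite ge_min lexx orbT.
have cE z : x + (z - x) = z by rewrite addrC subrK.
have [||||f Sf [phif hlt]] := @bump_class phi x p B eta del Sphi psdB eta0 del0.
- move=> z zin; set q := p + _.
  have qp : enorm (q - p) < d.
    have := ha (z - x) 0; rewrite mul0mx addr0 subr0 => /le_lt_trans; apply.
    by apply: le_lt_trans etaa; rewrite ler_wpM2l ?(ltW a0).
  have := hd _ qp; rewrite /B trAD.
  have : trA q (e%:M : 'M[R]_n) <= d.
    rewrite (le_trans (trA_scalar_le _ (ltW e0)))//.
    rewrite /e mulrCA ler_piMr ?(ltW d0)// ler_pdivrMr ?ltr0n// mul1r ler_nat.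
    exact: leqnSn.
  lra.
- move=> z zin; have := hM (z - x) (le_lt_trans zin etar); rewrite cE => h.
  have : 0 <= e * dot (z - x) (z - x) by rewrite mulr_ge0 ?dot_ge0// ltW.
  by move: h; rewrite qf_mxN /B qf_mxD qf_mxN qf_scalar; lra.
- move=> z ze; have := hM (z - x); rewrite ze => /(_ etar); rewrite cE.
  by rewrite qf_mxN /B qf_mxD qf_mxN qf_scalar -enorm_sqr ze; lra.
- move=> i z zin; rewrite qf_mxN.
  have h1 := psdB (z - x).
  have h2 : dot p (z - x) <= k * eta.
    rewrite (le_trans (dot_le _ _))// ler_pM ?enorm_ge0//; exact: ltW.
  have h3 : dot (slo i) (x - z) <= k * eta.
    by rewrite (le_trans (dot_le _ _))// slo_norm ler_wpM2l// enormBC.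
  have := gapP i; move: h3; rewrite /plane dotBr; lra.
by move: hlt; rewrite (maxphi f Sf phif) ltxx.
Qed.

Theorem perron_solution f0 : perron_class f0 ->
  exists2 phi, perron_class phi & visc_sup phi.
Proof.
move=> Sf0.
pose T := {f : V -> R | perron_class f}.
pose Rl : rel T := fun s t : T => `[< forall x, sval s x <= sval t x >].
have [|r s t /asboolP rs /asboolP st|s t /asboolP st /asboolP ts|A tot|phi hphi] :=
    @Zorn T Rl.
- by move=> t; apply/asboolP => x.
- by apply/asboolP => x; exact: le_trans (rs x) (st x).
- have : sval s = sval t by apply/funext => x; apply/le_anti; rewrite st ts.
  case: s t {st ts} => f Sf [g Sg] /= fg; move: Sf Sg; rewrite fg => Sf Sg.
  by congr exist; exact: Prop_irrelevance.
- have [A0|/set0P[s0 As0]] := eqVneq A set0.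
    by exists (exist _ f0 Sf0) => s; rewrite A0.
  have [||f g [s As <-] [t At <-]|phi Sphi hphi] := @chain_sup [set sval s | s in A].
  + by exists (sval s0), s0.
  + by move=> _ [s _ <-]; exact: (svalP s).
  + by have [/asboolP h|/asboolP h] := tot s t As At; [left|right].
  + exists (exist _ phi Sphi) => s As; apply/asboolP; apply: hphi.
    by exists s.
exists (sval phi); first exact: svalP.
apply: maximal_visc_sup; first exact: svalP.
move=> f Sf hf; have := hphi (exist _ f Sf).
by move=> /(_ (asboolT hf)) <-.
Qed.

End ViscosityClass.

(** * Elementary bounds on the exponential and the logarithm *)

Section ExpBounds.
Variable R : realType.
Implicit Types y s : R.

Lemma expR_le_quad y : `|y| <= 2^-1 -> expR y <= 1 + y + y ^+ 2 + 2 * `|y| ^+ 3.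
Proof.
move=> hy; have y1 : 0 < 1 - y by have := ler_norm y; lra.
have h1 : expR y <= (1 - y)^-1.
  rewrite -[expR y]invrK -expRN lef_pV2 ?posrE ?expR_gt0//.
  exact: expR_ge1Dx.
apply: (le_trans h1); rewrite -[leLHS]mul1r ler_pdivrMr//.
have : y ^+ 3 <= 2 * `|y| ^+ 3 * (1 - y).
  have : y ^+ 3 <= `|y| ^+ 3 by rewrite -normrX ler_norm.
  have : 0 <= `|y| ^+ 3 by rewrite exprn_ge0.
  have : y <= 2^-1 by have := ler_norm y; lra.
  move: (`|y| ^+ 3) (y ^+ 3) => z w; nra.
move: (`|y| ^+ 3) => z; nra.
Qed.

Lemma expR_le_quad2 y : `|y| <= 2^-1 -> expR y <= 1 + y + 2 * y ^+ 2.
Proof.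
move=> hy; apply: (le_trans (expR_le_quad hy)).
rewrite -[y ^+ 2]real_normK ?num_real//; move: (`|y|) hy (normr_ge0 y) => z; nra.
Qed.

Lemma ln_le_sub1 s : 0 < s -> ln s <= s - 1.
Proof.
move=> s0; have := expR_ge1Dx (ln s); rewrite lnK ?posrE//; lra.
Qed.

End ExpBounds.

(** * Soft minima of planes *)

Section SoftMin.
Variables (R : realType) (n m : nat) (k a : R).
Variables (nu : 'I_m.+1 -> 'rV[R]_n) (g : 'I_m.+1 -> R).
Local Notation V := 'rV[R]_n.
Hypotheses (k0 : 0 <= k) (a0 : 0 < a) (nu1 : forall i, enorm (nu i) = 1).
Implicit Types (x h : V).

Let lin i x : R := k * dot (nu i) x + g i.
Let Z x : R := \sum_i expR (- (a * lin i x)).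

(** The log-sum-exp regularisation of a minimum of affine functions; it lies below each of them. *)
Definition softmin x : R := - (a^-1 * ln (Z x)).

Lemma softmin_arg_gt0 x : 0 < Z x.
Proof.
rewrite /Z big_ord_recr /= ltr_wpDl ?expR_gt0//.
by apply: sumr_ge0 => i _; rewrite expR_ge0.
Qed.
Let Z0 := softmin_arg_gt0.

Let wt x i : R := expR (- (a * lin i x)) / Z x.

Let wt_ge0 x i : 0 <= wt x i.
Proof. by rewrite divr_ge0 ?expR_ge0// ltW. Qed.

Let wt_sum x : \sum_i wt x i = 1.
Proof. by rewrite /wt -mulr_suml -/(Z x) mulfV// gt_eqF. Qed.

Let nb x : V := \sum_i wt x i *: nu i.

Let dot_sum (f : 'I_m.+1 -> V) x : dot (\sum_i f i) x = \sum_i dot (f i) x.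
Proof. by rewrite (big_morph (fun v => dot v x) (fun u v => dotDl u v x) (dot0l x)). Qed.

(** [wt] are Gibbs weights and [nb] is their mean direction; [B] is [a k^2] times the covariance of
    the directions. Its size is twice that of the exact second order term, since the exponential is
    bounded with [y^2] in place of [y^2 / 2]. *)
Let B x : 'M[R]_n := (a * k ^+ 2) *: \sum_i wt x i *: ((nu i - nb x)^T *m (nu i - nb x)).

Let qf_sum (f : 'I_m.+1 -> 'M[R]_n) h : qf (\sum_i f i) h = \sum_i qf (f i) h.
Proof.
apply: (big_morph (fun v => qf v h) (fun u v => qf_mxD u v h)).
by rewrite -(scale0r 0) qf_mxZ mul0r.
Qed.

Let qf_rank1 (v h : V) : qf (v^T *m v) h = dot v h ^+ 2.
Proof.
rewrite expr2 /dot mulr_suml; apply: eq_bigr => i _; rewrite mulr_sumr.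
by apply: eq_bigr => j _; rewrite !mxE big_ord1 !mxE; ring.
Qed.

Let tr_rank1 (v : V) : \tr (v^T *m v) = dot v v.
Proof. by apply: eq_bigr => i _; rewrite !mxE big_ord1 !mxE. Qed.

Let qfB x h : qf (B x) h = a * k ^+ 2 * \sum_i wt x i * dot (nu i - nb x) h ^+ 2.
Proof.
by rewrite qf_mxZ qf_sum; congr (_ * _); apply: eq_bigr => i _; rewrite qf_mxZ qf_rank1.
Qed.

Let softmin_shift x h : softmin (x + h) = softmin x + dot (k *: nb x) h -
  a^-1 * ln (\sum_i wt x i * expR (- (a * k) * dot (nu i - nb x) h)).
Proof.
set S := \sum_i _ * _.
have E : Z (x + h) = Z x * expR (- (a * (k * dot (nb x) h))) * S.
  rewrite /S mulr_sumr; apply: eq_bigr => i _.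
  transitivity (expR (- (a * (k * dot (nb x) h))) * expR (- (a * lin i x)) *
      expR (- (a * k) * dot (nu i - nb x) h)).
    by rewrite -!expRD; congr expR; rewrite /lin dotDr dotBl; ring.
  rewrite /wt; move: (expR _) (expR _) (expR _) (Z0 x) => e1 e2 e3 z0.
  by field; rewrite gt_eqF.
have S0 : 0 < S.
  have := Z0 (x + h); rewrite E pmulr_rgt0// mulr_gt0// expR_gt0//.
rewrite /softmin E lnM ?posrE ?mulr_gt0 ?expR_gt0// lnM ?posrE ?expR_gt0// expRK.
rewrite dotZl; field; rewrite gt_eqF//.
Qed.

Let Ysum x h : \sum_i wt x i * (- (a * k) * dot (nu i - nb x) h) = 0.
Proof.
have -> : \sum_i wt x i * (- (a * k) * dot (nu i - nb x) h) =
    - (a * k) * \sum_i wt x i * dot (nu i - nb x) h.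
  by rewrite mulr_sumr; apply: eq_bigr => i _; rewrite mulrCA.
rewrite (_ : \sum_i _ = 0) ?mulr0//.
under eq_bigr do rewrite dotBl mulrBr.
rewrite sumrB -mulr_suml wt_sum mul1r dot_sum.
by under [X in _ - X]eq_bigr do rewrite dotZl; rewrite subrr.
Qed.

Let nb_le x : enorm (nb x) <= 1.
Proof.
rewrite (le_trans (enorm_sum _))// -(wt_sum x); apply: ler_sum => i _.
by rewrite enormZ nu1 mulr1 ger0_norm.
Qed.

Let Yle x h i : `|- (a * k) * dot (nu i - nb x) h| <= 2 * a * k * enorm h.
Proof.
have ak : 0 <= a * k by rewrite mulr_ge0// ltW.
rewrite normrM normrN (ger0_norm ak).
have : `|dot (nu i - nb x) h| <= 2 * enorm h.
  rewrite (le_trans (ler_norm_dot _ _))// ler_wpM2r ?enorm_ge0//.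
  rewrite (le_trans (enormB _ _))// nu1; have := nb_le x; lra.
move=> /(ler_wpM2l ak) /le_trans; apply.
by rewrite le_eqVlt; apply/orP; left; apply/eqP; ring.
Qed.

Let lin_lip i x y : lin i x - lin i y <= k * enorm (x - y).
Proof.
rewrite /lin opprD addrACA subrr addr0 -mulrBr -dotBr ler_wpM2l//.
by rewrite (le_trans (dot_le _ _))// nu1 mul1r.
Qed.

Lemma softmin_lipschitz x h : softmin x - k * enorm h <= softmin (x + h).
Proof.
rewrite /softmin -opprD lerN2.
have -> : k * enorm h = a^-1 * (a * (k * enorm h)) by rewrite mulKf// gt_eqF.
rewrite -mulrDr ler_pM2l ?invr_gt0// -[X in ln _ <= _ + X]expRK -lnM ?posrE ?expR_gt0//.
rewrite ler_ln ?posrE ?mulr_gt0 ?expR_gt0// /Z mulr_suml; apply: ler_sum => i _.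
rewrite -expRD ler_expR lerNl opprD opprK lerBlDr -mulrDr ler_pM2l// -lerBlDl.
by rewrite (le_trans (lin_lip i x (x + h)))// opprD addrA subrr add0r enormN.
Qed.

Lemma softmin_le i x : softmin x <= k * dot (nu i) x + g i.
Proof.
rewrite -/(lin i x) /softmin -mulrN ler_pdivrMl// lerNl -[leLHS]expRK.
rewrite ler_ln ?posrE ?expR_gt0// /Z (bigD1 i)//= lerDl.
by apply: sumr_ge0 => j _; rewrite expR_ge0.
Qed.

Lemma softmin_ge (b : R) x : (forall i, b <= k * dot (nu i) x) ->
  \sum_i expR (- (a * g i)) <= 1 -> b <= softmin x.
Proof.
move=> hb hg; rewrite /softmin -mulrN ler_pdivlMl// lerNr -[leRHS]expRK.
rewrite ler_ln ?posrE ?expR_gt0//.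
apply: (@le_trans _ _ (expR (- (a * b)) * \sum_i expR (- (a * g i)))).
  rewrite mulr_sumr /Z; apply: ler_sum => i _; rewrite -expRD ler_expR -opprD lerN2.
  by rewrite -mulrDr ler_pM2l// lerD2r.
by rewrite ler_piMr ?expR_ge0.
Qed.

(** The variance of unit vectors about their mean is [1 - |nb|^2], so the lower paraboloid has trace
    exactly [a (k^2 - |p|^2)]; like [G], this vanishes at [|p| = k]. The crude global paraboloid
    will serve [touch2], the sharp local one with cubic error the subsolution property. No constant
    depends on the number of planes. *)
Lemma softmin_touch x : exists p (A : 'M[R]_n),
  [/\ psd A /\ (forall i j, `|A i j| <= 4 * (a * k ^+ 2)),
      \tr A = a * (k ^+ 2 - dot p p), enorm p <= k,
      forall h, softmin x + dot p h - 8 * a * k ^+ 2 * dot h h <= softmin (x + h) /\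
        softmin (x + h) <= softmin x + dot p h &
      forall h, 2 * a * k * enorm h <= 2^-1 ->
        softmin x + dot p h - qf A h - 16 * a ^+ 2 * k ^+ 3 * enorm h ^+ 3
          <= softmin (x + h)].
Proof.
have ak0 : 0 <= a * k ^+ 2 by rewrite mulr_ge0 ?sqr_ge0// ltW.
exists (k *: nb x), (B x).
(* Jensen's inequality for the weights, through [1 + y <= exp y]; it yields the plane above. *)
have S1 h : 1 <= \sum_i wt x i * expR (- (a * k) * dot (nu i - nb x) h).
  apply: (@le_trans _ _ (\sum_i (wt x i +
      wt x i * (- (a * k) * dot (nu i - nb x) h)))).
    by rewrite big_split/= wt_sum Ysum addr0.
  apply: ler_sum => i _; rewrite -{1}(mulr1 (wt x i)) -mulrDr.
  by rewrite ler_wpM2l// expR_ge1Dx.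
have pk : enorm (k *: nb x) <= k.
  by rewrite enormZ ger0_norm// ler_piMr.
have up h : softmin (x + h) <= softmin x + dot (k *: nb x) h.
  by rewrite softmin_shift gerBl mulr_ge0 ?invr_ge0 ?(ltW a0)// ln_ge0.
split => //.
- split=> [h|i j].
    rewrite qfB mulr_ge0//; apply: sumr_ge0 => i _.
    by rewrite mulr_ge0// sqr_ge0.
  rewrite mxE normrM (ger0_norm ak0) mulrC ler_wpM2r// summxE.
  apply: (@le_trans _ _ (\sum_l wt x l * 4)); last by rewrite -mulr_suml wt_sum mul1r.
  rewrite (le_trans (ler_norm_sum _ _ _))//; apply: ler_sum => l _; rewrite !mxE big_ord1 !mxE normrM (ger0_norm (wt_ge0 x l)).
  rewrite ler_wpM2l//.
  have cc (j' : 'I_n) : `|nu l ord0 j' - nb x ord0 j'| <= 2.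
    have := coord_le (nu l - nb x) j'; rewrite !mxE => /le_trans; apply.
    by rewrite (le_trans (enormB _ _))// nu1; have := nb_le x; lra.
  rewrite normrM (_ : 4 = 2 * 2 :> R); last by ring.
  by rewrite ler_pM.
- rewrite mxtraceZ raddf_sum/=.
  under eq_bigr do rewrite mxtraceZ tr_rank1.
  have -> : \sum_i wt x i * dot (nu i - nb x) (nu i - nb x) = 1 - dot (nb x) (nb x).
    have E i : wt x i * dot (nu i - nb x) (nu i - nb x) =
        wt x i + wt x i * dot (nb x) (nb x) - 2 * dot (wt x i *: nu i) (nb x).
      rewrite dotBl !dotBr -(enorm_sqr (nu i)) nu1 (dotC (nb x) (nu i)) dotZl; ring.
    under eq_bigr do rewrite E.
    transitivity (\sum_i wt x i + (\sum_i wt x i) * dot (nb x) (nb x) -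
        2 * \sum_i dot (wt x i *: nu i) (nb x)).
      by rewrite sumrB big_split/= mulr_suml mulr_sumr.
    rewrite wt_sum -dot_sum -/(nb x); ring.
  rewrite dotZl dotZr; ring.
- move=> h; split => //.
  have [small|big] := leP (2 * a * k * enorm h) 2^-1; last first.
    apply: le_trans (softmin_lipschitz x h).
    rewrite -addrA lerD2l.
    have := le_trans (dot_le (k *: nb x) h) (ler_wpM2r (enorm_ge0 h) pk).
    have : 2 * k * enorm h * 1 <= 2 * k * enorm h * (4 * a * k * enorm h).
      by rewrite ler_wpM2l ?mulr_ge0 ?enorm_ge0//; lra.
    rewrite -enorm_sqr; move: (enorm h) (dot _ _) => e d; lra.
  rewrite softmin_shift lerD2l lerN2 ler_pdivrMl//.
  apply: (le_trans (ln_le_sub1 (lt_le_trans ltr01 (S1 h)))); rewrite lerBlDl.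
  apply: (@le_trans _ _ (\sum_i (wt x i + wt x i * (- (a * k) * dot (nu i - nb x) h) +
      wt x i * (8 * a ^+ 2 * k ^+ 2 * enorm h ^+ 2)))).
    apply: ler_sum => i _; rewrite -{2}(mulr1 (wt x i)) -!mulrDr ler_wpM2l//.
    apply: le_trans (expR_le_quad2 (le_trans (Yle x h i) small)) _; rewrite lerD2l.
    rewrite (_ : 8 * _ * _ * _ = 2 * (2 * a * k * enorm h) ^+ 2); last by ring.
    rewrite ler_pM2l// -(real_normK (num_real (- (a * k) * _))).
    by rewrite ler_pXn2r// nnegrE ?(le_trans _ (Yle x h i)).
  rewrite !big_split/= Ysum wt_sum -mulr_suml wt_sum -enorm_sqr.
  rewrite le_eqVlt; apply/orP; left; apply/eqP; ring.
- move=> h small.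
  rewrite softmin_shift -addrA lerD2l -opprD lerN2 ler_pdivrMl//.
  apply: (le_trans (ln_le_sub1 (lt_le_trans ltr01 (S1 h)))); rewrite lerBlDl.
  apply: (@le_trans _ _ (\sum_i (wt x i + wt x i * (- (a * k) * dot (nu i - nb x) h) +
      a * (a * k ^+ 2 * (wt x i * dot (nu i - nb x) h ^+ 2)) +
      wt x i * (16 * a ^+ 3 * k ^+ 3 * enorm h ^+ 3)))).
    apply: ler_sum => i _.
    have := expR_le_quad (le_trans (Yle x h i) small).
    have c3 : `|- (a * k) * dot (nu i - nb x) h| ^+ 3 <= (2 * a * k * enorm h) ^+ 3.
      by rewrite ler_pXn2r// nnegrE ?(le_trans _ (Yle x h i)).
    move=> he; have := ler_wpM2l (wt_ge0 x i) (le_trans he (lerD (lexx _) (ler_wpM2l (ler0n R 2) c3))).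
    move=> /le_trans; apply; rewrite le_eqVlt; apply/orP; left; apply/eqP; ring.
  rewrite !big_split/= Ysum wt_sum -mulr_suml wt_sum -!mulr_sumr qfB.
  by rewrite le_eqVlt; apply/orP; left; apply/eqP; ring.
Qed.

End SoftMin.

(** * Second order tests up to a cubic error *)

Section SecondOrder.
Variables (R : realType) (n : nat).
Local Notation V := 'rV[R]_n.
Implicit Types h : V.

Lemma le_small (a b K : R) : (forall e, 0 < e -> a <= b + K * e) -> a <= b.
Proof. by move=> h; apply: (@le_limit _ _ _ K) => i; apply: h; rewrite invr_gt0. Qed.

Fact le_approx_lower (f s p d q f' s' e m : R) : f <= s -> s + d - q <= s' ->
  s' <= f' + e -> - (m * e) <= d - p -> f + p - q <= f' + (1 + m) * e.
Proof. lra. Qed.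

Fact le_approx_lower3 (f s p d q q' c f' s' e m l : R) : f <= s ->
  s + d - q - c <= s' -> s' <= f' + e -> - (m * e) <= d - p -> q - q' <= l * e ->
  f + p - q' - c <= f' + (1 + m + l) * e.
Proof. lra. Qed.

Fact le_approx_upper (f s p d f' s' e m : R) : f' <= s' -> s' <= s + d ->
  s <= f + e -> d - p <= m * e -> f' <= f + p + (1 + m) * e.
Proof. lra. Qed.

(* A function touched from below at [x] by a paraboloid satisfying the
   inequality, up to a cubic error, satisfies it against every paraboloid
   touching it from above. *)
Lemma touch_below_sub (f : V -> R) (x p : V) (A : 'M[R]_n) (g K r : R) : 0 < r -> 0 <= K ->
  (forall h, enorm h < r -> f x + dot p h - qf A h - K * enorm h ^+ 3 <= f (x + h)) ->
  trA p A <= g -> forall q M s, 0 < s ->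
  (forall h, enorm h < s -> f (x + h) <= f x + dot q h + qf M h) ->
  q = p /\ - trA q M <= g.
Proof.
move=> r0 K0 lo tg q M s s0 up.
pose t := Num.min (Num.min r s) 1.
have t0 : 0 < t by rewrite !lt_min r0 s0 ltr01.
have tP h : enorm h < t -> [/\ enorm h < r, enorm h < s & enorm h <= 1].
  by rewrite !lt_min -andbA => /and3P[? ? /ltW].
have key h : enorm h < t -> dot p h <= dot q h + qf (M + A) h + K * enorm h ^+ 3.
  by move=> /tP[hr hs _]; have := lo h hr; have := up h hs; rewrite qf_mxD; lra.
have pq : p = q.
  apply: (slope_unique (K := mxbound (M + A) + K) t0) => h ht.
  apply: (le_trans (key h ht)); rewrite -addrA lerD2l mulrDl lerD//.
    by rewrite (le_trans (ler_norm _))// qf_le.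
  rewrite -enorm_sqr ler_wpM2l// exprS ler_piMl ?sqr_ge0//.
  by have [] := tP h ht.
split=> //; have : psd (M + A).
  move=> h; have [b b0 hb] := small_scale h t0.
  apply: (@le_limit _ _ _ (b * (K * enorm h ^+ 3))) => i.
  have i0 : 0 < i.+1%:R^-1 :> R by rewrite invr_gt0.
  have i1 : i.+1%:R^-1 <= 1 :> R by rewrite invf_le1// ler1n.
  have bi0 : 0 < b * i.+1%:R^-1 by rewrite mulr_gt0.
  have bi1 : b * i.+1%:R^-1 <= b by rewrite ler_piMr// ltW.
  have := key _ (hb _ bi0 bi1); rewrite pq -addrA lerDl qfZ enormZ gtr0_norm//.
  have -> : b * (K * enorm h ^+ 3) / i.+1%:R = (b * i.+1%:R^-1) * (K * enorm h ^+ 3).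
    by ring.
  move: (exprn_gt0 2 bi0); move: (b * i.+1%:R^-1) (qf _ h) (enorm h) => c d e c2 hh.
  rewrite -(pmulr_rge0 _ c2); apply: (le_trans hh).
  by rewrite le_eqVlt; apply/orP; left; apply/eqP; ring.
move=> /(psd_trA_ge0 q); rewrite trAD pq in tg *; lra.
Qed.

End SecondOrder.

(** * A first member of the Perron class *)

Section Barrier.
Variables (R : realType) (n : nat) (k c0 : R) (u : 'rV[R]_n -> R) (nu : nat -> 'rV[R]_n).
Local Notation V := 'rV[R]_n.
Hypotheses (k0 : 0 <= k) (c00 : 0 < c0) (nu1 : forall i, enorm (nu i) = 1).
Hypothesis u_nu : forall i y, u y <= k * dot (nu i) y.
Implicit Types (x h p : V).

(** Half of [c - c0 sqrt (1 + |p|^2)] with [c = c0 sqrt (1 + k^2)]; the half matches test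
    paraboloids written without a factor 1/2. *)
Definition half_speed p : R :=
  c0 / 2 * (Num.sqrt (1 + k ^+ 2) - Num.sqrt (1 + dot p p)).

Lemma half_speed_cont : continuous half_speed.
Proof.
have : Ck 0 half_speed; last exact.
apply: CkZ; apply: CkB; first exact: Ck_cst.
apply: Ck_sqrt => [x|]; first exact: dot1_gt0.
apply: CkD; first exact: Ck_cst.
by apply: Ck_sum => i; apply: CkM; exact: Ck_coord.
Qed.

Lemma half_speed_ge0 p : 0 <= half_speed p -> enorm p <= k.
Proof.
rewrite pmulr_rge0 ?divr_gt0// subr_ge0 ler_sqrt ?addr_ge0 ?sqr_ge0//.
by rewrite lerD2l -enorm_sqr ler_pXn2r// nnegrE enorm_ge0.
Qed.

Lemma half_speed_gt0 p : 0 < half_speed p -> enorm p < k.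
Proof.
rewrite pmulr_rgt0 ?divr_gt0// subr_gt0 ltr_sqrt; last by rewrite ltr_pwDl ?sqr_ge0.
by rewrite ltrD2l -enorm_sqr ltr_pXn2r// nnegrE enorm_ge0.
Qed.

Let K1 := Num.sqrt (1 + k ^+ 2).
Let K10 : 0 < K1. Proof. by rewrite sqrtr_gt0 ltr_pwDl ?sqr_ge0. Qed.
Let a := c0 / (4 * K1).
Let a0 : 0 < a. Proof. by rewrite divr_gt0 ?mulr_gt0. Qed.

(** [k^2 - |p|^2] factors as [(K1 - s) (K1 + s)] with [K1 + s <= 2 K1]; this dictates
    [a = c0 / (4 K1)]. *)
Lemma half_speed_lower p : enorm p <= k -> a * (k ^+ 2 - dot p p) <= half_speed p.
Proof.
move=> pk; rewrite /half_speed -/K1.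
pose s := Num.sqrt (1 + dot p p).
have s0 : 0 < s by rewrite sqrtr_gt0 dot1_gt0.
have pk2 : dot p p <= k ^+ 2 by rewrite -enorm_sqr ler_pXn2r// nnegrE enorm_ge0.
have sK : s <= K1 by rewrite ler_wsqrtr// lerD2l.
have E : k ^+ 2 - dot p p = (K1 - s) * (K1 + s).
  rewrite -subr_sqr !sqr_sqrtr ?(ltW (dot1_gt0 _))//; first by ring.
  by rewrite addr_ge0 ?sqr_ge0.
rewrite E -/s /a.
have -> : c0 / (4 * K1) * ((K1 - s) * (K1 + s)) =
    c0 / 2 * ((K1 - s) * ((K1 + s) / (2 * K1))) by field; rewrite gt_eqF.
rewrite ler_wpM2l ?divr_ge0 ?(ltW c00)// ler_piMr ?subr_ge0//.
by rewrite ler_pdivrMr ?mulr_gt0// mul1r; lra.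
Qed.

(** Large enough both for the opening [8 a k^2] of the soft minima and for the bound on positive
    matrices in [touch_const_bound]. *)
Definition touch_const := 8 * a * k ^+ 2 + (1 + k ^+ 2) * (c0 * K1) + 1.

Let ak2 : 0 <= 8 * a * k ^+ 2.
Proof. by apply: mulr_ge0 (sqr_ge0 k); apply: mulr_ge0 => //; exact: ltW. Qed.

Let cK : 0 <= (1 + k ^+ 2) * (c0 * K1).
Proof.
apply: mulr_ge0; first by rewrite addr_ge0// sqr_ge0.
by apply: mulr_ge0; exact: ltW.
Qed.

Lemma touch_const_gt0 : 0 < touch_const.
Proof. by rewrite ltr_wpDl// addr_ge0. Qed.

Lemma touch_const_bound p (B : 'M[R]_n) : psd B -> trA p B <= half_speed p ->
  forall x, qf B x <= touch_const * dot x x.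
Proof.
move=> psdB hB x; have t0 := psd_trA_ge0 p psdB.
have pk := half_speed_ge0 (le_trans t0 hB).
have pk2 : dot p p <= k ^+ 2 by rewrite -enorm_sqr ler_pXn2r// nnegrE enorm_ge0.
apply: (le_trans (psd_qf_le_trA x psdB pk2)); rewrite ler_wpM2r ?dot_ge0//.
have hs : half_speed p <= c0 * K1.
  apply: (@le_trans _ _ (c0 / 2 * K1)).
    by rewrite ler_wpM2l ?divr_ge0 ?(ltW c00)// gerBl sqrtr_ge0.
  by rewrite ler_wpM2r ?(ltW K10)// ler_pdivrMr// ler_peMr ?(ltW c00)// ler1n.
have : (1 + k ^+ 2) * trA p B <= (1 + k ^+ 2) * (c0 * K1).
  by rewrite ler_wpM2l ?addr_ge0 ?sqr_ge0// (le_trans hB).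
move: ak2; rewrite /touch_const; move: (8 * a * _) (trA p B) => A D; lra.
Qed.

(** Gives [exp (- a offset i) = 2^-(i+1)]. These weights sum to at most [1], which by [softmin_ge]
    keeps every soft minimum above [u]. *)
Definition offset (i : nat) : R := i.+1%:R * (ln 2 / a).

Let sm (m : nat) := softmin k a (fun i : 'I_m.+1 => nu i) (fun i : 'I_m.+1 => offset i).

Let offset_sum m : \sum_(i < m) expR (- (a * offset i)) <= 1.
Proof.
have E (i : nat) : expR (- (a * offset i)) = 2^-1 ^+ i.+1.
  rewrite (_ : - (a * offset i) = i.+1%:R * - ln 2); last first.
    by rewrite /offset; field; rewrite gt_eqF.
  by rewrite expRM_natl expRN lnK ?posrE.
have : \sum_(i < m) expR (- (a * offset i)) = 1 - 2^-1 ^+ m.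
  elim: m => [|m IH]; first by rewrite big_ord0 expr0 subrr.
  rewrite big_ord_recr /= IH E exprS; lra.
by move=> ->; rewrite gerBl exprn_ge0.
Qed.

Let sm_ge m x : u x <= sm m x.
Proof. by apply: softmin_ge => // i. Qed.

Let sm_le m i x : (i <= m)%N -> sm m x <= k * dot (nu i) x + offset i.
Proof.
rewrite -ltnS => im.
exact: (softmin_le k (fun i : 'I_m.+1 => nu i) (fun i : 'I_m.+1 => offset i) a0 (Ordinal im) x).
Qed.

Let sm_decr m l x : (m <= l)%N -> sm l x <= sm m x.
Proof.
move=> /subnK <-; elim: (l - m)%N => [//|j IH]; apply: le_trans IH; rewrite addSn.
rewrite /sm /softmin lerN2 ler_pM2l ?invr_gt0// ler_ln ?posrE ?softmin_arg_gt0//.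
by rewrite [leRHS]big_ord_recr/= lerDl expR_ge0.
Qed.

(** Infinitely many planes are handled by a decreasing limit of finite soft minima. *)
Let f0 x : R := inf [set sm m x | m in setT].

Let f0_has_inf x : has_inf [set sm m x | m in setT].
Proof. by split; [exists (sm 0 x), 0%N|exists (u x) => _ [m _ <-]]. Qed.

Let f0_le m x : f0 x <= sm m x.
Proof. by apply: inf_lbound; [have [] := f0_has_inf x|exists m]. Qed.

Let f0_near x e : 0 < e -> exists N, forall m, (N <= m)%N -> sm m x <= f0 x + e.
Proof.
move=> e0; have [_ [N _ <-] h] := inf_adherent e0 (f0_has_inf x).
by exists N => m Nm; apply: (le_trans (sm_decr _ Nm)); rewrite ltW.
Qed.

(** The bounds of [softmin_touch] are uniform in the number of planes, so slopes and matrices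
    converge along a subsequence and the inequalities survive. *)
Let f0_touch x : exists p (A : 'M[R]_n),
  [/\ psd A, \tr A <= a * (k ^+ 2 - dot p p), enorm p <= k,
      forall h, f0 x + dot p h - 8 * a * k ^+ 2 * dot h h <= f0 (x + h) /\
        f0 (x + h) <= f0 x + dot p h &
      forall h, 2 * a * k * enorm h <= 2^-1 ->
        f0 x + dot p h - qf A h - 16 * a ^+ 2 * k ^+ 3 * enorm h ^+ 3 <= f0 (x + h)].
Proof.
have hm m := softmin_touch (fun i : 'I_m.+1 => offset i) k0 a0
  (fun i : 'I_m.+1 => nu1 i) x.
have /choice[d /choice[A hA]] := hm.
have [|p [s1 hs1]] := @subseq_rV R n d k; first by move=> i; have [] := hA i.
have [|B [s2 hs2]] := @subseq_mx R n (fun i => A (s1 i)) (4 * (a * k ^+ 2)).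
  by move=> i; have [[]] := hA (s1 i).
have near_h h e : 0 < e -> exists m, [/\ enorm (d m - p) <= e,
    forall i j, `|A m i j - B i j| <= e, sm m x <= f0 x + e & sm m (x + h) <= f0 (x + h) + e].
  move=> e0; have [N1 hN1] := f0_near x e0; have [N2 hN2] := f0_near (x + h) e0.
  have [N3 hN3] := inv_small e0.
  pose i := maxn N1 (maxn N2 N3).
  have i1 : (i <= s1 (s2 i))%N by exact: leq_trans (hs2 i).1 (hs1 _).1.
  have le_inv (j : nat) : (i <= j)%N -> j.+1%:R^-1 <= e.
    move=> ij; apply: ltW; apply: le_lt_trans hN3.
    rewrite lef_pV2 ?posrE ?ltr0n// ler_nat ltnS.
    by apply: leq_trans ij; rewrite !leq_max leqnn !orbT.
  exists (s1 (s2 i)); split.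
  - by apply: le_trans (ltW (hs1 _).2) (le_inv _ (hs2 i).1).
  - by move=> j l; apply: le_trans (ltW ((hs2 i).2 j l)) (le_inv _ _).
  - by apply: hN1; apply: leq_trans i1; rewrite leq_max leqnn.
  - by apply: hN2; apply: leq_trans i1; rewrite !leq_max leqnn !orbT.
have pk : enorm p <= k.
  apply: (@le_small _ _ _ 1) => e e0; have [m [h1 _ _ _]] := near_h 0 e e0.
  have [_ _ h2 _ _] := hA m; rewrite -(subrK (d m) p) (le_trans (enormD _ _))//.
  by rewrite enormBC; lra.
have dB m e h : enorm (d m - p) <= e -> `|dot (d m) h - dot p h| <= enorm h * e.
  by move=> he; rewrite -dotBl (le_trans (ler_norm_dot _ _))// mulrC ler_wpM2l ?enorm_ge0.
have qB m e h : (forall i j, `|A m i j - B i j| <= e) ->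
    `|qf (A m) h - qf B h| <= n%:R * n%:R * dot h h * e.
  move=> he; rewrite -qf_mxN -qf_mxD (le_trans (qf_le _ _))// mulrAC.
  rewrite ler_wpM2r ?dot_ge0// /mxbound.
  apply: (@le_trans _ _ (\sum_(i < n) \sum_(j < n) e)).
    by apply: ler_sum => i _; apply: ler_sum => j _; rewrite !mxE.
  by rewrite !sumr_const !card_ord -[e *+ n]mulr_natl -[(n%:R * e) *+ n]mulr_natl mulrA.
exists p, B; split => //.
- move=> h; apply: (@le_small _ _ _ (n%:R * n%:R * dot h h)) => e e0.
  have [m [_ h1 _ _]] := near_h 0 e e0; have := qB m e h h1.
  by have [[/(_ h) h2 _] _ _ _ _] := hA m; rewrite ler_norml => /andP[]; lra.
- apply: (@le_small _ _ _ (n%:R + a * (2 * enorm p))) => e e0.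
  have [m [h1 h2 _ _]] := near_h 0 e e0; have [_ trE _ _ _] := hA m.
  have t1 : \tr B <= \tr (A m) + n%:R * e.
    have -> : n%:R * e = \sum_(i < n) e by rewrite sumr_const card_ord mulr_natl.
    rewrite -big_split/=; apply: ler_sum => i _.
    by have := h2 i i; rewrite ler_norml => /andP[]; lra.
  have t2 : dot p p <= dot (d m) (d m) + 2 * enorm p * e.
    have e1 : - (enorm p * e) <= dot p (d m - p).
      have := ler_norm_dot p (d m - p); rewrite ler_norml => /andP[e1 _].
      apply: le_trans e1; rewrite lerN2 ler_wpM2l ?enorm_ge0//.
    have -> : dot (d m) (d m) = dot (p + (d m - p)) (p + (d m - p)).
      by rewrite addrC subrK.
    move: (d m - p) e1 (dot_ge0 (d m - p)) => v e1 v0.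
    by rewrite !(dotDl, dotDr) (dotC v p); lra.
  have := ler_wpM2l (ltW a0) t2; move: t1; rewrite trE; lra.
- move=> h; split; apply: (@le_small _ _ _ (1 + enorm h)) => e e0;
    have [m [h1 _ h3 h4]] := near_h h e e0; have := dB m e h h1;
    have [_ _ _ /(_ h) [h5 h6] _] := hA m; rewrite ler_norml => /andP[d1 d2].
    exact: le_approx_lower (f0_le m x) h5 h4 d1.
  exact: le_approx_upper (f0_le m (x + h)) h6 h3 d2.
- move=> h hs; apply: (@le_small _ _ _ (1 + enorm h + n%:R * n%:R * dot h h)) => e e0.
  have [m [h1 h2 h3 h4]] := near_h h e e0.
  have := dB m e h h1; have := qB m e h h2; have [_ _ _ _ /(_ h hs) h5] := hA m.
  rewrite !ler_norml => /andP[d1 d2] /andP[d3 d4].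
  exact: le_approx_lower3 (f0_le m x) h5 h4 d3 d2.
Qed.

Lemma barrier_class :
  exists f, perron_class touch_const half_speed u (fun i => k *: nu i) offset f.
Proof.
exists f0; split.
- move=> x; have [p [A [_ _ _ hp _]]] := f0_touch x; exists p => h.
  have [h1 h2] := hp h; split => //; apply: le_trans h1.
  by rewrite lerD2l lerN2 ler_wpM2r ?dot_ge0// /touch_const -addrA lerDl addr_ge0.
- move=> x q M r r0 hM; have [p [A [psdA trAp pk _ hp]]] := f0_touch x.
  have a00 := ltW a0.
  have ak : 0 < 2 * a * k + 1.
    by rewrite ltr_wpDl//; apply: mulr_ge0 => //; apply: mulr_ge0.
  have K0 : 0 <= 16 * a ^+ 2 * k ^+ 3.
    by apply: mulr_ge0 (exprn_ge0 3 k0); apply: mulr_ge0 (exprn_ge0 2 a00).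
  have s0 : 0 < 2^-1 / (2 * a * k + 1) by rewrite divr_gt0.
  have [|| qp ] := touch_below_sub (p := p) (A := A) (g := half_speed p) s0 K0 _ _ r0 hM.
  + move=> h hs; apply: hp; move: hs; rewrite ltr_pdivlMr// => /ltW; apply: le_trans.
    by rewrite mulrC ler_wpM2l ?enorm_ge0// lerDl.
  + apply: le_trans (half_speed_lower pk); apply: le_trans trAp.
    rewrite /trA gerBl divr_ge0 ?psdA//; exact: ltW (dot1_gt0 _).
  by rewrite qp.
- by move=> x; apply: lb_le_inf; [have [] := f0_has_inf x|move=> _ [m _ <-]].
- move=> i x; rewrite /plane dotZl; apply: le_trans (sm_le x (leqnn i)).
  exact: f0_le.
Qed.

End Barrier.

(** * A countable family of supporting linear functions *)

Section DenseSupports.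
Variables (R : realType) (n : nat) (k : R) (u : 'rV[R]_n -> R).
Local Notation V := 'rV[R]_n.
Hypotheses (n0 : (0 < n)%N) (k0 : 0 <= k) (homu : homogeneous1 u).
Hypothesis solu : eikonal_viscosity_solution k u.

(* Points of the grid of step [2 / q] in the cube [-1, 1[^n, enumerated over all [q]. *)
Let grid := {q : nat & {ffun 'I_n -> 'I_q.+1}}.
Let pt (t : grid) : V := \row_j (2 * (tagged t j)%:R / (tag t).+1%:R - 1).
Let pt_nat (i : nat) : V := if @unpickle grid i is Some t then pt t else 0.

(** Take a support at every grid point. Both [u] and a support are [k]-Lipschitz, so the support at
    a grid point close to [x / |x|] is nearly exact in that direction; homogeneity extends the
    estimate from one finite grid to the whole space. *)
Lemma dense_supports : exists nu : nat -> V, [/\ forall i, enorm (nu i) = 1,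
  forall i y, u y <= k * dot (nu i) y &
  forall e, 0 < e -> exists I : nat, forall x, exists2 i, (i <= I)%N &
    k * dot (nu i) x <= u x + e * enorm x].
Proof.
have /choice[nu hnu] : forall i, exists nu, enorm nu = 1 /\
    (forall y, u y <= k * dot nu y) /\ u (pt_nat i) = k * dot nu (pt_nat i).
  by move=> i; exact: eikonal_support k0 homu solu (pt_nat i) n0.
exists nu; split => [i|i y|e e0]; [by have [] := hnu i|by have [_ []] := hnu i|].
(* Mesh for which [2 k] times the distance to the grid is at most [e]; the distance is bounded by
   [n] steps of size [2 / (q + 1)]. *)
pose q := Num.trunc (4 * k * n%:R / e).
have qe : 2 * k * (n%:R * (2 / q.+1%:R)) <= e.
  have : 4 * k * n%:R / e <= q.+1%:R by apply: ltW; rewrite truncnS_gt// divr_ge0 ?mulr_ge0// ltW.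
  rewrite ler_pdivrMr// => h.
  rewrite (_ : 2 * k * _ = 4 * k * n%:R / q.+1%:R); last by ring.
  by rewrite ler_pdivrMr ?ltr0n// [leRHS]mulrC.
pose I := (\max_(t : {ffun 'I_n -> 'I_q.+1}) @pickle grid (existT _ q t))%N.
exists I => x.
have [x0|xn0] := eqVneq x 0.
  exists 0%N => //; rewrite x0 dot0r enorm0 !mulr0 addr0.
  by rewrite (hom1_0 homu).
have X0 := enorm_gt0 xn0.
have [y [y1 xE]] : exists y, enorm y = 1 /\ x = enorm x *: y.
  exists ((enorm x)^-1 *: x); split; last by rewrite scalerA mulfV ?gt_eqF// scale1r.
  by rewrite enormZ ger0_norm ?invr_ge0 ?enorm_ge0// mulVf// gt_eqF.
have hc (j : 'I_n) : 0 <= (y ord0 j + 1) * q.+1%:R / 2.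
  rewrite divr_ge0// mulr_ge0//.
  by have := coord_le y j; rewrite y1 ler_norml => /andP[]; lra.
(* [minn q] takes care of the coordinate [1], whose truncation would be [q + 1]. *)
pose t : {ffun 'I_n -> 'I_q.+1} := [ffun j => inord (minn q (Num.trunc ((y ord0 j + 1) * q.+1%:R / 2)))].
pose T : grid := existT _ q t.
have TE : pt_nat (pickle T) = pt T by rewrite /pt_nat pickleK.
have near : enorm (y - pt T) <= n%:R * (2 / q.+1%:R).
  apply: enorm_le_coord => j; rewrite !mxE /= ffunE inordK; last by rewrite ltnS geq_minl.
  have q1 : 0 < q.+1%:R :> R by rewrite ltr0n.
  have yE : y ord0 j = 2 * ((y ord0 j + 1) * q.+1%:R / 2) / q.+1%:R - 1.
    by field; rewrite gt_eqF.
  rewrite [X in `|X - _|]yE opprB addrA subrK -mulrBl -mulrBr normrM normrM.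
  rewrite [`|2|]ger0_norm// [`|_^-1|]ger0_norm ?invr_ge0 ?(ltW q1)//.
  rewrite ler_wpM2r ?invr_ge0 ?(ltW q1)// -[leRHS]mulr1 ler_wpM2l//.
  have := hc j; have : (y ord0 j + 1) * q.+1%:R / 2 <= q.+1%:R.
    rewrite ler_pdivrMr// mulrC ler_wpM2l ?(ltW q1)//.
    by have := coord_le y j; rewrite y1 ler_norml => /andP[]; lra.
  move: ((y ord0 j + 1) * _ / 2) => z zq z0.
  have zt := truncn_itv z0; move/andP: zt => [zt1 zt2].
  have [h|h] := leqP q (Num.trunc z).
    rewrite ger0_norm; first by rewrite lerBlDr nat1r.
    by rewrite subr_ge0 (le_trans _ zt1)// ler_nat.
  rewrite ger0_norm ?subr_ge0//.
  by rewrite lerBlDr nat1r ltW.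
exists (pickle T).
  by rewrite /I (bigD1 t)//= leq_maxl.
have [nu1 [hu hE]] := hnu (pickle T); rewrite TE in hE.
have lip := eikonal_lipschitz k0 homu solu y (pt T).
have d1 : dot (nu (pickle T)) y <= dot (nu (pickle T)) (pt T) + enorm (y - pt T).
  by rewrite -lerBlDl -dotBr (le_trans (dot_le _ _))// nu1 mul1r.
have key : k * dot (nu (pickle T)) y <= u y + e.
  apply: le_trans (lerD (lexx _) qe).
  have := ler_wpM2l k0 d1; have := ler_wpM2l k0 near.
  rewrite enormBC in lip; move: lip; rewrite hE.
  move: (enorm (y - _)) (n%:R * _) (dot _ y) (dot _ _) (u y) => a b c d f; lra.
rewrite {1}xE dotZr {2}xE homu// mulrCA [e * _]mulrC -mulrDr.
by rewrite ler_pM2l.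
Qed.

End DenseSupports.

(** * Harmonic extension of polynomials from a sphere *)

Section Harmonic.
Variables (R : realType) (n : nat).
Local Notation V := 'rV[R]_n.
Implicit Types (x s : V) (f g h : V -> R) (i j : 'I_n) (d e : nat).
Local Notation e_ i := (delta_mx ord0 i : V).

(** Homogeneous polynomials as functions: induction on this predicate replaces coefficients. The
    zero function has every degree, so derivatives and Laplacians stay in the family. *)
Inductive hpoly : nat -> (V -> R) -> Prop :=
| hom_zero d : hpoly d (fun=> 0)
| hom_cst c : hpoly 0 (fun=> c)
| hom_mulX d i g : hpoly d g -> hpoly d.+1 (fun x => x ord0 i * g x)
| hom_add d f g : hpoly d f -> hpoly d g -> hpoly d (fun x => f x + g x).

Definition lap f x : R := \sum_(i < n) partial i (partial i f) x.

Lemma hom_smooth d f : hpoly d f -> forall k, Ck k f.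
Proof.
elim=> {d f} [d|c|d i g _ IH|d f g _ IHf _ IHg] k; try exact: Ck_cst.
  by apply: CkM => //; exact: Ck_coord.
exact: CkD.
Qed.

Lemma homZ d f (c : R) : hpoly d f -> hpoly d (fun x => c * f x).
Proof.
elim=> {d f} [d|c'|d i g _ IH|d f g _ IHf _ IHg].
- by rewrite mulr0; exact: hom_zero.
- exact: hom_cst.
- by under eq_fun do rewrite mulrCA; exact: hom_mulX.
- by under eq_fun do rewrite mulrDr; exact: hom_add.
Qed.

Lemma hom_sum d m (f : 'I_m -> V -> R) : (forall l, hpoly d (f l)) ->
  hpoly d (fun x => \sum_(l < m) f l x).
Proof.
elim: m f => [|m IH] f hf.
  by under eq_fun do rewrite big_ord0; exact: hom_zero.
by under eq_fun do rewrite big_ord_recr/=; apply: hom_add => //; exact: IH.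
Qed.

Lemma partialD f g i : Ck 1 f -> Ck 1 g ->
  partial i (fun x => f x + g x) = (fun x => partial i f x + partial i g x).
Proof.
by move=> hf hg; apply: partial_eq => x; apply: is_deriveDf;
  [exact: Ck_partial_is_derive hf|exact: Ck_partial_is_derive hg].
Qed.

Lemma partialZ f i (c : R) : Ck 1 f ->
  partial i (fun x => c * f x) = (fun x => c * partial i f x).
Proof.
by move=> hf; apply: partial_eq => x; apply: is_deriveZf; exact: Ck_partial_is_derive hf.
Qed.

Lemma partialM f g i : Ck 1 f -> Ck 1 g ->
  partial i (fun x => f x * g x) = (fun x => partial i f x * g x + f x * partial i g x).
Proof.
by move=> hf hg; apply: partial_eq => x; apply: is_deriveMf;
  [exact: Ck_partial_is_derive hf|exact: Ck_partial_is_derive hg].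
Qed.

Lemma partial_cst (c : R) i : partial i (fun _ : V => c) = (fun=> 0).
Proof. by apply: partial_eq => x; exact: is_derive_cst. Qed.

Lemma partial_coord i j : partial j (fun x : V => x ord0 i) = (fun=> (i == j)%:R).
Proof.
apply: partial_eq => x; apply: is_derive_eq (is_derive_coord x (e_ j) i) _.
by rewrite mxE eqxx.
Qed.

Lemma hom_partial d f i : hpoly d f ->
  if d is d'.+1 then hpoly d' (partial i f) else partial i f = (fun=> 0).
Proof.
elim=> {d f} [d|c|d j g hg IH|d f g hf IHf hg IHg].
- by rewrite partial_cst; case: d => // d; exact: hom_zero.
- exact: partial_cst.
- rewrite partialM ?partial_coord; [|exact: Ck_coord|exact: (hom_smooth hg 1)].
  apply: hom_add; first exact: homZ.
  case: d hg IH => [|d] hg IH; last exact: hom_mulX.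
  by rewrite IH; under eq_fun do rewrite mulr0; exact: hom_zero.
- rewrite partialD; [|exact: (hom_smooth hf 1)|exact: (hom_smooth hg 1)].
  case: d hf IHf hg IHg => [|d] hf IHf hg IHg; last exact: hom_add.
  by rewrite IHf IHg; apply/funext => x; rewrite addr0.
Qed.

Lemma hom_euler d f x : hpoly d f -> \sum_(i < n) x ord0 i * partial i f x = d%:R * f x.
Proof.
elim=> {d f} [d|c|d j g hg IH|d f g hf IHf hg IHg].
- by rewrite mulr0 big1// => i _; rewrite partial_cst mulr0.
- by rewrite mul0r big1// => i _; rewrite partial_cst mulr0.
- under eq_bigr => i _.
    rewrite partialM ?partial_coord; [|exact: Ck_coord|exact: (hom_smooth hg 1)].
    rewrite mulrDr mulrCA; over.
  rewrite big_split/= -[d.+1%:R]natr1 mulrDl mul1r addrC; congr (_ + _).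
    rewrite [RHS]mulrCA -IH mulr_sumr; apply: eq_bigr => i _; ring.
  rewrite (bigD1 j)//= eqxx mul1r big1 ?addr0// => i ij.
  by rewrite eq_sym (negbTE ij) mul0r.
- under eq_bigr => i _.
    rewrite partialD; [|exact: (hom_smooth hf 1)|exact: (hom_smooth hg 1)].
    rewrite mulrDr; over.
  by rewrite big_split/= IHf IHg mulrDr.
Qed.

Lemma lapD f g x : Ck 2 f -> Ck 2 g -> lap (fun x => f x + g x) x = lap f x + lap g x.
Proof.
move=> hf hg; rewrite -big_split; apply: eq_bigr => i _ /=.
rewrite partialD; [|exact: CkW|exact: CkW].
by rewrite partialD//; exact: Ck_partial.
Qed.

Lemma lapZ f (c : R) x : Ck 2 f -> lap (fun x => c * f x) x = c * lap f x.
Proof.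
move=> hf; rewrite /lap mulr_sumr; apply: eq_bigr => i _.
by rewrite partialZ ?partialZ//; [exact: Ck_partial|exact: CkW].
Qed.

Lemma hom_lap d f : hpoly d f -> if d is d'.+2 then hpoly d' (lap f) else lap f = (fun=> 0).
Proof.
case: d => [|[|d]] hf.
- apply/funext => x; rewrite /lap big1// => i _.
  by rewrite (hom_partial i hf) partial_cst.
- apply/funext => x; rewrite /lap big1// => i _.
  by rewrite (hom_partial i (hom_partial i hf)).
- by apply: hom_sum => i; exact: (hom_partial i (hom_partial i hf)).
Qed.

Lemma hom_sq d f : hpoly d f -> hpoly d.+2 (fun x => dot x x * f x).
Proof.
move=> hf; rewrite (_ : (fun x => _) = (fun x => \sum_(i < n) x ord0 i * (x ord0 i * f x))).
  by apply: hom_sum => i; do 2 apply: hom_mulX.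
by apply/funext => x; rewrite mulr_suml; apply: eq_bigr => i _; rewrite mulrA.
Qed.

Lemma Ck_dot k : Ck k (fun x : V => dot x x).
Proof. by apply: Ck_sum => i; apply: CkM; exact: Ck_coord. Qed.

Lemma partial_dot i : partial i (fun x : V => dot x x) = (fun x => 2 * x ord0 i).
Proof.
apply: partial_eq => x; have := is_derive_sqdist 0 x (e_ i).
by rewrite subr0 dot_delta; under eq_fun do rewrite subr0.
Qed.

Lemma partial_dotM i f : (forall k, Ck k f) ->
  partial i (fun x => dot x x * f x) = (fun x => 2 * (x ord0 i * f x) + dot x x * partial i f x).
Proof.
move=> hf; rewrite partialM ?partial_dot//; last exact: Ck_dot.
by apply/funext => x; rewrite mulrA.
Qed.

(** The cross term of the product rule is evaluated by Euler's identity. *)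
Lemma lap_sq d f x : hpoly d f ->
  lap (fun x => dot x x * f x) x = (2 * n%:R + 4 * d%:R) * f x + dot x x * lap f x.
Proof.
move=> hf; have sf := hom_smooth hf.
have E i : partial i (partial i (fun x => dot x x * f x)) x =
    2 * f x + 4 * (x ord0 i * partial i f x) + dot x x * partial i (partial i f) x.
  have si k : Ck k (partial i f) by exact: (Ck_partial i (sf k.+1)).
  have sx k : Ck k (fun x : V => x ord0 i * f x) by apply: CkM => //; exact: Ck_coord.
  rewrite partial_dotM// partialD; [|exact: CkZ|by apply: CkM => //; exact: Ck_dot].
  rewrite partialZ// partialM//; last exact: Ck_coord.
  rewrite partial_coord eqxx partial_dotM// mulr1n; ring.
transitivity (\sum_(i < n) (2 * f x + 4 * (x ord0 i * partial i f x) +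
    dot x x * partial i (partial i f) x)); first by apply: eq_bigr => i _; exact: E.
rewrite !big_split/= -!mulr_sumr (hom_euler x hf) sumr_const card_ord -mulr_natl -/(lap f x); ring.
Qed.

(** Put [r = (g - |x|^2 t) / kap], where [t] should be the Laplacian of [r]. By [lap_sq] this asks
    for [(kap + 2 n + 4 e) t + |x|^2 lap t = lap g], the same problem two degrees lower and again
    with a positive constant. *)
Lemma hom_solve e (kap : R) g : 0 < kap -> hpoly e g ->
  exists2 r, hpoly e r & forall x, kap * r x + dot x x * lap r x = g x.
Proof.
elim/ltn_ind: e kap g => e IH kap g k0 hg.
have kn0 : kap != 0 by rewrite gt_eqF.
case: e IH hg => [|[|e]] IH hg.
- exists (fun x => kap^-1 * g x) => [|x]; first exact: homZ.
  rewrite lapZ; last exact: (hom_smooth hg _).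
  by rewrite (hom_lap hg) !mulr0 addr0 mulVKf.
- exists (fun x => kap^-1 * g x) => [|x]; first exact: homZ.
  rewrite lapZ; last exact: (hom_smooth hg _).
  by rewrite (hom_lap hg) !mulr0 addr0 mulVKf.
- have k'0 : 0 < kap + (2 * n%:R + 4 * e%:R) by rewrite ltr_pwDl// addr_ge0// mulr_ge0.
  have [|t ht hE] := IH e _ _ _ k'0 (hom_lap hg); first exact: ltnW.
  have hsq := hom_sq ht.
  have hr : hpoly e.+2 (fun x => kap^-1 * (g x + -1 * (dot x x * t x))).
    by apply: homZ; apply: hom_add => //; exact: homZ.
  exists (fun x => kap^-1 * (g x + -1 * (dot x x * t x))) => // x.
  have sg := hom_smooth hg; have st := hom_smooth hsq.
  rewrite lapZ; last by apply: CkD => //; exact: CkZ.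
  rewrite lapD ?lapZ//; last exact: CkZ.
  rewrite (lap_sq x ht) -(hE x); field.
  exact: kn0.
Qed.

Definition harmonic_fun h := (forall k, Ck k h) /\ (forall x, lap h x = 0).

Lemma harmonicD f g : harmonic_fun f -> harmonic_fun g -> harmonic_fun (fun x => f x + g x).
Proof.
move=> [sf hf] [sg hg]; split=> [k|x]; first exact: CkD.
by rewrite lapD// hf hg addr0.
Qed.

Lemma harmonicZ f (c : R) : harmonic_fun f -> harmonic_fun (fun x => c * f x).
Proof.
move=> [sf hf]; split=> [k|x]; first exact: CkZ.
by rewrite lapZ// hf mulr0.
Qed.

Lemma harmonic_partial f i : harmonic_fun f -> harmonic_fun (partial i f).
Proof.
move=> [sf hf]; split=> [k|x]; first exact: (Ck_partial i (sf k.+1)).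
have E j : partial j (partial j (partial i f)) = partial i (partial j (partial j f)).
  by rewrite (schwarz i j (sf 2%N)) (schwarz j i (f := partial j f))//;
    exact: (Ck_partial j (sf 3%N)).
have lapE : lap f = (fun=> 0) by apply/funext.
have <- : partial i (lap f) x = 0 by rewrite lapE partial_cst.
transitivity (\sum_(j < n) partial i (partial j (partial j f)) x).
  by apply: eq_bigr => j _; rewrite E.
have D y : is_derive y (e_ i) (lap f) (\sum_(j < n) partial i (partial j (partial j f)) y).
  apply: is_derive_sumf => j; apply: Ck_partial_is_derive.
  exact: (Ck_partial j (Ck_partial j (sf 3%N))).
by rewrite (partial_eq D).
Qed.

(** Choose [r] with [lap (|x|^2 r) = lap g]. Then [g - |x|^2 r] is harmonic, and on the sphere the
    missing term is [rho r], whose degree is lower by two. *)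
Lemma hom_harmonic_ext d g (rho : R) : (0 < n)%N -> hpoly d g -> exists2 h, harmonic_fun h &
  forall x, dot x x = rho -> h x = g x.
Proof.
move=> n0; elim/ltn_ind: d g => d IH g hg.
case: d IH hg => [|[|d]] IH hg.
- by exists g => //; split=> [k|x]; [exact: (hom_smooth hg _)|rewrite (hom_lap hg)].
- by exists g => //; split=> [k|x]; [exact: (hom_smooth hg _)|rewrite (hom_lap hg)].
- have k0 : 0 < 2 * n%:R + 4 * d%:R :> R.
    by rewrite ltr_pwDl ?mulr_ge0// mulr_gt0// ltr0n.
  have [r hr hE] := hom_solve k0 (hom_lap hg).
  have [|h1 hh1 h1E] := IH d _ r hr; first exact: ltnW.
  exists (fun x => (g x + -1 * (dot x x * r x)) + rho * h1 x) => [|x xr]; last first.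
    by rewrite h1E// xr; ring.
  apply: harmonicD; last exact: harmonicZ.
  have sg := hom_smooth hg; have sr := hom_smooth (hom_sq hr).
  split=> [k|x]; first by apply: CkD => //; exact: CkZ.
  rewrite lapD ?lapZ//; last exact: CkZ.
  rewrite (lap_sq x hr) -hE; ring.
Qed.

Inductive poly_fun : (V -> R) -> Prop :=
| poly_hom d f : hpoly d f -> poly_fun f
| poly_add f g : poly_fun f -> poly_fun g -> poly_fun (fun x => f x + g x).

Lemma polyZ f (c : R) : poly_fun f -> poly_fun (fun x => c * f x).
Proof.
elim=> {f} [d f hf|f g _ IHf _ IHg]; first exact: poly_hom (homZ c hf).
by under eq_fun do rewrite mulrDr; exact: poly_add.
Qed.

Lemma poly_mulX f i : poly_fun f -> poly_fun (fun x => x ord0 i * f x).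
Proof.
elim=> {f} [d f hf|f g _ IHf _ IHg]; first exact: poly_hom (hom_mulX i hf).
by under eq_fun do rewrite mulrDr; exact: poly_add.
Qed.

Lemma poly_sum m (f : 'I_m -> V -> R) : (forall l, poly_fun (f l)) ->
  poly_fun (fun x => \sum_(l < m) f l x).
Proof.
elim: m f => [|m IH] f hf.
  by under eq_fun do rewrite big_ord0; exact: poly_hom (hom_zero 0).
by under eq_fun do rewrite big_ord_recr/=; apply: poly_add => //; exact: IH.
Qed.

Lemma poly_harmonic_ext g (rho : R) : (0 < n)%N -> poly_fun g -> exists2 h, harmonic_fun h &
  forall x, dot x x = rho -> h x = g x.
Proof.
move=> n0; elim=> {g} [d f hf|f g _ [f' hf fE] _ [g' hg gE]].
  exact: hom_harmonic_ext hf.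
exists (fun x => f' x + g' x) => [|x xr]; first exact: harmonicD.
by rewrite fE// gE.
Qed.

End Harmonic.

(** * Bernstein polynomials of a random walk and harmonic replacement *)

Section RandomWalk.
Variables (R : realType) (n : nat).
Local Notation V := 'rV[R]_n.
Implicit Types (x s : V) (f g h : V -> R) (i : 'I_n) (j : nat).
Local Notation e_ i := (delta_mx ord0 i : V).
Hypothesis n0 : (0 < n)%N.

(** Expectation of [g] after [j] steps from [s] of a walk that moves by [st] along the signed axes,
    with probabilities [(1 + x_i / r) / (2 n)] and [(1 - x_i / r) / (2 n)]. It is a polynomial in
    the drift parameter [x]: a Bernstein operator adapted to the ball. *)
Fixpoint walk (r st : R) g j s x : R :=
  if j is j'.+1 then \sum_(i < n)
    ((1 + x ord0 i / r) / (2 * n%:R) * walk r st g j' (s + st *: e_ i) x +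
     (1 - x ord0 i / r) / (2 * n%:R) * walk r st g j' (s - st *: e_ i) x)
  else g s.

Lemma walk_poly r st g j s : poly_fun (walk r st g j s).
Proof.
elim: j s => [|j IH] s /=; first exact: poly_hom (hom_cst _ _).
apply: poly_sum => i.
have W (c : R) F : poly_fun F -> poly_fun (fun x => (1 + c * x ord0 i) / (2 * n%:R) * F x).
  move=> hF; rewrite (_ : (fun x => _) = (fun x => (2 * n%:R)^-1 * F x +
      (c / (2 * n%:R)) * (x ord0 i * F x))); last by apply/funext => x; ring.
  by apply: poly_add; apply: polyZ => //; exact: poly_mulX.
apply: poly_add.
  by under eq_fun do rewrite [_ / r]mulrC; exact: W.
by under eq_fun do rewrite [_ / r]mulrC -mulNr; exact: W.
Qed.

Lemma walk_le r st g g' j s x : 0 < r -> 0 <= st -> (forall i, `|x ord0 i| <= r) ->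
  (forall s', enorm (s' - s) <= j%:R * st -> g s' <= g' s') ->
  walk r st g j s x <= walk r st g' j s x.
Proof.
move=> r0 st0 xr; elim: j s => [|j IH] s gg' /=.
  by apply: gg'; rewrite subrr enorm0 mul0r.
have nR : 0 < 2 * n%:R :> R by rewrite mulr_gt0// ltr0n.
apply: ler_sum => i _; have := xr i; rewrite ler_norml => /andP[x1 x2].
have xr1 : x ord0 i / r <= 1 by rewrite ler_pdivrMr// mul1r.
have xr2 : - 1 <= x ord0 i / r by rewrite ler_pdivlMr// mulN1r.
have step (b : V) : enorm b <= st ->
    walk r st g j (s + b) x <= walk r st g' j (s + b) x.
  move=> bs; apply: IH => s' s'b; apply: gg'.
  have -> : s' - s = (s' - (s + b)) + b by apply/rowP => k; rewrite !mxE; ring.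
  by rewrite (le_trans (enormD _ _))// -natr1 mulrDl mul1r lerD.
have ne : enorm (st *: e_ i) <= st by rewrite enormZ enorm_delta mulr1 ger0_norm.
apply: lerD; apply: ler_wpM2l.
- by rewrite divr_ge0 ?(ltW nR)//; move: (_ / r) xr2 => a; lra.
- exact: step.
- by rewrite divr_ge0 ?(ltW nR)//; move: (_ / r) xr1 => a; lra.
- by apply: step; rewrite enormN.
Qed.

(** Exact mean and variance: each step drifts by [k x] and adds [st^2 - k^2 |x|^2] to the
    variance. *)
Lemma walk_quad r st (a b : R) (c : V) k j s x : 0 < r -> k = st / (n%:R * r) ->
  walk r st (fun s => a + b * dot (s - c) (s - c)) j s x =
  a + b * (dot (s - c + (j%:R * k) *: x) (s - c + (j%:R * k) *: x)
    + j%:R * (st ^+ 2 - k ^+ 2 * dot x x)).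
Proof.
move=> r0 kE; elim: j s => [|j IH] s /=; first by rewrite !mul0r scale0r !addr0.
have nR : n%:R != 0 :> R by rewrite pnatr_eq0 -lt0n.
have rR : r != 0 by rewrite gt_eqF.
have [k' k'E] : exists k', k' = j%:R * k by exists (j%:R * k).
have [e eE] : exists e, e = j%:R * (st ^+ 2 - k ^+ 2 * dot x x).
  by exists (j%:R * (st ^+ 2 - k ^+ 2 * dot x x)).
have [w wE] : exists w, w = s - c + k' *: x by exists (s - c + k' *: x).
have P i (q : R) : dot (s + q *: e_ i - c + k' *: x) (s + q *: e_ i - c + k' *: x) =
    dot w w + 2 * q * w ord0 i + q ^+ 2.
  have -> : s + q *: e_ i - c + k' *: x = w + q *: e_ i.
    by rewrite wE; apply/rowP => l; rewrite !mxE; ring.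
  rewrite dotDl !dotDr !dotZl !dotZr dot_delta [dot (e_ i) w]dotC dot_delta dot_delta mxE !eqxx.
  by rewrite /=; ring.
transitivity (\sum_(i < n) ((a + b * (dot w w + st ^+ 2 + e)) / n%:R +
   2 * b * k * (x ord0 i * w ord0 i))).
  apply: eq_bigr => i _; rewrite !IH -(scaleNr st (e_ i)) -k'E -eE !P kE.
  field.
  by rewrite nR rR.
rewrite big_split/= sumr_const card_ord -mulr_sumr -[\sum_(i < n) _]/(dot x w).
have -> : s - c + (j.+1%:R * k) *: x = w + k *: x.
  by rewrite wE k'E -natr1; apply/rowP => l; rewrite !mxE; ring.
have -> : j.+1%:R * (st ^+ 2 - k ^+ 2 * dot x x) = e + (st ^+ 2 - k ^+ 2 * dot x x).
  by rewrite eE -natr1; move: (st ^+ 2 - _) => q; ring.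
rewrite dotDl !dotDr !dotZl !dotZr [dot w x]dotC -[_ *+ n]mulr_natl.
move: (dot x w) (dot w w) (dot x x) (k) => X W0 Y kk.
by field.
Qed.

(** On the sphere the Bernstein polynomial approximates [f] uniformly, by the usual variance
    estimate; its values there are those of a harmonic function. *)
Theorem harmonic_replacement (r L e : R) f : 0 < r -> 0 < e ->
  (forall s x, enorm s <= n%:R * r -> enorm x = r -> `|f s - f x| <= L * enorm (s - x)) ->
  exists2 h, harmonic_fun h & forall x, enorm x = r -> `|h x - f x| <= e.
Proof.
move=> r0 e0 fL.
have [L' L'0 LL'] : exists2 L', 0 < L' & L <= L'.
  by exists (`|L| + 1); [rewrite ltr_wpDl|rewrite (le_trans (ler_norm L))// lerDl].
have [d d0 dE] : exists2 d, 0 < d & L' * d = e / 2.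
  by exists (e / 2 / L'); [rewrite !divr_gt0|rewrite mulrC divfK// gt_eqF].
have nR : 0 < n%:R :> R by rewrite ltr0n.
have [N [N0 NE]] : exists N, (0 < N)%N /\ L' / d * (n%:R * r) ^+ 2 / N%:R <= e / 2.
  have [B BE] : exists B, B = L' / d * (n%:R * r) ^+ 2 by exists (L' / d * (n%:R * r) ^+ 2).
  exists (Num.truncn (B / (e / 2))).+1; split => //.
  rewrite -BE ler_pdivrMr ?ltr0n// mulrC -ler_pdivrMr ?divr_gt0//.
  by rewrite ltW// truncnS_gt.
have NR : 0 < N%:R :> R by rewrite ltr0n.
(* With this step the expected position after [N] steps is [x], and the walk never leaves the ball
   of radius [n r]. *)
have [st stE] : exists st, st = n%:R * r / N%:R by exists (n%:R * r / N%:R).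
have st0 : 0 <= st by rewrite stE divr_ge0 ?mulr_ge0 ?ltW.
have [h hh hE] := poly_harmonic_ext (r ^+ 2) n0 (walk_poly r st f N 0).
exists h => // x xr.
have xr2 : dot x x = r ^+ 2 by rewrite -enorm_sqr xr.
rewrite (hE _ xr2).
have xi i : `|x ord0 i| <= r by rewrite -xr; exact: coord_le.
have N1 : N%:R * (st / (n%:R * r)) = 1.
  by rewrite stE; field; rewrite !gt_eqF.
have Q b : walk r st (fun s => f x + L' * d * b + L' / d * b * dot (s - x) (s - x)) N 0 x =
    f x + L' * d * b + L' / d * b * (N%:R * (st ^+ 2 - (st / (n%:R * r)) ^+ 2 * r ^+ 2)).
  by rewrite (walk_quad _ _ _ _ _ _ r0 erefl)// N1 scale1r sub0r addNr dot0l add0r xr2.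
have Q0 : 0 <= N%:R * (st ^+ 2 - (st / (n%:R * r)) ^+ 2 * r ^+ 2) <= (n%:R * r) ^+ 2 / N%:R.
  have -> : N%:R * (st ^+ 2 - (st / (n%:R * r)) ^+ 2 * r ^+ 2) =
     (n%:R ^+ 2 - 1) * r ^+ 2 / N%:R.
    by rewrite stE; field; rewrite !gt_eqF.
  apply/andP; split.
    apply: divr_ge0 (ltW NR); apply: mulr_ge0 (sqr_ge0 _).
    by rewrite subr_ge0 -natrX ler1n expn_gt0 n0.
  rewrite ler_pM2r ?invr_gt0// exprMn ler_wpM2r ?sqr_ge0// gerBl; exact: ler01.
(* Replaces the Lipschitz modulus by a quadratic one, whose expectation [walk_quad] computes
   exactly. *)
have AG (t : R) : 0 <= t -> L * t <= L' * d + L' / d * t ^+ 2.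
  move=> t0; apply: (le_trans (ler_wpM2r t0 LL')).
  rewrite -mulrA -mulrDr ler_wpM2l ?(ltW L'0)//.
  rewrite -(ler_pM2l d0) mulrDr mulrA divff ?gt_eqF// mul1r.
  have := sqr_ge0 (d - t); have := sqr_ge0 d; have := sqr_ge0 t.
  move: d0; clear; move: d t => d t; rewrite !expr2; nra.
have fb s : enorm (s - 0) <= N%:R * st -> `|f s - f x| <= L' * d + L' / d * dot (s - x) (s - x).
  rewrite subr0 => sn; apply: (le_trans (fL s x _ xr)).
    by rewrite (le_trans sn)// stE mulrC divfK ?gt_eqF.
  by rewrite (le_trans (AG _ (enorm_ge0 _)))// enorm_sqr.
have LdN : L' / d * (N%:R * (st ^+ 2 - (st / (n%:R * r)) ^+ 2 * r ^+ 2)) <= e / 2.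
  have LD : 0 <= L' / d by rewrite divr_ge0 ?ltW.
  apply: le_trans NE; case/andP: Q0 => _ /(ler_wpM2l LD).
  by rewrite [L' / d * (_ / _)]mulrA.
rewrite ler_distl; apply/andP; split.
  have H : walk r st (fun s => f x + L' * d * -1 + L' / d * -1 * dot (s - x) (s - x)) N 0 x
      <= walk r st f N 0 x.
    apply: walk_le => // s /fb; rewrite ler_distl => /andP[H _].
    by apply: le_trans H; rewrite !mulrN1 mulNr opprD addrA.
  apply: le_trans H; rewrite Q dE !mulrN1 mulNr.
  by move: LdN; move: (L' / d * _) => Z; lra.
have H : walk r st f N 0 x <=
    walk r st (fun s => f x + L' * d * 1 + L' / d * 1 * dot (s - x) (s - x)) N 0 x.
  apply: walk_le => // s /fb; rewrite ler_distl => /andP[_ H].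
  by apply: (le_trans H); rewrite !mulr1 addrA.
apply: (le_trans H); rewrite Q dE !mulr1.
by move: LdN; move: (L' / d * _) => Z; lra.
Qed.

End RandomWalk.

(** * Maximum principle and interior gradient estimate *)

Section MaximumPrinciple.
Variables (R : realType) (n : nat).
Local Notation V := 'rV[R]_n.
Implicit Types (x y z : V) (f g h u : V -> R) (i j : 'I_n) (r d L M e : R).
Local Notation e_ i := (delta_mx ord0 i : V).

Lemma partial_affm (x0 : V) (S : 'M[R]_n) f j : Ck 1 f ->
  partial j (fun y => f (x0 + y *m S)) =
  (fun y => \sum_(k < n) S j k * partial k f (x0 + y *m S)).
Proof.
move=> hf; apply: partial_eq => y; apply: is_derive_aff => /=.
rewrite -rowE; have := C1_line (x0 + y *m S) (row j S) hf.
by rewrite (eq_bigr (fun k => S j k * partial k f (x0 + y *m S)))// => k _; rewrite mxE.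
Qed.

Lemma partial2_affm (x0 : V) (S : 'M[R]_n) f i j y : Ck 2 f ->
  partial i (partial j (fun y => f (x0 + y *m S))) y =
  \sum_(k < n) S j k * \sum_(l < n) S i l * partial l (partial k f) (x0 + y *m S).
Proof.
move=> hf; rewrite partial_affm; last exact: CkW.
suff D z : is_derive z (e_ i) (fun y => \sum_(k < n) S j k * partial k f (x0 + y *m S))
    (\sum_(k < n) S j k * \sum_(l < n) S i l * partial l (partial k f) (x0 + z *m S)).
  by rewrite (partial_eq D).
apply: is_derive_sumf => k; apply: is_deriveZf.
have hk := Ck_partial k hf.
have := @Ck_partial_is_derive R n 0 _ z i (Ck_aff x0 S hk).
by rewrite partial_affm.
Qed.

Lemma lap_affm (x0 : V) (S : 'M[R]_n) f y : Ck 2 f ->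
  lap (fun y => f (x0 + y *m S)) y =
  \sum_(k < n) \sum_(l < n) (S^T *m S) k l * partial l (partial k f) (x0 + y *m S).
Proof.
move=> hf; transitivity (\sum_(j < n) \sum_(k < n) \sum_(l < n)
    S j k * (S j l * partial l (partial k f) (x0 + y *m S))).
  by apply: eq_bigr => j _; rewrite partial2_affm//; apply: eq_bigr => k _; rewrite mulr_sumr.
rewrite exchange_big; apply: eq_bigr => k _; rewrite exchange_big; apply: eq_bigr => l _.
by rewrite !mxE mulr_suml; apply: eq_bigr => j _; rewrite mxE mulrA.
Qed.

Lemma lap_orthogonal (x0 : V) (S : 'M[R]_n) f y : Ck 2 f -> S^T *m S = 1%:M ->
  lap (fun y => f (x0 + y *m S)) y = lap f (x0 + y *m S).
Proof.
move=> hf SS; rewrite lap_affm// SS; apply: eq_bigr => k _.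
rewrite (bigD1 k)//= mxE eqxx mul1r big1 ?addr0// => l lk.
by rewrite mxE eq_sym (negbTE lk) mul0r.
Qed.

Lemma lap_local_max g y : Ck 2 g -> (\forall z \near y, g z <= g y) -> lap g y <= 0.
Proof.
move=> hg /nbhs_enormP[r /= r0 gy]; apply: sumr_le0 => i _.
rewrite -[leRHS](mulr0 2); apply: (@second_test _ _ g (partial i g) y (e_ i) _ 0 0 r) => //.
- by move=> z; exact: Ck_partial_is_derive hg.
- exact: Ck_partial_is_derive (Ck_partial i hg).
move=> t tr; rewrite !mul0r !addr0; apply: gy => /=.
by rewrite [y + _]addrC addrK enormZ enorm_delta mulr1.
Qed.

(** The alternative is asked at each point of [K], so that no boundary has to be described. *)
Lemma max_principle (K : set V) g : compact K -> Ck 2 g ->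
  (forall y, K y -> g y <= 0 \/ ((\forall z \near y, K z) /\ 0 < lap g y)) ->
  forall y, K y -> g y <= 0.
Proof.
move=> cK hg H y Ky.
have [||z] := @EVT_max_rV R n g _ _ cK; first by exists y.
  by apply: continuous_subspaceT; exact: Ck_cont hg.
rewrite inE => Kz zmax; have yz : g y <= g z by apply: zmax; rewrite inE.
have [gz|[nz lz]] := H _ Kz; first exact: le_trans gz.
have : lap g z <= 0.
  by apply: lap_local_max => //; apply: filterS nz => w Kw; apply: zmax; rewrite inE.
by rewrite leNgt lz.
Qed.

Lemma lap_dot y : lap (fun x : V => dot x x) y = 2 * n%:R.
Proof.
rewrite /lap (eq_bigr (fun=> 2)) => [|i _]; first by rewrite sumr_const card_ord -[_ *+ n]mulr_natr.
rewrite partial_dot partialZ; last exact: Ck_coord.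
by rewrite partial_coord eqxx mulr1.
Qed.

Lemma lapB f g x : Ck 2 f -> Ck 2 g -> lap (fun x => f x - g x) x = lap f x - lap g x.
Proof.
move=> hf hg; have -> : (fun x => f x - g x) = (fun x => f x + -1 * g x).
  by apply/funext => z; rewrite mulN1r.
by rewrite (lapD x hf (CkZ (-1) hg)) (lapZ (-1) x hg) mulN1r.
Qed.

Lemma lap_cst (c : R) x : lap (fun _ : V => c) x = 0.
Proof. by rewrite /lap big1// => i _; rewrite !partial_cst. Qed.

Lemma enorm_near (y : V) r : enorm y < r -> \forall z \near y, enorm z <= r.
Proof.
move=> yr; apply/nbhs_enormP; exists (r - enorm y); first by rewrite /= subr_gt0.
by move=> z /= zy; have := enormD (z - y) y; rewrite subrK; lra.
Qed.

Lemma ball0_compact r : compact [set y : V | enorm y <= r].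
Proof.
rewrite (_ : [set y : V | _] = [set y | enorm (y - 0) <= r]); first exact: ball_compact.
by apply/seteqP; split=> y /=; rewrite subr0.
Qed.

(** Comparison with [e + (L + d') (r^2 - |y|^2)]; the small [d'] makes the differential inequality
    strict. *)
Lemma ball_upper_bound r L e f : (0 < n)%N -> 0 <= L -> Ck 2 f ->
  (forall y, enorm y <= r -> - L <= lap f y) -> (forall y, enorm y = r -> f y <= e) ->
  forall y, enorm y <= r -> f y <= e + L * r ^+ 2.
Proof.
move=> n0 L0 hf lf fb y yr.
have n1 : 1 <= n%:R :> R by rewrite ler1n.
apply/ler_addgt0Pr => d d0.
have r20 := sqr_ge0 r.
have [d' d'0 d'E] : exists2 d', 0 < d' & d' * r ^+ 2 <= d.
  exists (d / (r ^+ 2 + 1)); first by rewrite divr_gt0// ltr_wpDl.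
  rewrite mulrAC ler_pdivrMr ?ltr_wpDl// ler_pM2l// lerDl; exact: ler01.
have c1 : Ck 2 (fun y : V => r ^+ 2 - dot y y) := CkB (Ck_cst _ _ _) (Ck_dot _ _ _).
have c2 : Ck 2 (fun y : V => e + (L + d') * (r ^+ 2 - dot y y)) :=
  CkD (Ck_cst _ _ _) (CkZ _ c1).
have hg : Ck 2 (fun y => f y - (e + (L + d') * (r ^+ 2 - dot y y))) := CkB hf c2.
have := max_principle (@ball0_compact r) hg _ yr.
have dy : 0 <= dot y y by exact: dot_ge0.
have H : (forall z, [set y | enorm y <= r] z -> f z - (e + (L + d') * (r ^+ 2 - dot z z)) <= 0 \/
   (\forall z0 \near z, [set y | enorm y <= r] z0) /\
    0 < lap (fun y => f y - (e + (L + d') * (r ^+ 2 - dot y y))) z).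
  move=> z /= zr; have [zr'|zr'] := eqVneq (enorm z) r.
    left; rewrite -enorm_sqr zr' subrr mulr0 addr0 subr_le0; exact: fb.
  right; split; first by apply: enorm_near; rewrite lt_neqAle zr'.
  rewrite (lapB z hf c2) (lapD z (Ck_cst _ _ _) (CkZ _ c1)) (lapZ _ z c1).
  rewrite (lapB z (Ck_cst _ _ _) (Ck_dot _ _ _)).
  rewrite !lap_cst lap_dot; have := lf _ zr; move: (lap f z) (n%:R) n1 L0 d'0.
  clear; move=> l N *; nra.
move=> /(_ H) /=; rewrite subr_le0 => /le_trans; apply.
rewrite -addrA lerD2l (le_trans (y := (L + d') * r ^+ 2))//; last by rewrite mulrDl lerD2l.
by rewrite ler_wpM2l ?addr_ge0 ?(ltW d'0)// gerBl.
Qed.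

Lemma ball_bound r L e f : (0 < n)%N -> 0 <= L -> Ck 2 f ->
  (forall y, enorm y <= r -> `|lap f y| <= L) -> (forall y, enorm y = r -> `|f y| <= e) ->
  forall y, enorm y <= r -> `|f y| <= e + L * r ^+ 2.
Proof.
move=> n0 L0 hf lf fb y yr; rewrite ler_norml; apply/andP; split; last first.
  apply: ball_upper_bound => // z zr; first by have := lf _ zr; rewrite ler_norml => /andP[].
  by have := fb _ zr; rewrite ler_norml => /andP[].
rewrite lerNl.
have := @ball_upper_bound r L e (fun y => -1 * f y) n0 L0 (CkZ _ hf) _ _ y yr.
rewrite mulN1r; apply=> z zr.
- by rewrite (lapZ _ z hf) mulN1r lerN2; have := lf _ zr; rewrite ler_norml => /andP[].
- by rewrite mulN1r lerNl; have := fb _ zr; rewrite ler_norml => /andP[].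
Qed.

Definition reflect i : 'M[R]_n := \matrix_(k, l) ((k == l)%:R * (1 - 2 * (k == i)%:R)).

Lemma reflectE i y j : (y *m reflect i) ord0 j = y ord0 j * (1 - 2 * (j == i)%:R).
Proof.
rewrite mxE (bigD1 j)//= mxE eqxx mul1r big1 ?addr0// => k kj.
by rewrite mxE (negbTE kj) mul0r mulr0.
Qed.

Lemma reflect_orthogonal i : (reflect i)^T *m reflect i = 1%:M.
Proof.
apply/matrixP => k l; rewrite !mxE (bigD1 k)//= big1 ?addr0 => [|j jk].
  rewrite !mxE eqxx; case: (k == i); case: (k == l); rewrite ?mulr1n ?mulr0n; ring.
by rewrite !mxE (negbTE jk) !mul0r.
Qed.

Lemma reflect_enorm i y : enorm (y *m reflect i) = enorm y.
Proof.
rewrite /enorm; congr Num.sqrt; apply: eq_bigr => j _; rewrite reflectE.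
by case: (j == i); rewrite ?mulr1n ?mulr0n; ring.
Qed.

Lemma reflect_delta i t : t *: e_ i *m reflect i = - t *: e_ i.
Proof.
by apply/rowP => j; rewrite reflectE !mxE /= eq_sym; case: (i == j); rewrite ?mulr1n ?mulr0n; ring.
Qed.

(* Brandt's barrier: the difference of [u] and its reflection vanishes on the
   hyperplane [y_i = 0], where it is compared with a quadratic polynomial that
   vanishes to first order at the origin. *)
Lemma gradient_upper d L M u x i : Ck 2 u -> 0 < d -> 0 <= L ->
  (forall y, enorm (y - x) <= d -> `|u y| <= M) ->
  (forall y, enorm (y - x) <= d -> `|lap u y| <= L) ->
  partial i u x <= n%:R * M / d + d * L.
Proof.
move=> hu d0 L0 uM uL.
have n1 : 1 <= n%:R :> R by rewrite ler1n (leq_ltn_trans _ (ltn_ord i)).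
have M0 : 0 <= M by apply: le_trans (uM x _) => //; rewrite subrr enorm0 ltW.
have xin y : enorm y <= d -> enorm (x + y *m 1%:M - x) <= d.
  by rewrite mulmx1 addrC addKr.
have xin' y : enorm y <= d -> enorm (x + y *m reflect i - x) <= d.
  by rewrite addrC addKr reflect_enorm.
have uL' y : enorm y <= d -> - L <= lap u (x + y) <= L.
  by move=> yd; rewrite -ler_norml; apply: uL; rewrite addrC addKr.
(* [A |y|^2] dominates the difference of [u] and its reflection on the outer sphere. [E] is chosen
   so that the term [d y_i - y_i^2] outweighs both the Laplacian of [A |y|^2] and the bound [2 L] on
   that of the difference. *)
have [A AE] : exists A, A * d ^+ 2 = 2 * M.
  by exists (2 * M / d ^+ 2); rewrite divfK// expf_neq0// gt_eqF.
have A0 : 0 <= A by rewrite -(pmulr_lge0 _ (exprn_gt0 2 d0)) AE mulr_ge0.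
have [E EE] : exists E, E = n%:R * A + 2 * L by exists (n%:R * A + 2 * L).
have EA : A <= E by rewrite EE; nra.
have c1 : Ck 2 (fun y : V => u (x + y *m 1%:M)) := Ck_aff x 1%:M hu.
have c2 : Ck 2 (fun y : V => u (x + y *m reflect i)) := Ck_aff x (reflect i) hu.
have ci : Ck 2 (fun y : V => y ord0 i) := Ck_coord _ _ _.
have main e t : 0 < e -> 0 <= t -> t <= d ->
    u (x + t *: e_ i) - u (x - t *: e_ i) <= (E + e) * d * t.
  move=> e0 t0 td.
  have cz : Ck 2 (fun y : V => d * y ord0 i) := CkZ d ci.
  have cm : Ck 2 (fun y : V => y ord0 i * y ord0 i) := CkM ci ci.
  have cb : Ck 2 (fun y : V => d * y ord0 i - y ord0 i * y ord0 i) := CkB cz cm.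
  have cd : Ck 2 (fun y : V => A * dot y y) := CkZ A (Ck_dot _ _ _).
  have ce : Ck 2 (fun y : V => (E + e) * (d * y ord0 i - y ord0 i * y ord0 i)) := CkZ _ cb.
  have cB : Ck 2 (fun y : V => A * dot y y + (E + e) * (d * y ord0 i - y ord0 i * y ord0 i)) :=
    CkD cd ce.
  have cw : Ck 2 (fun y : V => u (x + y *m 1%:M) - u (x + y *m reflect i)) := CkB c1 c2.
  have hg := CkB cw cB.
  have cK : compact ([set y : V | enorm y <= d] `&` [set y | 0 <= y ord0 i]).
    apply: compact_closedI; first exact: ball0_compact.
    have := @closed_comp _ _ (fun y : V => y ord0 i) [set a | 0 <= a].
    by apply; [move=> y _; exact: coord_cont|exact: closed_ge].
  have lb y : lap (fun y : V => d * y ord0 i - y ord0 i * y ord0 i) y = -2.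
    rewrite (lapB y cz cm) (lapZ d y ci).
    have -> : lap (fun y : V => y ord0 i) y = 0.
      by apply: big1 => j _; rewrite partial_coord partial_cst.
    have -> : lap (fun y : V => y ord0 i * y ord0 i) y = 2; last by rewrite mulr0 sub0r.
    rewrite /lap (bigD1 i)//= big1 ?addr0 => [|j ji].
      rewrite (partialM _ (Ck_coord _ 1 i) (Ck_coord _ 1 i)).
      rewrite partial_coord eqxx mulr1n.
      rewrite (_ : (fun y : V => _) = (fun y => 2 * y ord0 i)).
        by rewrite (partialZ _ _ (Ck_coord _ 1 i)) partial_coord eqxx mulr1.
      by apply/funext => z; ring.
    rewrite (partialM _ (Ck_coord _ 1 i) (Ck_coord _ 1 i)).
    rewrite partial_coord eq_sym (negbTE ji) mulr0n.
    rewrite (_ : (fun y : V => _) = (fun y => 0)) ?partial_cst//.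
    by apply/funext => z; ring.
  have H := max_principle cK hg _ (y := t *: e_ i).
  have : [set y | enorm y <= d] (t *: e_ i) /\ [set y : V | 0 <= y ord0 i] (t *: e_ i).
    by rewrite /= enormZ enorm_delta mulr1 ger0_norm// !mxE !eqxx mulr1.
  move=> /H {H} H.
  have {H} := H _; rewrite mulmx1 reflect_delta scaleNr.
  rewrite dotZl dotZr dot_delta !mxE !eqxx/= !mulr1 subr_le0 => H.
  have {}H : u (x + t *: e_ i) - u (x - t *: e_ i) <= A * (t * t) + (E + e) * (d * t - t * t).
    apply: H => y [/= yd yi].
    have w2M : u (x + y *m 1%:M) - u (x + y *m reflect i) <= 2 * M.
      have := uM _ (xin _ yd); have := uM _ (xin' _ yd); rewrite !ler_norml.
      by move: (u _) (u _) => a b; lra.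
    have yid : y ord0 i <= d.
      by apply: le_trans yd; apply: le_trans (coord_le y i); exact: ler_norm.
    have [y0|y0] := eqVneq (y ord0 i) 0.
      left; rewrite y0 !mulr0 subrr mulr0 addr0.
      have -> : y *m reflect i = y *m 1%:M.
        rewrite mulmx1; apply/rowP => j; rewrite reflectE.
        by have [->|_] := eqVneq j i; rewrite ?y0 ?mul0r ?mulr0n ?mulr0 ?subr0 ?mulr1.
      by rewrite subrr sub0r oppr_le0 mulr_ge0// dot_ge0.
    have [yd'|yd'] := eqVneq (enorm y) d.
      left; rewrite subr_le0; apply: (le_trans w2M); rewrite -AE -enorm_sqr yd'.
      have q0 : 0 <= d * y ord0 i - y ord0 i * y ord0 i by rewrite -mulrBl mulr_ge0// subr_ge0.
      by rewrite lerDl (mulr_ge0 _ q0)// addr_ge0 ?(ltW e0)// (le_trans A0 EA).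
    right; split.
      apply: filterI; first by apply: enorm_near; rewrite lt_neqAle yd' yd.
      have yi0 : 0 < y ord0 i by rewrite lt_def y0 yi.
      apply/nbhs_enormP; exists (y ord0 i) => // z /= zy.
      have := coord_le (z - y) i; rewrite !mxE ler_norml => /andP[]; move: zy; lra.
    rewrite (lapB y cw cB) (lapB y c1 c2) (lapD y cd ce) (lapZ A y (Ck_dot _ _ _)) (lapZ _ y cb).
    rewrite lb lap_dot (lap_orthogonal x y hu (reflect_orthogonal i)).
    rewrite (lap_orthogonal x y hu) ?trmx1 ?mulmx1//.
    have ydr : enorm (y *m reflect i) <= d by rewrite reflect_enorm.
    have /andP[_ l1] := uL' _ ydr; have /andP[l2 _] := uL' _ yd.
    move: l1 l2 e0 L0.
    rewrite EE; move: (lap u _) (lap u _) => a b; clear; nra.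
  apply: (le_trans H).
  have : 0 <= (E + e - A) * (t * t).
    by apply: mulr_ge0; [move: EA e0; clear; lra|exact: mulr_ge0].
  by move: H; clear; move: (E + e) => F _; nra.
have {}main t : 0 <= t -> t <= d ->
    u (x + t *: e_ i) - u (x - t *: e_ i) <= E * d * t.
  move=> t0 td; apply/ler_addgt0Pr => e e0.
  have [->|tn] := eqVneq t 0; first by rewrite scale0r subr0 addr0 subrr mulr0 add0r ltW.
  have t1 : 0 < t by rewrite lt_def tn.
  have := main (e / (d * t)) t (divr_gt0 e0 (mulr_gt0 d0 t1)) t0 td.
  by rewrite -!mulrA mulrDl divfK// gt_eqF// mulr_gt0.
have D := Ck_partial_is_derive x i hu.
have : 2 * partial i u x <= E * d.
  apply/ler_addgt0Pr => e e0.
  have [s s0 Hs] := (is_deriveP u x (e_ i) _).1 D (e / 2) (divr_gt0 e0 (ltr0Sn _ _)).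
  have [t t0 [ts td]] : exists2 t, 0 < t & t < s /\ t <= d.
    exists (Num.min (s / 2) d); first by rewrite lt_min d0 divr_gt0.
    by rewrite gt_min ge_min lexx orbT; split => //; apply/orP; left; rewrite ltr_pdivrMr//; lra.
  have h1 : `|t| < s by rewrite gtr0_norm.
  have h2 : `|- t| < s by rewrite normrN.
  have := Hs _ h1; have := Hs _ h2; have := main t (ltW t0) td.
  rewrite scaleNr normrN (gtr0_norm t0) !ler_norml => m1 /andP[_ m2] /andP[m3 _].
  rewrite -(ler_pM2r t0).
  move: m1 m2 m3; move: (u _) (u _) (u _) (partial i u x) => a b c' p; clear; lra.
have -> : n%:R * M / d + d * L = E * d / 2.
  rewrite EE -[M](mulfK (x := 2))//; rewrite [M * 2]mulrC -AE; field.
  by rewrite gt_eqF.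
by rewrite ler_pdivlMr// mulrC.
Qed.

Lemma gradient_estimate d L M u x i : Ck 2 u -> 0 < d -> 0 <= L ->
  (forall y, enorm (y - x) <= d -> `|u y| <= M) ->
  (forall y, enorm (y - x) <= d -> `|lap u y| <= L) ->
  `|partial i u x| <= n%:R * M / d + d * L.
Proof.
move=> hu d0 L0 uM uL; rewrite ler_norml; apply/andP; split; last exact: gradient_upper.
rewrite lerNl.
have := @gradient_upper d L M (fun y => -1 * u y) x i (CkZ _ hu) d0 L0 _ _.
rewrite (partialZ i (-1) (CkW hu)) mulN1r; apply=> y.
  by move=> /uM; rewrite mulN1r normrN.
by move=> /uL; rewrite (lapZ _ y hu) mulN1r normrN.
Qed.

End MaximumPrinciple.

(** * Derivative estimates and Taylor polynomials of harmonic functions *)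

Section HarmonicJets.
Variables (R : realType) (n : nat).
Local Notation V := 'rV[R]_n.
Implicit Types (x y z p : V) (f g h u w : V -> R) (i j k : 'I_n) (r d L M e t c : R).
Implicit Types (A : 'M[R]_n).
Local Notation e_ i := (delta_mx ord0 i : V).

Definition quad c p A y := c + dot p y + qf A y.

Lemma quadB c c' p p' A A' y :
  quad (c - c') (p - p') (A - A') y = quad c p A y - quad c' p' A' y.
Proof.
rewrite /quad qf_mxD qf_mxN dotBl.
by move: (dot _ _) (dot _ _) (qf _ _) (qf _ _) => a b d e; ring.
Qed.

Lemma hom_dot p : hpoly 1 (dot p).
Proof.
have -> : dot p = (fun y => \sum_(i < n) p ord0 i * (y ord0 i * 1)).
  by apply/funext => y; apply: eq_bigr => i _; rewrite mulr1.
by apply: hom_sum => i; apply: homZ; apply: hom_mulX; exact: hom_cst.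
Qed.

Lemma hom_qf A : hpoly 2 (qf A).
Proof.
have -> : qf A = (fun y => \sum_(i < n) y ord0 i * dot (row i A) y).
  apply/funext => y; apply: eq_bigr => i _; rewrite mulr_sumr; apply: eq_bigr => j _.
  by rewrite mxE mulrA.
by apply: hom_sum => i; apply: hom_mulX; exact: hom_dot.
Qed.

Lemma Ck_dotl m p : Ck m (dot p). Proof. exact: (hom_smooth (hom_dot p)). Qed.

Lemma Ck_qf m A : Ck m (qf A). Proof. exact: (hom_smooth (hom_qf A)). Qed.

Lemma Ck_quad m c p A : Ck m (quad c p A).
Proof. exact: (CkD (CkD (Ck_cst _ _ _) (Ck_dotl m p)) (Ck_qf m A)). Qed.

Lemma qf_mx0 y : qf 0 y = 0.
Proof. by rewrite -(scale0r (0 : 'M[R]_n)) qf_mxZ mul0r. Qed.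

Lemma partial_dotl p i : partial i (dot p) = (fun=> p ord0 i).
Proof.
apply: partial_eq => y; rewrite -(dot_delta p i).
have H (a b : R) : a = b -> is_derive y (e_ i) (dot p) a -> is_derive y (e_ i) (dot p) b.
  by move->.
apply: H (is_derive_sumf (f := fun l x => p ord0 l * x ord0 l) (fun l =>
  is_deriveZf (p ord0 l) (is_derive_coord y (e_ i) l))).
by [].
Qed.

Lemma row_sym A i y : dot (row i (A + A^T)) y = bf A (e_ i) y + bf A y (e_ i).
Proof.
rewrite bf_dotl bf_dotr -dotDl -!rowE; congr dot.
by apply/rowP => j; rewrite !mxE.
Qed.

Lemma partial_qf A i : partial i (qf A) = dot (row i (A + A^T)).
Proof.
apply: partial_eq => y; apply/is_deriveP => e e0; exists (e / (`|A i i| + 1)).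
  by rewrite divr_gt0// ltr_wpDl.
move=> t te; rewrite qf_add qfZ bfZl bfZr qf_delta.
rewrite row_sym.
have -> : qf A y + (t * bf A y (e_ i) + t * bf A (e_ i) y) + t ^+ 2 * A i i - qf A y -
    t * (bf A (e_ i) y + bf A y (e_ i)) = t * (t * A i i) by ring.
rewrite normrM mulrC ler_wpM2r// normrM.
have A1 : 0 < `|A i i| + 1 by rewrite ltr_wpDl.
move: te; rewrite ltr_pdivlMr// => te.
apply: le_trans (ltW te); rewrite ler_wpM2l// lerDl; exact: ler01.
Qed.

Lemma partial_quad c p A i :
  partial i (quad c p A) = quad (p ord0 i) (row i (A + A^T)) 0.
Proof.
rewrite (partialD i (CkD (Ck_cst _ _ _) (Ck_dotl 1 p)) (Ck_qf 1 A)).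
rewrite (partialD i (Ck_cst _ _ _) (Ck_dotl 1 p)) partial_cst partial_dotl partial_qf.
apply/funext => y; rewrite add0r /quad.
by rewrite qf_mx0 addr0.
Qed.

Lemma partial2_quad c p A i j y : partial j (partial i (quad c p A)) y = A i j + A j i.
Proof.
rewrite !partial_quad /quad qf_mx0 addr0 !mxE.
by rewrite (_ : row j _ = 0) ?dot0l ?addr0//; apply/rowP => k; rewrite !mxE addr0.
Qed.

Lemma lap_quad c p A y : lap (quad c p A) y = 2 * \tr A.
Proof.
rewrite /mxtrace mulr_sumr; apply: eq_bigr => i _.
by rewrite partial2_quad mulr_natl mulr2n.
Qed.

Lemma incr_bound g x y a : Ck 1 g ->
  (forall t i, 0 <= t <= 1 -> `|partial i g (x + t *: y)| <= a) ->
  `|g (x + y) - g x| <= n%:R * a * enorm y.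
Proof.
move=> hg ga; apply: (incr_line (df := grad_dot g y)) => [z|t t01]; first exact: C1_line.
apply: (le_trans (ler_norm_sum _ _ _)).
have -> : n%:R * a * enorm y = \sum_(i < n) enorm y * a.
  by rewrite sumr_const card_ord -[RHS]mulr_natl; ring.
apply: ler_sum => i _; rewrite normrM ler_pM//; [exact: coord_le|exact: ga].
Qed.

Lemma partialB f g i : Ck 1 f -> Ck 1 g ->
  partial i (fun z => f z - g z) = (fun z => partial i f z - partial i g z).
Proof.
move=> hf hg; apply: partial_eq => z; apply: is_deriveBf;
  [exact: Ck_partial_is_derive hf|exact: Ck_partial_is_derive hg].
Qed.

Definition jet2 g := quad (g 0) (grad g 0) (2^-1 *: hess g 0).

Lemma Ck_jet2 m g : Ck m (jet2 g). Proof. exact: Ck_quad. Qed.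

Lemma jet2_0 g : jet2 g 0 = g 0.
Proof. by rewrite /jet2 /quad dot0r qf0 !addr0. Qed.

Lemma partial_jet2 g i : partial i (jet2 g) 0 = partial i g 0.
Proof. by rewrite partial_quad /quad dot0r qf0 !addr0 mxE. Qed.

Lemma partial2_jet2 g i j z : Ck 2 g -> partial j (partial i (jet2 g)) z = partial j (partial i g) 0.
Proof.
move=> hg; rewrite partial2_quad !mxE (schwarz j i hg).
by move: (partial i (partial j g) 0) => a; lra.
Qed.

Lemma partial_sub_jet2 f g i : Ck 1 f ->
  partial i (fun z => f z - jet2 g z) 0 = partial i f 0 - partial i g 0.
Proof. by move=> hf; rewrite (partialB i hf (Ck_jet2 1 g)) partial_jet2. Qed.

Lemma partial2_sub_jet2 f g i j z : Ck 2 f -> Ck 2 g ->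
  partial j (partial i (fun z => f z - jet2 g z)) z =
  partial j (partial i f) z - partial j (partial i g) 0.
Proof.
move=> hf hg; rewrite (partialB i (CkW hf) (Ck_jet2 1 g)).
by rewrite (partialB j (Ck_partial i hf) (Ck_partial i (Ck_jet2 2 g))) partial2_jet2.
Qed.

Lemma jet2_sub f g y : Ck 2 f -> Ck 2 g ->
  jet2 (fun z => f z - jet2 g z) y = jet2 f y - jet2 g y.
Proof.
move=> hf hg; rewrite [LHS]/jet2 jet2_0.
have -> : grad (fun z => f z - jet2 g z) 0 = grad f 0 - grad g 0.
  by apply/rowP => i; rewrite !mxE partial_sub_jet2//; exact: CkW hf.
have -> : hess (fun z => f z - jet2 g z) 0 = hess f 0 - hess g 0.
  by apply/matrixP => i j; rewrite !mxE partial2_sub_jet2.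
by rewrite scalerBr; exact: quadB.
Qed.

(** Three integrations along segments from the origin, each costing a factor [n] for passing from
    partial derivatives to increments. *)
Lemma Taylor3 f r M y : Ck 3 f -> 0 <= M ->
  (forall z i j k, enorm z <= r -> `|partial k (partial j (partial i f)) z| <= M) ->
  enorm y <= r -> `|f y - jet2 f y| <= n%:R ^+ 3 * M * enorm y ^+ 3.
Proof.
move=> hf M0 fM yr.
have segm t z : 0 <= t <= 1 -> enorm (0 + t *: z) <= enorm z.
  by case/andP=> t0 t1; rewrite add0r enormZ ger0_norm// ler_piMl// enorm_ge0.
have D2 i j z : enorm z <= r -> `|partial j (partial i f) z - partial j (partial i f) 0| <=
    n%:R * M * enorm z.
  move=> zr; rewrite -{1}[z]add0r; apply: incr_bound => [|t l t01].
    exact: (Ck_partial j (Ck_partial i hf)).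
  by apply: fM; apply: le_trans (segm _ _ t01) zr.
have [g gE] : exists g, g = (fun z => f z - jet2 f z) by eexists.
have hg : Ck 3 g by rewrite gE; exact: (CkB hf (Ck_jet2 3 f)).
have g0 : g 0 = 0 by rewrite gE jet2_0 subrr.
have g10 i : partial i g 0 = 0.
  by rewrite gE (partial_sub_jet2 f i (CkW (CkW hf))) subrr.
have g2 i j z : partial j (partial i g) z = partial j (partial i f) z - partial j (partial i f) 0.
  by rewrite gE (partial2_sub_jet2 i j z (CkW hf) (CkW hf)).
have B1 i z : enorm z <= enorm y -> `|partial i g z| <= n%:R * (n%:R * M * enorm y) * enorm y.
  move=> zy; rewrite -[partial i g z]subr0 -{1}(g10 i) -{1}[z]add0r.
  apply: (le_trans (incr_bound (a := n%:R * M * enorm y) (CkW (Ck_partial i hg)) _)).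
    move=> t j t01; rewrite g2; have tz := segm t z t01.
    apply: (le_trans (D2 _ _ _ _)); first by rewrite (le_trans tz)// (le_trans zy).
    by rewrite ler_wpM2l ?mulr_ge0// (le_trans tz).
  by rewrite ler_wpM2l// !mulr_ge0// enorm_ge0.
have -> : f y - jet2 f y = g (0 + y) - g 0 by rewrite g0 gE add0r subr0.
apply: (le_trans (incr_bound (a := n%:R * (n%:R * M * enorm y) * enorm y) _ _)).
- exact: (CkW (CkW hg)).
- by move=> t i t01; apply: B1; exact: segm.
- by rewrite le_eqVlt; apply/orP; left; apply/eqP; ring.
Qed.

Lemma harmonic_gradient r M h y i : 0 < r -> harmonic_fun h ->
  (forall z, enorm z <= r -> `|h z| <= M) -> enorm y <= r / 2 ->
  `|partial i h y| <= 2 * n%:R * M / r.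
Proof.
move=> r0 [sh lh] hM yr.
have -> : 2 * n%:R * M / r = n%:R * M / (r / 2) + r / 2 * 0.
  by rewrite mulr0 addr0; field; rewrite gt_eqF.
apply: gradient_estimate => // [|z zy|z _]; first by rewrite divr_gt0.
  by apply: hM; have := enormD (z - y) y; rewrite subrK; lra.
by rewrite lh normr0.
Qed.

(** Derivatives of harmonic functions are harmonic, so the gradient estimate iterates, halving the
    ball each time. *)
Lemma harmonic_gradient2 r M h y i j : 0 < r -> harmonic_fun h ->
  (forall z, enorm z <= r -> `|h z| <= M) -> enorm y <= r / 4 ->
  `|partial j (partial i h) y| <= 8 * n%:R ^+ 2 * M / r ^+ 2.
Proof.
move=> r0 hh hM yr.
have -> : 8 * n%:R ^+ 2 * M / r ^+ 2 = 2 * n%:R * (2 * n%:R * M / r) / (r / 2).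
  by field; rewrite gt_eqF.
apply: harmonic_gradient; [by rewrite divr_gt0|exact: harmonic_partial| |lra].
by move=> z; exact: harmonic_gradient.
Qed.

Lemma harmonic_gradient3 r M h y i j k : 0 < r -> harmonic_fun h ->
  (forall z, enorm z <= r -> `|h z| <= M) -> enorm y <= r / 8 ->
  `|partial k (partial j (partial i h)) y| <= 64 * n%:R ^+ 3 * M / r ^+ 3.
Proof.
move=> r0 hh hM yr.
have -> : 64 * n%:R ^+ 3 * M / r ^+ 3 = 2 * n%:R * (8 * n%:R ^+ 2 * M / r ^+ 2) / (r / 4).
  by field; rewrite gt_eqF.
apply: harmonic_gradient; [by rewrite divr_gt0| | |lra].
  by apply: harmonic_partial; exact: harmonic_partial.
by move=> z; exact: harmonic_gradient2.
Qed.

(** Scale-invariant cubic remainder; a rate faster than 5/2 is what makes the Campanato iteration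
    contract. *)
Lemma harmonic_Taylor r M h y : 0 < r -> harmonic_fun h ->
  (forall z, enorm z <= r -> `|h z| <= M) -> enorm y <= r / 8 ->
  `|h y - jet2 h y| <= 64 * n%:R ^+ 6 * M * (enorm y / r) ^+ 3.
Proof.
move=> r0 hh hM yr.
have M0 : 0 <= M by apply: le_trans (hM 0 _); rewrite ?normr_ge0// enorm0 ltW.
have -> : 64 * n%:R ^+ 6 * M * (enorm y / r) ^+ 3 =
    n%:R ^+ 3 * (64 * n%:R ^+ 3 * M / r ^+ 3) * enorm y ^+ 3.
  by field; rewrite gt_eqF.
apply: (@Taylor3 h (r / 8)) => //; first exact: hh.1.
  by rewrite divr_ge0 ?exprn_ge0 ?(ltW r0)// !mulr_ge0// exprn_ge0.
by move=> z i j k; exact: harmonic_gradient3.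
Qed.

End HarmonicJets.

(** * Campanato iteration: from harmonic approximations to expansions *)

Section JetsOfApproximations.
Variables (R : realType) (n : nat).
Local Notation V := 'rV[R]_n.
Implicit Types (x y z p : V) (f g h u w : V -> R) (i j k : 'I_n) (m : nat).
Implicit Types (A : 'M[R]_n) (q t K M B C D : R).

Lemma geometric_limit q B (a : nat -> R) : 0 <= q -> q <= 2^-1 -> 0 <= B ->
  (forall m, `|a m.+1 - a m| <= B * q ^+ m) ->
  exists l, forall m, `|l - a m| <= 2 * B * q ^+ m.
Proof.
move=> q0 q2 B0 ha.
have step m : 2 * (B * q ^+ m.+1) <= B * q ^+ m.
  have : 0 <= B * q ^+ m by rewrite mulr_ge0// exprn_ge0.
  rewrite exprS; move: (q ^+ m) => s; nra.
have up m d : a (m + d)%N + 2 * (B * q ^+ (m + d)) <= a m + 2 * (B * q ^+ m).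
  elim: d => [|d IH]; first by rewrite addn0.
  apply: le_trans IH; rewrite addnS.
  have := ha (m + d)%N; have := step (m + d)%N; rewrite ler_norml => s /andP[_].
  by move: (a _) (a _) (q ^+ _) (q ^+ _) s => *; lra.
have lo m d : a m - 2 * (B * q ^+ m) <= a (m + d)%N - 2 * (B * q ^+ (m + d)).
  elim: d => [|d IH]; first by rewrite addn0.
  apply: (le_trans IH); rewrite addnS.
  have := ha (m + d)%N; have := step (m + d)%N; rewrite ler_norml => s /andP[+ _].
  by move: (a _) (a _) (q ^+ _) (q ^+ _) s => *; lra.
have lu m m' : a m - 2 * (B * q ^+ m) <= a m' + 2 * (B * q ^+ m').
  apply: (le_trans (lo m m')); apply: le_trans (up m' m); rewrite addnC.
  by rewrite lerD2l -subr_ge0 opprK addr_ge0// !mulr_ge0// exprn_ge0.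
have [E EE] : exists E : set R, E = range (fun m => a m - 2 * (B * q ^+ m)) by eexists.
have hE : has_sup E.
  split; first by exists (a 0%N - 2 * (B * q ^+ 0)); rewrite EE; exists 0%N.
  by exists (a 0%N + 2 * (B * q ^+ 0)); rewrite EE => _ [m _ <-].
exists (sup E) => m; rewrite ler_distl -mulrA; apply/andP; split.
  by apply: sup_upper_bound => //; rewrite EE; exists m.
by apply: ge_sup; [exact: hE.1|rewrite EE => _ [m' _ <-]].
Qed.

Lemma scale_index q t t0 : 0 < q -> q <= 2^-1 -> 0 < t -> t <= t0 ->
  exists m, t0 * q ^+ m.+1 < t /\ t <= t0 * q ^+ m.
Proof.
move=> q0 q2 tp tt0; have t00 : 0 < t0 by exact: lt_le_trans tt0.
have ex : exists m, t0 * q ^+ m.+1 < t.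
  have [m hm] : exists m, t0 / t < 2 ^+ m.
    by exists (Num.bound (t0 / t)); exact: upper_nthrootP.
  exists m; have qm : q ^+ m.+1 <= (2 ^+ m.+1)^-1.
    by rewrite -exprVn lerXn2r ?nnegrE ?invr_ge0 ?(ltW q0).
  apply: (le_lt_trans (ler_wpM2l (ltW t00) qm)).
  rewrite ltr_pdivrMr ?exprn_gt0// mulrC -ltr_pdivrMr//.
  by apply: (lt_le_trans hm); rewrite exprS ler_peMl ?exprn_ge0//; lra.
case: (ex_minnP ex) => m hm hmin; exists m; split=> //.
case: m hm hmin => [|m] hm hmin; first by rewrite expr0 mulr1.
by rewrite leNgt; apply/negP => /hmin; rewrite ltnn.
Qed.

(** A second order expansion with error [|y|^(5/2)]; measuring [|y|] by [t^2] keeps the powers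
    integral. A single [K] bounds coefficients and error, so uniformity over points is easy to
    state. *)
Definition jet K t0 f x := exists p A, [/\ enorm p <= K, forall i j, `|A i j| <= K &
  forall t y, 0 <= t <= t0 -> enorm y <= t ^+ 2 ->
    `|f (x + y) - quad (f x) p A y| <= K * t ^+ 5].

Lemma mxbound_le A B : (forall i j, `|A i j| <= B) -> mxbound A <= n%:R ^+ 2 * B.
Proof.
move=> AB; have -> : n%:R ^+ 2 * B = \sum_(i < n) \sum_(j < n) B.
  by under eq_bigr do rewrite sumr_const card_ord -mulr_natl; rewrite sumr_const card_ord -[RHS]mulr_natl; ring.
by apply: ler_sum => i _; apply: ler_sum => j _.
Qed.

Lemma jet2_zero y : jet2 (fun _ : V => 0) y = 0.
Proof.
have g0 : grad (fun _ : V => 0 : R) 0 = 0 by apply/rowP => i; rewrite !mxE partial_cst.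
have h0 : hess (fun _ : V => 0 : R) 0 = 0 by apply/matrixP => i j; rewrite !mxE !partial_cst.
by rewrite /jet2 g0 h0 /quad scaler0 qf_mx0 dot0l !addr0.
Qed.

(** The 2-jet of a harmonic function is harmonic, its Laplacian being a constant that vanishes. *)
Lemma harmonic_sub_jet2 f g : harmonic_fun f -> harmonic_fun g ->
  harmonic_fun (fun z => f z - jet2 g z).
Proof.
move=> [sf lf] [sg lg]; split=> [k|y]; first exact: (CkB (sf k) (Ck_jet2 k g)).
rewrite (lapB y (sf 2%N) (Ck_jet2 2 g)) lf lap_quad mxtraceZ mulrA mulfV// mul1r.
have -> : \tr (hess g 0) = lap g 0 by apply: eq_bigr => i _; rewrite mxE.
by rewrite lg subrr.
Qed.

Fact approx_const_ge0 K M t0 q : 0 <= K -> 0 <= M -> 0 < t0 -> 0 < q -> q <= 1 ->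
  exists2 K1, 0 <= K1 & M <= K1 * t0 ^+ 5 /\ 4 * K <= K1 * q ^+ 5.
Proof.
move=> K0 M0 t00 q0 q1; have t5 := exprn_gt0 5 t00; have q5 := exprn_gt0 5 q0.
have b1 : 0 <= M / t0 ^+ 5 := divr_ge0 M0 (ltW t5).
have b2 : 0 <= 4 * K / q ^+ 5 by apply: divr_ge0 (ltW q5); exact: mulr_ge0.
exists (M / t0 ^+ 5 + 4 * K / q ^+ 5); first exact: addr_ge0.
have a1 : M / t0 ^+ 5 * t0 ^+ 5 = M by rewrite divfK// gt_eqF.
have a2 : 4 * K / q ^+ 5 * q ^+ 5 = 4 * K by rewrite divfK// gt_eqF.
by rewrite 2!(mulrDl (M / t0 ^+ 5)) a1 a2 lerDl lerDr; split; apply: mulr_ge0 => //; exact: ltW.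
Qed.

(** The Taylor remainder gains [(q^2)^3 = q^6] where [q^5] is required; the spare factor [q] absorbs
    [C]. *)
Fact approx_step K K1 C q T : 0 <= K -> 0 <= K1 -> 0 <= C -> 0 < q -> q <= 1 -> 0 <= T ->
  C * q <= 2^-1 -> 4 * K <= K1 * q ^+ 5 ->
  K * T ^+ 5 + C * ((K + K1) * T ^+ 5) * (q ^+ 2) ^+ 3 <= K1 * (T * q) ^+ 5.
Proof.
move=> K0 K10 C0 q0 q1 T0 Cq KK1.
have T5 : 0 <= T ^+ 5 by exact: exprn_ge0.
have q5 : 0 <= q ^+ 5 by rewrite exprn_ge0// ltW.
have q51 : q ^+ 5 <= 1 by rewrite exprn_ile1// ltW.
rewrite [(T * q) ^+ 5]exprMn (_ : (q ^+ 2) ^+ 3 = q * q ^+ 5); last by ring.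
rewrite (_ : K * _ + _ = (K + (C * q) * ((K + K1) * q ^+ 5)) * T ^+ 5); last by ring.
rewrite [leRHS](_ : _ = K1 * q ^+ 5 * T ^+ 5); last by ring.
apply: ler_wpM2r => //.
have : 0 <= (K + K1) * q ^+ 5 by rewrite mulr_ge0// addr_ge0.
move: KK1 q5 q51; move: (q ^+ 5) (C * q) Cq => s c c2 h s0 s1 h2; nra.
Qed.

(** Along the scales [t0 q^m], the 2-jet of the approximant of one scale is subtracted from that of
    the next; the difference is harmonic and small, so its own 2-jet corrects the expansion. The
    coefficients change by geometrically decreasing amounts, and their limits form the jet. *)
Lemma jets_of_approx K M t0 : (0 < n)%N -> 0 <= K -> 0 <= M -> 0 < t0 ->
  exists K', forall w, (forall y, enorm y <= t0 ^+ 2 -> `|w y| <= M) ->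
  (forall t, 0 < t -> t <= t0 -> exists2 h, harmonic_fun h &
    forall y, enorm y <= t ^+ 2 -> `|w y - h y| <= K * t ^+ 5) -> jet K' t0 w 0.
Proof.
move=> n0 K0 M0 t00.
have n1 : 1 <= n%:R :> R by rewrite ler1n.
have [C CE] : exists C, C = 64 * n%:R ^+ 6 :> R by eexists.
have C64 : 64 <= C by rewrite CE ler_peMr// exprn_ege1.
have [q [q0 q8 Cq]] : exists q, [/\ 0 < q, q <= 8^-1 & C * q <= 2^-1].
  exists (2 * C)^-1; have C0 : 0 < 2 * C by lra.
  split; first by rewrite invr_gt0.
    by rewrite lef_pV2 ?posrE//; lra.
  by rewrite ler_pdivrMr//; lra.
have q1 : q <= 1 by lra.
have q2 : q <= 2^-1 by lra.
have [K1 K10 [MK1 KK1]] := approx_const_ge0 K0 M0 t00 q0 q1.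
have [D DE] : exists D, D = 8 * n%:R ^+ 2 * (K + K1) by eexists.
have D0 : 0 <= D by rewrite DE !mulr_ge0 ?addr_ge0// exprn_ge0.
have [S [S0 SE]] : exists S, 0 <= S /\ S = 2 * K1 + 2 * n%:R * D + 2 * n%:R ^+ 2 * D.
  eexists; split; last by []; apply: addr_ge0; last by apply: mulr_ge0 => //; exact: mulr_ge0 (sqr_ge0 _).
  by apply: addr_ge0; [exact: mulr_ge0|apply: mulr_ge0 => //; exact: mulr_ge0].
have [K2 K2E] : exists K2, K2 = S / q ^+ 5 by eexists.
have K20 : 0 <= K2 by rewrite K2E divr_ge0// exprn_ge0// ltW.
exists (K2 + n%:R * (2 * D * t0 ^+ 3) + 2 * D * t0) => w wM wh.
have T0 m : 0 < t0 * q ^+ m by rewrite mulr_gt0// exprn_gt0.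
have Tt m : t0 * q ^+ m <= t0 by rewrite ler_piMr ?(ltW t00)// exprn_ile1 ?(ltW q0).
have /choice[h hh] : forall m, exists h, harmonic_fun h /\
    forall y, enorm y <= (t0 * q ^+ m) ^+ 2 -> `|w y - h y| <= K * (t0 * q ^+ m) ^+ 5.
  by move=> m; have [h ? ?] := wh _ (T0 m) (Tt m); exists h.
(* The iteration starts from the zero function, whose error at the first scale is controlled by
   [M]. *)
have [g [g0 gS]] : exists g : nat -> V -> R, g 0%N = (fun=> 0) /\ forall m, g m.+1 = h m.
  by exists (fun m => if m is m'.+1 then h m' else (fun=> 0)).
have hg m : harmonic_fun (g m).
  case: m => [|m]; last by rewrite gS; exact: (hh m).1.
  by rewrite g0; split=> [k|y]; [exact: Ck_cst|exact: lap_cst].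
have jg0 y : jet2 (g 0%N) y = 0 by rewrite g0 jet2_zero.
have sg m := (hg m).1 2%N; have sh m := (hh m).1.1 2%N.
have Hb m : (forall y, enorm y <= (t0 * q ^+ m) ^+ 2 ->
      `|w y - jet2 (g m) y| <= K1 * (t0 * q ^+ m) ^+ 5) ->
    forall y, enorm y <= (t0 * q ^+ m) ^+ 2 ->
      `|h m y - jet2 (g m) y| <= (K + K1) * (t0 * q ^+ m) ^+ 5.
  move=> wg y yT; have := wg _ yT; have := (hh m).2 _ yT.
  rewrite -normrN opprB => w1 w2; have := lerD w1 w2; rewrite -mulrDl.
  by apply: le_trans; apply: le_trans (ler_normD _ _); rewrite addrA subrK.
have claim m y : enorm y <= (t0 * q ^+ m) ^+ 2 ->
    `|w y - jet2 (g m) y| <= K1 * (t0 * q ^+ m) ^+ 5.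
  elim: m y => [|m IH] y yT.
    by rewrite jg0 subr0 expr0 mulr1 (le_trans _ MK1)// wM// -[t0]mulr1.
  have [T TE] : exists T, T = t0 * q ^+ m by eexists.
  have HM := Hb m IH; rewrite -TE in IH HM.
  have TS : t0 * q ^+ m.+1 = T * q by rewrite exprSr TE mulrA.
  have Tp : 0 < T by rewrite TE.
  have T2 : 0 < T ^+ 2 by rewrite exprn_gt0.
  rewrite TS exprMn in yT; rewrite TS gS.
  have q28 : q ^+ 2 <= 8^-1 by rewrite expr2; nra.
  have yT8 : enorm y <= T ^+ 2 / 8 by rewrite (le_trans yT)// ler_wpM2l// ltW.
  have yT1 : enorm y <= T ^+ 2.
    by rewrite (le_trans yT8)// ler_pdivrMr// ler_peMr ?(ltW T2)//; lra.
  have := harmonic_Taylor T2 (harmonic_sub_jet2 (hh m).1 (hg m)) HM yT8.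
  have AB (a b c : R) : a - c - (b - c) = a - b by ring.
  rewrite (jet2_sub y (sh m) (sg m)) AB => HT.
  have := (hh m).2 y; rewrite -TE => /(_ yT1) wh1.
  have -> : w y - jet2 (h m) y = (w y - h m y) + (h m y - jet2 (h m) y) by rewrite addrA subrK.
  apply: (le_trans (ler_normD _ _)).
  apply: le_trans (approx_step K0 K10 (le_trans _ C64) q0 q1 (ltW Tp) Cq KK1); last by [].
  apply: lerD => //.
  rewrite -CE in HT; apply: (le_trans HT); apply: ler_wpM2l.
    apply: mulr_ge0; first by move: C64; clear; lra.
    by apply: mulr_ge0 (exprn_ge0 _ (ltW Tp)); exact: addr_ge0.
  have y0 : 0 <= enorm y / T ^+ 2 := divr_ge0 (enorm_ge0 y) (ltW T2).
  by rewrite lerXn2r ?nnegrE ?y0 ?sqr_ge0// ler_pdivrMr// mulrC.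
have dp m i : `|partial i (g m.+1) 0 - partial i (g m) 0| <= D * t0 ^+ 3 * (q ^+ 3) ^+ m.
  rewrite gS -(partial_sub_jet2 (g m) i (CkW (sh m))).
  have T2 : 0 < (t0 * q ^+ m) ^+ 2 by rewrite exprn_gt0.
  have := @harmonic_gradient _ _ _ _ _ 0 i T2 (harmonic_sub_jet2 (hh m).1 (hg m)) (Hb m (claim m)).
  rewrite enorm0 => /(_ (divr_ge0 (ltW T2) (ler0n _ _))) /le_trans; apply.
  have -> : D * t0 ^+ 3 * (q ^+ 3) ^+ m = D * (t0 * q ^+ m) ^+ 3.
    by rewrite [(t0 * _) ^+ 3]exprMn [(q ^+ m) ^+ 3]exprAC [RHS]mulrA.
  move: (T0 m) => {T2}; move: (t0 * q ^+ m) => T Tp.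
  rewrite (_ : _ / _ = 2 * n%:R * (K + K1) * T ^+ 3); last by field; rewrite gt_eqF.
  rewrite ler_wpM2r ?exprn_ge0 ?(ltW Tp)// DE ler_wpM2r ?addr_ge0//.
  by rewrite expr2; nra.
have dA m i j : `|partial j (partial i (g m.+1)) 0 - partial j (partial i (g m)) 0| <=
    D * t0 * q ^+ m.
  rewrite gS -(partial2_sub_jet2 i j 0 (sh m) (sg m)).
  have T2 : 0 < (t0 * q ^+ m) ^+ 2 by rewrite exprn_gt0.
  have := @harmonic_gradient2 _ _ _ _ _ 0 i j T2 (harmonic_sub_jet2 (hh m).1 (hg m)) (Hb m (claim m)).
  rewrite enorm0 => /(_ (divr_ge0 (ltW T2) (ler0n _ _))) /le_trans; apply.
  have -> : D * t0 * q ^+ m = D * (t0 * q ^+ m) by rewrite [RHS]mulrA.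
  move: (T0 m) => {T2}; move: (t0 * q ^+ m) => T Tp.
  by rewrite (_ : _ / _ = D * T)// DE; field; rewrite gt_eqF.
have q30 : 0 <= q ^+ 3 by rewrite exprn_ge0// ltW.
have q31 : q ^+ 3 <= 2^-1.
  by apply: le_trans q2; rewrite exprS ler_piMr ?(ltW q0)// exprn_ile1// ltW.
have /choice[p hp] : forall i, exists l, forall m,
    `|l - partial i (g m) 0| <= 2 * (D * t0 ^+ 3) * (q ^+ 3) ^+ m.
  by move=> i; apply: geometric_limit => //; rewrite mulr_ge0// exprn_ge0// ltW.
have /choice[a ha] : forall ij : 'I_n * 'I_n, exists l, forall m,
    `|l - partial ij.2 (partial ij.1 (g m)) 0| <= 2 * (D * t0) * q ^+ m.
  move=> ij; apply: geometric_limit => //; first exact: ltW.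
  by apply: mulr_ge0 => //; exact: ltW.
have K3 : 0 <= n%:R * (2 * D * t0 ^+ 3) 
  by apply: mulr_ge0 => //; apply: mulr_ge0; [exact: mulr_ge0|rewrite exprn_ge0// ltW].
have K4 : 0 <= 2 * D * t0 by apply: mulr_ge0 (ltW t00); exact: mulr_ge0.
exists (\row_i p i), (\matrix_(i, j) (2^-1 * a (i, j))); split.
- rewrite (@le_trans _ _ (n%:R * (2 * D * t0 ^+ 3)))//; last by move: K20 K3 K4; clear; lra.
  apply: enorm_le_coord => i; rewrite mxE; have := hp i 0%N.
  by rewrite g0 partial_cst subr0 expr0 mulr1 mulrA.
- move=> i j; rewrite mxE normrM ger0_norm ?invr_ge0//.
  have := ha (i, j) 0%N; rewrite g0 !partial_cst subr0 expr0 mulr1.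
  by move: K20 K3 K4; rewrite -!mulrA; move: (D * t0) (n%:R * _) `|a _|; clear; move=> *; lra.
move=> t y /andP[t_ge0 tt0] yt; rewrite add0r.
have [tp|] := ltrP 0 t; last first.
  move=> t_le0; have t0' : t = 0 by apply/le_anti; rewrite t_le0.
  have -> : y = 0.
    by apply: enorm_eq0; apply/le_anti; rewrite enorm_ge0 andbT (le_trans yt)// t0' expr0n.
  by rewrite /quad dot0r qf0 !addr0 subrr normr0 t0' expr0n/= mulr0.
(* Every [t] lies between consecutive scales; the expansion at the larger one is used, at the cost
   of a factor [q^-5]. *)
have [m [tl tu]] := scale_index q0 q2 tp tt0.
have yT : enorm y <= (t0 * q ^+ m) ^+ 2.
  by rewrite (le_trans yt)// lerXn2r ?nnegrE// ltW.
have := claim m y yT; have := claim m 0; rewrite enorm0 jet2_0 => /(_ (exprn_ge0 _ (ltW (T0 m)))).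
have hpm : enorm (grad (g m) 0 - \row_i p i) <= n%:R * (2 * D * (t0 * q ^+ m) ^+ 3).
  apply: enorm_le_coord => i; rewrite !mxE -normrN opprB; apply: (le_trans (hp i m)).
  rewrite [(t0 * _) ^+ 3]exprMn [(q ^+ m) ^+ 3]exprAC.
  by move: (t0 ^+ 3) (q ^+ 3 ^+ m); clear; move=> *; lra.
have ham : mxbound (2^-1 *: hess (g m) 0 - \matrix_(i, j) (2^-1 * a (i, j))) <=
    n%:R ^+ 2 * (D * (t0 * q ^+ m)).
  apply: mxbound_le => i j; rewrite !mxE -mulrBr normrM ger0_norm ?invr_ge0//.
  rewrite -normrN opprB; have := ha (i, j) m => /=; rewrite -!mulrA.
  by move: `|_| (D * _); clear; move=> *; lra.
have [T TE] : exists T, T = t0 * q ^+ m by eexists.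
have TS : t0 * q ^+ m.+1 = T * q by rewrite exprSr TE mulrA.
have := T0 m; rewrite -TE in yT hpm ham *; rewrite TS in tl => Tp w0 wy.
have T5 : T ^+ 5 <= t ^+ 5 / q ^+ 5.
  by rewrite ler_pdivlMr ?exprn_gt0// -exprMn lerXn2r ?nnegrE ?mulr_ge0 ?ltW.
have d1 : `|dot (grad (g m) 0 - \row_i p i) y| <= n%:R * (2 * D * T ^+ 3) * T ^+ 2.
  by apply: (le_trans (ler_norm_dot _ _)); apply: ler_pM; rewrite ?enorm_ge0.
have d2 : `|qf (2^-1 *: hess (g m) 0 - \matrix_(i, j) (2^-1 * a (i, j))) y| <=
    n%:R ^+ 2 * (D * T) * T ^+ 4.
  apply: (le_trans (qf_le _ _)); apply: ler_pM; rewrite ?mxbound_ge0 ?dot_ge0//.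
  by rewrite -enorm_sqr [T ^+ 4](exprM T 2 2) lerXn2r ?nnegrE ?enorm_ge0 ?sqr_ge0.
have E : w y - quad (w 0) (\row_i p i) (\matrix_(i, j) (2^-1 * a (i, j))) y =
    (w y - jet2 (g m) y) - (w 0 - g m 0) +
    dot (grad (g m) 0 - \row_i p i) y +
    qf (2^-1 *: hess (g m) 0 - \matrix_(i, j) (2^-1 * a (i, j))) y.
  rewrite /jet2 /quad qf_mxD qf_mxN dotBl.
  by move: (dot _ _) (dot _ _) (qf _ _) (qf _ _) (w _) (w _) (g _ _); clear; move=> *; ring.
rewrite E (@le_trans _ _ (K2 * t ^+ 5))//; last first.
  by rewrite ler_wpM2r ?exprn_ge0//; move: K3 K4; clear; lra.
apply: le_trans (_ : S * T ^+ 5 <= _); last first.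
  by rewrite K2E -mulrA [_^-1 * _]mulrC; exact: ler_wpM2l.
have {}d2 : `|qf (2^-1 *: hess (g m) 0 - \matrix_(i, j) (2^-1 * a (i, j))) y| <=
    2 * n%:R ^+ 2 * D * T ^+ 5.
  apply: (le_trans d2); rewrite (_ : _ * T ^+ 4 = n%:R ^+ 2 * D * T ^+ 5); last by ring.
  rewrite ler_wpM2r ?exprn_ge0 ?(ltW Tp)// ler_wpM2r// ler_peMl ?exprn_ge0//; lra.
have {}d1 : `|dot (grad (g m) 0 - \row_i p i) y| <= 2 * n%:R * D * T ^+ 5.
  by apply: (le_trans d1); rewrite (_ : _ * T ^+ 2 = 2 * n%:R * D * T ^+ 5)//; ring.
rewrite SE (mulrDl _ (_ * D)) (mulrDl _ (_ * D)).
apply: (le_trans (ler_normD _ _)); apply: lerD d2.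
apply: (le_trans (ler_normD _ _)); apply: lerD d1.
apply: (le_trans (ler_normB _ _)); rewrite (_ : 2 * K1 * T ^+ 5 = K1 * T ^+ 5 + K1 * T ^+ 5).
  exact: lerD.
by ring.
Qed.

End JetsOfApproximations.

(** * Local Hölder classes of exponent 1/2 *)

Section HolderClasses.
Variables (R : realType) (n : nat).
Local Notation V := 'rV[R]_n.
Implicit Types (x y z p : V) (f g : V -> R) (i j : 'I_n) (m : nat) (t K r : R).
Local Notation e_ i := (delta_mx ord0 i : V).

(* Local Hölder continuity with exponent 1/2; writing the distance as [t ^+ 2]
   keeps every power an integer one. *)
Definition hold f := forall x0, exists r K, [/\ 0 < r, 0 <= K &
  forall x y t, enorm (x - x0) <= r -> enorm (y - x0) <= r -> 0 <= t ->
    enorm (x - y) <= t ^+ 2 -> `|f x - f y| <= K * t].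

Fixpoint Hol m f : Prop :=
  if m is m'.+1 then continuous f /\
    forall i, (forall x, derivable f x (e_ i)) /\ Hol m' (partial i f)
  else hold f.

Lemma hold_bounded f x0 : hold f -> exists r K, [/\ 0 < r, 0 <= K &
  (forall x, enorm (x - x0) <= r -> `|f x| <= K) /\
  (forall x y t, enorm (x - x0) <= r -> enorm (y - x0) <= r -> 0 <= t ->
    enorm (x - y) <= t ^+ 2 -> `|f x - f y| <= K * t)].
Proof.
move=> /(_ x0)[r [K [r0 K0 h]]]; have [r' r'0 [r'r r'1]] : exists2 r', 0 < r' & r' <= r /\ r' <= 1.
  by exists (Num.min r 1); [rewrite lt_min r0 ltr01|rewrite !ge_min !lexx orbT].
exists r', (K + `|f x0|); split=> //; first exact: addr_ge0.
split=> [x xr|x y t xr yr t0 xy]; last first.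
  apply: (le_trans (h x y t (le_trans xr r'r) (le_trans yr r'r) t0 xy)).
  by rewrite ler_wpM2r// lerDl.
have := h x x0 1 (le_trans xr r'r); rewrite subrr enorm0 mulr1 expr1n.
move=> /(_ (ltW r0) ler01 (le_trans xr r'1)) H.
by have := ler_normD (f x - f x0) (f x0); rewrite subrK => /le_trans; apply; rewrite lerD2r.
Qed.

(** Separations above [t1] are covered by the bound on [|f|], so the modulus has to be checked for
    small ones only. *)
Lemma hold_small f : (forall x0, exists r K t1, [/\ 0 < r, 0 < t1,
  forall x, enorm (x - x0) <= r -> `|f x| <= K &
  forall x y t, enorm (x - x0) <= r -> enorm (y - x0) <= r -> 0 <= t -> t <= t1 ->
    enorm (x - y) <= t ^+ 2 -> `|f x - f y| <= K * t]) -> hold f.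
Proof.
move=> h x0; have [r [K [t1 [r0 t10 fK fh]]]] := h x0.
have K0 : 0 <= K by apply: le_trans (fK x0 _); rewrite ?subrr ?enorm0// ltW.
have d0 : 0 <= 2 * K / t1 by rewrite divr_ge0 ?mulr_ge0// ltW.
exists r, (K + 2 * K / t1); split=> //; first exact: addr_ge0.
move=> x y t xr yr t0 xy; have [tt1|tt1] := lerP t t1.
  by apply: (le_trans (fh x y t xr yr t0 tt1 xy)); rewrite ler_wpM2r// lerDl.
apply: (le_trans (ler_normB _ _)); apply: (le_trans (lerD (fK _ xr) (fK _ yr))).
rewrite mulrDl (le_trans (y := 2 * K / t1 * t))//; last by rewrite lerDr mulr_ge0.
have -> : K + K = 2 * K / t1 * t1 by rewrite divfK ?gt_eqF//; lra.
by rewrite ler_wpM2l// ltW.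
Qed.

Lemma hold_cont f : hold f -> continuous f.
Proof.
move=> h x; apply/continuous_enormP => e e0; have [r [K [r0 K0 hx]]] := h x.
have K1 : 0 < K + 1 by rewrite ltr_wpDl.
have [t [t0 [tr tK]]] : exists t, 0 < t /\ t ^+ 2 <= r /\ K * t < e.
  exists (Num.min (Num.min r 1) (e / (K + 1))).
  have t0 : 0 < Num.min (Num.min r 1) (e / (K + 1)) by rewrite !lt_min r0 ltr01 divr_gt0.
  have : Num.min (Num.min r 1) (e / (K + 1)) <= r by rewrite !ge_min lexx.
  have : Num.min (Num.min r 1) (e / (K + 1)) <= 1 by rewrite !ge_min lexx orbT.
  have : Num.min (Num.min r 1) (e / (K + 1)) <= e / (K + 1) by rewrite !ge_min lexx !orbT.
  rewrite ler_pdivlMr//; move: t0; move: (Num.min _ _) => t t0 te t1 tr.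
  split=> //; split; first by apply: le_trans tr; rewrite expr2 ler_piMr// ltW.
  by move: te; rewrite mulrDr mulr1 mulrC; move: t0; lra.
exists (t ^+ 2); first by rewrite exprn_gt0.
move=> y yx; apply: le_lt_trans tK; apply: hx (ltW t0) _ => //.
- by rewrite (le_trans _ tr)// ltW.
- by rewrite subrr enorm0 ltW.
- exact: ltW.
Qed.

Lemma Hol_Ck m f : Hol m f -> Ck m f.
Proof.
elim: m f => [|m IH] f; first exact: hold_cont.
by move=> [cf hf]; split=> // i; have [df /IH hi] := hf i; split.
Qed.

Lemma HolP m f (df : 'I_n -> V -> R) : continuous f ->
  (forall i x, is_derive x (e_ i) f (df i x)) -> (forall i, Hol m (df i)) -> Hol m.+1 f.
Proof.
move=> cf h hk; split => // i; split; first by move=> x; have [] := h i x.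
by rewrite (partial_eq (h i)).
Qed.

Lemma Hol_partial m f i : Hol m.+1 f -> Hol m (partial i f).
Proof. by case=> _ /(_ i)[]. Qed.

Lemma ord_bound k (P : 'I_k -> R -> Prop) : (forall l a b, a <= b -> P l a -> P l b) ->
  (forall l, exists a, P l a) -> exists2 a, 0 <= a & forall l, P l a.
Proof.
move=> mono /choice[a ha]; exists (\sum_(l < k) `|a l|); first exact: sumr_ge0.
move=> l; apply: mono (ha l); rewrite (bigD1 l)//=.
by apply: (le_trans (ler_norm _)); rewrite lerDl sumr_ge0.
Qed.

Lemma ord_radius k (P : 'I_k -> R -> Prop) : (forall l a b, a <= b -> P l b -> P l a) ->
  (forall l, exists2 a, 0 < a & P l a) -> exists2 a, 0 < a & forall l, P l a.
Proof.
move=> mono h.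
have [|l|a a0 ha] := @ord_bound k (fun l b => forall c, 0 < c -> c * b <= 1 -> P l c).
- by move=> l a b ab H c c0 cb; apply: H => //; apply: le_trans cb; rewrite ler_pM2l.
- have [a a0 Pa] := h l; exists a^-1 => c c0 ca; apply: mono Pa.
  by rewrite -[a]mul1r -ler_pdivrMr.
- exists (a + 1)^-1; first by rewrite invr_gt0 ltr_wpDl.
  move=> l; apply: ha; first by rewrite invr_gt0 ltr_wpDl.
  by rewrite mulrC ler_pdivrMr ?ltr_wpDl// mul1r lerDl ler01.
Qed.

Lemma Ck1_lipschitz f x0 r : Ck 1 f -> 0 <= r -> exists2 K, 0 <= K &
  forall x y, enorm (x - x0) <= r -> enorm (y - x0) <= r -> `|f x - f y| <= K * enorm (x - y).
Proof.
move=> hf r0.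
have [i a b ab h x xr|i|K K0 HK] := @ord_bound n (fun i K => forall x,
    enorm (x - x0) <= r -> `|partial i f x| <= K).
- exact: le_trans (h x xr) ab.
- have ci : continuous (partial i f) := Ck_partial i hf.
  have [y1 _ h1] := ball_max x0 r0 ci.
  have [y2 _ h2] := ball_max x0 r0 (@CkN _ _ 0 _ ci).
  exists (Num.max (partial i f y1) (- partial i f y2)) => x xr.
  rewrite ler_norml lerNl le_max h2//= orbT le_max h1//.
exists (n%:R * K); first exact: mulr_ge0.
move=> x y xr yr; have -> : f x = f (y + (x - y)) by rewrite [y + _]addrC subrK.
apply: incr_bound => // t i /andP[t0 t1]; apply: HK.
have -> : y + t *: (x - y) - x0 = t *: (x - x0) + (1 - t) *: (y - x0).
  by apply/rowP => j; rewrite !mxE; ring.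
apply: (le_trans (enormD _ _)); rewrite !enormZ !ger0_norm ?subr_ge0//.
have -> : r = t * r + (1 - t) * r by ring.
by apply: lerD; apply: ler_wpM2l => //; rewrite subr_ge0.
Qed.

Lemma Hol1_hold f : Hol 1 f -> hold f.
Proof.
move=> hf; have cf := Hol_Ck hf; apply: hold_small => x0.
have [K K0 HK] := Ck1_lipschitz x0 cf ler01; have r0 : 0 < 1 :> R := ltr01.
have [r rE] : exists r : R, r = 1 by eexists.
rewrite -rE in HK r0; exists r, (`|f x0| + K * (r + 1)), 1; split=> // [x xr|x y t xr yr t0 t1 xy].
  have := HK x x0 xr; rewrite subrr enorm0 => /(_ (ltW r0)) H.
  have := ler_normD (f x - f x0) (f x0); rewrite subrK => /le_trans; apply.
  rewrite addrC lerD2l (le_trans H)// ler_wpM2l// (le_trans xr)// lerDl; exact: ler01.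
apply: (le_trans (HK x y xr yr)); apply: (le_trans (ler_wpM2l K0 xy)).
rewrite expr2 mulrA ler_wpM2r//; apply: (@le_trans _ _ K); first by rewrite ler_piMr.
by have := normr_ge0 (f x0); nra.
Qed.

Lemma HolW m f : Hol m.+1 f -> Hol m f.
Proof.
elim: m f => [|m IH] f; first exact: Hol1_hold.
by move=> [cf h]; split=> // i; have [d hi] := h i; split=> //; exact: IH.
Qed.

Lemma Hol_le m m' f : (m <= m')%N -> Hol m' f -> Hol m f.
Proof.
elim: m' => [|m' IH]; first by rewrite leqn0 => /eqP->.
by rewrite leq_eqVlt => /predU1P[->//|]; rewrite ltnS => mm' /HolW; exact: IH.
Qed.

Lemma hold2 f g x0 : hold f -> hold g -> exists r K, [/\ 0 < r, 0 <= K &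
  forall x y t, enorm (x - x0) <= r -> enorm (y - x0) <= r -> 0 <= t ->
    enorm (x - y) <= t ^+ 2 -> [/\ `|f x| <= K, `|g y| <= K,
      `|f x - f y| <= K * t & `|g x - g y| <= K * t]].
Proof.
move=> hf hg; have [r [K [r0 K0 [fb fh]]]] := hold_bounded x0 hf.
have [r' [K' [r'0 K'0 [gb gh]]]] := hold_bounded x0 hg.
exists (Num.min r r'), (K + K'); split; first by rewrite lt_min r0.
  exact: addr_ge0.
move=> x y t; rewrite !le_min => /andP[x1 x2] /andP[y1 y2] t0 xy; split.
- by apply: (le_trans (fb _ x1)); rewrite lerDl.
- by apply: (le_trans (gb _ y2)); rewrite lerDr.
- by apply: (le_trans (fh x y t x1 y1 t0 xy)); rewrite ler_wpM2r// lerDl.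
- by apply: (le_trans (gh x y t x2 y2 t0 xy)); rewrite ler_wpM2r// lerDr.
Qed.

Lemma Hol_cst m (c : R) : Hol m (fun _ : V => c).
Proof.
elim: m c => [|m IH] c.
  by move=> x0; exists 1, 0; split=> // x y t *; rewrite subrr normr0 mul0r.
have cc : continuous (fun _ : V => c) by exact: cst_continuous.
exact: (HolP cc (fun i x => is_derive_cst c x (e_ i)) (fun i => IH 0)).
Qed.

Lemma HolD m f g : Hol m f -> Hol m g -> Hol m (fun x => f x + g x).
Proof.
elim: m f g => [|m IH] f g hf hg.
  move=> x0; have [r [K [r0 K0 H]]] := hold2 x0 hf hg.
  exists r, (K + K); split=> //; first exact: addr_ge0.
  move=> x y t xr yr t0 xy; have [_ _ h1 h2] := H x y t xr yr t0 xy.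
  rewrite opprD addrACA mulrDl; apply: (le_trans (ler_normD _ _)); exact: lerD.
have cf := Hol_Ck hf; have cg := Hol_Ck hg.
apply: (HolP (df := fun i x => partial i f x + partial i g x)).
- exact: contD (Ck_cont cf) (Ck_cont cg).
- move=> i x; apply: is_deriveDf; [exact: Ck_partial_is_derive cf|exact: Ck_partial_is_derive cg].
- by move=> i; apply: IH; exact: Hol_partial.
Qed.

Lemma HolM m f g : Hol m f -> Hol m g -> Hol m (fun x => f x * g x).
Proof.
elim: m f g => [|m IH] f g hf hg.
  move=> x0; have [r [K [r0 K0 H]]] := hold2 x0 hf hg.
  exists r, (K * K + K * K); split=> //; first by rewrite addr_ge0// mulr_ge0.
  move=> x y t xr yr t0 xy; have [f1 g1 h1 h2] := H x y t xr yr t0 xy.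
  have -> : f x * g x - f y * g y = f x * (g x - g y) + (f x - f y) * g y by ring.
  rewrite (_ : (K * K + K * K) * t = K * (K * t) + (K * t) * K); last by ring.
  apply: (le_trans (ler_normD _ _)); rewrite !normrM.
  by apply: lerD; apply: ler_pM.
have cf := Hol_Ck hf; have cg := Hol_Ck hg.
apply: (HolP (df := fun i x => partial i f x * g x + f x * partial i g x)).
- exact: contM (Ck_cont cf) (Ck_cont cg).
- move=> i x; apply: is_deriveMf; [exact: Ck_partial_is_derive cf|exact: Ck_partial_is_derive cg].
- move=> i; apply: HolD; apply: IH; try exact: HolW; exact: Hol_partial.
Qed.

Lemma HolZ m f (c : R) : Hol m f -> Hol m (fun x => c * f x).
Proof. by move=> hf; apply: HolM => //; exact: Hol_cst. Qed.

Lemma HolN m f : Hol m f -> Hol m (fun x => - f x).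
Proof. by move=> /(HolZ (-1)); under eq_fun do rewrite mulN1r. Qed.

Lemma HolB m f g : Hol m f -> Hol m g -> Hol m (fun x => f x - g x).
Proof. by move=> hf hg; apply: HolD => //; exact: HolN. Qed.

Lemma Hol_sum m k (f : 'I_k -> V -> R) : (forall l, Hol m (f l)) ->
  Hol m (fun x => \sum_(l < k) f l x).
Proof.
elim: k f => [|k IH] f h; first by under eq_fun do rewrite big_ord0; exact: Hol_cst.
by under eq_fun do rewrite big_ord_recr /=; apply: HolD => //; exact: IH.
Qed.

Lemma hold_comp f (F : R -> R) : (forall x, 1 <= f x) ->
  (forall a b, 1 <= a -> 1 <= b -> `|F a - F b| <= `|a - b|) -> hold f ->
  hold (fun x => F (f x)).
Proof.
move=> f1 hF hf x0; have [r [K [r0 K0 H]]] := hf x0; exists r, K; split=> // x y t xr yr t0 xy.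
exact: le_trans (hF _ _ (f1 x) (f1 y)) (H x y t xr yr t0 xy).
Qed.

Lemma Hol_inv m f : (forall x, 1 <= f x) -> Hol m f -> Hol m (fun x => (f x)^-1).
Proof.
move=> f1; have f0 x : 0 < f x by exact: lt_le_trans (f1 x).
have fn0 x : f x != 0 by rewrite gt_eqF.
elim: m => [|m IH] hf.
  apply: hold_comp hf => // a b a1 b1.
  have a0 : 0 < a by exact: lt_le_trans a1.
  have b0 : 0 < b by exact: lt_le_trans b1.
  have -> : a^-1 - b^-1 = (b - a) / (a * b) by field; rewrite !gt_eqF.
  have ab : 1 <= a * b by rewrite -[1]mulr1 ler_pM.
  rewrite normrM distrC normfV (ger0_norm (ltW (mulr_gt0 a0 b0))).
  by rewrite ler_pdivrMr ?mulr_gt0// ler_peMr.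
have cf := Hol_Ck hf.
apply: (HolP (df := fun i x => - (partial i f x * (f x)^-1 ^+ 2))).
- exact: (@Ck_inv _ _ 0 f f0 (Ck_cont cf)).
- by move=> i x; apply: is_derive_invf => //; exact: Ck_partial_is_derive cf.
- have hi := IH (HolW hf).
  move=> i; apply: HolN; apply: HolM; first exact: Hol_partial.
  by under eq_fun do rewrite expr2; exact: HolM.
Qed.

Lemma Hol_sqrt m f : (forall x, 1 <= f x) -> Hol m f -> Hol m (fun x => Num.sqrt (f x)).
Proof.
move=> f1; have f0 x : 0 < f x by exact: lt_le_trans (f1 x).
have s1 x : 1 <= Num.sqrt (f x) by rewrite -sqrtr1 ler_sqrt// ltW.
elim: m => [|m IH] hf.
  apply: hold_comp hf => // a b a1 b1.
  have a0 : 0 < a by exact: lt_le_trans a1.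
  have b0 : 0 < b by exact: lt_le_trans b1.
  rewrite -{2}(sqr_sqrtr (ltW a0)) -{2}(sqr_sqrtr (ltW b0)) subr_sqr normrM.
  have sa : 1 <= Num.sqrt a by rewrite -sqrtr1 ler_sqrt// ltW.
  rewrite ler_peMr// ger0_norm ?addr_ge0 ?sqrtr_ge0//.
  by rewrite (le_trans sa)// lerDl sqrtr_ge0.
have cf := Hol_Ck hf.
apply: (HolP (df := fun i x => partial i f x / (2 * Num.sqrt (f x)))).
- exact: (@Ck_sqrt _ _ 0 f f0 (Ck_cont cf)).
- by move=> i x; apply: is_derive_sqrtf => //; exact: Ck_partial_is_derive cf.
- have hi := IH (HolW hf).
  move=> i; apply: HolM; first exact: Hol_partial.
  apply: (@Hol_inv m (fun x => 2 * Num.sqrt (f x))); last exact: HolZ.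
  by move=> x; have := s1 x; lra.
Qed.

(** Over a segment of length [t^2] the gradient oscillates by [O(t)], hence the error [O(t^3)]. *)
Lemma Hol1_Taylor f x0 : Hol 1 f -> exists r K, [/\ 0 < r, 0 <= K &
  forall x h t, enorm (x - x0) <= r -> enorm (x + h - x0) <= r -> 0 <= t ->
    enorm h <= t ^+ 2 ->
    `|f (x + h) - f x - dot (grad f x) h| <= K * t ^+ 3 /\ `|f (x + h) - f x| <= K * t ^+ 2].
Proof.
move=> hf; have cf := Hol_Ck hf.
have [r r0 Hr] : exists2 r, 0 < r & forall i, exists K, 0 <= K /\ forall x y t,
    enorm (x - x0) <= r -> enorm (y - x0) <= r -> 0 <= t ->
    enorm (x - y) <= t ^+ 2 -> `|partial i f x - partial i f y| <= K * t.
  apply: ord_radius => [i a b ab [K [K0 HK]]|i].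
    by exists K; split=> // x y t xa ya; apply: HK; exact: le_trans ab.
  by have [r [K [r0 K0 HK]]] := Hol_partial i hf x0; exists r => //; exists K.
have [i a b ab [a0 h]||K K0 HK] := @ord_bound n (fun i K => 0 <= K /\ forall x y t,
    enorm (x - x0) <= r -> enorm (y - x0) <= r -> 0 <= t ->
    enorm (x - y) <= t ^+ 2 -> `|partial i f x - partial i f y| <= K * t).
- split; first exact: le_trans ab.
  by move=> x y t xr yr t0 xy; apply: le_trans (h x y t xr yr t0 xy) _; rewrite ler_wpM2r.
- exact: Hr.
have [K' K'0 HK'] := Ck1_lipschitz x0 cf (ltW r0).
exists r, (n%:R * K + K'); split=> //.
  by rewrite addr_ge0// mulr_ge0.
move=> x h t x1 y1 t0 ht; split; last first.
  have := HK' (x + h) x y1 x1; rewrite [x + h - x]addrAC subrr add0r => /le_trans; apply.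
  by apply: ler_pM => //; [exact: enorm_ge0|rewrite lerDr mulr_ge0].
have cl : Ck 1 (fun z => f z - dot (grad f x) z) := CkB cf (Ck_dotl 1 _).
have -> : f (x + h) - f x - dot (grad f x) h =
    (f (x + h) - dot (grad f x) (x + h)) - (f x - dot (grad f x) x) by rewrite dotDr; ring.
apply: (le_trans (incr_bound (a := K * t) cl _)).
  move=> s i /andP[s0 s1]; rewrite (partialB i cf (Ck_dotl 1 _)) partial_dotl mxE.
  apply: (HK i).2 => //; last first.
    rewrite [x + _ - x]addrAC subrr add0r enormZ ger0_norm// (le_trans _ ht)//.
    by rewrite ler_piMl// enorm_ge0.
  have -> : x + s *: h - x0 = s *: (x + h - x0) + (1 - s) *: (x - x0).
    by apply/rowP => j; rewrite !mxE; ring.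
  apply: (le_trans (enormD _ _)); rewrite !enormZ !ger0_norm ?subr_ge0//.
  have -> : r = s * r + (1 - s) * r by ring.
  by apply: lerD; apply: ler_wpM2l => //; rewrite subr_ge0.
have -> : n%:R * (K * t) * enorm h = n%:R * K * (t * enorm h) by ring.
rewrite exprS; apply: ler_pM; rewrite ?mulr_ge0 ?enorm_ge0//; first by rewrite lerDl.
by rewrite ler_wpM2l.
Qed.

End HolderClasses.

(** * A converse of Taylor's theorem *)

Section ConverseTaylor.
Variables (R : realType) (n : nat).
Local Notation V := 'rV[R]_n.
Implicit Types (x y z p h : V) (f g : V -> R) (i j : 'I_n) (t K r : R) (A : 'M[R]_n).
Local Notation e_ i := (delta_mx ord0 i : V).

Definition expands K t0 f x p A := forall t y, 0 <= t <= t0 -> enorm y <= t ^+ 2 ->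
  `|f (x + y) - quad (f x) p A y| <= K * t ^+ 5.

Lemma mxbound_entry A (B : R) y : (forall i j, `|A i j| <= B) ->
  `|qf A y| <= n%:R ^+ 2 * B * enorm y ^+ 2.
Proof.
move=> AB; rewrite enorm_sqr; apply: (le_trans (qf_le _ _)).
by rewrite ler_wpM2r ?dot_ge0// mxbound_le.
Qed.

Lemma expands_is_derive K t0 f x p A i : 0 < t0 -> expands K t0 f x p A ->
  is_derive x (e_ i) f (p ord0 i).
Proof.
move=> t00 hf; apply/is_deriveP => e e0.
have [K' K'0 KK] : exists2 K', 0 < K' & `|A i i| + `|K| <= K'.
  by exists (`|A i i| + `|K| + 1); [rewrite ltr_wpDl// addr_ge0|rewrite lerDl ler01].
have [r [r0 rt r1 re]] : exists r, [/\ 0 < r, r <= t0 ^+ 2, r <= 1 & r <= e / K'].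
  exists (Num.min (Num.min (t0 ^+ 2) 1) (e / K')).
  by rewrite !lt_min !ge_min !lexx ltr01 exprn_gt0// divr_gt0// !orbT.
exists r => // s sr; have sp := normr_ge0 s.
have [t [t0' st]] : exists t, 0 <= t /\ t ^+ 2 = `|s|.
  by exists (Num.sqrt `|s|); rewrite sqrtr_ge0 sqr_sqrtr.
have tt0 : t <= t0.
  rewrite -(@ler_pXn2r _ 2)// ?nnegrE ?(ltW t00)//.
  by rewrite st; apply: ltW; exact: lt_le_trans rt.
have t1 : t <= 1.
  rewrite -(@ler_pXn2r _ 2)// ?nnegrE// st expr1n; apply: ltW; exact: lt_le_trans r1.
have := hf t (s *: e_ i); rewrite t0' tt0 enormZ enorm_delta mulr1 st lexx => /(_ isT isT).
rewrite /quad dotZr dot_delta qfZ qf_delta => H.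
have -> : f (x + s *: e_ i) - f x - s * p ord0 i =
    (f (x + s *: e_ i) - (f x + s * p ord0 i + s ^+ 2 * A i i)) + s ^+ 2 * A i i by ring.
apply: (le_trans (ler_normD _ _)); rewrite [X in _ + X]normrM normrX.
have t5 : t ^+ 5 <= `|s| ^+ 2.
  by rewrite -st -exprM exprSr ler_piMr// exprn_ge0.
apply: (@le_trans _ _ ((`|A i i| + `|K|) * `|s| ^+ 2)).
  rewrite mulrDl addrC; apply: lerD; first by rewrite mulrC.
  apply: (le_trans H); apply: (le_trans (ler_wpM2r (exprn_ge0 _ t0') (ler_norm K))).
  exact: ler_wpM2l.
rewrite expr2 mulrA ler_wpM2r//; apply: (le_trans (ler_wpM2r sp KK)).
by rewrite mulrC -ler_pdivlMr// (le_trans (ltW sr)).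
Qed.

(** Expand [f (x + y + z)] from [x] and from [x + y]: the two polynomials in [z] differ by at most
    [(1 + 1 + 32) K t^5] when [|z| <= t^2]. The parts odd and even in [z] are then bounded
    separately, which gives the slopes and the matrices. *)
Lemma expands_pair K t0 f x y p A p' A' t : expands K t0 f x p A ->
  expands K t0 f (x + y) p' A' -> 0 < t -> 2 * t <= t0 -> enorm y <= t ^+ 2 ->
  (forall i, `|p' ord0 i - p ord0 i - dot (row i (A + A^T)) y| <= 34 * K * t ^+ 3) /\
  (forall i j, `|(A + A^T) i j - (A' + A'^T) i j| <= 204 * K * t).
Proof.
move=> hx hy tp tt0 yt; have t0' := ltW tp.
have t2 : 0 < t ^+ 2 := exprn_gt0 2 tp.
have t4 : 0 < t ^+ 4 := exprn_gt0 4 tp.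
pose X z := dot (p - p') z + (bf A y z + bf A z y) + qf (A - A') z.
have XE z : enorm z <= t ^+ 2 -> `|X z| <= 34 * K * t ^+ 5.
  move=> zt; have := hx t y; rewrite t0' (_ : t <= t0) => [/(_ isT yt) E3|]; last by lra.
  have := hy t z; rewrite t0' (_ : t <= t0) => [/(_ isT zt) E2|]; last by lra.
  have := hx (2 * t) (y + z); rewrite tt0 mulr_ge0// => /(_ isT) E1.
  have {}E1 : `|f (x + (y + z)) - quad (f x) p A (y + z)| <= K * (2 * t) ^+ 5.
    apply: E1; apply: (le_trans (enormD _ _)); rewrite exprMn.
    by move: yt zt t2; move: (t ^+ 2) => s; rewrite expr2; lra.
  have -> : X z = (f (x + y + z) - quad (f (x + y)) p' A' z) +
     (f (x + y) - quad (f x) p A y) - (f (x + (y + z)) - quad (f x) p A (y + z)).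
    rewrite /X /quad !dotDr qf_add dotBl qf_mxD qf_mxN [x + (y + z)]addrA.
    move: (f _) (f _) (f _) (dot p _) (dot p _) (dot p' _) (bf _ _ _) (bf _ _ _) (qf _ _) (qf _ _) (qf _ _).
    by clear; move=> *; ring.
  apply: (le_trans (ler_normB _ _)); apply: (le_trans (lerD (ler_normD _ _) (lexx _))).
  move: E1 E2 E3; rewrite exprMn; move: `|_ - _| `|_ - _| `|_ - _| (t ^+ 5).
  by clear; move=> a b c s; rewrite !exprS expr0; lra.
have Xo z : enorm z <= t ^+ 2 -> `|dot (p - p') z + (bf A y z + bf A z y)| <= 34 * K * t ^+ 5.
  move=> zt; have h1 := XE z zt; have := XE (- z); rewrite enormN => /(_ zt).
  have NB : bf A y (- z) + bf A (- z) y = - (bf A y z + bf A z y).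
    by rewrite -(scaleN1r z) bfZl bfZr; move: (bf _ _ _) (bf _ _ _) => a b; ring.
  rewrite /X NB dotNr qfN; move: h1; rewrite /X !ler_norml.
  by move: (dot _ _) (bf _ _ _ + _) (qf _ _) (K * t ^+ 5) => a b c d; lra.
have Xe z : enorm z <= t ^+ 2 -> `|qf (A - A') z| <= 34 * K * t ^+ 5.
  move=> zt; have h1 := XE z zt; have := XE (- z); rewrite enormN => /(_ zt).
  have NB : bf A y (- z) + bf A (- z) y = - (bf A y z + bf A z y).
    by rewrite -(scaleN1r z) bfZl bfZr; move: (bf _ _ _) (bf _ _ _) => a b; ring.
  rewrite /X NB dotNr qfN; move: h1; rewrite /X !ler_norml.
  by move: (dot _ _) (bf _ _ _ + _) (qf _ _) (K * t ^+ 5) => a b c d; lra.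
split=> [i|i j].
  have := Xo (t ^+ 2 *: e_ i); rewrite enormZ enorm_delta mulr1 ger0_norm ?(ltW t2)// => /(_ (lexx _)).
  rewrite bfZl bfZr dotZr dot_delta row_sym.
  have -> : t ^+ 2 * (p - p') ord0 i + (t ^+ 2 * bf A y (e_ i) + t ^+ 2 * bf A (e_ i) y) =
    t ^+ 2 * - (p' ord0 i - p ord0 i - (bf A (e_ i) y + bf A y (e_ i))) by rewrite !mxE; ring.
  rewrite normrM normrN (ger0_norm (ltW t2)) (_ : 34 * K * t ^+ 5 = t ^+ 2 * (34 * K * t ^+ 3)).
    by rewrite ler_pM2l.
  by ring.
have D l : `|(A - A') l l| <= 34 * K * t.
  have := Xe (t ^+ 2 *: e_ l); rewrite enormZ enorm_delta mulr1 ger0_norm ?(ltW t2)// => /(_ (lexx _)).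
  rewrite qfZ qf_delta -exprM normrM (ger0_norm (ltW t4)).
  rewrite (_ : 34 * K * t ^+ 5 = t ^+ (2 * 2) * (34 * K * t)); last by ring.
  by rewrite ler_pM2l.
(* Polarisation: the vector [e_i + e_j] gives the off-diagonal entries, with
   [204 = 136 + 34 + 34]. *)
have := Xe ((t ^+ 2 / 2) *: (e_ i + e_ j)).
have -> : enorm ((t ^+ 2 / 2) *: (e_ i + e_ j)) <= t ^+ 2.
  rewrite enormZ ger0_norm ?divr_ge0 ?(ltW t2)//.
  have := enormD (e_ i) (e_ j); rewrite !enorm_delta => H.
  rewrite [leRHS](_ : _ = t ^+ 2 / 2 * (1 + 1)); last by field.
  by rewrite ler_wpM2l// divr_ge0// ltW.
move=> /(_ isT); rewrite qfZ qf_add !qf_delta exprMn -exprM normrM.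
rewrite ger0_norm ?mulr_ge0 ?sqr_ge0 ?(ltW t4)//.
have -> : 34 * K * t ^+ 5 = t ^+ (2 * 2) * 2^-1 ^+ 2 * (136 * K * t) by field.
rewrite ler_pM2l ?mulr_gt0 ?exprn_gt0//.
have -> : bf (A - A') (e_ i) (e_ j) + bf (A - A') (e_ j) (e_ i) = (A - A') i j + (A - A') j i.
  by rewrite -row_sym dot_delta !mxE.
have := D i; have := D j; rewrite !mxE !ler_norml.
move: (A i i) (A' i i) (A j j) (A' j j) (A i j) (A' i j) (A j i) (A' j i) (K * t) => *; lra.
Qed.

Lemma jet_ge0 K t0 f x : jet K t0 f x -> 0 <= K.
Proof. by move=> [p [A [pK _ _]]]; apply: le_trans pK; exact: enorm_ge0. Qed.

Lemma jet_incr K t0 f x t y : jet K t0 f x -> 0 <= t -> t <= t0 -> t <= 1 ->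
  enorm y <= t ^+ 2 -> `|f (x + y) - f x| <= (2 + n%:R ^+ 2) * K * t.
Proof.
move=> hj; have K0 := jet_ge0 hj; case: hj => p [A [pK AK H]] t0' tt0 t1 yt.
have := H t y; rewrite t0' tt0 => /(_ isT yt) {}H.
have h1 : `|dot p y| <= K * t.
  apply: (le_trans (ler_norm_dot _ _)); apply: ler_pM; rewrite ?enorm_ge0//.
  by rewrite (le_trans yt)// expr2 ler_piMr.
have h2 : `|qf A y| <= n%:R ^+ 2 * K * t.
  apply: (le_trans (mxbound_entry _ AK)); rewrite ler_wpM2l ?mulr_ge0 ?sqr_ge0//.
  have y1 : enorm y <= 1 by rewrite (le_trans yt)// expr_le1.
  apply: (@le_trans _ _ (enorm y)); first by rewrite expr2 ler_piMr ?enorm_ge0.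
  by rewrite (le_trans yt)// expr2 ler_piMr.
have h3 : K * t ^+ 5 <= K * t by rewrite ler_wpM2l// exprS ler_piMr// exprn_ile1.
have -> : f (x + y) - f x = (f (x + y) - quad (f x) p A y) + dot p y + qf A y.
  by rewrite /quad; move: (dot _ _) (qf _ _) => a b; ring.
rewrite (_ : (2 + n%:R ^+ 2) * K * t = K * t + K * t + n%:R ^+ 2 * K * t); last by ring.
apply: (le_trans (ler_normD _ _)); apply: lerD h2.
apply: (le_trans (ler_normD _ _)); apply: lerD h1.
exact: le_trans H h3.
Qed.

Lemma small_time r t0 : 0 < r -> 0 < t0 ->
  exists t1, [/\ 0 < t1, t1 <= 1, 2 * t1 <= t0, t1 <= t0 & t1 ^+ 2 <= r].
Proof.
move=> r0 t00; exists (Num.min (Num.min 1 r) (t0 / 2)).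
have : 0 < Num.min (Num.min 1 r) (t0 / 2) by rewrite !lt_min ltr01 r0 divr_gt0.
have : Num.min (Num.min 1 r) (t0 / 2) <= 1 by rewrite !ge_min lexx.
have : Num.min (Num.min 1 r) (t0 / 2) <= r by rewrite !ge_min lexx orbT.
have : Num.min (Num.min 1 r) (t0 / 2) <= t0 / 2 by rewrite !ge_min lexx !orbT.
move: (Num.min _ _) => t a b c d; split=> //; try lra.
by rewrite expr2; nra.
Qed.

Lemma expands_partial K t0 f x p A i : 0 < t0 -> expands K t0 f x p A -> partial i f x = p ord0 i.
Proof.
by move=> t00 he; have D := expands_is_derive i t00 he; exact: (@derive_val _ _ _ _ _ _ _ D).
Qed.

Lemma jets_is_derive2 f r K t0 x0 x p A i j : 0 < r -> 0 < t0 ->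
  (forall x, enorm (x - x0) <= r -> jet K t0 f x) -> enorm (x - x0) <= r / 2 ->
  expands K t0 f x p A -> is_derive x (e_ j) (partial i f) ((A + A^T) i j).
Proof.
move=> r0 t00 H xr he; apply/is_deriveP => e e0.
have K0 : 0 <= K by apply: (@jet_ge0 K t0 f x0); apply: H; rewrite subrr enorm0 ltW.
have r2 : 0 < r / 2 by rewrite divr_gt0.
have K1 : 0 < 34 * K + 1 by rewrite ltr_wpDl// mulr_ge0.
have [s [s0 s2 st0 sr]] : exists s, [/\ 0 < s, 34 * K * s <= e, 2 * s <= t0 & s ^+ 2 <= r / 2].
  have m0 : 0 < Num.min t0 (e / (34 * K + 1)) by rewrite lt_min t00 divr_gt0.
  have [s [s0 s1 s2 _ sr]] := small_time r2 m0.
  move: s2; rewrite le_min ler_pdivlMr// => /andP[s2 s3]; exists s; split=> //.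
  by move: s3 s0 K0; clear; move=> *; nra.
exists (s ^+ 2); first exact: exprn_gt0.
move=> u us; have [->|u0] := eqVneq u 0.
  by rewrite scale0r addr0 subrr mul0r subr0 normr0 mulr0.
have up : 0 < `|u| by rewrite normr_gt0.
have [t [tp ut]] : exists t, 0 < t /\ t ^+ 2 = `|u|.
  by exists (Num.sqrt `|u|); rewrite sqrtr_gt0 sqr_sqrtr// ltW.
have ts : t <= s.
  by rewrite -(@ler_pXn2r _ 2) ?nnegrE ?(ltW s0) ?(ltW tp)// ut ltW.
have ue : enorm (u *: e_ j) = t ^+ 2 by rewrite enormZ enorm_delta mulr1 ut.
have [|p' [A' [_ _ he']]] := H (x + u *: e_ j).
  rewrite addrAC; apply: (le_trans (enormD _ _)); rewrite ue.
  have : t ^+ 2 <= s ^+ 2 by rewrite ut ltW.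
  by move: xr sr; move: (t ^+ 2) (s ^+ 2) (enorm _); clear; move=> *; lra.
rewrite (expands_partial i t00 he) (expands_partial i t00 he').
have [|//|/(_ i) h1 _] := expands_pair he he' tp _ (_ : enorm (u *: e_ j) <= t ^+ 2).
- by rewrite (le_trans _ st0)// ler_wpM2l.
- by rewrite ue.
move: h1; rewrite dotZr dot_delta !mxE => /le_trans; apply; rewrite -ut exprS mulrA.
rewrite ler_wpM2r ?sqr_ge0//; apply: le_trans s2; rewrite ler_wpM2l// mulr_ge0//.
Qed.

(** The jets are forced to be the derivatives, and [expands_pair] is then precisely the
    differentiability of the gradient and the Hölder continuity of the second derivatives. *)
Lemma jets_Hol2 f : (forall x0, exists r K t0, [/\ 0 < r, 0 < t0 &
  forall x, enorm (x - x0) <= r -> jet K t0 f x]) -> Hol 2 f.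
Proof.
move=> hf.
have der1' x i : derivable f x (e_ i).
  have [r [K [t0 [r0 t00 H]]]] := hf x.
  have [|p [A [_ _ he]]] := H x; first by rewrite subrr enorm0 ltW.
  by have [] := expands_is_derive i t00 he.
have hold_f : hold f.
  apply: hold_small => x0; have [r [K [t0 [r0 t00 H]]]] := hf x0.
  have [t1 [t10 t11 _ t1t0 t1r]] := small_time r0 t00.
  have j0 : jet K t0 f x0 by apply: H; rewrite subrr enorm0 ltW.
  have K0 := jet_ge0 j0; have C0 : 0 <= (2 + n%:R ^+ 2) * K.
    by rewrite mulr_ge0// addr_ge0// sqr_ge0.
  exists (t1 ^+ 2), (`|f x0| + (2 + n%:R ^+ 2) * K), t1; split=> // [|x xr|x y t xr yr t0' tt1 xy].
  - exact: exprn_gt0.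
  - have := jet_incr j0 (ltW t10) t1t0 t11 xr; rewrite [x0 + _]addrC subrK => h.
    have := ler_normD (f x - f x0) (f x0); rewrite subrK => /le_trans; apply.
    by rewrite addrC lerD2l (le_trans h)// ler_piMr.
  - have := jet_incr (H y (le_trans yr t1r)) t0' (le_trans tt1 t1t0) (le_trans tt1 t11) xy.
    rewrite [y + _]addrC subrK => /le_trans; apply.
    by rewrite ler_wpM2r// lerDr.
have hold_p i : hold (partial i f).
  apply: hold_small => x0; have [r [K [t0 [r0 t00 H]]]] := hf x0.
  have [t1 [t10 t11 t1t0 _ _]] := small_time r0 t00.
  have K0 : 0 <= K by apply: (@jet_ge0 K t0 f x0); apply: H; rewrite subrr enorm0 ltW.
  have nK : 0 <= n%:R * K by exact: mulr_ge0.
  exists r, (K + 2 * (n%:R * K) + 34 * K), t1; split=> // [x xr|x y t xr yr t0' tt1 xy].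
    have [p [A [pK _ he]]] := H x xr; rewrite (expands_partial i t00 he).
    apply: (le_trans (coord_le _ _)); apply: (le_trans pK); lra.
  have [tp|t_le0] := ltrP 0 t; last first.
    have t_0 : t = 0 by apply/le_anti; rewrite t_le0.
    have -> : x = y.
      apply/eqP; rewrite -subr_eq0; apply/eqP; apply: enorm_eq0.
      by apply/le_anti; rewrite enorm_ge0 (le_trans xy)// t_0 expr0n.
    by rewrite subrr normr0 t_0 mulr0.
  have [p [A [pK AK he]]] := H y yr; have [p' [A' [pK' AK' he']]] := H x xr.
  rewrite (expands_partial i t00 he) (expands_partial i t00 he').
  have xE : x = y + (x - y) by rewrite addrC subrK.
  rewrite xE in he'.
  have [] := expands_pair he he' tp _ xy; first by rewrite (le_trans _ t1t0)// ler_wpM2l.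
  move=> /(_ i) h1 _.
  have h2 : `|dot (row i (A + A^T)) (x - y)| <= 2 * (n%:R * K) * t.
    apply: (le_trans (ler_norm_dot _ _)); apply: ler_pM; rewrite ?enorm_ge0//; last first.
      by rewrite (le_trans xy)// expr2 ler_piMr// (le_trans tt1).
    have -> : 2 * (n%:R * K) = n%:R * (K + K) by ring.
    apply: enorm_le_coord => j; rewrite !mxE; apply: (le_trans (ler_normD _ _)); exact: lerD.
  have h3 : 34 * K * t ^+ 3 <= 34 * K * t.
    rewrite ler_wpM2l ?mulr_ge0// exprS ler_piMr// exprn_ile1// (le_trans tt1)//.
  have := ler_normD (p' ord0 i - p ord0 i - dot (row i (A + A^T)) (x - y)) (dot (row i (A + A^T)) (x - y)).
  rewrite subrK => /le_trans; apply; apply: (le_trans (lerD (le_trans h1 h3) h2)).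
  have Kt : 0 <= K * t by exact: mulr_ge0.
  by move: Kt; clear; move: (n%:R * K) => a; rewrite !mulrDl; lra.
split; first exact: hold_cont.
move=> i; split=> //; split; first exact: hold_cont.
move=> j; split=> [x|].
  have [r [K [t0 [r0 t00 H]]]] := hf x.
  have xr : enorm (x - x) <= r / 2 by rewrite subrr enorm0 divr_ge0// ltW.
  have [|p [A [_ _ he]]] := H x; first by rewrite subrr enorm0 ltW.
  by have [] := jets_is_derive2 i j r0 t00 H xr he.
apply: hold_small => x0; have [r [K [t0 [r0 t00 H]]]] := hf x0.
have [t1 [t10 t11 t1t0 _ _]] := small_time r0 t00.
have K0 : 0 <= K by apply: (@jet_ge0 K t0 f x0); apply: H; rewrite subrr enorm0 ltW.
have rr : r / 2 <= r by rewrite ler_pdivrMr// ler_peMr ?(ltW r0)//; lra.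
have V x p A : enorm (x - x0) <= r / 2 -> expands K t0 f x p A ->
    partial j (partial i f) x = (A + A^T) i j.
  move=> xr he; have D := jets_is_derive2 i j r0 t00 H xr he.
  exact: (@derive_val _ _ _ _ _ _ _ D).
exists (r / 2), (204 * K), t1; split=> // [|x xr|x y t xr yr t0' tt1 xy]; first by rewrite divr_gt0.
  have [p [A [_ AK he]]] := H x (le_trans xr rr); rewrite (V _ _ _ xr he) !mxE.
  by apply: (le_trans (ler_normD _ _)); have := AK i j; have := AK j i; lra.
have [tp|t_le0] := ltrP 0 t; last first.
  have t_0 : t = 0 by apply/le_anti; rewrite t_le0.
  have -> : x = y.
    apply/eqP; rewrite -subr_eq0; apply/eqP; apply: enorm_eq0.
    by apply/le_anti; rewrite enorm_ge0 (le_trans xy)// t_0 expr0n.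
  by rewrite subrr normr0 t_0 mulr0.
have [p [A [pK AK he]]] := H y (le_trans yr rr).
have [p' [A' [pK' AK' he']]] := H x (le_trans xr rr).
rewrite (V _ _ _ yr he) (V _ _ _ xr he') distrC.
have xE : x = y + (x - y) by rewrite addrC subrK.
rewrite xE in he'.
have [|_ h] := expands_pair he he' tp _ xy; first by rewrite (le_trans _ t1t0)// ler_wpM2l.
exact: h.
Qed.

End ConverseTaylor.

(** * The square root of the coefficient matrix *)

Section Shear.
Variables (R : realType) (n : nat).
Local Notation V := 'rV[R]_n.
Implicit Types (x y z p q h : V) (M N : 'M[R]_n) (a b k : R).

Definition wlen p : R := Num.sqrt (1 + dot p p).

Lemma wlen_ge1 p : 1 <= wlen p.
Proof. by rewrite -sqrtr1 ler_sqrt ?lerDl ?dot_ge0// ltW// dot1_gt0. Qed.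

Lemma wlen_sqr p : wlen p ^+ 2 = 1 + dot p p.
Proof. by rewrite sqr_sqrtr// ltW// dot1_gt0. Qed.

(* [shear p] is the symmetric square root of the coefficient matrix
   [1 - p^T p / (1 + |p|^2)], and [unshear p] its inverse. *)
Definition shear p : 'M[R]_n := 1%:M - (wlen p * (wlen p + 1))^-1 *: (p^T *m p).
Definition unshear p : 'M[R]_n := 1%:M + (wlen p + 1)^-1 *: (p^T *m p).

Lemma outer_sqr p : (p^T *m p) *m (p^T *m p) = dot p p *: (p^T *m p).
Proof.
rewrite mulmxA -(mulmxA p^T) [p *m p^T]mx11_scalar.
rewrite (_ : (p *m p^T) 0 0 = dot p p); first by rewrite mul_mx_scalar -scalemxAl.
by rewrite mxE; apply: eq_bigr => i _; rewrite mxE !ord1.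
Qed.

Lemma outer_apply y p : y *m (p^T *m p) = dot y p *: p.
Proof.
rewrite mulmxA [y *m p^T]mx11_scalar mul_scalar_mx; congr (_ *: _).
by rewrite mxE; apply: eq_bigr => i _; rewrite mxE !ord1.
Qed.

Lemma affine_outer_mul p a b : (1%:M + a *: (p^T *m p)) *m (1%:M + b *: (p^T *m p)) =
  1%:M + (a + b + a * b * dot p p) *: (p^T *m p).
Proof.
rewrite mulmxDl !mulmxDr !mulmx1 mul1mx -scalemxAl -scalemxAr outer_sqr !scalerA.
by move: (p^T *m p) (dot p p) => O d; apply/matrixP => i j; rewrite !mxE; ring.
Qed.

Lemma dot_wlen p : dot p p = wlen p ^+ 2 - 1.
Proof. by rewrite wlen_sqr addrC addKr. Qed.

Lemma wlen_neq0 p : (wlen p != 0) /\ (wlen p + 1 != 0).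
Proof. by have := wlen_ge1 p => w1; rewrite !gt_eqF//; lra. Qed.

Lemma shear_unshear p : shear p *m unshear p = 1%:M.
Proof.
rewrite /shear -scaleNr affine_outer_mul dot_wlen; have [w0 w1] := wlen_neq0 p.
rewrite [X in X *: _](_ : _ = 0) ?scale0r ?addr0//; move: (wlen p) w0 w1 => w w0 w1.
by field; rewrite ?w0 ?w1.
Qed.

Lemma unshear_shear p : unshear p *m shear p = 1%:M.
Proof. by apply: mulmx1C; exact: shear_unshear. Qed.

Lemma shear_sqr p : shear p *m shear p = 1%:M - (wlen p ^+ 2)^-1 *: (p^T *m p).
Proof.
rewrite /shear -!scaleNr affine_outer_mul dot_wlen; have [w0 w1] := wlen_neq0 p.
congr (_ + _ *: _); move: (wlen p) w0 w1 => w w0 w1.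
by field; rewrite ?w0 ?w1.
Qed.

Lemma shear_sym p : (shear p)^T = shear p.
Proof. by rewrite /shear linearB linearZ/= trmx1 trmx_mul trmxK. Qed.

Lemma unshear_sym p : (unshear p)^T = unshear p.
Proof. by rewrite /unshear linearD linearZ/= trmx1 trmx_mul trmxK. Qed.

Lemma shear_enorm p y : enorm (y *m shear p) <= 2 * enorm y.
Proof.
rewrite /shear mulmxBr mulmx1 -scalemxAr outer_apply scalerA.
have w1 := wlen_ge1 p; have y0 := enorm_ge0 y; have p0 := enorm_ge0 p.
have pw : enorm p ^+ 2 <= wlen p ^+ 2 by rewrite wlen_sqr enorm_sqr lerDr.
have w0 : 0 < wlen p * (wlen p + 1) by rewrite mulr_gt0//; lra.
rewrite (le_trans (enormB _ _))// mulr_natl mulr2n lerD2l enormZ normrM.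
rewrite ger0_norm ?invr_ge0 ?(ltW w0)// -mulrA mulrC ler_pdivrMr//.
have := ler_norm_dot y p; move: (enorm y) (enorm p) (wlen p) `|_| y0 p0 w1 pw.
clear; move=> y p w d y0 p0 w1 pw dy.
have : d * p <= y * p * p by rewrite ler_wpM2r.
have : y * p ^+ 2 <= y * w ^+ 2 by rewrite ler_wpM2l.
have : 0 <= y * w by apply: mulr_ge0 => //; lra.
by rewrite !expr2; nra.
Qed.

Lemma unshear_enorm p k y : enorm p <= k -> enorm (y *m unshear p) <= (1 + k ^+ 2) * enorm y.
Proof.
move=> pk; rewrite /unshear mulmxDr mulmx1 -scalemxAr outer_apply scalerA.
have w1 := wlen_ge1 p; have y0 := enorm_ge0 y; have p0 := enorm_ge0 p.
have w0 : 1 <= wlen p + 1 by lra.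
rewrite (le_trans (enormD _ _))// mulrDl mul1r lerD2l enormZ normrM.
have i1 : `|(wlen p + 1)^-1| <= 1.
  by rewrite ger0_norm ?invr_ge0 ?invf_le1//; lra.
have d1 : `|dot y p| <= enorm y * k by rewrite (le_trans (ler_norm_dot _ _))// ler_wpM2l.
rewrite (_ : k ^+ 2 * enorm y = 1 * (enorm y * k) * k); last by ring.
by do 2 (apply: ler_pM => //; try exact: mulr_ge0).
Qed.

Lemma bf_trmx M x y : bf M x y = (x *m M *m y^T) 0 0.
Proof. by rewrite bf_dotl [RHS]mxE; apply: eq_bigr => i _; rewrite [y^T _ _]mxE. Qed.

Lemma qf_mulmx M S x : qf M (x *m S) = qf (S *m M *m S^T) x.
Proof. by rewrite /qf !bf_trmx trmx_mul !mulmxA. Qed.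

Lemma dot_mulmx p (S : 'M[R]_n) x : dot p (x *m S) = dot (p *m S^T) x.
Proof. by rewrite [LHS]dotC -bf_dotl bf_dotr. Qed.

(** In coordinates changed by the square root, the operator frozen at [p] is the Laplacian. *)
Lemma tr_shear p M : \tr (shear p *m M *m shear p) = trA p M.
Proof.
have E : \tr (p^T *m p *m M) = qf M p.
  by rewrite -mulmxA mxtrace_mulC /qf bf_trmx /mxtrace big_ord1.
rewrite mxtrace_mulC mulmxA shear_sqr mulmxBl mul1mx linearB/= -scalemxAl mxtraceZ E.
by rewrite /trA -wlen_sqr mulrC.
Qed.

(** Only the quadratic form of [M] is controlled, so the mixed terms are recovered from its values
    at [p], at a unit vector [v] and at [p + v]. *)
Lemma qf_diff_le M p d b k : 0 <= b -> 0 <= k -> enorm p <= k ->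
  (forall x, `|qf M x| <= b * dot x x) ->
  `|qf M (p + d) - qf M p| <= b * (k ^+ 2 + (k + 1) ^+ 2 + 1 + enorm d) * enorm d.
Proof.
move=> b0 k0 pk hM; have [->|d0] := eqVneq d 0.
  by rewrite addr0 subrr normr0 enorm0 mulr0.
have ed : 0 < enorm d by exact: enorm_gt0.
have [v [v1 vE]] : exists v, enorm v = 1 /\ d = enorm d *: v.
  exists ((enorm d)^-1 *: d); rewrite scalerA mulfV ?gt_eqF// scale1r; split=> //.
  by rewrite enormZ ger0_norm ?invr_ge0 ?(ltW ed)// mulVf// gt_eqF.
have q1 := hM (p + v); have q2 := hM p; have q3 := hM v.
rewrite -!enorm_sqr v1 expr1n mulr1 in q1 q2 q3.
have {}q2 : `|qf M p| <= b * k ^+ 2.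
  by rewrite (le_trans q2)// ler_wpM2l// lerXn2r ?nnegrE ?enorm_ge0.
have {}q1 : `|qf M (p + v)| <= b * (k + 1) ^+ 2.
  rewrite (le_trans q1)// ler_wpM2l// lerXn2r ?nnegrE ?enorm_ge0 ?addr_ge0//.
  by rewrite (le_trans (enormD _ _))// v1 lerD2r.
rewrite {1}vE !qf_add qfZ bfZl bfZr in q1 *.
have -> : qf M p + (enorm d * bf M p v + enorm d * bf M v p) + enorm d ^+ 2 * qf M v - qf M p =
   enorm d * (qf M p + (bf M p v + bf M v p) + qf M v - qf M p - qf M v + enorm d * qf M v) by ring.
rewrite normrM (ger0_norm (ltW ed)) mulrC ler_wpM2r ?(ltW ed)//.
rewrite (_ : b * _ = b * (k + 1) ^+ 2 + b * k ^+ 2 + b + enorm d * b); last by ring.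
apply: (le_trans (ler_normD _ _)); apply: lerD; last first.
  by rewrite normrM (ger0_norm (ltW ed)) ler_wpM2l ?(ltW ed).
apply: (le_trans (ler_normB _ _)); apply: lerD => //.
by apply: (le_trans (ler_normB _ _)); exact: lerD.
Qed.

Lemma dot_diff_le p q k : enorm p <= k -> enorm q <= k ->
  `|dot q q - dot p p| <= 2 * k * enorm (p - q).
Proof.
move=> pk qk; rewrite (_ : dot q q - dot p p = - dot (p + q) (p - q)); last first.
  by rewrite dotDl !dotBr [dot q p]dotC; ring.
rewrite normrN (le_trans (ler_norm_dot _ _))// ler_wpM2r ?enorm_ge0//.
by rewrite (le_trans (enormD _ _))// mulr_natl mulr2n lerD.
Qed.

Lemma trA_lipschitz k b p q M : 0 <= b -> 0 <= k -> enorm p <= k -> enorm q <= k ->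
  (forall x, `|qf M x| <= b * dot x x) ->
  `|trA p M - trA q M| <=
    b * (k ^+ 2 + (k + 1) ^+ 2 + 1 + 2 * k + 2 * k ^+ 3) * enorm (p - q).
Proof.
move=> b0 k0 pk qk hM; have p1 := dot1_gt0 p; have q1 := dot1_gt0 q.
have -> : trA p M - trA q M = (qf M q - qf M p) / (1 + dot p p) -
    qf M q * (dot q q - dot p p) / ((1 + dot p p) * (1 + dot q q)).
  by rewrite /trA; field; rewrite !gt_eqF.
have le1 (a c : R) : 1 <= c -> `|a / c| <= `|a|.
  move=> c1; rewrite normrM ler_piMr// normfV invf_le1 ger0_norm//; lra.
have dp : 1 <= 1 + dot p p by rewrite lerDl dot_ge0.
have dq : 1 <= 1 + dot q q by rewrite lerDl dot_ge0.
have h1 := le1 (qf M q - qf M p) _ dp.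
have h2 := le1 (qf M q * (dot q q - dot p p)) _ (mulr_ege1 dp dq).
have d2k : enorm (p - q) <= 2 * k.
  by rewrite (le_trans (enormB _ _))// mulr_natl mulr2n lerD.
have {}h3 : `|qf M q - qf M p| <= b * (k ^+ 2 + (k + 1) ^+ 2 + 1 + 2 * k) * enorm (p - q).
  have := qf_diff_le (p - q) b0 k0 qk hM; rewrite [q + _]addrC subrK distrC => /le_trans; apply.
  by rewrite ler_wpM2r ?enorm_ge0// ler_wpM2l// lerD2l.
have h4 : `|qf M q * (dot q q - dot p p)| <= b * (2 * k ^+ 3) * enorm (p - q).
  rewrite normrM (_ : b * (2 * k ^+ 3) * _ = (b * k ^+ 2) * (2 * k * enorm (p - q))); last by ring.
  apply: ler_pM => //; last exact: dot_diff_le.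
  by rewrite (le_trans (hM q))// ler_wpM2l// -enorm_sqr lerXn2r ?nnegrE ?enorm_ge0.
apply: (le_trans (ler_normB _ _)); apply: (le_trans (lerD (le_trans h1 h3) (le_trans h2 h4))).
by rewrite le_eqVlt; apply/orP; left; apply/eqP; ring.
Qed.

End Shear.

(** * Comparison of viscosity subsolutions with harmonic functions *)

Section Comparison.
Variables (R : realType) (n : nat).
Local Notation V := 'rV[R]_n.
Implicit Types (x y z p : V) (f h u : V -> R) (r e D c : R) (N : 'M[R]_n).

Lemma Taylor2_local f e : Ck 2 f -> 0 < e -> exists2 r, 0 < r &
  forall z, enorm z < r -> `|f z - jet2 f z| <= e * dot z z.
Proof.
move=> hf e0.
have n1 : 0 < n%:R ^+ 2 + 1 :> R by rewrite ltr_wpDl// sqr_ge0.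
have [d [d0 dE]] : exists d, 0 < d /\ n%:R ^+ 2 * d <= e.
  exists (e / (n%:R ^+ 2 + 1)); split; first exact: divr_gt0.
  by rewrite mulrA ler_pdivrMr// mulrC ler_wpM2l ?(ltW e0)// lerDl ler01.
have [r r0 Hr] : exists2 r, 0 < r & forall i j z, enorm z < r ->
    `|partial j (partial i f) z - partial j (partial i f) 0| <= d.
  apply: (@ord_radius _ n (fun i r => forall j z, enorm z < r ->
      `|partial j (partial i f) z - partial j (partial i f) 0| <= d)) => [i a b ab H j z za|i].
    by apply: H; exact: lt_le_trans ab.
  apply: (@ord_radius _ n (fun j r => forall z, enorm z < r ->
      `|partial j (partial i f) z - partial j (partial i f) 0| <= d)) => [j a b ab H z za|j].
    by apply: H; exact: lt_le_trans ab.
  have cj : continuous (partial j (partial i f)) := Ck_cont (Ck_partial j (Ck_partial i hf)).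
  have [s s0 Hs] := (continuous_enormP (partial j (partial i f)) 0).1 (cj 0) d d0.
  by exists s => // z zs; apply: ltW; apply: Hs; rewrite subr0.
exists r => // y yr.
have segm t z : 0 <= t <= 1 -> enorm (0 + t *: z) <= enorm z.
  by case/andP=> t0 t1; rewrite add0r enormZ ger0_norm// ler_piMl// enorm_ge0.
have [g gE] : exists g, g = (fun z => f z - jet2 f z) by eexists.
have hg : Ck 2 g by rewrite gE; exact: (CkB hf (Ck_jet2 2 f)).
have g10 i : partial i g 0 = 0 by rewrite gE (partial_sub_jet2 f i (CkW hf)) subrr.
have g2 i j z : partial j (partial i g) z = partial j (partial i f) z - partial j (partial i f) 0.
  by rewrite gE (partial2_sub_jet2 i j z hf hf).
have B1 i z : enorm z <= enorm y -> `|partial i g z| <= n%:R * d * enorm y.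
  move=> zy; rewrite -[partial i g z]subr0 -{1}(g10 i) -{1}[z]add0r.
  apply: (le_trans (incr_bound (a := d) (Ck_partial i hg) _)).
    move=> t j t01; rewrite g2; apply: Hr; apply: le_lt_trans (segm t z t01) _.
    exact: le_lt_trans yr.
  by rewrite ler_wpM2l// mulr_ge0// ltW.
have -> : f y - jet2 f y = g (0 + y) - g 0 by rewrite gE add0r jet2_0 subrr subr0.
apply: (le_trans (incr_bound (a := n%:R * d * enorm y) (CkW hg) _)).
  by move=> t i t01; apply: B1; exact: segm.
rewrite -enorm_sqr (_ : _ * enorm y = n%:R ^+ 2 * d * enorm y ^+ 2); last by ring.
by rewrite ler_wpM2r ?sqr_ge0.
Qed.

Lemma lap_shift y f : Ck 2 f -> lap (fun z => f (y + z *m 1%:M)) 0 = lap f y.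
Proof.
move=> hf; have o1 : (1%:M : 'M[R]_n)^T *m 1%:M = 1%:M by rewrite trmx1 mulmx1.
have := lap_orthogonal y 0 hf o1; rewrite mul0mx addr0; exact.
Qed.

(** At an interior maximum of [u - h + (D + c) |y|^2], the 2-jet of [h - (D + c) |y|^2] raised by
    [c / 2 |z|^2] touches [u] from above. The trace of its matrix is [- n (D + c / 2)], which is
    below [- D]. *)
Lemma visc_compare r e D c u h : (0 < n)%N -> 0 < r -> 0 <= D -> 0 < c -> continuous u -> harmonic_fun h ->
  (forall y p N s, enorm y < r -> 0 < s ->
    (forall z, enorm z < s -> u (y + z) <= u y + dot p z + qf N z) -> - \tr N <= D) ->
  (forall y, enorm y = r -> u y <= h y + e) ->
  forall y, enorm y <= r -> u y <= h y + e + (D + c) * r ^+ 2.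
Proof.
move=> n0 r0 D0 c0 cu [sh lh] hu ub y yr.
have n1 : 1 <= n%:R :> R by rewrite ler1n.
have cF : Ck 2 (fun y => h y - (D + c) * dot y y) := CkB (sh 2%N) (CkZ _ (Ck_dot _ _ _)).
have [F FE] : exists F, F = (fun y => h y - (D + c) * dot y y) by eexists.
rewrite -FE in cF.
have cg : continuous (fun y => u y - F y).
  have := contD cu (Ck_cont (CkN cF)); exact.
have [y1 y1r ymax] := @ball_max _ _ _ 0 r (ltW r0) cg.
have D1 : 0 <= D + c by lra.
have := ymax y; rewrite subr0 => /(_ yr) yy1; rewrite subr0 in y1r.
have [y1b|y1b] := eqVneq (enorm y1) r.
  have := ub _ y1b; move: yy1; rewrite FE -[in dot y1 y1]enorm_sqr y1b.
  have : 0 <= (D + c) * dot y y by rewrite mulr_ge0// dot_ge0.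
  by move: ((D + c) * dot y y) ((D + c) * r ^+ 2); clear; move=> *; lra.
exfalso.
have y1i : enorm y1 < r by rewrite lt_neqAle y1b.
have cs : Ck 2 (fun z => F (y1 + z *m 1%:M)) := Ck_aff y1 1%:M cF.
have c20 : 0 < c / 2 by rewrite divr_gt0.
have [s s0 Hs] := Taylor2_local cs c20.
have := hu y1 (grad (fun z => F (y1 + z *m 1%:M)) 0)
  (2^-1 *: hess (fun z => F (y1 + z *m 1%:M)) 0 + (c / 2)%:M) (Num.min s (r - enorm y1)) y1i.
have -> : \tr (2^-1 *: hess (fun z => F (y1 + z *m 1%:M)) 0 + (c / 2)%:M) =
    2^-1 * lap F y1 + n%:R * (c / 2).
  rewrite mxtraceD mxtraceZ mxtrace_scalar -[_ *+ n]mulr_natl; congr (_ * _ + _).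
  rewrite -(lap_shift y1 cF).
  by apply: eq_bigr => i _; rewrite mxE.
have -> : lap F y1 = - (2 * n%:R * (D + c)).
  rewrite FE (lapB y1 (sh 2%N) (CkZ _ (Ck_dot _ _ _))) (lapZ _ y1 (Ck_dot _ _ _)) lh lap_dot.
  by ring.
rewrite lt_min s0 subr_gt0 y1i => /(_ isT) H.
have : - (2^-1 * - (2 * n%:R * (D + c)) + n%:R * (c / 2)) <= D; last first.
  by move: n1 D0 c0; move: (n%:R : R); clear; move=> m m1 D0 c0; nra.
apply: H => z; rewrite lt_min => /andP[zs zr].
have := Hs z zs; rewrite ler_distl => /andP[_].
have := ymax (y1 + z); rewrite subr0.
have -> : enorm (y1 + z) <= r by apply: (le_trans (enormD _ _)); lra.
move=> /(_ isT); rewrite mulmx1 /jet2 /quad mul0mx addr0 qf_mxD qf_scalar.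
by move: (dot _ _) (qf _ _) (dot _ _) (u _) (u _) (F _) (F _); clear; move=> *; lra.
Qed.

End Comparison.

(** * Jets under changes of variables, and the equation at a jet *)

Section JetTransport.
Variables (R : realType) (n : nat).
Local Notation V := 'rV[R]_n.
Implicit Types (x y z p q h : V) (f u w : V -> R) (M N A S T : 'M[R]_n) (K t c : R).
Local Notation e_ i := (delta_mx ord0 i : V).

Lemma bf_entry A (i j : 'I_n) : A i j = bf A (e_ i) (e_ j).
Proof. by rewrite bf_dotl -rowE dot_delta mxE. Qed.

Lemma mx_transport_le T A B c i j : (forall z, enorm (z *m T) <= c * enorm z) ->
  (forall i j, `|A i j| <= B) -> `|(T *m A *m T^T) i j| <= n%:R ^+ 2 * B * c ^+ 2.
Proof.
move=> hT hA; rewrite bf_entry bf_trmx mulmxA -[_ *m T^T *m _]mulmxA -trmx_mul mulmxA -bf_trmx.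
apply: (le_trans (bf_le _ _ _)); have e1 k := hT (e_ k).
have {}e1 k : enorm (e_ k *m T) <= c by have := e1 k; rewrite enorm_delta mulr1.
have c0 : 0 <= c by apply: le_trans (e1 i); exact: enorm_ge0.
apply: ler_pM; rewrite ?mxbound_ge0 ?mulr_ge0 ?enorm_ge0//; first exact: mxbound_le.
by rewrite expr2; apply: ler_pM; rewrite ?enorm_ge0.
Qed.

Lemma jet_add_quad K K1 t0 u c p A : 0 <= K1 -> enorm p <= K1 -> (forall i j, `|A i j| <= K1) ->
  jet K t0 u 0 -> jet (K + K1) t0 (fun y => u y + quad c p A y) 0.
Proof.
move=> K10 pK AK [p' [A' [pK' AK' H]]]; exists (p' + p), (A' + A); split.
- by rewrite (le_trans (enormD _ _))// lerD.
- by move=> i j; rewrite mxE (le_trans (ler_normD _ _))// lerD.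
move=> t y tt0 yt; have t0' : 0 <= t by case/andP: tt0.
rewrite (@le_trans _ _ (K * t ^+ 5))//; last by rewrite ler_wpM2r ?exprn_ge0// lerDl.
have := H t y tt0 yt; rewrite add0r; congr (`|_| <= _).
rewrite /quad dot0r qf0 !addr0 dotDl qf_mxD.
by move: (u _) (u _) (dot _ _) (dot _ _) (qf _ _) (qf _ _); clear; move=> *; ring.
Qed.

Lemma jet_transport K t0 c f x S T : 1 <= c -> 0 <= K -> T *m S = 1%:M ->
  (forall z, enorm (z *m T) <= c * enorm z) ->
  jet K t0 (fun y => f (x + y *m S)) 0 -> jet (c * K + n%:R ^+ 2 * K * c ^+ 2 + K * c ^+ 5) (t0 / c) f x.
Proof.
move=> c1 K0 TS hT [p [A [pK AK H]]]; have c0 : 0 < c by lra.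
have k1 : 0 <= c * K by rewrite mulr_ge0// ltW.
have k2 : 0 <= n%:R ^+ 2 * K * c ^+ 2.
  by apply: mulr_ge0 (sqr_ge0 _); exact: mulr_ge0 (sqr_ge0 _) K0.
have k3 : 0 <= K * c ^+ 5 by rewrite mulr_ge0// exprn_ge0// ltW.
exists (p *m T^T), (T *m A *m T^T); split.
- rewrite (@le_trans _ _ (c * K))//; last by rewrite -addrA lerDl addr_ge0.
  have [->|v0] := eqVneq (p *m T^T) 0; first by rewrite enorm0.
  have vp : 0 < enorm (p *m T^T) by exact: enorm_gt0.
  rewrite -(ler_pM2r vp) -expr2 enorm_sqr -dot_mulmx.
  apply: (le_trans (dot_le _ _)); rewrite [c * K]mulrC -mulrA.
  by apply: ler_pM; rewrite ?enorm_ge0.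
- move=> i j; apply: (le_trans (mx_transport_le i j hT AK)).
  by rewrite -addrA [c * K + _]addrC -addrA lerDl addr_ge0.
move=> t y /andP[t0' tt0] yt.
have := H (c * t) (y *m T); rewrite mulr_ge0 ?(ltW c0)//= mulrC -ler_pdivlMr// tt0.
have -> : enorm (y *m T) <= (t * c) ^+ 2.
  apply: (le_trans (hT y)); rewrite exprMn mulrC; apply: ler_pM; rewrite ?enorm_ge0 ?(ltW c0)//.
  by rewrite expr2 ler_peMr// ltW.
move=> /(_ isT isT); rewrite add0r -mulmxA TS mulmx1 mul0mx addr0.
rewrite /quad dot_mulmx qf_mulmx => /le_trans; apply.
rewrite (_ : K * (t * c) ^+ 5 = K * c ^+ 5 * t ^+ 5); last by ring.
by rewrite ler_wpM2r ?exprn_ge0// lerDr addr_ge0.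
Qed.

Lemma expands_touch K t0 f x p A e : 0 < t0 -> 0 < e -> expands K t0 f x p A ->
  exists2 s, 0 < s & forall h, enorm h < s ->
    `|f (x + h) - quad (f x) p A h| <= e * dot h h.
Proof.
move=> t00 e0 hf; have K1 : 0 < `|K| + 1 by rewrite ltr_wpDl.
have [t [tp tt0 tK]] : exists t, [/\ 0 < t, t <= t0 & (`|K| + 1) * t <= e].
  exists (Num.min t0 (e / (`|K| + 1))); rewrite lt_min t00 divr_gt0// ge_min lexx; split=> //.
  by rewrite mulrC -ler_pdivlMr// ge_min lexx orbT.
exists (t ^+ 2); first exact: exprn_gt0.
move=> h ht; have [s [s0 hs]] : exists s, 0 <= s /\ s ^+ 2 = enorm h.
  by exists (Num.sqrt (enorm h)); rewrite sqrtr_ge0 sqr_sqrtr ?enorm_ge0.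
have st : s <= t by rewrite -(@ler_pXn2r _ 2) ?nnegrE ?(ltW tp)// hs ltW.
have := hf s h; rewrite s0 (le_trans st tt0) hs lexx => /(_ isT isT) /le_trans; apply.
rewrite -enorm_sqr -hs -exprM exprS mulrA; apply: ler_wpM2r; first exact: exprn_ge0.
apply: le_trans tK; apply: le_trans (ler_wpM2r s0 (ler_norm K)) _.
by apply: ler_pM => //; rewrite lerDl ler01.
Qed.

(** Adding or subtracting [e |h|^2] turns an expansion into test paraboloids from above and from
    below; then [e] tends to zero. *)
Lemma visc_expands G K t0 f x p A : 0 < t0 -> visc_sub G f -> visc_sup G f ->
  expands K t0 f x p A -> trA p A = - G p.
Proof.
move=> t00 sub sup hf; apply/le_anti; apply/andP; split.
  rewrite -[trA p A]opprK lerN2.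
  apply: (@le_small _ _ _ n%:R) => e e0; have [s s0 Hs] := expands_touch t00 e0 hf.
  have := sup x p (A - e%:M) s s0; rewrite trAD trAN.
  have te := trA_scalar_le p (ltW e0).
  move=> H; have {}H : G p <= - (trA p A - trA p e%:M).
    apply: H => h hs; have := Hs h hs; rewrite ler_distl /quad qf_mxD qf_mxN qf_scalar.
    by move=> /andP[+ _]; move: (e * _) => a; lra.
  by move: H te; clear; lra.
rewrite lerNl; apply: (@le_small _ _ _ n%:R) => e e0; have [s s0 Hs] := expands_touch t00 e0 hf.
have := sub x p (A + e%:M) s s0; rewrite trAD.
have te := trA_scalar_le p (ltW e0).
move=> H; have {}H : - (trA p A + trA p e%:M) <= G p.
  apply: H => h hs; have := Hs h hs; rewrite ler_distl /quad qf_mxD qf_scalar.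
  by move=> /andP[_]; move: (e * _) => a; lra.
by move: H te; clear; lra.
Qed.

End JetTransport.

(** * From C^{1,1} viscosity solutions to C^{2,1/2} *)

Section ViscosityRegularity.
Variables (R : realType) (n : nat) (k C g1 LG : R) (G phi : 'rV[R]_n -> R).
Local Notation V := 'rV[R]_n.
Implicit Types (x y z p q h : V) (M N : 'M[R]_n) (t s d : R).
Hypotheses (n0 : (0 < n)%N) (k0 : 0 <= k) (C0 : 0 < C) (LG0 : 0 <= LG).
Hypothesis G_ge0 : forall p, enorm p <= k -> 0 <= G p.
Hypothesis G_le : forall p, enorm p <= k -> G p <= g1.
Hypothesis G_lip : forall p q, enorm p <= k -> enorm q <= k ->
  `|G p - G q| <= LG * enorm (p - q).

Definition slope x p := enorm p <= k /\ forall h,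
  phi x + dot p h - C * dot h h <= phi (x + h) /\ phi (x + h) <= phi x + dot p h.

Hypothesis phi_slope : forall x, exists p, slope x p.
Hypothesis phi_lip : forall x y, `|phi x - phi y| <= k * enorm (x - y).
Hypothesis phi_sub : visc_sub G phi.
Hypothesis phi_sup : visc_sup G phi.

(** The paraboloid below [phi] at [x] and the plane above it at [y] are compared at a displacement
    of length [d] in the direction [p - q]. *)
Lemma slope_lipschitz x p y q d : slope x p -> slope y q -> 0 < d -> enorm (y - x) <= d ->
  enorm (p - q) <= 4 * C * d.
Proof.
move=> [_ hp] [_ hq] d0 yx; have [->|pq] := eqVneq (p - q) 0.
  by rewrite enorm0 !mulr_ge0// ltW.
have e0 : 0 < enorm (p - q) by exact: enorm_gt0.
have [z [zd zE]] : exists z, enorm z <= d /\ dot (p - q) z = d * enorm (p - q).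
  exists ((d / enorm (p - q)) *: (p - q)); rewrite enormZ dotZr -enorm_sqr ger0_norm; last first.
    by rewrite divr_ge0 ?ltW.
  by rewrite divfK ?gt_eqF//; split=> //; field; rewrite gt_eqF.
have [_ u1] := hp (y - x); have [u2 _] := hp ((y - x) + z); have [_ u3] := hq z.
have E1 : x + (y - x) = y by rewrite addrC subrK.
rewrite addrA E1 in u2; rewrite E1 in u1.
have hz : enorm (y - x + z) <= 2 * d.
  by rewrite (le_trans (enormD _ _))// mulr_natl mulr2n lerD.
have u4 : C * dot (y - x + z) (y - x + z) <= C * (2 * d) ^+ 2.
  by rewrite ler_wpM2l ?(ltW C0)// -enorm_sqr lerXn2r ?nnegrE ?enorm_ge0// mulr_ge0// ltW.
have u5 : d * enorm (p - q) <= C * (2 * d) ^+ 2.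
  rewrite -zE dotBl; move: u2; rewrite dotDr.
  by move: u1 u3 u4; move: (C * _) (C * _) => *; lra.
rewrite -(ler_pM2l d0) (le_trans u5)//.
by rewrite (_ : C * (2 * d) ^+ 2 = d * (4 * C * d))//; ring.
Qed.

Let kk := 1 + k ^+ 2.
(** [bb] bounds the test matrices that matter. [DD] measures the variation of the operator when
    coefficients are frozen: over a distance [2 d] the slope moves by at most [8 C d]. *)
Let bb := kk * (n%:R * C + g1).
Let DD := (LG + bb * (k ^+ 2 + (k + 1) ^+ 2 + 1 + 2 * k + 2 * k ^+ 3)) * (8 * C).

Lemma g1_ge0 : 0 <= g1.
Proof.
by apply: le_trans (G_ge0 (p := 0) _) (G_le _); rewrite enorm0.
Qed.

Lemma bb_ge0 : 0 <= bb.
Proof.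
apply: mulr_ge0; first by rewrite addr_ge0// sqr_ge0.
by apply: addr_ge0 g1_ge0; apply: mulr_ge0 => //; exact: ltW.
Qed.

Lemma kpoly_ge0 : 0 <= k ^+ 2 + (k + 1) ^+ 2 + 1 + 2 * k + 2 * k ^+ 3.
Proof.
have a := sqr_ge0 k; have b := sqr_ge0 (k + 1); have c := exprn_ge0 3 k0.
by move: ((k + 1) ^+ 2) (k ^+ 2) (k ^+ 3) a b c k0 => *; lra.
Qed.

Lemma DD_ge0 : 0 <= DD.
Proof.
apply: mulr_ge0; last by apply: mulr_ge0 => //; exact: ltW.
by apply: addr_ge0 => //; exact: mulr_ge0 bb_ge0 kpoly_ge0.
Qed.

Lemma slope_dot x p : slope x p -> dot p p <= k ^+ 2.
Proof. by case=> pk _; rewrite -enorm_sqr lerXn2r ?nnegrE ?enorm_ge0. Qed.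

Lemma slope_touch_upper x p q M s : slope x p -> 0 < s ->
  (forall h, enorm h < s -> phi (x + h) <= phi x + dot q h + qf M h) ->
  p = q /\ psd (M + C%:M).
Proof.
move=> [pk hp] s0 hM; have pq : p = q.
  apply: (@slope_unique _ _ _ _ (mxbound M + C) _ s0) => h hs; have [h1 _] := hp h.
  have := hM h hs; have := qf_le M h; rewrite ler_norml => /andP[_ h2] h3.
  by move: h1 h2 h3; rewrite mulrDl; lra.
split=> //; apply: (psd_local s0) => h hs; rewrite qf_mxD qf_scalar.
by have [h1 _] := hp h; have := hM h hs; move: h1; rewrite pq; lra.
Qed.

Lemma slope_touch_lower x p q M s : slope x p -> 0 < s ->
  (forall h, enorm h < s -> phi x + dot q h + qf M h <= phi (x + h)) ->
  p = q /\ psd (- M).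
Proof.
move=> [pk hp] s0 hM; have pq : q = p.
  apply: (@slope_unique _ _ _ _ (mxbound M) _ s0) => h hs; have [_ h1] := hp h.
  have := hM h hs; have := qf_le M h; rewrite ler_norml => /andP[h2 _] h3.
  by move: h1 h2 h3; lra.
split=> //; apply: (psd_local s0) => h hs; rewrite qf_mxN.
by have [_ h1] := hp h; have := hM h hs; move: h1; rewrite pq; lra.
Qed.

Lemma frozen_estimate x p x' p' M d : slope x p -> slope x' p' -> 0 < d ->
  enorm (x' - x) <= 2 * d -> (forall h, `|qf M h| <= bb * dot h h) ->
  `|trA p' M - trA p M| + `|G p' - G p| <= DD * d.
Proof.
move=> hp hp' d0 xx hM; have d20 : 0 < 2 * d by rewrite mulr_gt0.
have pp := slope_lipschitz hp hp' d20 xx.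
have h1 := trA_lipschitz bb_ge0 k0 hp'.1 hp.1 hM; have h2 := G_lip hp'.1 hp.1.
rewrite enormBC in pp; apply: (le_trans (lerD h1 h2)).
rewrite -mulrDl [X in X * _]addrC /DD -mulrA; apply: ler_wpM2l.
  by apply: addr_ge0 => //; exact: mulr_ge0 bb_ge0 kpoly_ge0.
by apply: (le_trans pp); rewrite le_eqVlt; apply/orP; left; apply/eqP; ring.
Qed.

Lemma mxtr_opp N : \tr (- N) = - \tr N.
Proof. by rewrite -scaleN1r mxtraceZ mulN1r. Qed.

Section Frozen.
Variables (x0 p0 : V).
Hypothesis hp0 : slope x0 p0.

Let v y := phi (x0 + y *m shear p0).

Lemma frozen_shift y h : v (y + h *m unshear p0) = phi (x0 + y *m shear p0 + h).
Proof. by rewrite /v mulmxDl -mulmxA unshear_shear mulmx1 addrA. Qed.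

Lemma unshear_small h s : 0 < s -> enorm h < s / kk -> enorm (h *m unshear p0) < s.
Proof.
move=> s0; have k1 : 0 < kk by rewrite ltr_pwDl// sqr_ge0.
rewrite ltr_pdivlMr// mulrC; apply: le_lt_trans; exact: unshear_enorm hp0.1.
Qed.

Lemma tr_frozen N : \tr N = trA p0 (unshear p0 *m N *m (unshear p0)^T).
Proof.
rewrite -tr_shear unshear_sym !mulmxA shear_unshear mul1mx -mulmxA unshear_shear.
by rewrite mulmx1.
Qed.

Lemma kk_gt0 : 0 < kk.
Proof. by rewrite ltr_pwDl// sqr_ge0. Qed.

Lemma frozen_dist y d : enorm y <= d -> enorm (x0 + y *m shear p0 - x0) <= 2 * d.
Proof.
by move=> yd; rewrite addrC addKr (le_trans (shear_enorm _ _))// ler_wpM2l.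
Qed.

(** Semiconvexity bounds the test matrix from below; unless the inequality is trivial, ellipticity
    bounds it from above as well. Freezing the coefficients then costs only [DD d]. *)
Lemma frozen_touch_upper y q N d s : 0 < d -> enorm y <= d -> 0 < s ->
  (forall z, enorm z < s -> v (y + z) <= v y + dot q z + qf N z) ->
  - \tr N <= G p0 + DD * d.
Proof.
move=> d0 yd s0 hN; rewrite tr_frozen; set M := unshear p0 *m N *m _.
have Dd : 0 <= DD * d by rewrite mulr_ge0 ?DD_ge0 ?ltW.
have g0 := G_ge0 hp0.1; have g01 := G_le hp0.1.
have [tM|tM] := lerP 0 (trA p0 M); first by move: tM g0 Dd; lra.
have s'0 : 0 < s / kk by rewrite divr_gt0 ?kk_gt0.
have hM h : enorm h < s / kk -> phi (x0 + y *m shear p0 + h) <=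
    phi (x0 + y *m shear p0) + dot (q *m (unshear p0)^T) h + qf M h.
  by move=> hs; rewrite -frozen_shift -dot_mulmx -qf_mulmx; apply: hN; exact: unshear_small.
have [p hp] := phi_slope (x0 + y *m shear p0).
have [pE pM] := slope_touch_upper hp s'0 hM.
have nC : 0 <= n%:R * C by rewrite mulr_ge0// ltW.
have Mb h : `|qf M h| <= bb * dot h h.
  have := pM h; rewrite qf_mxD qf_scalar => h1.
  have := psd_qf_le_trA h pM (slope_dot hp0); rewrite trAD qf_mxD qf_scalar => h2.
  have h3 := trA_scalar_le p0 (ltW C0).
  have hh := dot_ge0 h.
  have h4 : kk * (trA p0 M + trA p0 C%:M) * dot h h <= bb * dot h h.
    apply: ler_wpM2r => //; apply: ler_wpM2l; first exact: ltW kk_gt0.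
    by move: tM h3 g1_ge0; lra.
  have Cb : C <= bb.
    rewrite /bb; apply: (@le_trans _ _ (n%:R * C + g1)).
      have n1 : 1 <= n%:R :> R by rewrite ler1n.
      by have := ler_wpM2r (ltW C0) n1; rewrite mul1r; move: g1_ge0; lra.
    by rewrite ler_peMl ?addr_ge0 ?g1_ge0// lerDl sqr_ge0.
  have h5 := ler_wpM2r hh Cb; have h6 : 0 <= C * dot h h by rewrite mulr_ge0// ltW.
  rewrite ler_norml; apply/andP; split; first by move: h1 h5; lra.
  apply: le_trans h4; apply: le_trans h2; by rewrite lerDl.
have := phi_sub s'0 hM; rewrite -pE => h1.
have := frozen_estimate hp0 hp d0 (frozen_dist yd) Mb.
move: (ler_norm (trA p M - trA p0 M)) (ler_norm (G p - G p0)) h1.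
by move: (DD * d) `|_| `|_| => *; lra.
Qed.

(** As above with the roles exchanged: concavity gives the upper bound on the test matrix, and the
    lower one is needed only when the inequality is not trivial. *)
Lemma frozen_touch_lower y q N d s : 0 < d -> enorm y <= d -> 0 < s ->
  (forall z, enorm z < s -> v y + dot q z + qf N z <= v (y + z)) ->
  G p0 - DD * d <= - \tr N.
Proof.
move=> d0 yd s0 hN; rewrite tr_frozen; set M := unshear p0 *m N *m _.
have Dd : 0 <= DD * d by rewrite mulr_ge0 ?DD_ge0 ?ltW.
have g0 := G_ge0 hp0.1; have g01 := G_le hp0.1.
have [tM|tM] := lerP (G p0) (- trA p0 M); first by move: tM g0 Dd; lra.
have s'0 : 0 < s / kk by rewrite divr_gt0 ?kk_gt0.
have hM h : enorm h < s / kk -> phi (x0 + y *m shear p0) + dot (q *m (unshear p0)^T) h + qf M h <=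
    phi (x0 + y *m shear p0 + h).
  by move=> hs; rewrite -frozen_shift -dot_mulmx -qf_mulmx; apply: hN; exact: unshear_small.
have [p hp] := phi_slope (x0 + y *m shear p0).
have [pE pM] := slope_touch_lower hp s'0 hM.
have nC : 0 <= n%:R * C by rewrite mulr_ge0// ltW.
have Mb h : `|qf M h| <= bb * dot h h.
  have := pM h; rewrite qf_mxN => h1.
  have := psd_qf_le_trA h pM (slope_dot hp0); rewrite trAN qf_mxN => h2.
  have hh := dot_ge0 h.
  have h4 : kk * - trA p0 M * dot h h <= bb * dot h h.
    apply: ler_wpM2r => //; apply: ler_wpM2l; first exact: ltW kk_gt0.
    by move: tM g01 nC; lra.
  rewrite -normrN ger0_norm//; exact: le_trans h2 h4.
have := phi_sup s'0 hM; rewrite -pE => h1.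
have := frozen_estimate hp0 hp d0 (frozen_dist yd) Mb.
move: (ler_norm (- (trA p M - trA p0 M))) (ler_norm (- (G p - G p0))) h1; rewrite !normrN.
by move: (DD * d) `|_| `|_| => *; lra.
Qed.

Let u y := v y - phi x0 + G p0 / n%:R * dot y y.

Lemma frozen_quad y z : G p0 / n%:R * dot (y + z) (y + z) =
  G p0 / n%:R * dot y y + dot ((2 * (G p0 / n%:R)) *: y) z + qf (G p0 / n%:R)%:M z.
Proof. by rewrite dotDl !dotDr dotZl qf_scalar [dot z y]dotC; move: (G p0 / _) => a; ring. Qed.

Lemma tr_frozen_quad : \tr ((G p0 / n%:R)%:M : 'M[R]_n) = G p0.
Proof. by rewrite mxtrace_scalar -[_ *+ n]mulr_natr divfK// pnatr_eq0 -lt0n. Qed.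

(** On the ball of radius [t^2] the boundary data are matched up to [t^6], and the differential
    inequality of size [O(t^2)] contributes [O(t^2) (t^2)^2]. The total is even of order [t^6]. *)
Lemma frozen_approx t : 0 < t -> t <= 1 -> exists2 h, harmonic_fun h &
  forall y, enorm y <= t ^+ 2 -> `|u y - h y| <= (DD + 2) * t ^+ 5.
Proof.
move=> t0 t1; have t2 : 0 < t ^+ 2 by rewrite exprn_gt0.
have t21 : t ^+ 2 <= 1 by rewrite exprn_ile1// ltW.
have g0 := G_ge0 hp0.1; have n1 : 1 <= n%:R :> R by rewrite ler1n.
have nn0 : 0 < n%:R :> R by lra.
have gn : 0 <= G p0 / n%:R by rewrite divr_ge0.
have ulip z x : enorm z <= n%:R * t ^+ 2 -> enorm x = t ^+ 2 ->
    `|u z - u x| <= (2 * k + 2 * G p0) * enorm (z - x).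
  move=> sn xt; have e0 := enorm_ge0 (z - x).
  have -> : u z - u x = (v z - v x) + G p0 / n%:R * (dot z z - dot x x) by rewrite /u; ring.
  apply: (le_trans (ler_normD _ _)); rewrite mulrDl; apply: lerD.
    apply: (le_trans (phi_lip _ _)); rewrite opprD addrACA subrr add0r -mulmxBl.
    by rewrite [2 * k]mulrC -mulrA ler_wpM2l// shear_enorm.
  rewrite normrM (ger0_norm gn).
  have := @dot_diff_le _ _ x z (n%:R * t ^+ 2); rewrite xt => H.
  have {}H := H (ler_peMl (ltW t2) n1) sn.
  apply: (le_trans (ler_wpM2l gn H)); rewrite enormBC.
  rewrite (_ : _ / _ * _ = 2 * G p0 * enorm (z - x) * t ^+ 2); last by field; rewrite gt_eqF.
  by rewrite ler_piMr// !mulr_ge0.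
have t6 : 0 < t ^+ 6 by rewrite exprn_gt0.
have [h hh hE] := harmonic_replacement n0 t2 t6 ulip.
have cu : continuous u.
  have cv : continuous v.
    apply: (@lipschitz_continuous _ _ v (2 * k)) => x y; apply: (le_trans (phi_lip _ _)).
    rewrite opprD addrACA subrr add0r -mulmxBl [2 * k]mulrC -mulrA.
    by rewrite ler_wpM2l// shear_enorm.
  apply: contD; last exact: Ck_cont (CkZ _ (Ck_dot _ _ 0)).
  exact: contD cv (Ck_cont (Ck_cst _ 0 _)).
have Dt : 0 <= DD * t ^+ 2 by rewrite mulr_ge0 ?DD_ge0// ltW.
have up y : enorm y <= t ^+ 2 -> u y <= h y + t ^+ 6 + (DD * t ^+ 2 + t ^+ 2) * (t ^+ 2) ^+ 2.
  apply: (visc_compare n0 t2 Dt t2 cu hh) => [y' q N s yr s0 hN|y' y'r]; last first.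
    by have := hE _ y'r; rewrite ler_distl => /andP[+ _]; lra.
  have := @frozen_touch_upper y' (q - (2 * (G p0 / n%:R)) *: y') (N - (G p0 / n%:R)%:M) _ s t2 (ltW yr) s0.
  rewrite mxtraceD mxtr_opp tr_frozen_quad => H.
  have {}H := H (ltac:(move=> z zs; have := hN z zs; rewrite /u frozen_quad dotBl qf_mxD qf_mxN;
    move: (v _) (v _) (dot _ z) (dot _ z) (qf _ _) (qf _ _) (_ / _ * _); move=> *; lra)).
  by move: H; lra.
have lo y : enorm y <= t ^+ 2 -> - u y <= - h y + t ^+ 6 + (DD * t ^+ 2 + t ^+ 2) * (t ^+ 2) ^+ 2.
  have hhN : harmonic_fun (fun y => - h y).
    have := harmonicZ (-1) hh; rewrite (_ : (fun y => -1 * h y) = (fun y => - h y))//.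
    by apply/funext => z; rewrite mulN1r.
  have cuN : continuous (fun y => - u y) := @CkN _ _ 0 u cu.
  apply: (visc_compare n0 t2 Dt t2 cuN hhN) => [y' q N s yr s0 hN|y' y'r]; last first.
    by have := hE _ y'r; rewrite ler_distl => /andP[_]; lra.
  have := @frozen_touch_lower y' (- q - (2 * (G p0 / n%:R)) *: y') (- N - (G p0 / n%:R)%:M) _ s t2 (ltW yr) s0.
  rewrite mxtraceD !mxtr_opp tr_frozen_quad => H.
  have {}H := H (ltac:(move=> z zs; have := hN z zs; rewrite /u frozen_quad dotBl dotNl qf_mxD !qf_mxN;
    move: (v _) (v _) (dot _ z) (dot _ z) (qf _ _) (qf _ _) (_ / _ * _); move=> *; lra)).
  by move: H; lra.
exists h => // y yt; have t65 : t ^+ 6 <= t ^+ 5 by rewrite exprS ler_piMl// exprn_ge0// ltW.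
have E : t ^+ 6 + (DD * t ^+ 2 + t ^+ 2) * (t ^+ 2) ^+ 2 <= (DD + 2) * t ^+ 5.
  rewrite (_ : _ + _ = (DD + 2) * t ^+ 6); last by ring.
  by rewrite ler_wpM2l// addr_ge0 ?DD_ge0.
have [X XE] : exists X, X = t ^+ 6 + (DD * t ^+ 2 + t ^+ 2) * (t ^+ 2) ^+ 2 by eexists.
have := up y yt; have := lo y yt; rewrite -(addrA (h y)) -(addrA (- h y)) -XE.
rewrite -XE in E; move: E; move: (u y) (h y) (_ * t ^+ 5) => a b c E h1 h2.
by rewrite ler_norml; apply/andP; split; lra.
Qed.

Lemma frozen_bound y : enorm y <= 1 ^+ 2 -> `|u y| <= 2 * k + g1.
Proof.
rewrite expr1n => y1; have g0 := G_ge0 hp0.1; have n1 : 1 <= n%:R :> R by rewrite ler1n.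
apply: (le_trans (ler_normD _ _)); apply: lerD.
  apply: (le_trans (phi_lip _ _)); rewrite addrC addKr mulrC ler_wpM2r//.
  by rewrite (le_trans (shear_enorm _ _))// ler_piMr.
have y2 : dot y y <= 1 by rewrite -enorm_sqr exprn_ile1 ?enorm_ge0.
rewrite normrM !ger0_norm ?dot_ge0 ?divr_ge0//.
apply: le_trans (G_le hp0.1); rewrite -[leRHS]mulr1; apply: ler_pM; rewrite ?dot_ge0 ?divr_ge0//.
by rewrite ler_pdivrMr ?ler_peMr//; lra.
Qed.

End Frozen.

(** The approximations give a jet of the corrected function; the quadratic correction is put back
    and the change of variables undone. All constants are independent of the point. *)
Lemma visc_jets : exists K t0, 0 < t0 /\ forall x, jet K t0 phi x.
Proof.
have g10 := g1_ge0.
have K0 : 0 <= DD + 2 by rewrite addr_ge0 ?DD_ge0.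
have M0 : 0 <= 2 * k + g1 by rewrite addr_ge0// mulr_ge0.
have [K' HK'] := jets_of_approx n0 K0 M0 ltr01.
exists (kk * (K' + g1) + n%:R ^+ 2 * (K' + g1) * kk ^+ 2 + (K' + g1) * kk ^+ 5), (1 / kk).
split; first by rewrite divr_gt0 ?kk_gt0.
move=> x; have [p hp] := phi_slope x.
have j1 : jet K' 1 (fun y => phi (x + y *m shear p) - phi x + G p / n%:R * dot y y) 0.
  by apply: HK' => [y|t t0 t1]; [exact: frozen_bound|exact: frozen_approx].
have n1 : 1 <= n%:R :> R by rewrite ler1n.
have gn : G p / n%:R <= g1.
  rewrite ler_pdivrMr ?(lt_le_trans ltr01)//; apply: (le_trans (G_le hp.1)).
  by rewrite ler_peMr.
have gn0 : 0 <= G p / n%:R by rewrite divr_ge0// G_ge0//; exact: hp.1.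
have H : jet (K' + g1) 1 (fun y => phi (x + y *m shear p) - phi x + G p / n%:R * dot y y +
    quad (phi x) 0 (- (G p / n%:R)%:M) y) 0.
  apply: jet_add_quad => //; first by rewrite enorm0.
  move=> i j; rewrite !mxE normrN; case: (i == j);
    by rewrite ?mulr1n ?mulr0n ?normr0// ger0_norm.
have Kg : 0 <= K' + g1 by exact: jet_ge0 H.
apply: (@jet_transport _ _ (K' + g1) 1 kk phi x (shear p) (unshear p)) => //.
- by rewrite lerDl sqr_ge0.
- exact: unshear_shear.
- by move=> z; exact: unshear_enorm hp.1.
move: H; congr (jet _ _ _ _); apply/funext => y.
rewrite /quad dot0l qf_mxN qf_scalar.
by move: (phi _) (phi _) (_ * dot _ _) => a b c; ring.
Qed.

Lemma visc_Hol2 : Hol 2 phi.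
Proof.
have [K [t0 [t00 H]]] := visc_jets.
by apply: jets_Hol2 => x0; exists 1, K, t0; split.
Qed.

Lemma trA_trmx p M : trA p M^T = trA p M.
Proof. by rewrite /trA mxtrace_tr /qf bf_dotr trmxK -bf_dotl. Qed.

(** The Hessian is [A + A^T], which doubles the identity of [visc_expands]. *)
Lemma visc_equation x : trA (grad phi x) (hess phi x) = - (2 * G (grad phi x)).
Proof.
have [K [t0 [t00 H]]] := visc_jets; have [p [A [_ _ he]]] := H x.
have h2 := visc_Hol2; have c1 := CkW (Hol_Ck h2).
have gp : grad phi x = p.
  apply/rowP => i; rewrite mxE.
  exact: expands_partial he.
have hA : hess phi x = A + A^T.
  apply/matrixP => i j; rewrite mxE.
  have xr : enorm (x - x) <= 1 / 2 by rewrite subrr enorm0 divr_ge0.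
  have D := jets_is_derive2 i j ltr01 t00 (fun y _ => H y) xr he.
  exact: (@derive_val _ _ _ _ _ _ _ D).
by rewrite hA gp trAD trA_trmx (visc_expands t00 phi_sub phi_sup he); ring.
Qed.

End ViscosityRegularity.

(** * A cubic polynomial with prescribed affine Laplacian *)

Section CubicPotential.
Variables (R : realType) (n : nat).
Local Notation V := 'rV[R]_n.
Implicit Types (x y b p : V) (f g : V -> R) (i j k : 'I_n) (c : R) (M : 'M[R]_n).
Local Notation e_ i := (delta_mx ord0 i : V).

Definition coef p i j : R := (i == j)%:R - p ord0 i * p ord0 j / (1 + dot p p).

Lemma trA_sum p M : trA p M = \sum_(i < n) \sum_(j < n) coef p i j * M i j.
Proof.
rewrite /trA /qf /bf mulr_suml -sumrB; apply: eq_bigr => i _.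
rewrite (_ : M i i = \sum_(j < n) (i == j)%:R * M i j); last first.
  rewrite (bigD1 i)//= eqxx mul1r big1 ?addr0// => j ji.
  by rewrite eq_sym (negbTE ji) mul0r.
by rewrite mulr_suml -sumrB; apply: eq_bigr => j _; rewrite /coef; ring.
Qed.

Lemma shear_coef p i j : ((shear p)^T *m shear p) i j = coef p i j.
Proof.
rewrite shear_sym shear_sqr wlen_sqr !mxE big_ord1 !mxE ord1 /coef.
by rewrite mulrC.
Qed.

(** Separable, with Laplacian [n c + dot b y]: subtracting it removes the first order Taylor
    polynomial of a Laplacian. *)
Definition cubic c b y : R :=
  \sum_(i < n) (c / 2 * (y ord0 i * y ord0 i) +
                b ord0 i / 6 * (y ord0 i * (y ord0 i * y ord0 i))).

Lemma Ck_cubic m c b : Ck m (cubic c b).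
Proof.
apply: Ck_sum => i; have ci : Ck m (fun y : V => y ord0 i) := Ck_coord _ _ _.
exact: (CkD (CkZ _ (CkM ci ci)) (CkZ _ (CkM ci (CkM ci ci)))).
Qed.

Lemma is_derive_eqd f x v (a a' : R) : is_derive x v f a -> a = a' -> is_derive x v f a'.
Proof. by move=> h <-. Qed.

Lemma partial_cubic c b k :
  partial k (cubic c b) = (fun y => c * y ord0 k + b ord0 k / 2 * (y ord0 k * y ord0 k)).
Proof.
apply: partial_eq => y.
have D i := is_derive_coord y (e_ k) i.
have D2 i := is_deriveMf (D i) (D i).
have D3 i := is_deriveMf (D i) (D2 i).
have DS := is_derive_sumf (fun i => is_deriveDf (is_deriveZf (c / 2) (D2 i))
  (is_deriveZf (b ord0 i / 6) (D3 i))).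
apply: (is_derive_eqd DS); rewrite (bigD1 k)//= big1 => [|i ik].
  by rewrite mxE !eqxx /=; field.
by rewrite mxE (negbTE ik) andbF /=; ring.
Qed.

Lemma lap_cubic c b y : lap (cubic c b) y = n%:R * c + dot b y.
Proof.
have E k : partial k (partial k (cubic c b)) y = c + b ord0 k * y ord0 k.
  rewrite partial_cubic.
  have D := is_derive_coord y (e_ k) k.
  have DS := is_deriveDf (is_deriveZf c D) (is_deriveZf (b ord0 k / 2) (is_deriveMf D D)).
  transitivity (c * (e_ k) ord0 k +
    b ord0 k / 2 * ((e_ k) ord0 k * y ord0 k + y ord0 k * (e_ k) ord0 k)).
    exact: (@derive_val _ _ _ _ _ _ _ DS).
  by rewrite mxE !eqxx /=; field.
transitivity (\sum_(k < n) (c + b ord0 k * y ord0 k)); first by apply: eq_bigr => k _; exact: E.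
by rewrite big_split /= sumr_const card_ord -[X in X + _ = _]mulr_natl.
Qed.

Lemma harmonic_sum m (a : 'I_m -> R) (h : 'I_m -> V -> R) : (forall l, harmonic_fun (h l)) ->
  harmonic_fun (fun y => \sum_(l < m) a l * h l y).
Proof.
elim: m a h => [|m IH] a h hh.
  under eq_fun do rewrite big_ord0.
  by split=> [k|y]; [exact: Ck_cst|exact: lap_cst].
under eq_fun do rewrite big_ord_recr /=.
apply: harmonicD; last exact: harmonicZ.
exact: (IH (fun l => a (widen_ord (leqnSn m) l)) (fun l => h (widen_ord (leqnSn m) l))).
Qed.

End CubicPotential.

(** * Uniform constants near a point *)

Section UniformConstants.
Variables (R : realType) (n : nat).
Local Notation V := 'rV[R]_n.
Implicit Types (x y h : V) (f g : V -> R) (r K t : R).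

Lemma ord_uniform m (P : 'I_m -> R -> R -> Prop) :
  (forall l r r' K K', r' <= r -> K <= K' -> P l r K -> P l r' K') ->
  (forall l, exists2 r, 0 < r & exists K, P l r K) ->
  exists2 r, 0 < r & exists2 K, 0 <= K & forall l, P l r K.
Proof.
move=> mono hP.
have [l a b ab [K HK]|r r0 Hr] := ord_radius _ hP; first by exists K; exact: mono HK.
have [l a b ab|//|K K0 HK] := @ord_bound _ m (fun l K => P l r K); first exact: mono.
by exists r => //; exists K.
Qed.

Definition hold_on x0 f r K := forall x h t, enorm (x - x0) <= r -> enorm (x + h - x0) <= r ->
  0 <= t -> enorm h <= t ^+ 2 -> `|f (x + h) - f x| <= K * t /\ `|f x| <= K.

Definition taylor_on x0 f r K := forall x h t, enorm (x - x0) <= r -> enorm (x + h - x0) <= r ->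
  0 <= t -> enorm h <= t ^+ 2 ->
  [/\ `|f (x + h) - f x - dot (grad f x) h| <= K * t ^+ 3, `|f (x + h) - f x| <= K * t ^+ 2,
    `|f x| <= K & enorm (grad f x) <= K].

Lemma hold_on_le x0 f r r' K K' : r' <= r -> K <= K' -> hold_on x0 f r K -> hold_on x0 f r' K'.
Proof.
move=> rr KK H x h t xr yr t0 ht.
have [h1 h2] := H x h t (le_trans xr rr) (le_trans yr rr) t0 ht.
by split; [apply: (le_trans h1); exact: ler_wpM2r|exact: le_trans KK].
Qed.

Lemma taylor_on_le x0 f r r' K K' : r' <= r -> K <= K' -> taylor_on x0 f r K -> taylor_on x0 f r' K'.
Proof.
move=> rr KK H x h t xr yr t0 ht.
have [h1 h2 h3 h4] := H x h t (le_trans xr rr) (le_trans yr rr) t0 ht.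
split; [apply: (le_trans h1)|apply: (le_trans h2)|exact: le_trans KK|exact: le_trans KK];
  by apply: ler_wpM2r => //; exact: exprn_ge0.
Qed.

Lemma hold_on_ex x0 f : hold f -> exists2 r, 0 < r & exists K, hold_on x0 f r K.
Proof.
move=> /(hold_bounded x0)[r [K [r0 K0 [H1 H2]]]]; exists r => //; exists K => x h t xr yr t0 ht.
split; last exact: H1.
by apply: H2 => //; rewrite addrAC subrr add0r.
Qed.

Lemma taylor_on_ex x0 f : Hol 1 f -> exists2 r, 0 < r & exists K, taylor_on x0 f r K.
Proof.
move=> hf; have [r1 [K1 [r10 K10 H1]]] := Hol1_Taylor x0 hf.
have [r2 r20 [K2 H2]] := hold_on_ex x0 (Hol1_hold hf).
have [r3 r30 [K3 K30 H3]] := ord_uniform (fun i r r' K K' => @hold_on_le x0 (partial i f) r r' K K')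
  (fun i => hold_on_ex x0 (Hol_partial i hf)).
exists (Num.min (Num.min r1 r2) r3); first by rewrite !lt_min r10 r20.
have K20 : 0 <= `|K2| := normr_ge0 _; have nK : 0 <= n%:R * K3 by exact: mulr_ge0.
exists (K1 + `|K2| + n%:R * K3) => x h t.
rewrite !le_min -!andbA => /and3P[x1 x2 x3] /and3P[y1 y2 y3] t0 ht.
have [h1 h2] := H1 x h t x1 y1 t0 ht; have [_ h3] := H2 x h t x2 y2 t0 ht.
have le1 : K1 <= K1 + `|K2| + n%:R * K3 by rewrite -addrA lerDl addr_ge0.
split.
- by apply: (le_trans h1); rewrite ler_wpM2r// exprn_ge0.
- by apply: (le_trans h2); rewrite ler_wpM2r// exprn_ge0.
- by apply: (le_trans h3); apply: (le_trans (ler_norm _)); move: K10 nK; lra.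
- rewrite (@le_trans _ _ (n%:R * K3))//; last by rewrite lerDr addr_ge0.
  by apply: enorm_le_coord => i; rewrite mxE; have [] := H3 i x h t x3 y3 t0 ht.
Qed.

End UniformConstants.

Lemma sum2_const (R : realType) (n : nat) (X : R) :
  \sum_(i < n) \sum_(j < n) X = n%:R ^+ 2 * X.
Proof.
under eq_bigr do rewrite sumr_const card_ord -mulr_natl.
by rewrite sumr_const card_ord -[LHS]mulr_natl; ring.
Qed.

Lemma sum_delta (R : realType) (n : nat) (i : 'I_n) (F : 'I_n -> R) :
  \sum_(m < n) (i == m)%:R * F m = F i.
Proof.
rewrite (bigD1 i)//= eqxx mul1r big1 ?addr0// => m mi.
by rewrite eq_sym (negbTE mi) mul0r.
Qed.

(** * A Schauder estimate gaining one derivative *)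

Section SchauderStep.
Variables (R : realType) (n : nat) (k : R) (P : 'rV[R]_n -> 'rV[R]_n) (g w : 'rV[R]_n -> R).
Local Notation V := 'rV[R]_n.
Implicit Types (x y h : V) (r K t : R) (i j l : 'I_n).
Local Notation e_ i := (delta_mx ord0 i : V).
Hypotheses (n0 : (0 < n)%N) (P_le : forall x, enorm (P x) <= k).
Hypothesis coef_Hol : forall i j, Hol 1 (fun x => coef (P x) i j).
Hypotheses (g_Hol : Hol 1 g) (w_Hol : Hol 2 w).
Hypothesis w_eq : forall x, trA (P x) (hess w x) = g x.

Let a i j x := coef (P x) i j.
Let W i j := partial j (partial i w).

Lemma uniform_data xb : exists2 r, 0 < r & exists2 K, 0 <= K &
  [/\ taylor_on xb g r K, taylor_on xb w r K, forall i j, taylor_on xb (a i j) r K &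
    forall i j, hold_on xb (W i j) r K].
Proof.
have [r1 r10 [K1 H1]] := taylor_on_ex xb g_Hol.
have [r2 r20 [K2 H2]] := taylor_on_ex xb (HolW w_Hol).
have [r3 r30 [K3 K30 H3]] := ord_uniform
  (P := fun i r K => forall j, taylor_on xb (a i j) r K)
  (fun i r r' K K' rr KK H j => taylor_on_le rr KK (H j))
  (fun i => let: ex_intro2 r r0 (ex_intro2 K _ H) := ord_uniform
     (fun j r r' K K' => @taylor_on_le _ _ xb (a i j) r r' K K')
     (fun j => taylor_on_ex xb (coef_Hol i j)) in ex_intro2 _ _ r r0 (ex_intro _ K H)).
have [r4 r40 [K4 K40 H4]] := ord_uniform
  (P := fun i r K => forall j, hold_on xb (W i j) r K)
  (fun i r r' K K' rr KK H j => hold_on_le rr KK (H j))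
  (fun i => let: ex_intro2 r r0 (ex_intro2 K _ H) := ord_uniform
     (fun j r r' K K' => @hold_on_le _ _ xb (W i j) r r' K K')
     (fun j => hold_on_ex xb (Hol_partial j (Hol_partial i w_Hol))) in
     ex_intro2 _ _ r r0 (ex_intro _ K H)).
have K10 := normr_ge0 K1; have K20 := normr_ge0 K2.
have k1 := ler_norm K1; have k2 := ler_norm K2.
exists (Num.min (Num.min r1 r2) (Num.min r3 r4)); first by rewrite !lt_min r10 r20 r30.
have m1 : Num.min (Num.min r1 r2) (Num.min r3 r4) <= r1 by rewrite !ge_min lexx.
have m2 : Num.min (Num.min r1 r2) (Num.min r3 r4) <= r2 by rewrite !ge_min lexx orbT.
have m3 : Num.min (Num.min r1 r2) (Num.min r3 r4) <= r3 by rewrite !ge_min lexx !orbT.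
have m4 : Num.min (Num.min r1 r2) (Num.min r3 r4) <= r4 by rewrite !ge_min lexx !orbT.
exists (`|K1| + `|K2| + K3 + K4); first by lra.
split=> [||i j|i j].
- by apply: taylor_on_le m1 _ H1; lra.
- by apply: taylor_on_le m2 _ H2; lra.
- by apply: taylor_on_le m3 _ (H3 i j); lra.
- by apply: hold_on_le m4 _ (H4 i j); lra.
Qed.

Lemma dot_sum m (F : 'I_m -> V) y : dot (\sum_(i < m) F i) y = \sum_(i < m) dot (F i) y.
Proof. by apply: (big_morph (fun p => dot p y)) => [p q|]; rewrite ?dotDl ?dot0l. Qed.

Section Local.
Variables (xb : V) (r K t1 : R).
Hypotheses (r0 : 0 < r) (K0 : 0 <= K) (t10 : 0 < t1) (t11 : t1 <= 1) (t1r : t1 ^+ 2 <= r / 4).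
Hypotheses (hg : taylor_on xb g r K) (hw : taylor_on xb w r K).
Hypothesis ha : forall i j, taylor_on xb (a i j) r K.
Hypothesis hW : forall i j, hold_on xb (W i j) r K.
Variable x0 : V.
Hypothesis x0r : enorm (x0 - xb) <= r / 2.

Let p := P x0.
Let v y := w (x0 + y *m shear p).
Let Bv := grad g x0 - \sum_(i < n) \sum_(j < n) W i j x0 *: grad (a i j) x0.
Let b := Bv *m shear p.
Let E := 8 * K + 16 * n%:R ^+ 2 * K ^+ 2.

Lemma in_ball y t : 0 <= t -> t <= t1 -> enorm y <= t ^+ 2 ->
  enorm (x0 + y *m shear p - xb) <= r.
Proof.
move=> t0 tt1 yt; rewrite addrAC; apply: (le_trans (enormD _ _)).
have := shear_enorm p y; have : t ^+ 2 <= t1 ^+ 2 by rewrite lerXn2r ?nnegrE ?(ltW t10).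
by move: yt x0r t1r; move: (t ^+ 2) (t1 ^+ 2) => *; lra.
Qed.

Lemma x0_in : enorm (x0 - xb) <= r.
Proof. by move: x0r r0; lra. Qed.

Lemma lap_shear y : lap v y = \sum_(i < n) \sum_(j < n) a i j x0 * W i j (x0 + y *m shear p).
Proof.
rewrite /v (lap_affm x0 (shear p) y (Hol_Ck w_Hol)).
by apply: eq_bigr => i _; apply: eq_bigr => j _; rewrite shear_coef.
Qed.

Lemma E_ge0 : 0 <= E.
Proof.
have := sqr_ge0 K; have := sqr_ge0 (n%:R : R) => h1 h2.
have := mulr_ge0 h1 h2; rewrite /E -mulrA; move: (_ * _ ^+ 2) K0 => c; lra.
Qed.

Lemma lap_expansion y t : 0 <= t -> t <= t1 -> enorm y <= t ^+ 2 ->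
  `|lap v y - (g x0 + dot b y)| <= E * t ^+ 3.
Proof.
move=> t0 tt1 yt; have [h hE] : exists h, h = y *m shear p by eexists.
have xin : enorm (x0 + h - xb) <= r by rewrite hE; exact: in_ball tt1 yt.
have ht : enorm h <= (2 * t) ^+ 2.
  rewrite hE (le_trans (shear_enorm _ _))// exprMn expr2.
  by move: yt (enorm_ge0 y) (sqr_ge0 t); move: (t ^+ 2) => *; lra.
have t20 : 0 <= 2 * t by rewrite mulr_ge0.
have bE : dot b y = dot Bv h by rewrite hE dot_mulmx shear_sym.
have [g1 _ _ _] := hg x0_in xin t20 ht.
have -> : lap v y - (g x0 + dot b y) = (g (x0 + h) - g x0 - dot (grad g x0) h) -
   \sum_(i < n) \sum_(j < n) ((a i j (x0 + h) - a i j x0 - dot (grad (a i j) x0) h) * W i j x0 +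
      (a i j (x0 + h) - a i j x0) * (W i j (x0 + h) - W i j x0)).
  rewrite bE lap_shear -hE -(w_eq (x0 + h)) trA_sum /Bv dotBl dot_sum.
  under [in LHS]eq_bigr => i _ do under eq_bigr => j _ do rewrite -[W i j (x0 + h)]/(W i j (x0 + h)).
  rewrite [X in _ = _ - g x0 - _ - X](_ : _ =
     \sum_(i < n) \sum_(j < n) coef (P (x0 + h)) i j * hess w (x0 + h) i j -
     \sum_(i < n) \sum_(j < n) a i j x0 * W i j (x0 + h) -
     \sum_(i < n) dot (\sum_(j < n) W i j x0 *: grad (a i j) x0) h).
    by move: (\sum_(i < n) _) (\sum_(i < n) _) (\sum_(i < n) _) (dot _ h) => *; ring.
  rewrite -!sumrB; apply: eq_bigr => i _; rewrite dot_sum -!sumrB; apply: eq_bigr => j _.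
  rewrite dotZl mxE -/(W i j) -/(a i j (x0 + h)).
  by move: (a i j _) (a i j _) (W i j _) (W i j _) (dot _ _) => *; ring.
apply: (le_trans (ler_normB _ _)).
have -> : E * t ^+ 3 = K * (2 * t) ^+ 3 +
    \sum_(i < n) \sum_(j < n) (K * (2 * t) ^+ 3 * K + K * (2 * t) ^+ 2 * (K * (2 * t))).
  by rewrite sum2_const /E; ring.
apply: lerD => //; apply: (le_trans (ler_norm_sum _ _ _)); apply: ler_sum => i _.
apply: (le_trans (ler_norm_sum _ _ _)); apply: ler_sum => j _.
have [a1 a2 _ _] := ha i j x0_in xin t20 ht; have [W1 W2] := hW i j x0_in xin t20 ht.
by apply: (le_trans (ler_normD _ _)); rewrite !normrM; apply: lerD; apply: ler_pM.
Qed.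

Lemma Bv_le : enorm Bv <= K + n%:R ^+ 2 * K ^+ 2.
Proof.
have z0 : enorm (0 : V) <= 0 ^+ 2 by rewrite enorm0 expr0n.
have xin : enorm (x0 + 0 - xb) <= r by rewrite addr0 x0_in.
have [_ _ _ g1] := hg x0_in xin (lexx 0) z0.
apply: (le_trans (enormB _ _)); apply: lerD => //; apply: (le_trans (enorm_sum _)).
have -> : n%:R ^+ 2 * K ^+ 2 = \sum_(i < n) \sum_(j < n) (K * K).
  by rewrite sum2_const; ring.
apply: ler_sum => i _; apply: (le_trans (enorm_sum _)); apply: ler_sum => j _.
have [_ _ _ a1] := ha i j x0_in xin (lexx 0) z0; have [_ W1] := hW i j x0_in xin (lexx 0) z0.
by rewrite enormZ; apply: ler_pM => //; exact: enorm_ge0.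
Qed.

Let c := g x0 / n%:R.
Let u y := v y - cubic c b y.

Lemma Ck_v : Ck 2 v.
Proof. exact: (@Ck_aff _ _ x0 (shear p) 2 w (Hol_Ck w_Hol)). Qed.

Lemma Ck_u : Ck 2 u.
Proof. exact: (CkB Ck_v (Ck_cubic 2 c b)). Qed.

Lemma lap_u y t : 0 <= t -> t <= t1 -> enorm y <= t ^+ 2 -> `|lap u y| <= E * t ^+ 3.
Proof.
move=> t0 tt1 yt; have := lap_expansion t0 tt1 yt; congr (`|_| <= _).
rewrite /u (lapB y Ck_v (Ck_cubic 2 c b)) lap_cubic /c mulrC divfK//.
by rewrite pnatr_eq0 -lt0n.
Qed.

(** On the ball of radius [t^2] the harmonic replacement of [u] has error [(1 + E) t^7]; the
    gradient estimate divides by the radius and leaves [t^5]. *)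
Lemma gradient_approx t : 0 < t -> t <= t1 -> exists2 h, harmonic_fun h &
  forall y l, enorm y <= t ^+ 2 / 2 ->
    `|partial l u y - partial l h y| <= (2 * n%:R * (1 + E) + E) * t ^+ 5.
Proof.
move=> t0 tt1; have t2 : 0 < t ^+ 2 by rewrite exprn_gt0.
have n1 : 1 <= n%:R :> R by rewrite ler1n.
have nt : 0 <= n%:R * t ^+ 2 by rewrite mulr_ge0 ?(ltW t2).
have [L L0 HL] := Ck1_lipschitz 0 (CkW Ck_u) nt.
have t7 : 0 < t ^+ 7 by rewrite exprn_gt0.
have ulip z x : enorm z <= n%:R * t ^+ 2 -> enorm x = t ^+ 2 ->
    `|u z - u x| <= L * enorm (z - x).
  by move=> zt xt; apply: HL; rewrite subr0// xt ler_peMl ?(ltW t2).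
have [h hh hE] := harmonic_replacement n0 t2 t7 ulip.
exists h => // y l yt.
have cf : Ck 2 (fun z => u z - h z) := CkB Ck_u (hh.1 2%N).
have lf z : lap (fun z => u z - h z) z = lap u z by rewrite (lapB z Ck_u (hh.1 2%N)) hh.2 subr0.
have Et : 0 <= E * t ^+ 3 by rewrite mulr_ge0 ?E_ge0 ?exprn_ge0 ?(ltW t0).
have lb z : enorm z <= t ^+ 2 -> `|lap (fun z => u z - h z) z| <= E * t ^+ 3.
  by rewrite lf; apply: lap_u => //; exact: ltW.
have fb z : enorm z <= t ^+ 2 -> `|u z - h z| <= t ^+ 7 + E * t ^+ 3 * (t ^+ 2) ^+ 2.
  apply: (ball_bound (f := fun z => u z - h z) n0 Et cf lb) => x xt.
  by rewrite distrC; exact: hE.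
have d0 : 0 < t ^+ 2 / 2 by rewrite divr_gt0.
have near z : enorm (z - y) <= t ^+ 2 / 2 -> enorm z <= t ^+ 2.
  by move=> zy; have := enormD (z - y) y; rewrite subrK; move: yt zy; move: (t ^+ 2) => *; lra.
have := gradient_estimate l cf d0 Et (fun z zy => fb z (near z zy)) (fun z zy => lb z (near z zy)).
rewrite (partialB l (CkW Ck_u) (hh.1 1%N)) => /le_trans; apply.
rewrite (_ : n%:R * _ / _ + _ = (2 * n%:R * (1 + E) + E / 2) * t ^+ 5); last first.
  by move: (E) => E'; field; rewrite gt_eqF.
rewrite ler_wpM2r ?exprn_ge0 ?(ltW t0)// lerD2l ler_pdivrMr// ler_peMr ?E_ge0//; lra.
Qed.

Let c1 := 1 + k ^+ 2.
Let K1 := K * c1 + c1 * (2 * (K + n%:R ^+ 2 * K ^+ 2)).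

Lemma c1_ge1 : 1 <= c1.
Proof. by rewrite lerDl sqr_ge0. Qed.

Lemma unshear_row_le i : enorm (row i (unshear p)) <= c1.
Proof.
by rewrite rowE; apply: (le_trans (unshear_enorm _ (P_le x0))); rewrite enorm_delta mulr1.
Qed.

Lemma unshear_entry_le i j : `|unshear p i j| <= c1.
Proof.
by apply: le_trans (unshear_row_le i); have := coord_le (row i (unshear p)) j; rewrite mxE.
Qed.

Let A i : 'M[R]_n := \matrix_(l, m) ((l == m)%:R * (unshear p i l * (b ord0 l / 2))).

Lemma K1_parts : [/\ 0 <= K * c1, 0 <= c1 * (2 * (K + n%:R ^+ 2 * K ^+ 2)) & 0 <= K1].
Proof.
have c10 : 0 <= c1 by apply: le_trans c1_ge1; exact: ler01.
have h1 : 0 <= K * c1 by exact: mulr_ge0.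
have h2 : 0 <= c1 * (2 * (K + n%:R ^+ 2 * K ^+ 2)).
  by do 2 apply: mulr_ge0 => //; apply: addr_ge0 => //; apply: mulr_ge0; exact: sqr_ge0.
by split=> //; exact: addr_ge0.
Qed.

Lemma A_le i l m : `|A i l m| <= K1.
Proof.
have [h1 h2 h3] := K1_parts; rewrite mxE; case: (l == m); last by rewrite mulr0n mul0r normr0.
rewrite mulr1n mul1r normrM; apply: (@le_trans _ _ (c1 * (2 * (K + n%:R ^+ 2 * K ^+ 2)))).
  apply: ler_pM => //; first exact: unshear_entry_le.
  rewrite normrM [`|2^-1|]ger0_norm ?invr_ge0// ler_pdivrMr//.
  have bl : `|b ord0 l| <= 2 * (K + n%:R ^+ 2 * K ^+ 2).
    apply: (le_trans (coord_le _ _)); apply: (le_trans (shear_enorm _ _)).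
    by rewrite ler_wpM2l// Bv_le.
  by apply: (le_trans bl); rewrite ler_peMr ?(le_trans _ bl)//; lra.
by rewrite lerDr.
Qed.

Lemma c_row_le i : enorm (c *: row i (unshear p)) <= K1.
Proof.
have [h1 h2 h3] := K1_parts; apply: (@le_trans _ _ (K * c1)); last by rewrite lerDl.
rewrite enormZ; apply: ler_pM; rewrite ?enorm_ge0 ?unshear_row_le//.
have z0 : enorm (0 : V) <= 0 ^+ 2 by rewrite enorm0 expr0n.
have xin : enorm (x0 + 0 - xb) <= r by rewrite addr0 x0_in.
have [_ _ g1 _] := hg x0_in xin (lexx 0) z0.
have n1 : 1 <= n%:R :> R by rewrite ler1n.
rewrite /c normrM normfV [`|n%:R|]ger0_norm// ler_pdivrMr ?(lt_le_trans ltr01)//.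
by apply: (le_trans g1); rewrite ler_peMr.
Qed.

(** A derivative of [w] in the new coordinates, minus the matching combination of derivatives of the
    cubic; by [U_sum] it is a combination of the [partial l u], hence well approximated by harmonic
    functions. *)
Let U i y := partial i w (x0 + y *m shear p) - quad 0 (c *: row i (unshear p)) (A i) y.

Lemma U_sum i y : U i y = \sum_(l < n) unshear p i l * partial l u y.
Proof.
have Pu l : partial l u y = \sum_(m < n) shear p l m * partial m w (x0 + y *m shear p) -
    (c * y ord0 l + b ord0 l / 2 * (y ord0 l * y ord0 l)).
  rewrite /u (partialB l (CkW Ck_v) (Ck_cubic 1 c b)) partial_cubic.
  by rewrite /v (partial_affm x0 (shear p) l (CkW (Hol_Ck w_Hol))).
under eq_bigr do rewrite Pu mulrBr; rewrite sumrB /U; congr (_ - _).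
  have TS m : \sum_(l < n) unshear p i l * shear p l m = (i == m)%:R.
    by have := congr1 (fun M : 'M[R]_n => M i m) (unshear_shear p); rewrite !mxE.
  rewrite -(sum_delta i (fun m => partial m w (x0 + y *m shear p))).
  under [RHS]eq_bigr do rewrite mulr_sumr; rewrite exchange_big /=.
  by apply: eq_bigr => m _; rewrite -TS mulr_suml; apply: eq_bigr => l _; rewrite mulrA.
rewrite /quad add0r /dot /qf /bf -big_split; apply: eq_bigr => l _ /=.
rewrite (bigD1 l)//= big1 ?addr0 => [|m ml].
  by rewrite !mxE eqxx mulr1n; ring.
by rewrite mxE eq_sym (negbTE ml) mulr0n mul0r mulr0 mul0r.
Qed.

Lemma U_bound i y : enorm y <= (t1 / 2) ^+ 2 -> `|U i y| <= K + K1 + n%:R ^+ 2 * K1.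
Proof.
move=> yt; have [_ _ h3] := K1_parts.
have th : 0 <= t1 / 2 by rewrite divr_ge0// ltW.
have tt : t1 / 2 <= t1 by move: t10; lra.
have xin := in_ball th tt yt.
have y1 : enorm y <= 1 by rewrite (le_trans yt)// exprn_ile1//; move: t11; lra.
have z0 : enorm (0 : V) <= 0 ^+ 2 by rewrite enorm0 expr0n.
have xin' : enorm (x0 + y *m shear p + 0 - xb) <= r by rewrite addr0.
have [_ _ _ w1] := hw xin xin' (lexx 0) z0.
rewrite /U /quad add0r; apply: (le_trans (ler_normB _ _)); rewrite -addrA; apply: lerD.
  by have := coord_le (grad w (x0 + y *m shear p)) i; rewrite mxE => /le_trans; apply.
apply: (le_trans (ler_normD _ _)); apply: lerD.
  apply: (le_trans (ler_norm_dot _ _)); rewrite -[K1]mulr1.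
  by apply: ler_pM; rewrite ?enorm_ge0// c_row_le.
apply: (le_trans (mxbound_entry y (A_le i))); rewrite ler_piMr ?exprn_ile1 ?enorm_ge0//.
by apply: mulr_ge0 => //; exact: sqr_ge0.
Qed.

Lemma U_approx i t : 0 < t -> t <= t1 / 2 -> exists2 h, harmonic_fun h &
  forall y, enorm y <= t ^+ 2 ->
    `|U i y - h y| <= n%:R * c1 * (2 * n%:R * (1 + E) + E) * 32 * t ^+ 5.
Proof.
move=> t0 tt; have t20 : 0 < 2 * t by rewrite mulr_gt0.
have [|h hh hE] := gradient_approx t20; first by move: tt; lra.
exists (fun y => \sum_(l < n) unshear p i l * partial l h y) => [|y yt].
  by apply: harmonic_sum => l; exact: harmonic_partial.
rewrite U_sum -sumrB.
have -> : n%:R * c1 * (2 * n%:R * (1 + E) + E) * 32 * t ^+ 5 =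
    \sum_(l < n) c1 * ((2 * n%:R * (1 + E) + E) * (2 * t) ^+ 5).
  by rewrite sumr_const card_ord -[RHS]mulr_natl; move: (c1) (E) => *; ring.
apply: (le_trans (ler_norm_sum _ _ _)); apply: ler_sum => l _.
rewrite -mulrBr normrM; apply: ler_pM => //; first exact: unshear_entry_le.
apply: hE; rewrite exprMn expr2; move: yt (sqr_ge0 t); move: (t ^+ 2) => *; lra.
Qed.

Lemma U_jet i K' : jet K' (t1 / 2) (U i) 0 ->
  jet (c1 * (K' + K1) + n%:R ^+ 2 * (K' + K1) * c1 ^+ 2 + (K' + K1) * c1 ^+ 5)
    (t1 / 2 / c1) (partial i w) x0.
Proof.
move=> hj; have [_ _ h3] := K1_parts.
have H := jet_add_quad 0 h3 (c_row_le i) (A_le i) hj.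
apply: (@jet_transport _ _ (K' + K1) (t1 / 2) c1 (partial i w) x0 (shear p) (unshear p)).
- exact: c1_ge1.
- exact: jet_ge0 H.
- exact: unshear_shear.
- by move=> z; exact: unshear_enorm (P_le x0).
by move: H; congr (jet _ _ _ _); apply/funext => y; rewrite /U subrK.
Qed.

End Local.

(** The iteration is applied to the first derivatives of [w]: they have harmonic approximations of
    order 5/2, so they are C^{2,1/2}. *)
Lemma schauder_step : Hol 3 w.
Proof.
have cw := Hol_Ck w_Hol; split; first exact: Ck_cont cw.
move=> i; split=> [x|]; first by have [] := Ck_partial_is_derive x i cw.
apply: jets_Hol2 => xb; have [r r0 [K K0 [hg hw ha hW]]] := uniform_data xb.
have [|t1 [t10 t11 _ _ t1r]] := @small_time R (r / 4) 1 _ ltr01; first by rewrite divr_gt0.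
have t20 : 0 < t1 / 2 by rewrite divr_gt0.
have c1 : 1 <= 1 + k ^+ 2 by rewrite lerDl sqr_ge0.
have E0 : 0 <= 8 * K + 16 * n%:R ^+ 2 * K ^+ 2 := E_ge0 K0.
have N1 : 0 <= n%:R * (1 + k ^+ 2) *
    (2 * n%:R * (1 + (8 * K + 16 * n%:R ^+ 2 * K ^+ 2)) + (8 * K + 16 * n%:R ^+ 2 * K ^+ 2)) * 32.
  apply: mulr_ge0 => //; apply: mulr_ge0; first by apply: mulr_ge0 => //; exact: le_trans c1.
  by apply: addr_ge0 => //; apply: mulr_ge0; [exact: mulr_ge0|exact: addr_ge0].
have [_ _ h3] := K1_parts K0.
have N2 : 0 <= K + (K * (1 + k ^+ 2) + (1 + k ^+ 2) * (2 * (K + n%:R ^+ 2 * K ^+ 2))) +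
    n%:R ^+ 2 * (K * (1 + k ^+ 2) + (1 + k ^+ 2) * (2 * (K + n%:R ^+ 2 * K ^+ 2))).
  by apply: addr_ge0; [exact: addr_ge0|apply: mulr_ge0 => //; exact: sqr_ge0].
have [K' HK'] := jets_of_approx n0 N1 N2 t20.
eexists (r / 2), _, (t1 / 2 / (1 + k ^+ 2)); split; [by rewrite divr_gt0| |].
  by rewrite divr_gt0// (lt_le_trans ltr01).
move=> x0 x0r; apply: (U_jet (K' := K') r0 K0 hg ha hW x0r); apply: HK' => [y|t t0 tt].
  exact: (U_bound r0 K0 t10 t11 t1r hg hw ha hW x0r).
exact: (U_approx r0 K0 t10 t1r hg ha hW x0r).
Qed.

End SchauderStep.

Lemma sum2D (R : realType) (n : nat) (F G : 'I_n -> 'I_n -> R) :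
  \sum_(i < n) \sum_(j < n) (F i j + G i j) =
  \sum_(i < n) \sum_(j < n) F i j + \sum_(i < n) \sum_(j < n) G i j.
Proof. by rewrite -big_split; apply: eq_bigr => i _; rewrite -big_split. Qed.

(** * Higher regularity by differentiating the equation *)

Section Bootstrap.
Variables (R : realType) (n : nat) (k : R) (P : 'rV[R]_n -> 'rV[R]_n).
Local Notation V := 'rV[R]_n.
Implicit Types (g w : V -> R) (m : nat) (i j l : 'I_n).
Hypotheses (n0 : (0 < n)%N) (P_le : forall x, enorm (P x) <= k).

(** Once [w] is C^{3,1/2} the equation can be differentiated: [partial e w] solves an equation with
    the same coefficients, whose right-hand side contains second derivatives of [w]. The induction
    hypothesis is applied to [w], for the regularity of that right-hand side, and then to
    [partial e w]. *)
Lemma schauder m w g : (forall i j, Hol m.+1 (fun x => coef (P x) i j)) -> Hol m.+1 g ->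
  Hol 2 w -> (forall x, trA (P x) (hess w x) = g x) -> Hol m.+3 w.
Proof.
elim: m w g => [|m IH] w g ha hg hw E; first exact: schauder_step P_le ha hg hw E.
have ha' i j : Hol m.+1 (fun x => coef (P x) i j) by exact (HolW (ha i j)).
have w3 : Hol 3 w.
  apply: (schauder_step n0 P_le _ _ hw E) => [i j|].
    by apply: Hol_le (ha i j).
  by apply: Hol_le hg.
have wm : Hol m.+3 w by exact: (IH w g ha' (HolW hg) hw E).
have c3 := Hol_Ck w3.
split; first exact: Ck_cont c3.
move=> e; split=> [x|]; first by have [] := Ck_partial_is_derive x e c3.
have wW i j : Hol m.+1 (partial j (partial i w)) by exact (Hol_partial j (Hol_partial i wm)).
apply: (IH (partial e w) (fun x => partial e g x - \sum_(i < n) \sum_(j < n)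
    partial e (fun y => coef (P y) i j) x * partial j (partial i w) x)).
- exact: ha'.
- apply: HolB; first exact (Hol_partial e hg).
  apply: Hol_sum => i; apply: Hol_sum => j; apply: HolM => //.
  exact (Hol_partial e (ha i j)).
- exact (Hol_partial e w3).
move=> x; rewrite trA_sum.
have gE : g = (fun x => \sum_(i < n) \sum_(j < n) coef (P x) i j * partial j (partial i w) x).
  apply/funext => y; rewrite -E trA_sum; apply: eq_bigr => i _; apply: eq_bigr => j _.
  by rewrite mxE.
have D i j : is_derive x (delta_mx ord0 e : V) (fun x => coef (P x) i j * partial j (partial i w) x)
   (partial e (fun y => coef (P y) i j) x * partial j (partial i w) x +
    coef (P x) i j * partial e (partial j (partial i w)) x).
  apply: is_deriveMf; first exact: Ck_partial_is_derive (Hol_Ck (ha' i j)).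
  exact: Ck_partial_is_derive (Ck_partial j (Ck_partial i c3)).
have S i j : partial j (partial i (partial e w)) = partial e (partial j (partial i w)).
  by rewrite (schwarz e i (CkW c3)) (schwarz e j (Ck_partial i c3)).
have DS := is_derive_sumf (fun i => is_derive_sumf (fun j => D i j)).
have -> : partial e g x = \sum_(i < n) \sum_(j < n)
    (partial e (fun y => coef (P y) i j) x * partial j (partial i w) x +
    coef (P x) i j * partial e (partial j (partial i w)) x).
  by rewrite gE; exact: (@derive_val _ _ _ _ _ _ _ DS).
rewrite sum2D [X in X - _]addrC addrK; apply: eq_bigr => i _; apply: eq_bigr => j _.
by rewrite -S mxE.
Qed.

End Bootstrap.

(** * Conclusion: the equation, smoothness and behaviour at infinity *)

Section Assembly.
Variables (R : realType) (n : nat).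
Local Notation V := 'rV[R]_n.
Implicit Types (x y p q : V) (phi : V -> R) (k c e : R).
Local Notation e_ i := (delta_mx ord0 i : V).

Lemma half_speed_bounds k c0 p : 0 <= k -> 0 < c0 -> enorm p <= k ->
  0 <= half_speed k c0 p <= c0 / 2 * Num.sqrt (1 + k ^+ 2).
Proof.
move=> k0 c00 pk; have pk2 : dot p p <= k ^+ 2.
  by rewrite -enorm_sqr lerXn2r ?nnegrE ?enorm_ge0.
have c2 : 0 <= c0 / 2 by rewrite divr_ge0// ltW.
rewrite mulr_ge0//=; last by rewrite subr_ge0 ler_wsqrtr// lerD2l.
by rewrite ler_wpM2l// gerBl sqrtr_ge0.
Qed.

Lemma half_speed_lipschitz k c0 p q : 0 <= k -> 0 < c0 -> enorm p <= k -> enorm q <= k ->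
  `|half_speed k c0 p - half_speed k c0 q| <= c0 * k * enorm (p - q).
Proof.
move=> k0 c00 pk qk; have c2 : 0 <= c0 / 2 by rewrite divr_ge0// ltW.
have -> : half_speed k c0 p - half_speed k c0 q = c0 / 2 * (wlen q - wlen p).
  by rewrite /half_speed /wlen; ring.
rewrite normrM (ger0_norm c2) (_ : c0 * k * _ = c0 / 2 * (2 * k * enorm (p - q))); last by field.
rewrite ler_wpM2l//; apply: le_trans (dot_diff_le pk qk).
have -> : dot q q - dot p p = (wlen q - wlen p) * (wlen q + wlen p).
  by rewrite -subr_sqr !wlen_sqr; ring.
have wq := wlen_ge1 q; have wp := wlen_ge1 p.
by rewrite normrM ler_peMr// ger0_norm; lra.
Qed.

(** Product rule for the normalised gradient; the symmetry of the Hessian identifies the derivative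
    of the length with the quadratic form in [trA]. *)
Lemma divergence_eq phi x : Ck 2 phi ->
  divergence (fun y => (Num.sqrt (1 + enorm (grad phi y) ^+ 2))^-1 *: grad phi y) x =
  (wlen (grad phi x))^-1 * trA (grad phi x) (hess phi x).
Proof.
move=> c2; have [w0 _] := wlen_neq0 (grad phi x).
have wE y : Num.sqrt (1 + enorm (grad phi y) ^+ 2) = wlen (grad phi y) by rewrite enorm_sqr.
have D1 i j y : is_derive y (e_ i) (partial j phi) (partial i (partial j phi) y).
  exact: Ck_partial_is_derive (Ck_partial j c2).
have N0 y : 0 < 1 + \sum_(j < n) partial j phi y * partial j phi y.
  by rewrite ltr_pwDl// sumr_ge0// => j _; rewrite -expr2 sqr_ge0.
have wS y : wlen (grad phi y) = Num.sqrt (1 + \sum_(j < n) partial j phi y * partial j phi y).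
  by congr Num.sqrt; congr (_ + _); apply: eq_bigr => j _; rewrite !mxE.
have s0 y : Num.sqrt (1 + \sum_(j < n) partial j phi y * partial j phi y) != 0.
  by rewrite gt_eqF// sqrtr_gt0.
have DN i := is_deriveDf (is_derive_cst (1 : R) x (e_ i)) (is_derive_sumf (fun j =>
  is_deriveMf (D1 i j x) (D1 i j x))).
have DV i := is_derive_invf (s0 x) (is_derive_sqrtf (N0 x) (DN i)).
have DF i := is_deriveMf (DV i) (D1 i i x).
rewrite /divergence.
transitivity (\sum_(i < n) ((wlen (grad phi x))^-1 * hess phi x i i -
  (wlen (grad phi x))^-1 / (1 + dot (grad phi x) (grad phi x)) *
   \sum_(j < n) grad phi x ord0 i * hess phi x i j * grad phi x ord0 j)).
  apply: eq_bigr => i _.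
  rewrite (_ : (fun y => _) = (fun y => (Num.sqrt (1 + \sum_(j < n) partial j phi y * partial j phi y))^-1 * partial i phi y)); last first.
    by apply/funext => y; rewrite !mxE wE wS.
  apply: (etrans (@derive_val _ _ _ _ _ _ _ (DF i))).
  rewrite -wS add0r -wlen_sqr !mxE.
  have -> : \sum_(j < n) (partial i (partial j phi) x * partial j phi x +
      partial j phi x * partial i (partial j phi) x) =
      2 * \sum_(j < n) hess phi x i j * partial j phi x.
    rewrite mulr_sumr; apply: eq_bigr => j _; rewrite mxE (schwarz i j c2); ring.
  have -> : \sum_(j < n) partial i phi x * hess phi x i j * grad phi x ord0 j =
      partial i phi x * \sum_(j < n) hess phi x i j * partial j phi x.
    by rewrite mulr_sumr; apply: eq_bigr => j _; rewrite [grad _ _ _ _]mxE mulrA.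
  move: (\sum_(j < n) _) (partial i phi x) (partial i _ x) => s p q.
  by move: (wlen _) w0 => w w0; field.
rewrite sumrB -!mulr_sumr /trA mulrBr -/(bf _ _ _) -/(qf _ _); congr (_ - _).
by rewrite /qf /bf mulrA mulrAC.
Qed.

Lemma mean_curvature_eq k c0 phi x : Ck 2 phi ->
  trA (grad phi x) (hess phi x) = - (2 * half_speed k c0 (grad phi x)) ->
  forced_mean_curvature c0 (c0 * Num.sqrt (1 + k ^+ 2)) phi x = 0.
Proof.
move=> c2 E; rewrite /forced_mean_curvature divergence_eq// E /half_speed enorm_sqr.
have [w0 _] := wlen_neq0 (grad phi x); rewrite -/(wlen _).
by move: (Num.sqrt _) (wlen _) w0 => s w w0; field.
Qed.

Lemma slope_grad C k phi x p : 0 < C -> slope k C phi x p -> grad phi x = p.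
Proof.
move=> C0 [_ hp]; apply/rowP => i; rewrite mxE.
have D : is_derive x (e_ i) phi (p ord0 i).
  apply/is_deriveP => e e0; exists (e / C); first exact: divr_gt0.
  move=> t te; have [h1 h2] := hp (t *: e_ i).
  move: h1 h2; rewrite dotZr dotZr dotZl !dot_delta mxE !eqxx /= mulr1 => h1 h2.
  have t2 : C * (t * t) <= e * `|t|.
    rewrite -(ger0_norm (_ : 0 <= t * t)) -?expr2 ?sqr_ge0// normrX expr2 mulrA.
    by rewrite ler_wpM2r// mulrC -ler_pdivlMr// ltW.
  have et : 0 <= e * `|t| by rewrite mulr_ge0// ltW.
  rewrite ler_norml; apply/andP; split; first by move: h1 t2; lra.
  by move: h2 et; lra.
exact: (@derive_val _ _ _ _ _ _ _ D).
Qed.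

Lemma cvx_comb_concave phi : cvx_comb phi -> concave phi.
Proof.
move=> h t x y _ _; rewrite -convN lerN2 convRE.
by apply: h => //; rewrite ?subr_ge0// addrC subrK.
Qed.

(** For a given [e] finitely many planes are involved; their offsets have a common bound, negligible
    against [e |x| / 2] far away. *)
Lemma littleo_of_supports phi u (nu : nat -> V) k (off : nat -> R) :
  (forall e, 0 < e -> exists I : nat, forall x, exists2 i, (i <= I)%N &
    k * dot (nu i) x <= u x + e * enorm x) ->
  (forall x, u x <= phi x) -> (forall i x, phi x <= dot (k *: nu i) x + off i) ->
  phi = u +o_ (enorm_infty R n) (@enorm R n).
Proof.
move=> dense lo hi; apply/eqaddoP => e e0.
have [I hI] := dense (e / 2) (divr_gt0 e0 (ltr0Sn _ _)).
have [Om offO] : exists Om, forall i, (i <= I)%N -> off i <= Om.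
  exists (\sum_(i < I.+1) `|off i|) => i iI; apply: (le_trans (ler_norm _)).
  by rewrite (bigD1 (Ordinal (iI : (i < I.+1)%N)))//= lerDl sumr_ge0.
exists (2 * Om / e) => // x /= xM.
have [i iI hx] := hI x; have h1 := lo x; have h2 := hi i x; have h3 := offO i iI.
rewrite dotZl in h2; rewrite ltr_pdivrMr// in xM.
rewrite -[(phi - u) x]/(phi x - u x) [X in _ <= _ * X]ger0_norm ?enorm_ge0//.
rewrite ger0_norm ?subr_ge0//; move: (enorm x) xM hx h1 h2 h3 => X; move: (k * dot _ _) (off i) => *; lra.
Qed.

(** Coefficients and right-hand side are smooth functions of the gradient: they inherit its
    regularity, and the Schauder estimate gains one order each time. *)
Lemma bootstrap_smooth k c phi : (0 < n)%N -> (forall x, enorm (grad phi x) <= k) ->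
  Hol 2 phi -> (forall x, trA (grad phi x) (hess phi x) = - (2 * half_speed k c (grad phi x))) ->
  Csmooth phi.
Proof.
move=> n0 gk h2 E; suff H m : Hol m.+2 phi.
  by move=> m; exact: Hol_Ck (HolW (HolW (H m))).
elim: m => [//|m IH].
have hp i : Hol m.+1 (partial i phi) := Hol_partial i IH.
have hN : Hol m.+1 (fun x => 1 + dot (grad phi x) (grad phi x)).
  apply: HolD; first exact: Hol_cst.
  have -> : (fun x => dot (grad phi x) (grad phi x)) =
      (fun x => \sum_(i < n) partial i phi x * partial i phi x).
    by apply/funext => x; apply: eq_bigr => i _; rewrite !mxE.
  by apply: Hol_sum => i; exact: HolM.
have N1 x : 1 <= 1 + dot (grad phi x) (grad phi x) by rewrite lerDl dot_ge0.
apply: (@schauder _ _ k (grad phi) n0 gk m phi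
    (fun x => - (2 * half_speed k c (grad phi x)))) => // [i j|].
  have -> : (fun x => coef (grad phi x) i j) = (fun x => (i == j)%:R -
      partial i phi x * partial j phi x * (1 + dot (grad phi x) (grad phi x))^-1).
    by apply/funext => x; rewrite /coef !mxE.
  apply: HolB; first exact: Hol_cst.
  by apply: HolM; [exact: HolM|exact: Hol_inv].
apply: HolN; do 2 apply: HolZ; apply: HolB; first exact: Hol_cst.
exact: Hol_sqrt.
Qed.

(** The identity rewrites [c] as [c0 sqrt (1 + k^2)], the speed for which planes of slope [k] are
    solutions. *)
Lemma cot_facts (alpha : R) : 0 < alpha -> alpha <= pi / 2 ->
  0 <= cot alpha /\ (sin alpha)^-1 = Num.sqrt (1 + cot alpha ^+ 2).
Proof.
move=> a0 a2; have pi0 := @pi_gt0 R.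
have s0 : 0 < sin alpha by apply: sin_gt0_pi; rewrite a0/=; lra.
have co : 0 <= cos alpha by apply: cos_ge0_pihalf; apply/andP; split; lra.
split; first by rewrite /cot divr_ge0// ltW.
have si : 0 <= (sin alpha)^-1 by rewrite invr_ge0 ltW.
rewrite -(ger0_norm si) -sqrtr_sqr; congr Num.sqrt.
have := cos2Dsin2 alpha; rewrite /cot => E.
have -> : (sin alpha)^-1 ^+ 2 = (cos alpha ^+ 2 + sin alpha ^+ 2) / sin alpha ^+ 2.
  by rewrite E; field; rewrite gt_eqF.
by field; rewrite gt_eqF.
Qed.

Lemma eikonal_barrier_solution k c (u : V -> R) : (0 < n)%N -> 0 <= k -> 0 < c ->
  homogeneous1 u -> eikonal_viscosity_solution k u ->
  exists phi, [/\ Csmooth phi, concave phi,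
    forall x, trA (grad phi x) (hess phi x) = - (2 * half_speed k c (grad phi x)) &
    phi = u +o_ (enorm_infty R n) (@enorm R n)].
Proof.
move=> n0 k0 c00 homu solu; have [nu [nu1 u_nu dense]] := dense_supports n0 k0 homu solu.
have low y : - (k * enorm y) <= u y.
  have := eikonal_lipschitz k0 homu solu y 0.
  by rewrite (hom1_0 homu) sub0r enormN; lra.
have slo i : enorm (k *: nu i) = k by rewrite enormZ nu1 mulr1 ger0_norm.
have C0 : 0 < touch_const k c by exact: touch_const_gt0.
have [f0 Sf0] := barrier_class k0 c00 nu1 u_nu.
have [phi Sphi sup] := perron_solution k0 C0 (@half_speed_cont _ _ k c) low slo
  (@half_speed_gt0 _ _ _ _ k0 c00) (@touch_const_bound _ _ _ _ k0 c00) Sf0.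
have [t2 sub lo hi] := Sphi.
have sl x : exists p, slope k (touch_const k c) phi x p.
  have [p hp] := t2 x; exists p; split=> //.
  by apply: (perron_slope k0 low Sphi) => h; exact: (hp h).2.
have lip x y := perron_lipschitz k0 low x y Sphi.
have LG : 0 <= c * k by rewrite mulr_ge0// ltW.
have Gb p : enorm p <= k -> 0 <= half_speed k c p /\
    half_speed k c p <= c / 2 * Num.sqrt (1 + k ^+ 2).
  by move=> pk; apply/andP; exact: half_speed_bounds.
have Gl p q : enorm p <= k -> enorm q <= k ->
    `|half_speed k c p - half_speed k c q| <= c * k * enorm (p - q).
  exact: half_speed_lipschitz.
have h2 : Hol 2 phi.
  exact: (visc_Hol2 n0 k0 C0 LG (fun p pk => (Gb p pk).1) (fun p pk => (Gb p pk).2) Gl sl lip sub sup).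
have E x : trA (grad phi x) (hess phi x) = - (2 * half_speed k c (grad phi x)).
  exact: (visc_equation n0 k0 C0 LG (fun p pk => (Gb p pk).1) (fun p pk => (Gb p pk).2) Gl sl lip sub sup).
exists phi; split=> //.
- apply: (bootstrap_smooth n0 _ h2 E) => x.
  by have [p hp] := sl x; rewrite (slope_grad C0 hp); exact: hp.1.
- exact: cvx_comb_concave (touch2_concave t2).
- exact: littleo_of_supports dense lo hi.
Qed.

End Assembly.

Theorem theorem1p1 (R : realType) (N : nat) (alpha c0 c : R)
    (phi_infty : 'rV[R]_N.-1 -> R) :
  (2 <= N)%N ->
  0 < alpha -> alpha <= pi / 2 ->
  0 < c0 -> c = c0 / sin alpha ->
  homogeneous1 phi_infty ->
  eikonal_viscosity_solution (cot alpha) phi_infty ->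
  exists phi : 'rV[R]_N.-1 -> R,
    [/\ Csmooth phi,
        concave phi,
        forall x : 'rV[R]_N.-1, forced_mean_curvature c0 c phi x = 0
      & phi = phi_infty +o_ (enorm_infty R N.-1) (@enorm R N.-1)].
Proof.
move=> N2 a0 a2 c00 cE homu solu; have [k0 sE] := cot_facts a0 a2.
have n0 : (0 < N.-1)%N by case: N N2 {phi_infty homu solu} => [|[|N]].
have [phi [sm cc E lo]] := eikonal_barrier_solution n0 k0 c00 homu solu.
exists phi; split=> // x; rewrite cE sE.
by apply: mean_curvature_eq => //; exact: sm.
Qed.
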